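(* Let $n\ge2$, $s\in(0,1)$, and let $A(x)=(a_{ij}(x))$ be a bounded symmetric $n\times n$ matrix-valued function with $a_{ij}\in C^\infty(\mathbb{R}^n)$ and, for some $\Lambda>0$, $\Lambda^{-1}|\xi|^2\le\sum_{i,j}a_{ij}(x)\xi_i\xi_j\le\Lambda|\xi|^2$ for all $x,\xi\in\mathbb{R}^n$; let $\mathcal{L}=-\nabla\cdot(A(x)\nabla)$. If $u\in H^s(\mathbb{R}^n)$ satisfies $u=\mathcal{L}^su=0$ in some nonempty open set $\mathcal{O}$ of $\mathbb{R}^n$, then $u\equiv0$ in $\mathbb{R}^n$.
   Context: All function spaces are real. $H^s(\mathbb{R}^n)=W^{s,2}(\mathbb{R}^n)$, with dual $H^{-s}(\mathbb{R}^n)$. Operator $\mathcal{L}^s$: $\mathcal{L}$ also denotes the non-negative self-adjoint realization of $-\nabla\cdot(A\nabla)$ in $L^2(\mathbb{R}^n)$ (whose domain the paper takes to be $H^2(\mathbb{R}^n)$), and $p_t(x,z)$, $t>0$, is its symmetric heat kernel, $(e^{-t\mathcal{L}}f)(x)=\int_{\mathbb{R}^n}p_t(x,z)f(z)\,dz$. Put $\mathcal{K}_s(x,z)=\frac{1}{|\Gamma(-s)|}\int_0^\infty p_t(x,z)\frac{dt}{t^{1+s}}$, where $\Gamma(-s)=-\Gamma(1-s)/s$. Then $\mathcal{L}^s:H^s(\mathbb{R}^n)\to H^{-s}(\mathbb{R}^n)$ is the bounded operator $$\langle\mathcal{L}^sf,g\rangle=\frac12\int_{\mathbb{R}^n\times\mathbb{R}^n}(f(x)-f(z))(g(x)-g(z))\mathcal{K}_s(x,z)\,dx\,dz.$$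 $\mathcal{L}^su=0$ in $\mathcal{O}$ means $\langle\mathcal{L}^su,\phi\rangle=0$ for all $\phi\in C_c^\infty(\mathcal{O})$. *)

(* Defs.v *)
From HB Require Import structures.
From mathcomp Require Import all_boot all_order all_algebra.
From mathcomp Require Import all_classical all_reals all_analysis.

Set Implicit Arguments.
Unset Strict Implicit.
Unset Printing Implicit Defensive.

Import Order.TTheory GRing.Theory Num.Theory.
Import numFieldNormedType.Exports.

Local Open Scope classical_set_scope.
Local Open Scope ring_scope.

(* 'rV[R]_n carries the sigma-algebra generated by the coordinates, which is
   the Borel sigma-algebra of R^n. *)
Definition rV_display : measure_display.
Proof. exact: default_measure_display. Qed.

Section measurable_rV.
Variables (R : realType) (n : nat).

Let coors : 'I_n -> 'rV[R]_n -> measurableTypeR R := fun i x => x 0 i.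

Let rV_set0 : g_sigma_preimage coors set0.
Proof. exact: sigma_algebra0. Qed.

Let rV_setC X : g_sigma_preimage coors X -> g_sigma_preimage coors (~` X).
Proof. exact: sigma_algebraC. Qed.

Let rV_bigcup (F : _^nat) : (forall i, g_sigma_preimage coors (F i)) ->
  g_sigma_preimage coors (\bigcup_i (F i)).
Proof. exact: sigma_algebra_bigcup. Qed.

HB.instance Definition _ := @isMeasurable.Build rV_display
  'rV[R]_n (g_sigma_preimage coors) rV_set0 rV_setC rV_bigcup.

End measurable_rV.

Section lebesgue_rV.
Context {R : realType}.

Lemma measurable_coord n (i : 'I_n) :
  measurable_fun setT ((fun x => x 0 i) : 'rV[R]_n -> measurableTypeR R).
Proof.
move=> _ Y mY; rewrite setTI; apply: sub_sigma_algebra => /=.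
rewrite -bigcup_seq/=; exists i => /=; first by rewrite mem_index_enum.
by exists Y => //; rewrite setTI.
Qed.

Lemma measurable_fun_rV d (T : measurableType d) n (f : T -> 'rV[R]_n) :
  (forall i, measurable_fun setT ((fun t => f t 0 i) : T -> measurableTypeR R)) ->
  measurable_fun setT f.
Proof.
move=> mf _ X mX.
suff: preimage_set_system setT f (g_sigma_preimage
    (fun i (x : 'rV[R]_n) => x 0 i : measurableTypeR R)) `<=` measurable.
  by apply; exists X.
rewrite -g_sigma_preimage_comp.
apply: smallest_sub; first exact: sigma_algebra_measurable.
by rewrite -bigcup_seq => Y [i _ [Z mZ <-]]; exact: (mf i).
Qed.

Definition cons_rV n (q : measurableTypeR R * 'rV[R]_n) : 'rV[R]_n.+1 :=
  row_mx (q.1%:M : 'rV[R]_1) q.2.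

Let uncons_rV n (x : 'rV[R]_n.+1) : measurableTypeR R * 'rV[R]_n :=
  (x 0 ord0, \row_i x 0 (lift ord0 i)).

Let cons_rV0 n (q : measurableTypeR R * 'rV[R]_n) : cons_rV q 0 ord0 = q.1.
Proof.
rewrite (_ : ord0 = lshift n ord0 :> 'I_(1 + n)); last exact: val_inj.
by apply: (etrans (row_mxEl _ _ _ _)); rewrite mxE eqxx mulr1n.
Qed.

Let cons_rVS n (q : measurableTypeR R * 'rV[R]_n) i :
  cons_rV q 0 (lift ord0 i) = q.2 0 i.
Proof.
rewrite (_ : lift ord0 i = rshift 1 i :> 'I_(1 + n)); last exact: val_inj.
exact: (etrans (row_mxEr _ _ _ _)).
Qed.

Let cons_rVK n : cancel (@cons_rV n) (@uncons_rV n).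
Proof.
move=> [a x]; rewrite /uncons_rV cons_rV0; congr pair.
by apply/rowP => i; rewrite mxE cons_rVS.
Qed.

Let measurable_uncons_rV n : measurable_fun setT (@uncons_rV n).
Proof.
apply/measurable_fun_pair; first exact: measurable_coord.
apply: measurable_fun_rV => i.
rewrite (_ : (fun _ => _) = fun x : 'rV[R]_n.+1 => x 0 (lift ord0 i)).
  exact: measurable_coord.
by apply/funext => x; rewrite mxE.
Qed.

Lemma measurable_cons_rV n : measurable_fun setT (@cons_rV n).
Proof.
apply: measurable_fun_rV => i; case: (unliftP ord0 i) => [j|] ->.
  rewrite (_ : (fun _ => _) = (fun x : 'rV[R]_n => x 0 j) \o snd).
    by apply: (measurableT_comp (measurable_coord j)) => //; exact: measurable_snd.
  by apply/funext => q; rewrite cons_rVS.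
rewrite (_ : (fun _ => _) = fst); first exact: measurable_fst.
by apply/funext => q; rewrite cons_rV0.
Qed.

Fixpoint lebesgue_rV n : set 'rV[R]_n -> \bar R :=
  match n with
  | 0 => dirac (0 : 'rV[R]_0)
  | m.+1 => pushforward ((@lebesgue_measure R) \x (@lebesgue_rV m))%E
              (@cons_rV m)
  end.

Section lebesgue_rV_step.
Variables (n : nat) (l : {sigma_finite_measure set measurableTypeR R -> \bar R})
  (m : {sigma_finite_measure set 'rV[R]_n -> \bar R}).

Let step := pushforward (l \x m)%E (@cons_rV n).

Let prod : {measure set (measurableTypeR R * 'rV[R]_n)%type -> \bar R} :=
  (l \x m)%E.

Let step0 : step set0 = 0%E.
Proof. by rewrite /step /pushforward preimage_set0 (measure0 prod). Qed.

Let step_ge0 X : (0 <= step X)%E.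
Proof. exact: (measure_ge0 prod). Qed.

Let step_sigma_additive : semi_sigma_additive step.
Proof.
have mX X : measurable X -> measurable (@cons_rV n @^-1` X).
  by move=> mX; rewrite -[_ @^-1` _]setTI; exact: measurable_cons_rV.
move=> F mF tF mUF; rewrite /step /pushforward preimage_bigcup.
apply: measure_semi_sigma_additive => [k||]; first exact: mX.
- apply/trivIsetP => i j _ _ ij; rewrite -preimage_setI.
  by move/trivIsetP : tF => ->//; rewrite preimage_set0.
- by rewrite -preimage_bigcup; exact: mX.
Qed.

HB.instance Definition _ := isMeasure.Build _ _ _ step
  step0 step_ge0 step_sigma_additive.

Let step_sigma_finite : sigma_finite setT step.
Proof.
have /sigma_finiteP[F [FT ndF Foo]] := sigma_finiteT l.
have /sigma_finiteP[G [GT ndG Goo]] := sigma_finiteT m.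
exists (fun k => @uncons_rV n @^-1` (F k `*` G k)).
  rewrite -preimage_bigcup (_ : \bigcup_k _ = setT) ?preimage_setT//.
  apply/seteqP; split=> // -[x y] _.
  have [i _ Fx] : (\bigcup_k F k) x by rewrite -FT.
  have [j _ Gy] : (\bigcup_k G k) y by rewrite -GT.
  exists (maxn i j) => //; split.
    by move: x Fx; exact/subsetPset/ndF/leq_maxl.
  by move: y Gy; exact/subsetPset/ndG/leq_maxr.
move=> k; have [mFk Fkoo] := Foo k; have [mGk Gkoo] := Goo k; split.
  rewrite -[_ @^-1` _]setTI; apply: measurable_uncons_rV => //.
  exact: measurableX.
rewrite /step /pushforward -comp_preimage (_ : _ \o _ = id); last first.
  by apply/funext => q; exact: cons_rVK.
rewrite preimage_id product_measure1E//.
by rewrite lte_mul_pinfty// ge0_fin_numE.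
Qed.

HB.instance Definition _ := Measure_isSigmaFinite.Build _ _ _ step
  step_sigma_finite.

Lemma lebesgue_rV_step :
  exists m' : {sigma_finite_measure set 'rV[R]_n.+1 -> \bar R}, step = m'.
Proof. by exists step. Qed.

End lebesgue_rV_step.

Lemma lebesgue_rV_spec n :
  exists m : {sigma_finite_measure set 'rV[R]_n -> \bar R},
    @lebesgue_rV n = m.
Proof.
elim: n => [|n [m /= ->]]; first by exists (dirac (0 : 'rV[R]_0)).
exact: (lebesgue_rV_step lebesgue_measure m).
Qed.

Section lebesgue_rV_measure.
Variable n : nat.
Let lebesgue_rV0 : @lebesgue_rV n set0 = 0%E.
Proof. by have [m ->] := lebesgue_rV_spec n; rewrite measure0. Qed.

Let lebesgue_rV_ge0 X : (0 <= @lebesgue_rV n X)%E.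
Proof. by have [m ->] := lebesgue_rV_spec n; exact: measure_ge0. Qed.

Let lebesgue_rV_sigma_additive : semi_sigma_additive (@lebesgue_rV n).
Proof.
by have [m ->] := lebesgue_rV_spec n; exact: measure_semi_sigma_additive.
Qed.

HB.instance Definition _ := isMeasure.Build _ _ _ (@lebesgue_rV n)
  lebesgue_rV0 lebesgue_rV_ge0 lebesgue_rV_sigma_additive.

Let lebesgue_rV_sigma_finite : sigma_finite setT (@lebesgue_rV n).
Proof. by have [m ->] := lebesgue_rV_spec n; exact: sigma_finiteT. Qed.

HB.instance Definition _ := Measure_isSigmaFinite.Build _ _ _ (@lebesgue_rV n)
  lebesgue_rV_sigma_finite.

End lebesgue_rV_measure.
End lebesgue_rV.

Section calculus.
Context {R : realType} {n : nat}.
Implicit Types (f g u v : 'rV[R]_n -> R) (i : 'I_n).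

Definition partial i f : 'rV[R]_n -> R := fun x => 'D_(delta_mx 0 i) f x.

(* C^oo: for every multi-index l, the iterated partial derivative of f along l
   exists and is continuous. *)
Definition smooth f := forall l : seq 'I_n,
  continuous (foldr partial f l) /\
  forall i x, derivable (foldr partial f l) x (delta_mx 0 i).

Definition test_function (O : set 'rV[R]_n) f :=
  smooth f /\
  exists K : set 'rV[R]_n, [/\ compact K, K `<=` O & forall x, ~ K x -> f x = 0].

Definition sqnorm (x : 'rV[R]_n) : R := \sum_(i < n) x 0 i ^+ 2.

End calculus.

Section function_spaces.
Context {R : realType} {n : nat}.
Local Notation V := 'rV[R]_n.
Local Notation mu := (@lebesgue_rV R n).
Implicit Types (f g h u v : V -> R).

Definition L2 f := f \in Lfun mu 2%:E.

Definition inner f g : R := \int[mu]_x (f x * g x).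

(* Gagliardo (Sobolev-Slobodeckij) form of W^{s,2}(R^n), for 0 < s < 1; the
   denominator is |x - z|^(n + 2s) with the Euclidean norm, and the integrand
   is 0 on the diagonal. *)
Definition Hs (s : R) u :=
  L2 u /\
  (\int[mu \x mu]_q
     ((u q.1 - u q.2) ^+ 2
       / (Num.sqrt (sqnorm (q.1 - q.2)) `^ (n%:R + 2 * s)))%:E < +oo)%E.

Definition weak_partial (i : 'I_n) u v :=
  forall phi, test_function setT phi -> inner u (partial i phi) = - inner v phi.

(* The graph {(u, f) : u in Dom(L), L u = f} of the self-adjoint realization of
   -div(A grad) in L^2(R^n), the operator of the closed form
   (u, v) |-> \int A grad u . grad v on H^1(R^n): u is in H^1 and the weak
   divergence of A grad u is in L^2.  This domain is H^2(R^n) when the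
   derivatives of A are bounded; for arbitrary smooth A the operator is not
   defined on the whole of H^2(R^n), whereas the present one always is
   self-adjoint and non-negative. *)
Definition div_op (A : V -> 'M[R]_n) u f :=
  [/\ L2 u, L2 f &
  exists G : 'I_n -> V -> R,
    (forall i, L2 (G i) /\ weak_partial i u (G i)) /\
    forall phi, test_function setT phi ->
      \int[mu]_x (\sum_(i < n) \sum_(j < n) A x i j * G j x * partial i phi x)
      = inner f phi].

End function_spaces.

Section spectral_calculus.
Context {R : realType} {n : nat}.
Local Notation V := 'rV[R]_n.
Local Notation mu := (@lebesgue_rV R n).
Implicit Types (f g h : V -> R) (E : set (measurableTypeR R) -> (V -> R) -> V -> R).

Definition spectral_mass E f : set (measurableTypeR R) -> \bar R :=
  fun B => (inner (E B f) f)%:E.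

(* Projection-valued measures on R acting on L^2(R^n). *)
Definition projection_valued_measure E :=
  [/\ forall B f, measurable B -> L2 f -> L2 (E B f),
      forall B (a : R) f g, measurable B -> L2 f -> L2 g ->
        ae_eq mu setT (E B (a \*: f \+ g)) (a \*: E B f \+ E B g),
      forall B f g, measurable B -> L2 f -> L2 g ->
        inner (E B f) g = inner f (E B g),
      forall B C f, measurable B -> measurable C -> L2 f ->
        ae_eq mu setT (E B (E C f)) (E (B `&` C) f) &
      (forall f, L2 f -> ae_eq mu setT (E setT f) f) /\
      (forall f, L2 f -> semi_sigma_additive (spectral_mass E f))].

Definition spectral_domain E (phi : R -> R) f :=
  L2 f /\ (\int[spectral_mass E f]_l (phi l ^+ 2)%:E < +oo)%E.

(* h = (\int phi dE) f, i.e. <h, g> = \int phi(l) d<E_l f, g> for g in the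
   domain, the signed measure <E_l f, g> being written by polarization as
   (<E_l (f + g), f + g> - <E_l (f - g), f - g>) / 4. *)
Definition spectral_integral E (phi : R -> R) f h :=
  [/\ spectral_domain E phi f, L2 h &
  forall g, spectral_domain E phi g ->
    inner h g =
    4^-1 * (fine (\int[spectral_mass E (f \+ g)%R]_l (phi l)%:E)
            - fine (\int[spectral_mass E (f \- g)%R]_l (phi l)%:E))].

Definition spectral_resolution (L : (V -> R) -> (V -> R) -> Prop) E :=
  projection_valued_measure E /\
  forall f h, L f h <-> spectral_integral E id f h.

(* h = phi(L) f, for a self-adjoint operator given by its graph L *)
Definition functional_calculus (L : (V -> R) -> (V -> R) -> Prop)
    (phi : R -> R) f h :=
  exists2 E, spectral_resolution L E & spectral_integral E phi f h.

End spectral_calculus.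

Section fractional_operator.
Context {R : realType} {n : nat}.
Local Notation V := 'rV[R]_n.
Local Notation mu := (@lebesgue_rV R n).

Definition is_heat_kernel (A : V -> 'M[R]_n) (p : R -> V -> V -> R) :=
  [/\ measurable_fun ((`]0, +oo[ : set (measurableTypeR R)) `*` setT)
        (fun q : measurableTypeR R * (V * V) => p q.1 q.2.1 q.2.2),
      forall t x z, 0 < t -> p t x z = p t z x &
      forall t f, 0 < t -> L2 f ->
        {ae mu, forall x,
          mu.-integrable setT (fun z => (p t x z * f z)%:E)} /\
        functional_calculus (div_op A) (fun l => expR (- (t * l)))
          f (fun x => \int[mu]_z (p t x z * f z))].

Definition Gamma (a : R) : R :=
  \int[lebesgue_measure]_(t in `]0, +oo[) (t `^ (a - 1) * expR (- t)).

(* The value at -s of the analytic continuation, for 0 < s < 1. *)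
Definition GammaN (s : R) : R := - (Gamma (1 - s) / s).

Definition frac_kernel (p : R -> V -> V -> R) (s : R) (x z : V) : \bar R :=
  ((`|GammaN s|^-1)%:E *
   \int[lebesgue_measure]_(t in `]0%R, +oo[) (p t x z / t `^ (1 + s))%:E)%E.

(* <L^s f, g>; the integrand vanishes on the diagonal, where the kernel is
   infinite. *)
Definition frac_pairing (p : R -> V -> V -> R) (s : R) (f g : V -> R) : \bar R :=
  ((2^-1)%:E *
   \int[mu \x mu]_q (((f q.1 - f q.2) * (g q.1 - g q.2))%:E
                     * frac_kernel p s q.1 q.2))%E.

End fractional_operator.

(* Main.v *)
From HB Require Import structures.
Require Import Defs.
From mathcomp Require Import all_boot all_order all_algebra.
From mathcomp Require Import all_classical all_reals all_analysis.
From mathcomp Require Import measurable_realfun.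
From mathcomp Require Import ring lra zify.
Import Order.TTheory GRing.Theory Num.Theory.
Import numFieldNormedType.Exports.
Local Open Scope classical_set_scope.
Local Open Scope ring_scope.
Set Implicit Arguments.
Unset Strict Implicit.
Unset Printing Implicit Defensive.

(* For a test function phi supported in O put F(t) = <exp(-tL) u, phi>. Since
   u = 0 on O and the heat kernel is nonnegative, Fubini turns <L^s u, phi> = 0
   into the vanishing of the integral of F(t) t^(-1-s) over t > 0. The same
   holds for L^j phi, and F' = -<exp(-tL) u, L phi>; as F(t) = O(exp(-c/t)) by a
   Combes-Thomas estimate, integrating by parts gives the vanishing of the
   integrals of F(t) t^(-1-s-j) for all j, whence F = 0. So the spectral measure
   of (u, phi) vanishes and each truncation w = 1_[0,N)(L) u is zero on a ball.
   There L^k w is zero too, while |L^k w| <= N^k |w|: iterating in k a Carleman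
   estimate with weight exp(t exp(-l|x - x1|^2)) and letting t tend to infinity
   spreads the zero set of w to the whole space. Let N tend to infinity. *)

(** The hypothesis on [p] gives some spectral resolution for each [t] and [f], possibly a different
    one each time. The exponential formula removes this freedom: exp(-tL) is the weak limit of the
    resolvent powers (1 + (t/m)L)^-m, which depend on the graph of L alone. Both weighted decay and
    positivity of the semigroup are energy inequalities for a single resolvent, tested with exp(2 a
    psi) w or with a smooth negative part of w, and pass to the limit along these powers.

    The derivatives of A may be unbounded, so no global regularity is used: elements of the domain
    are handled through their weak gradients. The Carleman inequality is proved for smooth functions
    supported in an annulus and reaches weak gradients by Friedrichs' commutator lemma, with
    coefficients cut off near the annulus.

    The bound of L w by N holds in the global L^2 norm, not pointwise, so a single Carleman
    inequality cannot absorb L w. But L w vanishes on the same ball and lies in the same spectral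
    subspace, so the inequality applies to it again; the gain t^3 beats N^2 at every round, with a
    threshold on t that does not depend on the number of rounds. *)

(** * Integration of real-valued functions *)

Section real_integrals.
Context d (T : measurableType d) (R : realType) (mu : {measure set T -> \bar R}).
Implicit Types f g : T -> R.
Local Notation intg f := (mu.-integrable setT (EFin \o f)).

Lemma intg_meas f : intg f -> measurable_fun setT f.
Proof. by move=> /(measurable_int mu)/measurable_EFinP. Qed.

Lemma intgD f g : intg f -> intg g -> intg (fun x => f x + g x).
Proof.
move=> fi gi; have := integrableD measurableT fi gi.
by apply: eq_integrable.
Qed.

Lemma intgB f g : intg f -> intg g -> intg (fun x => f x - g x).
Proof.
move=> fi gi; have := integrableB measurableT fi gi.
by apply: eq_integrable.
Qed.

Lemma intgZ a f : intg f -> intg (fun x => a * f x).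
Proof. by move=> fi; have := integrableZl measurableT a fi; apply: eq_integrable. Qed.

Lemma intgN f : intg f -> intg (fun x => - f x).
Proof.
move=> /(intgZ (-1)); apply: eq_integrable => // x _ /=; first by rewrite mulN1r.
Qed.

Lemma intg_le f g : measurable_fun setT f -> (forall x, `|f x| <= g x) ->
  intg g -> intg f.
Proof.
move=> mf fg gi; apply: le_integrable gi => //=; first exact/measurable_EFinP.
by move=> x _; rewrite lee_fin (le_trans (fg x))// ler_norm.
Qed.

Lemma intg_norm f : intg f -> intg (fun x => `|f x|).
Proof. exact: integrable_norm. Qed.

Lemma intg0 : intg (fun _ => 0).
Proof. exact: integrable0. Qed.

Lemma intg_sum I (s : seq I) (F : I -> T -> R) :
  (forall i, intg (F i)) -> intg (fun x => \sum_(i <- s) F i x).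
Proof.
move=> Fi; elim: s => [|i s IH].
  by apply: eq_integrable intg0 => // x _; rewrite /= big_nil.
apply: eq_integrable (intgD (Fi i) IH) => // x _ /=; by rewrite big_cons.
Qed.

Lemma eq_intg f g : f =1 g -> intg f -> intg g.
Proof. by move=> fg; apply: eq_integrable => // x _ /=; rewrite fg. Qed.

Lemma RintD f g : intg f -> intg g ->
  \int[mu]_x (f x + g x) = \int[mu]_x f x + \int[mu]_x g x.
Proof. exact: RintegralD. Qed.

Lemma RintB f g : intg f -> intg g ->
  \int[mu]_x (f x - g x) = \int[mu]_x f x - \int[mu]_x g x.
Proof. exact: RintegralB. Qed.

Lemma RintZ a f : intg f -> \int[mu]_x (a * f x) = a * \int[mu]_x f x.
Proof. exact: RintegralZl. Qed.

Lemma Rint_sum I (s : seq I) (F : I -> T -> R) : (forall i, intg (F i)) ->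
  \int[mu]_x (\sum_(i <- s) F i x) = \sum_(i <- s) \int[mu]_x F i x.
Proof.
move=> Fi; elim: s => [|i s IH].
  rewrite big_nil; under eq_Rintegral do rewrite big_nil.
  by rewrite /Rintegral integral0.
rewrite big_cons -IH -RintD//; last exact: intg_sum.
by apply: eq_Rintegral => x _; rewrite big_cons.
Qed.

Lemma Rint_le f g : intg f -> intg g -> (forall x, f x <= g x) ->
  \int[mu]_x f x <= \int[mu]_x g x.
Proof. by move=> fi gi fg; exact: le_Rintegral. Qed.

Lemma Rint_EFin f : intg f -> (\int[mu]_x f x)%:E = (\int[mu]_x (f x)%:E)%E.
Proof.
move=> fi; rewrite /Rintegral fineK//; exact: integrable_fin_num.
Qed.

Lemma Rint_ae f g : measurable_fun setT f -> measurable_fun setT g ->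
  {ae mu, forall x, f x = g x} ->
  \int[mu]_x f x = \int[mu]_x g x.
Proof.
move=> mf mg fg; congr fine; apply: ae_eq_integral => //; try exact/measurable_EFinP.
by apply: filterS fg => x -> _.
Qed.

Lemma intg_ae f g : measurable_fun setT g ->
  {ae mu, forall x, f x = g x} -> intg f -> intg g.
Proof.
move=> mg fg fi; apply/integrableP; split; first exact/measurable_EFinP.
case/integrableP: (fi) => mf; congr (_ < _)%E; apply: ae_eq_integral => //.
- exact: measurableT_comp.
- by apply: measurableT_comp => //; exact/measurable_EFinP.
- by apply: filterS fg => x /= -> _.
Qed.

Lemma Rint_eq0_ae f : intg f -> (forall x, 0 <= f x) -> \int[mu]_x f x = 0 ->
  {ae mu, forall x, f x = 0}.
Proof.
move=> fi f0 If0; have If := congr1 EFin If0; rewrite Rint_EFin// in If.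
have mf := measurable_int mu fi.
have H : (\int[mu]_x `|(EFin \o f) x| = 0)%E.
  by rewrite -[RHS]If; apply: eq_integral => x _ /=; rewrite ger0_norm.
have := (ae_eq_integral_abs mu measurableT mf).1 H.
by apply: filterS => x /= /(_ I) [].
Qed.

Lemma Rint_dct (f_ : nat -> T -> R) f g :
  (forall n, measurable_fun setT (f_ n)) ->
  (forall x, f_ n x @[n --> \oo] --> f x) ->
  intg g -> (forall n x, `|f_ n x| <= g x) ->
  intg f /\ \int[mu]_x f_ n x @[n --> \oo] --> \int[mu]_x f x.
Proof.
move=> mf_ cv gi dom.
have mf : measurable_fun setT f.
  by apply: (measurable_fun_cvg mf_) => x _; exact: cv.
have [|||||fi _ H2] := @dominated_convergence _ T R mu setT measurableT
  (fun n => EFin \o f_ n) (EFin \o f) (EFin \o g).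
- by move=> n; exact/measurable_EFinP.
- exact/measurable_EFinP.
- by apply: aeW => x _; apply: cvg_EFin; [exact: nearW|exact: cv].
- exact: gi.
- by apply: aeW => x n _; rewrite lee_fin.
split=> //; apply: fine_cvg; rewrite Rint_EFin//; exact: H2.
Qed.

Lemma intg_ge0 f : measurable_fun setT f -> (forall x, 0 <= f x) ->
  (\int[mu]_x (f x)%:E < +oo)%E -> intg f.
Proof.
move=> mf f0 fi; apply/integrableP; split; first exact/measurable_EFinP.
by under eq_integral do rewrite /= ger0_norm//.
Qed.

Lemma intg_lty f : intg f -> (\int[mu]_x (f x)%:E < +oo)%E.
Proof. exact: integrable_lty. Qed.

Lemma Rint_ge0 f : (forall x, 0 <= f x) -> 0 <= \int[mu]_x f x.
Proof. by move=> f0; apply: Rintegral_ge0. Qed.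

Lemma Rint_norm f : intg f -> `|\int[mu]_x f x| <= \int[mu]_x `|f x|.
Proof. by move=> fi; exact: le_normr_Rintegral. Qed.

End real_integrals.

Notation intg mu f := (mu.-integrable setT (EFin \o f)).

Local Notation mu := (@lebesgue_rV _ _).

(** * The space L^2(R^n) *)

Section L2_theory.
Context {R : realType} {n : nat}.
Local Notation V := 'rV[R]_n.
Implicit Types (f g h : V -> R).

Lemma L2_meas f : L2 f -> measurable_fun setT f.
Proof. by rewrite /L2 inE => /andP[]; rewrite !inE. Qed.

Lemma L2_intg_sqr f : L2 f -> intg mu (fun x => f x ^+ 2).
Proof. exact: Lfun2_integrable_sqr. Qed.

Lemma L2P f : measurable_fun setT f -> intg mu (fun x => f x ^+ 2) -> L2 f.
Proof.
move=> mf fi; rewrite /L2 inE; apply/andP; split; rewrite inE//=.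
rewrite /finite_norm unlock poweR_lty//=.
have := intg_lty fi; congr (_ < _)%E; apply: eq_integral => x _ /=.
by rewrite powR_mulrn// real_normK// num_real.
Qed.

Lemma L2M f g : L2 f -> L2 g -> intg mu (fun x => f x * g x).
Proof. by move=> Lf Lg; apply/Lfun1_integrable; exact: Lfun2_mul_Lfun1. Qed.

Lemma L2D f g : L2 f -> L2 g -> L2 (fun x => f x + g x).
Proof.
move=> Lf Lg; apply: L2P.
  by apply: measurable_funD; exact: L2_meas.
apply: (@intg_le _ _ _ mu _ (fun x => 2 * f x ^+ 2 + 2 * g x ^+ 2)).
- by apply: measurable_funX; apply: measurable_funD; exact: L2_meas.
- move=> x; rewrite ger0_norm ?sqr_ge0//.
  by have := sqr_ge0 (f x - g x); nra.
- by apply: intgD; apply: intgZ; exact: L2_intg_sqr.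
Qed.

Lemma L2_le f g : measurable_fun setT f -> (forall x, `|f x| <= g x) -> L2 g -> L2 f.
Proof.
move=> mf fg Lg; apply: L2P => //.
apply: intg_le (L2_intg_sqr Lg); first exact: measurable_funX.
move=> x; rewrite normrX ler_sqr ?nnegrE//; exact: le_trans (fg x).
Qed.

Lemma L2_bM a f g : measurable_fun setT g -> (forall x, `|g x| <= a) -> L2 f ->
  L2 (fun x => g x * f x).
Proof.
move=> mg ga Lf; apply: L2P.
  by apply: measurable_funM => //; exact: L2_meas.
apply: (@intg_le _ _ _ mu _ (fun x => a ^+ 2 * f x ^+ 2)).
- by apply: measurable_funX; apply: measurable_funM => //; exact: L2_meas.
- move=> x; rewrite ger0_norm ?sqr_ge0// exprMn ler_wpM2r ?sqr_ge0//.
  by rewrite -[_ ^+ 2]real_normK ?num_real// ler_sqr ?nnegrE// (le_trans _ (ga x)).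
- by apply: intgZ; exact: L2_intg_sqr.
Qed.

Lemma L2Z a f : L2 f -> L2 (fun x => a * f x).
Proof. by move=> Lf; apply: (@L2_bM `|a| f (cst a)). Qed.

Lemma L2N f : L2 f -> L2 (fun x => - f x).
Proof.
move=> /(L2Z (-1)); congr L2; apply/funext => x; by rewrite mulN1r.
Qed.

Lemma L2B f g : L2 f -> L2 g -> L2 (fun x => f x - g x).
Proof. by move=> Lf Lg; apply: L2D => //; exact: L2N. Qed.

Lemma L20 : L2 (fun _ : V => 0).
Proof.
apply: L2P; first exact: measurable_cst.
by apply: eq_intg (intg0 _) => x; rewrite expr0n.
Qed.

Lemma L2_sum I (s : seq I) (F : I -> V -> R) : (forall i, L2 (F i)) ->
  L2 (fun x => \sum_(i <- s) F i x).
Proof.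
move=> LF; elim: s => [|i s IH].
  by have := L20; congr L2; apply/funext => x; rewrite big_nil.
by have := L2D (LF i) IH; congr L2; apply/funext => x; rewrite big_cons.
Qed.

Lemma innerC f g : inner f g = inner g f.
Proof. by apply: eq_Rintegral => x _; rewrite mulrC. Qed.

Lemma innerDl f g h : L2 f -> L2 g -> L2 h ->
  inner (fun x => f x + g x) h = inner f h + inner g h.
Proof.
move=> Lf Lg Lh; rewrite /inner -RintD; [|exact: L2M..].
by apply: eq_Rintegral => x _; rewrite mulrDl.
Qed.

Lemma innerZl a f h : L2 f -> L2 h -> inner (fun x => a * f x) h = a * inner f h.
Proof.
move=> Lf Lh; rewrite /inner -RintZ; last exact: L2M.
by apply: eq_Rintegral => x _; rewrite mulrA.
Qed.

Lemma innerNl f h : L2 f -> L2 h -> inner (fun x => - f x) h = - inner f h.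
Proof.
move=> Lf Lh; rewrite -[RHS]mulN1r -innerZl//.
by congr inner; apply/funext => x; rewrite mulN1r.
Qed.

Lemma innerBl f g h : L2 f -> L2 g -> L2 h ->
  inner (fun x => f x - g x) h = inner f h - inner g h.
Proof. by move=> Lf Lg Lh; rewrite innerDl ?innerNl//; exact: L2N. Qed.

Lemma innerDr f g h : L2 f -> L2 g -> L2 h ->
  inner h (fun x => f x + g x) = inner h f + inner h g.
Proof. by move=> *; rewrite innerC innerDl// !(innerC _ h). Qed.

Lemma innerZr a f h : L2 f -> L2 h -> inner h (fun x => a * f x) = a * inner h f.
Proof. by move=> *; rewrite innerC innerZl// (innerC _ h). Qed.

Lemma innerBr f g h : L2 f -> L2 g -> L2 h ->
  inner h (fun x => f x - g x) = inner h f - inner h g.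
Proof. by move=> *; rewrite innerC innerBl// !(innerC _ h). Qed.

Lemma inner_suml I (s : seq I) (F : I -> V -> R) h : (forall i, L2 (F i)) -> L2 h ->
  inner (fun x => \sum_(i <- s) F i x) h = \sum_(i <- s) inner (F i) h.
Proof.
move=> LF Lh; rewrite /inner -Rint_sum; last by move=> i; exact: L2M.
by apply: eq_Rintegral => x _; rewrite mulr_suml.
Qed.

Lemma inner_ge0 f : 0 <= inner f f.
Proof. by apply: Rint_ge0 => x; rewrite -expr2 sqr_ge0. Qed.

Lemma inner0l h : inner (fun=> 0) h = 0.
Proof.
rewrite /inner (@eq_Rintegral _ _ _ _ _ (fun=> 0)).
  by rewrite /Rintegral integral0.
by move=> x _; rewrite mul0r.
Qed.

Lemma inner_ae f f' g : L2 f -> L2 f' -> L2 g -> {ae mu, forall x, f x = f' x} ->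
  inner f g = inner f' g.
Proof.
move=> Lf Lf' Lg ff'; apply: Rint_ae.
- by apply: measurable_funM; exact: L2_meas.
- by apply: measurable_funM; exact: L2_meas.
- by apply: filterS ff' => x ->.
Qed.

Lemma inner_eq0 f : L2 f -> inner f f = 0 -> {ae mu, forall x, f x = 0}.
Proof.
move=> Lf If0; have : {ae mu, forall x, f x * f x = 0}.
  by apply: Rint_eq0_ae => //; [exact: L2M|move=> x; rewrite -expr2 sqr_ge0].
by apply: filterS => x /eqP; rewrite mulf_eq0 orbb => /eqP.
Qed.

Lemma inner_ext f f' : L2 f -> L2 f' -> (forall g, L2 g -> inner f g = inner f' g) ->
  {ae mu, forall x, f x = f' x}.
Proof.
move=> Lf Lf' ff'; have LB := L2B Lf Lf'.
have : inner (fun x => f x - f' x) (fun x => f x - f' x) = 0.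
  by rewrite innerBl// ff'// subrr.
by move=> /(inner_eq0 LB); apply: filterS => x /eqP; rewrite subr_eq0 => /eqP.
Qed.

Lemma inner_CS f g : L2 f -> L2 g -> inner f g ^+ 2 <= inner f f * inner g g.
Proof.
move=> Lf Lg.
have Q a : 0 <= inner f f + 2 * a * inner f g + a ^+ 2 * inner g g.
  have La := L2Z a Lg; have := inner_ge0 (fun x => f x + a * g x).
  rewrite innerDl ?innerDr ?innerZl ?innerZr//; last exact: L2D.
  by rewrite (innerC g f); nra.
have [g0|g0] := eqVneq (inner g g) 0.
  have fg : inner f g = 0.
    apply/eqP/negPn/negP => fg.
    (* With <g, g> = 0 the quadratic is affine in [a]; if its slope were nonzero, it would take the
       value -1 here. *)
    have := Q (- (inner f f + 1) / (2 * inner f g)).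
    rewrite g0 mulr0 addr0 => H.
    have E : 2 * (- (inner f f + 1) / (2 * inner f g)) * inner f g = - (inner f f + 1).
      by field.
    by rewrite E in H; lra.
  by rewrite fg g0 mulr0 expr0n.
have gg : 0 < inner g g by rewrite lt_neqAle eq_sym g0 inner_ge0.
have := Q (- inner f g / inner g g).
have E : inner f f + 2 * (- inner f g / inner g g) * inner f g
  + (- inner f g / inner g g) ^+ 2 * inner g g = inner f f - inner f g ^+ 2 / inner g g.
  by field.
by rewrite E subr_ge0 ler_pdivrMr.
Qed.

Lemma inner_CS_sqrt f g : L2 f -> L2 g ->
  `|inner f g| <= Num.sqrt (inner f f) * Num.sqrt (inner g g).
Proof.
move=> Lf Lg; rewrite -sqrtrM ?inner_ge0// -sqrtr_sqr ler_sqrt ?inner_CS//.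
by rewrite mulr_ge0 ?inner_ge0.
Qed.

Definition L2cvg (f_ : nat -> V -> R) f :=
  [/\ forall k, L2 (f_ k), L2 f &
  inner (fun x => f_ k x - f x) (fun x => f_ k x - f x) @[k --> \oo] --> (0 : R)].

End L2_theory.

(** * Completeness of L^2 *)

Section completeness.
Context {R : realType}.

Lemma geometric_cauchy (a : nat -> R) (M : R) :
  (forall k, `|a k.+1 - a k| <= M * (2^-1) ^+ k) ->
  cvgn a /\ forall k, `|limn a - a k| <= 2 * M * (2^-1) ^+ k.
Proof.
move=> aM.
have M0 : 0 <= M by have := aM 0%N; rewrite expr0 mulr1; apply: le_trans.
(* The factor 1 - 2^-j is the exact partial geometric sum, which closes the induction. *)
have A k j : `|a (k + j)%N - a k| <= 2 * M * (2^-1) ^+ k * (1 - (2^-1) ^+ j).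
  elim: j => [|j IH]; first by rewrite addn0 subrr normr0 expr0 subrr mulr0.
  rewrite addnS.
  have -> : a (k + j).+1 - a k = (a (k + j).+1 - a (k + j)%N) + (a (k + j)%N - a k) by ring.
  rewrite (le_trans (ler_normD _ _))// (le_trans (lerD (aM _) IH))//.
  by rewrite exprD exprS; lra.
have B k j : (k <= j)%N -> `|a j - a k| <= 2 * M * (2^-1) ^+ k.
  move=> kj; rewrite -(subnKC kj) (le_trans (A _ _))//.
  by rewrite ler_piMr ?mulr_ge0 ?exprn_ge0// gerBl exprn_ge0.
have ca : cvgn a.
  apply/cauchy_cvgP/cauchy_exP => e e0 /=.
  have [N _ HN] : \forall N \near \oo, 2 * M * (2^-1 : R) ^+ N < e.
    have : geometric (2 * M) (2^-1 : R) @ \oo --> (0 : R).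
      by apply: cvg_geometric; rewrite ger0_norm// invf_lt1// ltr1n.
    move=> /cvgr0Pnorm_lt /(_ e e0); apply: filterS => N.
    by apply: le_lt_trans; rewrite ler_norm.
  exists (a N); exists N => // j /= Nj.
  rewrite /ball /= distrC (le_lt_trans (B _ _ Nj))//; exact: HN (leqnn N).
split=> // k.
have cd : (fun j => `|a j - a k|) @ \oo --> `|limn a - a k|.
  by apply: cvg_norm; apply: cvgB => //; exact: cvg_cst.
rewrite -(cvg_lim _ cd)//; apply: limr_le; first by apply/cvg_ex; eexists; exact: cd.
by exists k => // j /= kj; exact: B.
Qed.

Context {n : nat}.
Local Notation V := 'rV[R]_n.

Lemma sq_add_le (x y : R) : (x + y) ^+ 2 <= 2 * x ^+ 2 + 2 * y ^+ 2.
Proof. by have := sqr_ge0 (x - y); nra. Qed.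

Lemma inner_sqr (f : V -> R) : inner f f = \int[mu]_x (f x ^+ 2).
Proof. by apply: eq_Rintegral => x _; rewrite expr2. Qed.

Lemma inner_add_le (f g : V -> R) : L2 f -> L2 g ->
  inner (fun x => f x + g x) (fun x => f x + g x) <= 2 * inner f f + 2 * inner g g.
Proof.
move=> Lf Lg; rewrite !inner_sqr -!RintZ; [|exact: L2_intg_sqr..].
rewrite -RintD; [|by apply: intgZ; exact: L2_intg_sqr..].
apply: Rint_le => [|| x]; last exact: sq_add_le.
- by apply: L2_intg_sqr; exact: L2D.
- by apply: intgD; apply: intgZ; exact: L2_intg_sqr.
Qed.

(** The Riesz-Fischer argument: W, the sum of 4^k |f_(k+1) - f_k|^2, has integral at most the sum of
    4^k 8^-k = 2^-k. On the set C where W is finite, consecutive terms differ by at most sqrt(W)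
    2^-k, so they converge pointwise with an integrable bound; off the null complement of C
    everything is replaced by 0. *)
Lemma L2_fast_cauchy (f_ : nat -> V -> R) : (forall k, L2 (f_ k)) ->
  (forall k, inner (fun x => f_ k.+1 x - f_ k x) (fun x => f_ k.+1 x - f_ k x)
     <= (8^-1) ^+ k) ->
  exists f, L2cvg f_ f.
Proof.
move=> Lf fc.
pose g k x := 4 ^+ k * (f_ k.+1 x - f_ k x) ^+ 2.
have mg k : measurable_fun setT (g k).
  apply: measurable_funM => //; apply: measurable_funX.
  by apply: measurable_funB; exact: L2_meas.
have ig k : intg mu (g k) by apply: intgZ; apply: L2_intg_sqr; exact: L2B.
have g0 k x : 0 <= g k x by rewrite mulr_ge0 ?sqr_ge0// exprn_ge0.
pose W x := (\sum_(k <oo) (g k x)%:E)%E.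
have mW : measurable_fun setT W.
  apply: (@ge0_emeasurable_sum _ _ _ setT (fun k x => (g k x)%:E) xpredT).
    by move=> k x _ _; rewrite lee_fin.
  by move=> k _; exact/measurable_EFinP.
have IW : (\int[mu]_x W x <= 2%:E)%E.
  rewrite integral_nneseries//; [|by move=> k; exact/measurable_EFinP|by move=> k x _; rewrite lee_fin].
  have -> : (2%:E = \sum_(k <oo) (((2^-1 : R) ^+ k)%:E))%E.
    apply/esym/cvg_lim => //.
    have := @cvg_geometric_series R 1 (2^-1) _.
    rewrite ger0_norm// invf_lt1// ltr1n => /(_ isT).
    have -> : 1 * (1 - 2^-1)^-1 = 2 :> R by field.
    move=> H; rewrite (_ : (fun _ => _) = EFin \o series (geometric 1 (2^-1 : R))).
      by apply: cvg_EFin; [exact: nearW|].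
    apply/funext => k; rewrite /= /series /= -sumEFin.
    by apply: eq_bigr => i _; rewrite /= mul1r.
  apply: lee_nneseries => [k _ _|k _].
    by apply: integral_ge0 => x _; rewrite lee_fin.
  rewrite -Rint_EFin// lee_fin RintZ; last by apply: L2_intg_sqr; exact: L2B.
  rewrite -inner_sqr (le_trans (ler_wpM2l _ (fc k)))// ?exprn_ge0// -exprMn.
  by rewrite (_ : 4 * 8^-1 = 2^-1 :> R)//; field.
have W0 x : (0 <= W x)%E by apply: nneseries_ge0 => k _ _; rewrite lee_fin.
have iW : mu.-integrable setT W.
  apply/integrableP; split => //; apply: le_lt_trans (ltry 2).
  by under eq_integral do rewrite gee0_abs//.
pose C := [set x | (W x < +oo)%E].
have mC : measurable C.
  have := emeasurable_fun_infty_o measurableT mW +oo%E.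
  by rewrite setTI.
have aeC : {ae mu, forall x, C x}.
  have := integrable_ae measurableT iW.
  by apply: filterS => x /(_ I); rewrite /C /= ge0_fin_numE.
pose w x := fine (W x) * \1_C x.
have w0 x : 0 <= w x by rewrite mulr_ge0// ?fine_ge0.
have mw : measurable_fun setT w.
  by apply: measurable_funM => //; apply: (measurableT_comp (fine_measurable measurableT)).
have iw : intg mu w.
  apply: intg_ge0 => //; apply: le_lt_trans (ltry 2); apply: le_trans IW.
  apply: ge0_le_integral => //; try exact/measurable_EFinP.
    by move=> x _; rewrite lee_fin.
  move=> x _; rewrite /w indicE; have [|] := boolP (x \in C) => xC; last by rewrite mulr0.
  by rewrite mulr1 fineK// ge0_fin_numE//; rewrite inE in xC.
pose h k x := f_ k x * \1_C x.
have hg x k : `|h k.+1 x - h k x| <= Num.sqrt (w x) * (2^-1) ^+ k.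
  rewrite /h /w -mulrBl indicE; have [|] := boolP (x \in C) => xC; last first.
    by rewrite !mulr0 normr0 mulr_ge0 ?sqrtr_ge0// exprn_ge0.
  rewrite inE /C /= in xC; rewrite !mulr1.
  rewrite -(@ler_pXn2r _ 2)// ?nnegrE ?sqrtr_ge0 ?mulr_ge0 ?sqrtr_ge0 ?exprn_ge0//.
  rewrite exprMn sqr_sqrtr ?fine_ge0//.
  have gW : ((g k x)%:E <= W x)%E.
    apply: le_trans (nneseries_lim_ge k.+1 _); last by move=> j _ _; rewrite lee_fin.
    rewrite big_nat_recr//= leeDr//; apply: sume_ge0 => j _; by rewrite lee_fin.
  have {}gW : g k x <= fine (W x) by rewrite -lee_fin fineK// ge0_fin_numE.
  rewrite real_normK ?num_real// -exprM mulnC exprM.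
  rewrite -ler_pdivrMr ?exprn_gt0// -exprVn mulrC (le_trans _ gW)// /g.
  have -> : (2^-1 : R) ^- 2 = 4 by field.
  by rewrite ler_wpM2r ?sqr_ge0.
pose f x := limn (h ^~ x).
have hf x : (h ^~ x) @ \oo --> f x /\ forall k, `|f x - h k x| <= 2 * Num.sqrt (w x) * (2^-1) ^+ k.
  exact: geometric_cauchy (hg x).
have mh k : measurable_fun setT (h k).
  by apply: measurable_funM => //; exact: L2_meas.
have mf : measurable_fun setT f.
  by apply: (measurable_fun_cvg mh) => x _; case: (hf x).
have fh k : L2 (fun x => f x - h k x) /\
   inner (fun x => f x - h k x) (fun x => f x - h k x) <= 8 * (4^-1) ^+ k.
  have mfh : measurable_fun setT (fun x => f x - h k x) by exact: measurable_funB.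
  have B x : (f x - h k x) ^+ 2 <= 4 * (4^-1) ^+ k * w x.
    have [_ /(_ k)] := hf x.
    rewrite -(@ler_pXn2r _ 2) ?nnegrE ?mulr_ge0 ?sqrtr_ge0 ?exprn_ge0// real_normK ?num_real//.
    rewrite !exprMn sqr_sqrtr// -exprM mulnC exprM => /le_trans; apply.
    rewrite -mulrA [w x * _]mulrC mulrA ler_wpM2r// -natrX.
    by rewrite (_ : 2^-1 ^+ 2 = 4^-1 :> R)//; field.
  have iB : intg mu (fun x => 4 * (4^-1) ^+ k * w x) by exact: intgZ.
  have Lfh : L2 (fun x => f x - h k x).
    apply: L2P => //; apply: intg_le iB; first exact: measurable_funX.
    by move=> x; rewrite ger0_norm ?sqr_ge0.
  split=> //; rewrite inner_sqr.
  apply: le_trans (Rint_le (L2_intg_sqr Lfh) iB B) _.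
  rewrite RintZ// (_ : 8 * _ = 4 * (4^-1) ^+ k * 2); last by ring.
  rewrite ler_wpM2l ?mulr_ge0 ?exprn_ge0// -lee_fin Rint_EFin//.
  apply: le_trans IW; apply: ge0_le_integral => //; try exact/measurable_EFinP.
    by move=> x _; rewrite lee_fin.
  move=> x _; rewrite /w indicE; have [|] := boolP (x \in C) => xC; last by rewrite mulr0.
  by rewrite mulr1 fineK// ge0_fin_numE//; rewrite inE in xC.
have Lh k : L2 (h k).
  have := @L2_bM _ _ 1 (f_ k) (\1_C) _ _ (Lf k).
  rewrite (_ : (fun x => _) = h k); first by apply => // x; rewrite indicE; case: (_ \in _); rewrite ?normr1 ?normr0.
  by apply/funext => x; rewrite mulrC.
have Lff : L2 f.
  have := L2D (proj1 (fh 0%N)) (Lh 0%N); congr L2; apply/funext => x; by rewrite subrK.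
exists f; split=> //.
apply: (@squeeze_cvgr _ _ _ _ (cst 0) (geometric 8 (4^-1))).
- apply: nearW => k; rewrite inner_ge0/=; apply: le_trans (proj2 (fh k)).
  rewrite !inner_sqr le_eqVlt; apply/orP; left; apply/eqP/Rint_ae.
  + by apply: measurable_funX; apply: measurable_funB => //; exact: L2_meas.
  + by apply: measurable_funX; exact: measurable_funB.
  + apply: filterS aeC => x Cx; rewrite /h indicE mem_set// mulr1; ring.
- exact: cvg_cst.
- by apply: cvg_geometric; rewrite ger0_norm// invf_lt1// ltr1n.
Qed.

Lemma L2_complete (f_ : nat -> V -> R) : (forall k, L2 (f_ k)) ->
  (forall e, 0 < e -> exists N, forall i j, (N <= i)%N -> (N <= j)%N ->
     inner (fun x => f_ i x - f_ j x) (fun x => f_ i x - f_ j x) <= e) ->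
  exists f, L2cvg f_ f.
Proof.
move=> Lf fc.
have /choice[N HN] : forall k, exists N, forall i j, (N <= i)%N -> (N <= j)%N ->
     inner (fun x => f_ i x - f_ j x) (fun x => f_ i x - f_ j x) <= (8^-1) ^+ k.
  by move=> k; apply: fc; rewrite exprn_gt0.
(* Both [phi k] and [phi k.+1] exceed [N k], so consecutive members of the subsequence are 8^-k
   close; the summand [k] sends [phi] to infinity. *)
pose phi k := (\sum_(i < k.+1) N i + k)%N.
have phi1 k : (N k <= phi k)%N by rewrite /phi big_ord_recr/= -addnA addnCA leq_addr.
have phi2 k : (N k <= phi k.+1)%N.
  have -> : phi k.+1 = (phi k + (N k.+1 + 1))%N by rewrite /phi big_ord_recr/=; lia.
  by rewrite (leq_trans (phi1 k))// leq_addr.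
have phi3 k : (k <= phi k)%N by rewrite /phi leq_addl.
have [k||f [_ Lff cv]] := @L2_fast_cauchy (fun k => f_ (phi k)); first exact: Lf.
  by move=> k; exact: HN.
exists f; split=> //; apply/cvgrPdist_le => e e0.
have e4 : 0 < e / 4 by rewrite divr_gt0.
have [M HM] := fc _ e4.
move/cvgrPdist_le : (cv) => /(_ _ e4)[K _ HK].
pose m := maxn K M.
exists M => // j /= Mj; rewrite sub0r normrN ger0_norm ?inner_ge0//.
have H1 : inner (fun x => f_ j x - f_ (phi m) x) (fun x => f_ j x - f_ (phi m) x) <= e / 4.
  by apply: HM => //; apply: leq_trans (phi3 m); exact: leq_maxr.
have := HK m (leq_maxl _ _); rewrite sub0r normrN ger0_norm ?inner_ge0// => H2.
have := inner_add_le (L2B (Lf j) (Lf (phi m))) (L2B (Lf (phi m)) Lff).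
rewrite (_ : (fun x => _ + _) = fun x => f_ j x - f x); last by apply/funext => x; ring.
by move=> /le_trans; apply; lra.
Qed.

End completeness.

Import HBNNSimple.

(** * Bounded functional calculus *)

Section staircase.
Context {R : realType}.

(** The sum counts the positive integers below y: it is the integer part of y. *)
Lemma staircase_sum (N : nat) (y : R) : 0 <= y <= N%:R ->
  `|\sum_(i < N) ((i.+1%:R <= y)%R%:R : R) - y| <= 1.
Proof.
elim: N => [|N IH] /andP[y0 yN].
  have -> : y = 0 by apply/eqP; rewrite eq_le yN y0.
  by rewrite big_ord0 subrr normr0.
have [yN'|yN'] := leP y N%:R.
  rewrite big_ord_recr/= (_ : (N.+1%:R <= y) = false) ?addr0; first by rewrite IH// y0.
  by apply/negbTE; rewrite -ltNge (le_lt_trans yN')// ltr_nat.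
rewrite big_ord_recr/= (eq_bigr (fun=> 1)); last first.
  by move=> i _; rewrite (le_trans _ (ltW yN'))// ler_nat.
rewrite sumr_const card_ord.
have [yN1|yN1] := leP N.+1%:R y; rewrite ler_norml; apply/andP; split;
  rewrite ?mulr1n ?mulr0n; move: yN yN1; rewrite -natr1; lra.
Qed.

(** The sets are the superlevel sets of psi at spacing e above -M. The approximant is a constant
    plus one multiple of a sum of indicators, so a linear functional that is known on indicators can
    be evaluated on it. *)
Lemma bounded_staircase (psi : R -> R) (M e : R) : measurable_fun setT psi ->
  0 < e -> (forall l, `|psi l| <= M) ->
  exists (N : nat) (a b : R) (B : nat -> set (measurableTypeR R)),
   (forall i, measurable (B i)) /\
   forall l, `|psi l - (a + b * \sum_(i < N) \1_(B i) l)| <= e.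
Proof.
move=> mpsi e0 psiM.
have M0 : 0 <= M by exact: le_trans (psiM 0).
pose y l := (psi l + M) / e.
have [N yN] : exists N : nat, forall l, y l <= N%:R.
  exists (Num.truncn (2 * M / e)).+1 => l.
  have /ltW : 2 * M / e < (Num.truncn (2 * M / e)).+1%:R.
    by rewrite truncnS_gt.
  apply: le_trans; rewrite ler_pM2r ?invr_gt0//.
  by have := psiM l; rewrite ler_norml => /andP[]; lra.
exists N, (- M), e, (fun i => y @^-1` `[i.+1%:R, +oo[%classic); split.
  have my : measurable_fun setT y.
    by apply: measurable_funM => //; apply: measurable_funD.
  by move=> i; have := my measurableT _ (@measurable_itv R `[i.+1%:R, +oo[); rewrite setTI.
move=> l; have := @staircase_sum N (y l).
have -> : 0 <= y l <= N%:R.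
  rewrite yN andbT divr_ge0 ?(ltW e0)//.
  by have := psiM l; rewrite ler_norml => /andP[]; lra.
move=> /(_ isT) H.
have -> : psi l - (- M + e * (\sum_(i < N) \1_(y @^-1` `[i.+1%:R, +oo[%classic) l))
  = - e * ((\sum_(i < N) ((i.+1%:R <= y l)%R%:R : R)) - y l).
  rewrite (eq_bigr (fun i : 'I_N => ((i.+1%:R <= y l)%R%:R : R))); last first.
    move=> i _; rewrite indicE; congr (_%:R); congr nat_of_bool.
    by apply/idP/idP => [|h]; rewrite inE /= in_itv/= ?andbT//; exact/mem_set.
  by rewrite /y; field; rewrite gt_eqF.
rewrite normrM normrN (gtr0_norm e0); apply: ler_piMr => //; exact: ltW.
Qed.

End staircase.

Section spectral.
Context {R : realType} {n : nat}.
Local Notation V := 'rV[R]_n.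
Variable E : set (measurableTypeR R) -> (V -> R) -> V -> R.
Hypothesis hE : projection_valued_measure E.

Lemma E_L2 B f : measurable B -> L2 f -> L2 (E B f).
Proof. by case: hE => h *; exact: h. Qed.

Lemma E_sym B f g : measurable B -> L2 f -> L2 g -> inner (E B f) g = inner f (E B g).
Proof. by case: hE => _ _ h *; exact: h. Qed.

Lemma E_inner_I B C f g : measurable B -> measurable C -> L2 f -> L2 g ->
  inner (E B f) (E C g) = inner (E (B `&` C) f) g.
Proof.
move=> mB mC Lf Lg; case: hE => _ _ _ h _.
rewrite -E_sym//; last exact: E_L2.
have := h C B f mC mB Lf; rewrite setIC => {}h.
apply: inner_ae => //.
- by apply: E_L2 => //; exact: E_L2.
- by apply: E_L2 => //; exact: measurableI.
- by apply: filterS h => x /= /(_ I).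
Qed.

Lemma E_D B f g h a : measurable B -> L2 f -> L2 g -> L2 h ->
  inner (E B (fun x => a * f x + g x)) h = a * inner (E B f) h + inner (E B g) h.
Proof.
move=> mB Lf Lg Lh; case: hE => _ H _ _ _.
have Laf := L2Z a Lf.
rewrite -innerZl ?E_L2// -innerDl ?E_L2//; last exact/L2Z/E_L2.
apply: inner_ae => //; first by apply: E_L2 => //; exact: L2D.
  by apply: L2D; [apply: L2Z|]; exact: E_L2.
have := H B a f g mB Lf Lg.
by apply: filterS => x /= /(_ I).
Qed.

Lemma spectral_mass_ge0 B f : measurable B -> L2 f -> 0 <= inner (E B f) f.
Proof.
by move=> mB Lf; rewrite -[B]setIid -E_inner_I// inner_ge0.
Qed.

Section smeas_measure.
Variables (f : V -> R) (Lf : L2 f).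

(** The value is 0 off the sigma-algebra: the axioms on [E] control measurable sets only, while a
    measure must be nonnegative on every set. *)
Let sm (B : set (measurableTypeR R)) : \bar R :=
  if `[< measurable B >] then spectral_mass E f B else 0%E.

Let smE B : measurable B -> sm B = spectral_mass E f B.
Proof. by move=> mB; rewrite /sm; case: asboolP. Qed.

(** Additivity applied to the constant sequence of empty sets makes the multiples k c of the mass c
    converge; their consecutive differences, all equal to c, then tend to 0. *)
Let sm0 : sm set0 = 0%E.
Proof.
rewrite smE// /spectral_mass; congr (_%:E).
case: hE => _ _ _ _ [_ /(_ f Lf) sa].
have := sa (fun=> set0) (fun=> measurable0) (@trivIset_set0 _ _ _) _.
rewrite bigcup0// => /(_ measurable0) /= cv.
have c0 : inner (E set0 f) f = 0; last by [].
apply/eqP/negPn/negP => c0.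
have cvr : (fun k : nat => inner (E set0 f) f *+ k) @ \oo --> inner (E set0 f) f.
  have : fine \o (fun k => \sum_(0 <= i < k) spectral_mass E f set0)%E @ \oo --> inner (E set0 f) f.
    by apply: fine_cvg; exact: cv.
  rewrite (_ : fine \o _ = fun k : nat => inner (E set0 f) f *+ k)//.
  by apply/funext => k; rewrite /= /spectral_mass sumEFin/= sumr_const_nat subn0.
have cvs : (fun k : nat => inner (E set0 f) f *+ (k + 1)) @ \oo --> inner (E set0 f) f.
  by apply: (cvg_comp _ _ (cvg_addnr 1) cvr).
have H : (fun k : nat => inner (E set0 f) f *+ (k + 1) - inner (E set0 f) f *+ k) @ \oo -->
    inner (E set0 f) f - inner (E set0 f) f by exact: cvgB.
rewrite subrr (_ : (fun k : nat => _) = cst (inner (E set0 f) f)) in H; last first.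
  by apply/funext => k; rewrite /= mulrnDr addrAC subrr add0r.
have E0 : inner (E set0 f) f = 0.
  by apply: (cvg_unique (@Rhausdorff R) _ H); exact: cvg_cst.
by move: c0; rewrite E0 eqxx.
Qed.

Let sm_ge0 B : (0 <= sm B)%E.
Proof. by rewrite /sm; case: asboolP => // mB; rewrite lee_fin spectral_mass_ge0. Qed.

Let sm_sigma_additive : semi_sigma_additive sm.
Proof.
move=> F mF tF mUF; case: hE => _ _ _ _ [_ /(_ f Lf) sa].
rewrite smE//; have := sa F mF tF mUF; apply: cvg_trans; apply: near_eq_cvg; near=> k.
by apply: eq_bigr => i _; rewrite smE.
Unshelve. all: by end_near. Qed.

HB.instance Definition _ := isMeasure.Build _ _ _ sm sm0 sm_ge0 sm_sigma_additive.

Lemma smeas_ex : exists m : {measure set (measurableTypeR R) -> \bar R},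
  forall B, measurable B -> m B = spectral_mass E f B.
Proof. by exists sm => B; exact: smE. Qed.

End smeas_measure.

Definition smeas (f : V -> R) : {measure set (measurableTypeR R) -> \bar R} :=
  match pselect (L2 f) with
  | left Lf => projT1 (cid (smeas_ex Lf))
  | right _ => mzero
  end.

Lemma smeasE f B : L2 f -> measurable B -> smeas f B = (inner (E B f) f)%:E.
Proof.
by move=> Lf mB; rewrite /smeas; case: pselect => // {}Lf; case: cid => m /= ->.
Qed.

Lemma smeasT f : L2 f -> smeas f setT = (inner f f)%:E.
Proof.
move=> Lf; rewrite smeasE//; congr (_%:E); apply: inner_ae => //; first exact: E_L2.
by case: hE => _ _ _ _ [/(_ f Lf) h _]; apply: filterS h => x /= /(_ I).
Qed.

(** The integral against a bare set function unfolds into suprema over simple functions, whose level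
    sets are measurable; on these the set function and the measure coincide. *)
Lemma spectral_mass_integral f (F : R -> \bar R) : L2 f ->
  (\int[spectral_mass E f]_l F l = \int[smeas f]_l F l)%E.
Proof.
move=> Lf; rewrite /integral.
have S (h : {nnsfun (measurableTypeR R) >-> R}) :
    sintegral (spectral_mass E f) h = sintegral (smeas f) h.
  by apply: eq_fsbigr => r _; congr (_ * _)%E; rewrite smeasE//; exact: measurable_funPTI.
congr (_ - _)%E; congr ereal_sup; apply/seteqP; split => _ [h Hh <-]; exists h => //.
Qed.

Definition bdd (psi : R -> R) := measurable_fun setT psi /\ exists M : R, forall l, `|psi l| <= M.

Lemma bdd_intg psi f : L2 f -> bdd psi -> intg (smeas f) psi.
Proof.
move=> Lf [mpsi [M psiM]]; apply: measurable_bounded_integrable => //.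
  by rewrite smeasT// ltry.
by exists M; split; [exact: num_real|move=> x Mx t _; exact: le_trans (ltW Mx)].
Qed.

Lemma bdd_indic (B : set (measurableTypeR R)) : measurable B -> bdd (\1_B : R -> R).
Proof.
move=> mB; split; first exact: measurable_indic.
by exists 1 => l; rewrite indicE; case: (_ \in _); rewrite ?normr1 ?normr0.
Qed.

Lemma bdd_cst a : bdd (cst a).
Proof. by split=> //; exists `|a| => l. Qed.

Lemma bddD p q : bdd p -> bdd q -> bdd (fun l => p l + q l).
Proof.
move=> [mp [M pM]] [mq [N qN]]; split; first exact: measurable_funD.
by exists (M + N) => l; rewrite (le_trans (ler_normD _ _))// lerD.
Qed.

Lemma bddM p q : bdd p -> bdd q -> bdd (fun l => p l * q l).
Proof.
move=> [mp [M pM]] [mq [N qN]]; split; first exact: measurable_funM.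
by exists (M * N) => l; rewrite normrM ler_pM.
Qed.

Lemma bddZ a p : bdd p -> bdd (fun l => a * p l).
Proof. by move=> bp; apply: bddM => //; exact: bdd_cst. Qed.

Lemma bdd_sum I (s : seq I) (F : I -> R -> R) : (forall i, bdd (F i)) ->
  bdd (fun l => \sum_(i <- s) F i l).
Proof.
move=> bF; elim: s => [|i s IH].
  by have := bdd_cst 0; congr bdd; apply/funext => l; rewrite big_nil.
by have := bddD (bF i) IH; congr bdd; apply/funext => l; rewrite big_cons.
Qed.

(** Up to a uniform error, a bounded function is a staircase, on which D vanishes by linearity. This
    principle reduces every identity of the bounded functional calculus to indicators. *)
Lemma bdd_functional_eq0 (D : (R -> R) -> R) (K : R) :
  (forall p q a, bdd p -> bdd q -> D (fun l => a * p l + q l) = a * D p + D q) ->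
  (forall p (c : R), bdd p -> (forall l, `|p l| <= c) -> `|D p| <= K * c) ->
  (forall B, measurable B -> D (\1_B) = 0) ->
  forall p, bdd p -> D p = 0.
Proof.
move=> Dlin Dbdd D1 p bp; case: (bp) => mp [M pM].
have D0 : D (fun=> 0) = 0.
  by rewrite -[RHS](D1 set0)//; congr D; apply/funext => l; rewrite indic0.
have Dsum (N : nat) (B : nat -> set (measurableTypeR R)) : (forall i, measurable (B i)) ->
    D (fun l => \sum_(i < N) \1_(B i) l) = 0.
  move=> mB; elim: N => [|N IH].
    by rewrite -[RHS]D0; congr D; apply/funext => l; rewrite big_ord0.
  rewrite (_ : (fun l => _) = fun l : R => 1 * \1_(B N) l + \sum_(i < N) \1_(B i) l).
    have b1 : bdd (\1_(B N) : R -> R) by exact: bdd_indic (mB N).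
    have b2 : bdd (fun l : R => \sum_(i < N) \1_(B i) l).
      by apply: bdd_sum => i; exact: bdd_indic (mB i).
    by have := Dlin _ _ 1 b1 b2; rewrite IH (D1 _ (mB N)) mulr0 addr0.
  by apply/funext => l; rewrite big_ord_recr/= mul1r addrC.
have DT : D (cst 1) = 0.
  by rewrite -[RHS](D1 setT)//; congr D; apply/funext => l; rewrite indicT.
suff H (e : R) : 0 < e -> `|D p| <= K * e.
  have K0 : 0 <= K.
    have := Dbdd (fun=> 0) 1 (bdd_cst 0); rewrite D0 normr0 mulr1; apply => l.
    exact: ler01.
  apply/eqP; rewrite -normr_le0; apply/ler_addgt0Pl => e e0; rewrite addr0.
  have K1 : 0 < K + 1 by rewrite ltr_wpDl.
  apply: le_trans (H (e / (K + 1)) _) _; first by rewrite divr_gt0.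
  by rewrite mulrCA ler_piMr ?(ltW e0)// ler_pdivrMr// mul1r lerDl.
move=> e0; have [N [a [b [B [mB HB]]]]] := bounded_staircase mp e0 pM.
pose st (l : R) : R := \sum_(i < N) \1_(B i) l.
have bst : bdd st by apply: bdd_sum => i; exact: (bdd_indic (mB i)).
have bab : bdd (fun l => a * cst 1 l + (fun l => b * st l + (fun=> 0) l) l).
  by apply: bddD; [apply: bddZ; exact: bdd_cst|apply: bddD; [exact: bddZ|exact: bdd_cst]].
have := Dbdd (fun l => (-1) * (a * cst 1 l + (fun l => b * st l + (fun=> 0) l) l) + p l) e.
rewrite Dlin// [D (fun l => a * _ + _)]Dlin; [|exact: bdd_cst|by apply: bddD; [exact: bddZ|exact: bdd_cst]].
rewrite [D (fun l => b * _ + _)]Dlin//; last exact: bdd_cst.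
rewrite DT D0 [D st]Dsum// !mulr0 !addr0 mulr0 add0r; apply.
  by apply: bddD => //; exact: bddZ.
by move=> l; have := HB l; rewrite /cst mulr1 addr0 mulN1r addrC.
Qed.

(** The number <psi(L) f, g>, as the integral of psi against the polarized spectral measures. *)
Definition polar (psi : R -> R) f g : R :=
  4^-1 * (\int[smeas (f \+ g)%R]_l psi l - \int[smeas (f \- g)%R]_l psi l).

Lemma pol_lin f g p q a : L2 f -> L2 g -> bdd p -> bdd q ->
  polar (fun l => a * p l + q l) f g = a * polar p f g + polar q f g.
Proof.
move=> Lf Lg bp bq; have LD := L2D Lf Lg; have LB := L2B Lf Lg.
have ip h : L2 h -> \int[smeas h]_l (a * p l + q l) =
    a * \int[smeas h]_l p l + \int[smeas h]_l q l.
  by move=> Lh; rewrite RintD ?RintZ//; [exact: bdd_intg|apply: intgZ; exact: bdd_intg|exact: bdd_intg].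
rewrite /polar !ip//; ring.
Qed.

Lemma quad_bound (f : V -> R) p (c : R) : L2 f -> bdd p -> (forall l, `|p l| <= c) ->
  `|\int[smeas f]_l p l| <= c * inner f f.
Proof.
move=> Lf bp pc; apply: le_trans (Rint_norm (bdd_intg Lf bp)) _.
apply: (@le_trans _ _ (\int[smeas f]_l (cst c l))).
  apply: Rint_le => //; first exact/intg_norm/bdd_intg.
  by apply: bdd_intg => //; exact: bdd_cst.
by have := @Rintegral_cst _ _ _ (smeas f) setT measurableT c; rewrite smeasT// => ->.
Qed.

Lemma inner_DB (f g : V -> R) : L2 f -> L2 g ->
  inner (f \+ g)%R (f \+ g)%R + inner (f \- g)%R (f \- g)%R = 2 * (inner f f + inner g g).
Proof.
move=> Lf Lg; have LD : L2 (f \+ g) := L2D Lf Lg; have LB : L2 (f \- g) := L2B Lf Lg.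
rewrite (innerDl Lf Lg LD) (innerBl Lf Lg LB).
rewrite !(innerDr Lf Lg)// !(innerBr Lf Lg)// (innerC g f); ring.
Qed.

(** The parallelogram law sums the two spectral masses. Half the sum of the squared norms serves as
    well as a Cauchy-Schwarz bound for continuity in p, and for f = g it is the sharp ||p||
    ||f||^2. *)
Lemma pol_bound (f g : V -> R) p (c : R) : L2 f -> L2 g -> bdd p -> (forall l, `|p l| <= c) ->
  `|polar p f g| <= (2^-1 * (inner f f + inner g g)) * c.
Proof.
move=> Lf Lg bp pc; rewrite /polar normrM ger0_norm//.
have H1 := quad_bound (L2D Lf Lg) bp pc; have H2 := quad_bound (L2B Lf Lg) bp pc.
have /= H := inner_DB Lf Lg.
have := ler_normB (\int[smeas (f \+ g)%R]_l p l) (\int[smeas (f \- g)%R]_l p l).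
set x := `|_ - _|; move=> Hx.
have : x <= c * (2 * (inner f f + inner g g)) by rewrite -H mulrDr; lra.
by lra.
Qed.

Lemma Rint_indic d (T : measurableType d) (m : {measure set T -> \bar R}) B :
  measurable B -> \int[m]_x \1_B x = fine (m B).
Proof. by move=> mB; rewrite /Rintegral integral_indic// setIT. Qed.

Lemma pol_indic f g B : L2 f -> L2 g -> measurable B -> polar (\1_B) f g = inner (E B f) g.
Proof.
move=> Lf Lg mB; have LD := L2D Lf Lg; have LB := L2B Lf Lg.
rewrite /polar !Rint_indic// !smeasE//=.
rewrite (_ : (f \+ g)%R = fun x => 1 * f x + g x); last by apply/funext => x; rewrite mul1r.
rewrite (_ : (f \- g)%R = fun x => (-1) * g x + f x); last first.
  by apply/funext => x /=; rewrite mulN1r addrC.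
have L1 : L2 (fun x => 1 * f x + g x) by apply: L2D => //; exact: L2Z.
have L2' : L2 (fun x => (-1) * g x + f x) by apply: L2D => //; exact: L2Z.
rewrite !E_D// !(innerC (E B _) _) !innerDl ?innerZl ?E_L2//; try exact: L2Z; try exact: E_L2.
have -> : inner g (E B f) = inner f (E B g) by rewrite -E_sym// innerC.
by rewrite -!E_sym//; field.
Qed.

(** Uniqueness of the calculus: a linear functional that is continuous for the uniform norm is
    determined by its values on indicators. Symmetry, multiplicativity and the diagonal formula are
    all instances. *)
Lemma pol_eq (T : (R -> R) -> R) (K : R) psi f g :  L2 f -> L2 g ->
  (forall p q a, bdd p -> bdd q -> T (fun l => a * p l + q l) = a * T p + T q) ->
  (forall p (c : R), bdd p -> (forall l, `|p l| <= c) -> `|T p| <= K * c) ->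
  (forall B, measurable B -> T (\1_B) = inner (E B f) g) ->
  bdd psi -> T psi = polar psi f g.
Proof.
move=> Lf Lg Tlin Tbdd T1 bpsi; apply/eqP; rewrite -subr_eq0; apply/eqP.
apply: (@bdd_functional_eq0 (fun p => T p - polar p f g) (K + (2^-1 * (inner f f + inner g g)))) => //.
- by move=> p q a bp bq; rewrite Tlin// pol_lin//; ring.
- move=> p c bp pc; rewrite (le_trans (ler_normB _ _))// mulrDl lerD//; first exact: Tbdd.
  exact: pol_bound.
- by move=> B mB; rewrite T1// pol_indic// subrr.
Qed.

End spectral.

Lemma L2cvg_inner {R : realType} {n : nat} (f_ : nat -> 'rV[R]_n -> R) f g :
  L2cvg f_ f -> L2 g -> inner (f_ k) g @[k --> \oo] --> inner f g.
Proof.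
move=> [Lf_ Lf cv] Lg; apply: cvg_zero.
apply/cvgrPdist_le => e e0.
have ge : 0 < e ^+ 2 / (inner g g + 1).
  by rewrite divr_gt0 ?exprn_gt0// ltr_wpDl// inner_ge0.
move/cvgrPdist_le : cv => /(_ _ ge); apply: filterS => k.
rewrite !sub0r !normrN (ger0_norm (inner_ge0 _)) => H.
change (`|inner (f_ k) g - inner f g| <= e); rewrite -innerBl//.
rewrite -(@ler_pXn2r _ 2) ?nnegrE ?(ltW e0)// real_normK ?num_real//.
apply: le_trans (inner_CS (L2B (Lf_ k) Lf) Lg) _.
apply: (@le_trans _ _ (e ^+ 2 / (inner g g + 1) * inner g g)).
  by rewrite ler_wpM2r ?inner_ge0.
rewrite -mulrA ler_piMr ?sqr_ge0// mulrC ler_pdivrMr ?mul1r ?lerDl//.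
by rewrite ltr_wpDl// inner_ge0.
Qed.

(** The arithmetic of the Cauchy property in [bfc_ex]: D is the squared norm of a difference of
    approximants and a, b are their uniform errors. The bounds on x and y contain D itself, which is
    absorbed because a and b are at most 1/2. *)
Lemma cauchy_arith {R : realType} (a b F D x y e m : R) : 0 <= a -> 0 <= b -> 0 <= F -> 0 <= D ->
  x <= 2^-1 * (F + D) * a -> y <= 2^-1 * (F + D) * b ->
  a * (2 * F + 1) <= m / 2 -> b * (2 * F + 1) <= m / 2 ->
  D <= x + y -> m <= e -> m <= 1 -> D <= e.
Proof.
move=> a0 b0 F0 D0 Hx Hy Ha Hb HD me m1.
have aF : 0 <= a * F by rewrite mulr_ge0.
have bF : 0 <= b * F by rewrite mulr_ge0.
have aD : a * D <= 2^-1 * D by rewrite ler_wpM2r//; lra.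
have bD : b * D <= 2^-1 * D by rewrite ler_wpM2r//; lra.
by nra.
Qed.

Section bfc.
Context {R : realType} {n : nat}.
Local Notation V := 'rV[R]_n.
Variable E : set (measurableTypeR R) -> (V -> R) -> V -> R.
Hypothesis hE : projection_valued_measure E.
Local Notation pol := (polar hE).
Local Notation sm := (smeas hE).

Lemma pol0 f g : pol (fun=> 0) f g = 0.
Proof. by rewrite /polar /Rintegral !integral0_eq// subrr mulr0. Qed.

(** h = psi(L) f, as a relation because h is determined only almost everywhere. *)
Definition bfc (psi : R -> R) (f h : V -> R) :=
  L2 h /\ forall g, L2 g -> inner h g = pol psi f g.

(** Staircases p_m within 1/(m+1) of psi turn into finite combinations of projections applied to f.
    By [pol_bound] these are Cauchy in L^2, and their limit represents psi(L) f. *)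
Lemma bfc_ex psi f : L2 f -> bdd psi -> exists h, bfc psi f h.
Proof.
move=> Lf bpsi; case: (bpsi) => mpsi [M psiM].
have ex m : exists h p, [/\ L2 h, bdd p, forall g, L2 g -> inner h g = pol p f g &
    forall l, `|psi l - p l| <= m.+1%:R^-1].
  have [|N [a [b [B [mB HB]]]]] := @bounded_staircase _ psi M m.+1%:R^-1 mpsi _ psiM.
    by rewrite invr_gt0.
  have bi i : bdd (\1_(B i) : R -> R) by exact: bdd_indic (mB i).
  have bst : bdd (fun l : R => \sum_(i < N) \1_(B i) l : R).
    by apply: bdd_sum => i; exact: bi.
  exists (fun x => \sum_(i < N) b * E (B i) f x + a * f x).
  exists (fun l => b * (\sum_(i < N) \1_(B i) l) + a * 1).
  have Lb i : L2 (fun x => b * E (B i) f x) by exact/L2Z/E_L2.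
  have Ls := L2_sum (index_enum 'I_N) (fun i => Lb (val i)).
  split.
  - by apply: L2D => //; exact: L2Z.
  - by apply: bddD; [exact: bddZ|exact: bdd_cst].
  - move=> g Lg; rewrite innerDl//; last exact: L2Z.
    rewrite (inner_suml _ (fun i => Lb (val i)))// innerZl//.
    rewrite (_ : (fun l => _ + a * 1) = fun l => b * (\sum_(i < N) \1_(B i) l) + (fun=> a * 1) l)//.
    rewrite pol_lin//; last exact: bdd_cst.
    have -> : pol (fun=> a * 1) f g = a * inner f g.
      have T1 : bdd (\1_[set: R] : R -> R) by apply: bdd_indic.
      have := pol_lin hE a Lf Lg T1 (bdd_cst 0).
      have -> : (fun l => a * \1_[set: R] l + cst 0 l) = (fun=> a * 1) :> (R -> R).
        by apply/funext => l; rewrite indicT addr0.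
      move=> ->; rewrite pol_indic//.
      have -> : pol (cst 0) f g = 0.
        exact: pol0.
      rewrite addr0; congr (_ * _); apply: inner_ae => //; first exact: E_L2.
      by case: hE => _ _ _ _ [/(_ f Lf) h _]; apply: filterS h => x /= /(_ I).
    congr (_ + _).
    transitivity (b * \sum_(i < N) inner (E (B i) f) g).
      rewrite mulr_sumr; apply: eq_bigr => i _; rewrite innerZl//; exact: E_L2.
    congr (_ * _).
    elim: N {Lb Ls bst HB} => [|N IH].
      rewrite big_ord0; under [X in pol X]funext do rewrite big_ord0.
      exact/esym/pol0.
    rewrite big_ord_recr/= IH.
    rewrite (_ : (fun l => \sum_(i < N.+1) _) = fun l => 1 * \1_(B N) l + \sum_(i < N) \1_(B i) l).
      rewrite pol_lin//; last by apply: bdd_sum => i; exact: bi.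
      by rewrite (pol_indic hE Lf Lg (mB N)) mul1r addrC.
    by apply/funext => l; rewrite big_ord_recr/= mul1r addrC.
  - by move=> l; rewrite mulr1 [X in _ - X]addrC; exact: HB.
have /choice[h /choice[p hp]] := ex.
have Lh m : L2 (h m) by case: (hp m).
have bp m : bdd (p m) by case: (hp m).
have ph m : forall g, L2 g -> inner (h m) g = pol (p m) f g by case: (hp m).
have pp m : forall l, `|psi l - p m l| <= m.+1%:R^-1 by case: (hp m).
have hpsi m g : L2 g -> `|inner (h m) g - pol psi f g| <= (2^-1 * (inner f f + inner g g)) * m.+1%:R^-1.
  move=> Lg; rewrite ph//.
  have := pol_lin hE (-1) Lf Lg bpsi (bp m); rewrite mulN1r addrC => <-.
  apply: pol_bound => //; first by apply: bddD => //; exact: bddZ.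
  by move=> l; rewrite mulN1r addrC -normrN opprB.
have [|k Lk] := @L2_complete R n h Lh.
  move=> e e0.
  have [N HN] : exists N : nat, forall i, (N <= i)%N -> i.+1%:R^-1 * (2 * inner f f + 1) <= Num.min e 1 / 2.
    have m0 : 0 < Num.min e 1 by rewrite lt_min e0 ltr01.
    have c0 : 0 < 2 * inner f f + 1 by rewrite ltr_wpDl// mulr_ge0// inner_ge0.
    exists (Num.truncn ((Num.min e 1 / 2 / (2 * inner f f + 1))^-1)) => i Ni.
    rewrite -ler_pdivlMr// invf_ple ?posrE ?divr_gt0//.
    by apply: le_trans (ltW (truncnS_gt _)) _; rewrite ler_nat ltnS.
  exists N => i j Ni Nj; set d := (fun x => h i x - h j x).
  have Ld : L2 d by exact: L2B.
  have id0 := inner_ge0 d.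
  have Hi := hpsi i d Ld; have Hj := hpsi j d Ld.
  have : inner d d <= `|inner (h i) d - pol psi f d| + `|inner (h j) d - pol psi f d|.
    rewrite {1}/d innerBl//.
    have -> : inner (h i) d - inner (h j) d = (inner (h i) d - pol psi f d) - (inner (h j) d - pol psi f d) by ring.
    by rewrite (le_trans (ler_norm _))// ler_normB.
  have m1 : Num.min e 1 <= e by rewrite ge_min lexx.
  have m2 : Num.min e 1 <= 1 by rewrite ge_min lexx orbT.
  have i0 : 0 <= i.+1%:R^-1 :> R by rewrite invr_ge0.
  have j0 : 0 <= j.+1%:R^-1 :> R by rewrite invr_ge0.
  by move=> Hd; exact: (cauchy_arith i0 j0 (inner_ge0 f) id0 Hi Hj (HN i Ni) (HN j Nj) Hd m1 m2).
exists k; case: (Lk) => _ Lkk _; split => // g Lg.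
apply/eqP; rewrite -subr_eq0 -normr_le0.
have c1 := L2cvg_inner Lk Lg.
have c2 : (fun m : nat => inner (h m) g) @ \oo --> pol psi f g.
  apply: cvg_zero; apply/norm_cvg0P.
  apply: (@squeeze_cvgr _ _ _ _ (cst 0) (fun m => (2^-1 * (inner f f + inner g g)) * m.+1%:R^-1)).
  - by apply: nearW => m; rewrite normr_ge0/=; exact: hpsi.
  - exact: cvg_cst.
  - rewrite -[X in _ --> X](mulr0 (2^-1 * (inner f f + inner g g))).
    by apply: cvgM; [exact: cvg_cst|exact: cvg_harmonic].
by rewrite (cvg_unique (@Rhausdorff R) c1 c2) subrr normr0.
Qed.

Lemma E_T f g : L2 f -> L2 g -> inner (E setT f) g = inner f g.
Proof.
move=> Lf Lg; apply: inner_ae => //; first exact: E_L2.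
by case: hE => _ _ _ _ [/(_ f Lf) h _]; apply: filterS h => x /= /(_ I).
Qed.

Lemma pol_cst a f g : L2 f -> L2 g -> pol (fun=> a) f g = a * inner f g.
Proof.
move=> Lf Lg; have T1 : bdd (\1_[set: R] : R -> R) by apply: bdd_indic.
have := pol_lin hE a Lf Lg T1 (bdd_cst 0); rewrite pol0 addr0 pol_indic// E_T// => <-.
by congr polar; apply/funext => l; rewrite indicT mulr1 addr0.
Qed.

Lemma polD p q f g : L2 f -> L2 g -> bdd p -> bdd q ->
  pol (fun l => p l + q l) f g = pol p f g + pol q f g.
Proof.
move=> Lf Lg bp bq; rewrite -[pol p f g]mul1r -pol_lin//.
by congr polar; apply/funext => l; rewrite mul1r.
Qed.

Lemma polZ a p f g : L2 f -> L2 g -> bdd p -> pol (fun l => a * p l) f g = a * pol p f g.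
Proof.
move=> Lf Lg bp; rewrite -[RHS]addr0 -[in RHS](pol0 f g) -pol_lin//; last exact: bdd_cst.
by congr polar; apply/funext => l; rewrite addr0.
Qed.

Lemma polC p f g : L2 f -> L2 g -> bdd p -> pol p f g = pol p g f.
Proof.
move=> Lf Lg bp; apply: (@pol_eq R n E hE (fun q => pol q f g) (2^-1 * (inner f f + inner g g)) p g f) => //.
- by move=> *; exact: pol_lin.
- by move=> q c bq qc; exact: pol_bound.
- by move=> B mB; rewrite pol_indic// E_sym// innerC.
Qed.

Lemma pol_E p f g C : L2 f -> L2 g -> bdd p -> measurable C ->
  pol p f (E C g) = pol (fun l => \1_C l * p l) f g.
Proof.
move=> Lf Lg bp mC; apply/esym.
have b1 q : bdd q -> bdd (fun l => \1_C l * q l).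
  by move=> bq; apply: bddM => //; exact: bdd_indic.
apply: (@pol_eq R n E hE (fun q => pol (fun l => \1_C l * q l) f g)
   (2^-1 * (inner f f + inner g g))) => //; first exact: E_L2.
- move=> q r a bq br; rewrite -(pol_lin hE a Lf Lg (b1 _ bq) (b1 _ br)).
  by congr polar; apply/funext => l; ring.
- move=> q c bq qc; apply: pol_bound => //; first exact: b1.
  move=> l; rewrite normrM indicE; case: (_ \in _); rewrite ?normr1 ?mul1r ?normr0 ?mul0r//.
  by apply: le_trans (qc 0).
- move=> B mB; rewrite E_inner_I// -pol_indic//; last exact: measurableI.
  by congr polar; apply/funext => l; rewrite indicI mulrC.
Qed.

(** For fixed psi both sides are continuous functionals of chi; on an indicator they agree because
    the projection can be moved to g and absorbed by [pol_E]. *)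
Lemma bfc_comp psi chi f h k : L2 f -> bdd psi -> bdd chi -> bfc psi f h -> bfc chi h k ->
  bfc (fun l => chi l * psi l) f k.
Proof.
move=> Lf bp bc [Lh hh] [Lk hk]; split=> // g Lg; rewrite hk//.
case: (bp) => mpsi [M psiM]; apply/esym.
apply: (@pol_eq R n E hE (fun q => pol (fun l => q l * psi l) f g)
   ((2^-1 * (inner f f + inner g g)) * M)) => //.
- move=> q r a bq br; rewrite -(pol_lin hE a Lf Lg (bddM bq bp) (bddM br bp)).
  by congr polar; apply/funext => l; ring.
- move=> q c bq qc; rewrite -(mulrA _ M c).
  have qp l : `|q l * psi l| <= M * c by rewrite normrM mulrC ler_pM.
  exact: (pol_bound hE Lf Lg (bddM bq bp) qp).
- by move=> B mB; rewrite E_sym// hh ?pol_E//; exact: E_L2.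
Qed.

Lemma bfc_lin p q f h k a : L2 f -> bdd p -> bdd q -> bfc p f h -> bfc q f k ->
  bfc (fun l => a * p l + q l) f (fun x => a * h x + k x).
Proof.
move=> Lf bp bq [Lh hh] [Lk hk]; split; first by apply: L2D => //; exact: L2Z.
move=> g Lg; rewrite innerDl ?innerZl ?hh ?hk ?pol_lin//; exact: L2Z.
Qed.

Lemma bfc_sym p f h g : L2 f -> L2 g -> bdd p -> bfc p f h -> forall k, bfc p g k ->
  inner h g = inner f k.
Proof.
by move=> Lf Lg bp [Lh hh] k [Lk hk]; rewrite hh// innerC hk// polC.
Qed.

Lemma bfc_inner p q f h k : L2 f -> bdd p -> bdd q -> bfc p f h -> bfc q f k ->
  inner h k = pol (fun l => p l * q l) f f.
Proof.
move=> Lf bp bq bh bk; have [r br] := bfc_ex bh.1 bq.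
rewrite -(bfc_sym bh.1 Lf bq br bk).
have [_ ->]// := bfc_comp Lf bp bq bh br.
by congr polar; apply/funext => l; rewrite mulrC.
Qed.

Lemma pol_diag p f : L2 f -> bdd p -> pol p f f = \int[sm f]_l p l.
Proof.
move=> Lf bp; apply/esym; apply: (@pol_eq R n E hE (fun q => \int[sm f]_l q l) (inner f f)) => //.
- move=> q r a bq br; rewrite RintD ?RintZ//; try exact: bdd_intg.
  by apply: intgZ; exact: bdd_intg.
- by move=> q c bq qc; rewrite mulrC; exact: quad_bound.
- by move=> B mB; rewrite Rint_indic// smeasE.
Qed.

Lemma sm_bfc p q f h : L2 f -> bdd p -> bdd q -> bfc p f h ->
  \int[sm h]_l q l = \int[sm f]_l (q l * p l ^+ 2).
Proof.
move=> Lf bp bq bh; have [k bk] := bfc_ex bh.1 bq.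
rewrite -(pol_diag bh.1 bq) -(bk.2 _ bh.1).
have := bfc_comp Lf bp bq bh bk => bk'.
rewrite (bfc_inner Lf (bddM bq bp) bp bk' bh) pol_diag//; last exact/bddM/bp/bddM.
by apply: eq_Rintegral => l _; rewrite expr2 mulrA.
Qed.

(** Applied to truncations of l^2, this shows that the spectral domain of L is stable under sums and
    differences, which the mere positivity of each spectral measure does not give. *)
Lemma sm_parallelogram p f g : L2 f -> L2 g -> bdd p ->
  \int[sm (fun x => f x + g x)]_l p l + \int[sm (fun x => f x - g x)]_l p l
    = 2 * (\int[sm f]_l p l) + 2 * (\int[sm g]_l p l).
Proof.
move=> Lf Lg bp; have LD := L2D Lf Lg; have LB := L2B Lf Lg.
pose T (q : R -> R) := \int[sm (fun x => f x + g x)]_l q l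
  + \int[sm (fun x => f x - g x)]_l q l - 2 * (\int[sm f]_l q l) - 2 * (\int[sm g]_l q l).
suff : T p = 0 by rewrite /T; lra.
have sl q r a h : L2 h -> bdd q -> bdd r ->
   \int[sm h]_l (a * q l + r l) = a * \int[sm h]_l q l + \int[sm h]_l r l.
  move=> Lh bq br; rewrite RintD ?RintZ//; try exact: bdd_intg.
  by apply: intgZ; exact: bdd_intg.
apply: (@bdd_functional_eq0 R T (inner (fun x => f x + g x) (fun x => f x + g x)
  + inner (fun x => f x - g x) (fun x => f x - g x) + 2 * inner f f + 2 * inner g g)) => //.
- by move=> q r a bq br; rewrite /T !sl//; ring.
- move=> q c bq qc; rewrite /T.
  have H1 := quad_bound hE LD bq qc; have H2 := quad_bound hE LB bq qc.
  have H3 := quad_bound hE Lf bq qc; have H4 := quad_bound hE Lg bq qc.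
  by move: H1 H2 H3 H4; rewrite !ler_norml => /andP[? ?] /andP[? ?] /andP[? ?] /andP[? ?]; lra.
- move=> B mB; rewrite /T !Rint_indic// !smeasE//=.
  rewrite (_ : (fun x => f x + g x) = fun x => 1 * f x + g x); last by apply/funext => x; rewrite mul1r.
  rewrite (_ : (fun x => f x - g x) = fun x => (-1) * g x + f x); last first.
    by apply/funext => x /=; rewrite mulN1r addrC.
  have L1 : L2 (fun x => 1 * f x + g x) by apply: L2D => //; exact: L2Z.
  have L2' : L2 (fun x => (-1) * g x + f x) by apply: L2D => //; exact: L2Z.
  rewrite !E_D// !(innerC (E B _) _) !innerDl ?innerZl ?E_L2//; try exact: L2Z; try exact: E_L2.
  ring.
Qed.

End bfc.

Lemma measurable_fun_ler_cst d (T : measurableType d) {R : realType} (f : T -> R) (c : R) :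
  measurable_fun setT f -> measurable_fun setT (fun x => (f x <= c)%R%:R : R).
Proof.
move=> mf; rewrite (_ : (fun x => _) = \1_(f @^-1` `]-oo, c]%classic)).
  apply: measurable_indic; have := mf measurableT _ (@measurable_itv R `]-oo, c]).
  by rewrite setTI.
apply/funext => x; rewrite indicE; congr (_%:R); congr nat_of_bool.
by apply/idP/idP => [h|]; rewrite ?inE /= ?in_itv//=; exact/mem_set.
Qed.

(** Monotone convergence along the truncations to the sets where chi is at most N, which brings
    unbounded integrands within reach of the bounded calculus. *)
Lemma Rint_trunc_le d (T : measurableType d) {R : realType} (m : {measure set T -> \bar R})
    (chi : T -> R) (C : R) :
  measurable_fun setT chi -> (forall x, 0 <= chi x) ->
  (forall N : nat, (\int[m]_x (chi x * (chi x <= N%:R)%R%:R)%:E <= C%:E)%E) ->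
  (\int[m]_x (chi x)%:E <= C%:E)%E.
Proof.
move=> mchi chi0 HN.
pose g (N : nat) x := (chi x * (chi x <= N%:R)%R%:R)%:E.
have mg N : measurable_fun setT (g N).
  apply/measurable_EFinP; apply: measurable_funM => //; exact: measurable_fun_ler_cst.
have g0 N x : (0 <= g N x)%E by rewrite lee_fin mulr_ge0.
have ndg x : {homo g ^~ x : N M / (N <= M)%N >-> (N <= M)%E}.
  move=> N M NM; rewrite /g lee_fin ler_wpM2l// ler_nat.
  by case: leP => // H; rewrite lt0b (le_trans H)// ler_nat.
have gl x : limn (g ^~ x) = (chi x)%:E.
  apply/cvg_lim => //; apply: cvg_near_cst; near=> N.
  rewrite /g (_ : chi x <= N%:R) ?mulr1//.
  near: N; exists (Num.truncn (chi x)).+1 => // N /= HN'.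
  by apply: le_trans (ltW (truncnS_gt _)) _; rewrite ler_nat.
under eq_integral do rewrite -gl.
rewrite monotone_convergence//.
apply: lime_le; last by apply: nearW => N; exact: HN.
apply: ereal_nondecreasing_is_cvgn => N M NM.
by apply: ge0_le_integral => // x _; exact: ndg.
Unshelve. all: by end_near. Qed.

Lemma ae_intgl d (T : measurableType d) {R : realType} (m : {measure set T -> \bar R})
  (p q : T -> R) (A : set T) : measurable A -> m A = 0%E ->
  measurable_fun setT p -> measurable_fun setT q ->
  (forall x, ~ A x -> p x = q x) -> \int[m]_x p x = \int[m]_x q x.
Proof.
move=> mA A0 mp mq pq; apply: Rint_ae => //.
exists A; split => // x /= npq; apply: contrapT => nA; apply: npq; exact: pq.
Qed.

(** * Resolvents and heat semigroup of a nonnegative operator *)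

Section operator.
Context {R : realType} {n : nat}.
Local Notation V := 'rV[R]_n.
Variable L : (V -> R) -> (V -> R) -> Prop.
Hypothesis hL2 : forall f k, L f k -> L2 f /\ L2 k.
Hypothesis hsub : forall f k f' k', L f k -> L f' k' ->
  L (fun x => f x - f' x) (fun x => k x - k' x).
Hypothesis hpos : forall f k, L f k -> 0 <= inner k f.

(** w = (1 + hL)^-1 f, expressed by the graph of L without any spectral resolution; [riter] is its
    m-th power. *)
Definition resolv (h : R) (f w : V -> R) := exists k, L w k /\ {ae mu, forall x, f x = w x + h * k x}.

Fixpoint riter (h : R) m (f w : V -> R) : Prop :=
  match m with
  | 0 => L2 w /\ {ae mu, forall x, f x = w x}
  | m.+1 => exists v, riter h m f v /\ resolv h v w
  end.

(** The difference d of two solutions satisfies d + h L d = 0; pairing with d and using <L d, d> >=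
    0 forces d = 0. *)
Lemma resolv_uniq (h : R) f f' w w' : 0 < h -> {ae mu, forall x, f x = f' x} ->
  resolv h f w -> resolv h f' w' -> {ae mu, forall x, w x = w' x}.
Proof.
move=> h0 ff' [k [Lk Hk]] [k' [Lk' Hk']].
have [Lw Lkk] := hL2 Lk; have [Lw' Lkk'] := hL2 Lk'.
have p0 := hpos (hsub Lk Lk').
have LB := L2B Lw Lw'; have LBk := L2B Lkk Lkk'.
have ae1 : {ae mu, forall x, k x - k' x = (- h^-1) * (w x - w' x)}.
  apply: filterS3 ff' Hk Hk' => x -> -> e.
  have {}e : h * (k x - k' x) = - (w x - w' x) by lra.
  by rewrite -[LHS]mul1r -(@mulVf _ h) ?gt_eqF// -mulrA e; ring.
have : inner (fun x => w x - w' x) (fun x => w x - w' x) = 0.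
  apply/eqP; rewrite eq_le inner_ge0 andbT.
  have := p0; rewrite (inner_ae LBk _ LB ae1); last exact: L2Z.
  rewrite innerZl// mulNr oppr_ge0 -ler_pdivlMl ?invr_gt0// mulr0.
  by move=> /le_trans; apply.
by move=> /(inner_eq0 LB); apply: filterS => x /eqP; rewrite subr_eq0 => /eqP.
Qed.

Lemma riter_uniq (h : R) m f w w' : 0 < h -> riter h m f w -> riter h m f w' ->
  {ae mu, forall x, w x = w' x}.
Proof.
move=> h0; elim: m w w' => [|m IH] w w' /=.
  by move=> [_ H] [_ H']; apply: filterS2 H H' => x <- <-.
move=> [v [Hv Rv]] [v' [Hv' Rv']]; apply: (resolv_uniq h0 (IH _ _ Hv Hv')); [exact: Rv|exact: Rv'].
Qed.

Lemma riter_L2 h m f w : riter h m f w -> L2 w.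
Proof. by case: m => [[]//|m /= [v [_ [k [/hL2[]]]]]]. Qed.

Section resolution.
Variable E : set (measurableTypeR R) -> (V -> R) -> V -> R.
Hypothesis hres : spectral_resolution L E.
Let hE := hres.1.
Local Notation pol := (polar hE).
Local Notation sm := (smeas hE).
Local Notation bfc := (bfc hE).

Lemma msqr : measurable_fun setT (fun l : R => l ^+ 2).
Proof. exact: measurable_funX. Qed.

Lemma bdd_trunc_sqr (N : nat) : bdd (fun l : R => l ^+ 2 * (l ^+ 2 <= N%:R)%R%:R).
Proof.
split; first by apply: measurable_funM; [exact: msqr|exact: measurable_fun_ler_cst].
exists N%:R => l; rewrite ger0_norm; last by apply: mulr_ge0 => //; exact: sqr_ge0.
by case: (leP (l ^+ 2)) => h; rewrite ?mulr1 ?mulr0.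
Qed.

Definition fin2 f := (\int[sm f]_l (l ^+ 2)%:E < +oo)%E.

(** The spectral measure of h has density psi^2 with respect to that of f, so each truncation of l^2
    integrates to at most M^2 ||f||^2. *)
Lemma fin2_bfc psi f h (M : R) : L2 f -> bdd psi -> (forall l, `|l * psi l| <= M) ->
  bfc psi f h -> fin2 h.
Proof.
move=> Lf bp psiM bh; apply: (@le_lt_trans _ _ (M ^+ 2 * inner f f)%:E); last by rewrite ltry.
apply: Rint_trunc_le => [|l|N]; [exact: msqr|exact: sqr_ge0|].
have bt := bdd_trunc_sqr N.
rewrite -Rint_EFin; last exact: bdd_intg bh.1 bt.
rewrite lee_fin (sm_bfc Lf bp bt bh) (le_trans (ler_norm _))//.
apply: quad_bound => //; first by apply: bddM => //; exact: bddM.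
move=> l; have -> : l ^+ 2 * (l ^+ 2 <= N%:R)%R%:R * psi l ^+ 2 = (l * psi l) ^+ 2 * (l ^+ 2 <= N%:R)%R%:R by ring.
rewrite normrM normrX; apply: (@le_trans _ _ (M ^+ 2 * 1)); last by rewrite mulr1.
apply: ler_pM => //; first by rewrite ler_sqr ?nnegrE// (le_trans _ (psiM 0)).
by case: (l ^+ 2 <= N%:R); rewrite ?normr1 ?normr0.
Qed.

Lemma fin2_DB f g : L2 f -> L2 g -> fin2 f -> fin2 g ->
  fin2 (fun x => f x + g x) /\ fin2 (fun x => f x - g x).
Proof.
move=> Lf Lg Ff Fg.
have iv h : L2 h -> fin2 h -> intg (sm h) (fun l => l ^+ 2).
  move=> Lh Fh; apply: intg_ge0 => [|l|]; [exact: msqr|exact: sqr_ge0|exact: Fh].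
pose C := 2 * (\int[sm f]_l (l ^+ 2)) + 2 * (\int[sm g]_l (l ^+ 2)).
have tr h N : L2 h -> fin2 h -> \int[sm h]_l (l ^+ 2 * (l ^+ 2 <= N%:R)%R%:R) <= \int[sm h]_l (l ^+ 2).
  move=> Lh Fh; apply: Rint_le; [apply: bdd_intg => //; exact: bdd_trunc_sqr|exact: iv|].
  by move=> l; rewrite ler_piMr ?sqr_ge0//; case: (l ^+ 2 <= N%:R).
have H N : \int[sm (fun x => f x + g x)]_l (l ^+ 2 * (l ^+ 2 <= N%:R)%R%:R) <= C /\
    \int[sm (fun x => f x - g x)]_l (l ^+ 2 * (l ^+ 2 <= N%:R)%R%:R) <= C.
  have := sm_parallelogram hE Lf Lg (bdd_trunc_sqr N).
  have := tr f N Lf Ff; have := tr g N Lg Fg.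
  have p0 h : 0 <= \int[sm h]_l (l ^+ 2 * (l ^+ 2 <= N%:R)%R%:R).
    by apply: Rint_ge0 => l; rewrite mulr_ge0 ?sqr_ge0.
  have := p0 (fun x => f x + g x); have := p0 (fun x => f x - g x).
  by rewrite /C; split; lra.
split; (apply: (@le_lt_trans _ _ C%:E); last by rewrite ltry);
  (apply: Rint_trunc_le => [|l|N]; [exact: msqr|exact: sqr_ge0|]);
  rewrite -Rint_EFin ?lee_fin; try (by case: (H N));
  by apply: bdd_intg; [exact: L2D || exact: L2B|exact: bdd_trunc_sqr].
Qed.

Lemma bdd_trunc (N : nat) : bdd (fun l : R => l * (l ^+ 2 <= N%:R)%R%:R).
Proof.
split; first by apply: measurable_funM => //; apply: measurable_fun_ler_cst; exact: msqr.
exists (1 + N%:R) => l; rewrite normrM.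
case: (leP (l ^+ 2)) => h; rewrite ?normr1 ?normr0 ?mulr1 ?mulr0 ?addr_ge0//.
by move: h; rewrite -[l ^+ 2]real_normK ?num_real//; have := normr_ge0 l; nra.
Qed.

Lemma trunc_cvg (l : R) : (fun N : nat => (l ^+ 2 <= N%:R)%R%:R) @ \oo --> (1 : R).
Proof.
apply: cvg_near_cst; near=> N.
rewrite (_ : l ^+ 2 <= N%:R)//.
near: N; exists (Num.truncn (l ^+ 2)).+1 => // N /= HN'.
by apply: le_trans (ltW (truncnS_gt _)) _; rewrite ler_nat.
Unshelve. all: by end_near. Qed.

Lemma pol_dct (p_ : nat -> measurableTypeR R -> R) (p b : measurableTypeR R -> R) f g : L2 f -> L2 g ->
  (forall N, measurable_fun setT (p_ N)) -> (forall l, p_ N l @[N --> \oo] --> p l) ->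
  intg (sm (f \+ g)%R) b -> intg (sm (f \- g)%R) b -> (forall N l, `|p_ N l| <= b l) ->
  pol (p_ N) f g @[N --> \oo] --> pol p f g.
Proof.
move=> Lf Lg mp cp i1 i2 dom; apply: cvgM; first exact: cvg_cst.
have [_ c1] := Rint_dct mp cp i1 dom; have [_ c2] := Rint_dct mp cp i2 dom.
exact: cvgB.
Qed.

(** The symbol l is unbounded, so the spectral integral that defines L h is reached as the limit of
    its truncations to l^2 <= N. Dominated convergence applies on both sides: with 1 + l^2 for the
    spectral measures of h and g, with the constant M once l is multiplied by psi. *)
Lemma bfc_op psi f h k : L2 f -> bdd psi -> bdd (fun l => l * psi l) ->
  bfc psi f h -> bfc (fun l => l * psi l) f k -> L h k.
Proof.
move=> Lf bp bq bh bk; case: (bq) => mq [M qM].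
have Fh := fin2_bfc Lf bp qM bh.
apply/hres.2; split; [split; first exact: bh.1| exact: bk.1|].
  by rewrite spectral_mass_integral//; exact: bh.1.
move=> g [Lg Fg]; rewrite (spectral_mass_integral hE _ Lg) in Fg.
have Lh := bh.1; have [FD FB] := fin2_DB Lh Lg Fh Fg.
have LD : L2 (h \+ g)%R := L2D Lh Lg; have LB : L2 (h \- g)%R := L2B Lh Lg.
rewrite (spectral_mass_integral hE _ LD) (spectral_mass_integral hE _ LB).
rewrite -/(Rintegral _ _ _) -/(Rintegral _ _ _) -/(polar hE id h g).
have bd h' : L2 h' -> fin2 h' -> intg (sm h') (fun l => 1 + l ^+ 2).
  move=> Lh' Fh'; apply: intgD; first by apply: bdd_intg => //; exact: bdd_cst.
  by apply: intg_ge0 => [|l|]; [exact: msqr|exact: sqr_ge0|exact: Fh'].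
have c1 : pol (fun l => l * (l ^+ 2 <= N%:R)%R%:R) h g @[N --> \oo] --> pol id h g.
  apply: (pol_dct (b := fun l => 1 + l ^+ 2)) => //.
  - by move=> N; have [] := bdd_trunc N.
  - by move=> l; rewrite -[X in _ --> X]mulr1; apply: cvgM; [exact: cvg_cst|exact: trunc_cvg].
  - exact: bd (L2D Lh Lg) FD.
  - exact: bd (L2B Lh Lg) FB.
  - move=> N l; rewrite normrM; apply: (@le_trans _ _ (`|l| * 1)).
      by apply: ler_pM => //; case: (l ^+ 2 <= N%:R); rewrite ?normr1 ?normr0.
    by rewrite mulr1 -[l ^+ 2]real_normK ?num_real//; have := normr_ge0 l; nra.
have c2 : pol (fun l => l * (l ^+ 2 <= N%:R)%R%:R * psi l) f g @[N --> \oo] --> inner k g.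
  rewrite bk.2//; apply: (pol_dct (b := fun=> M)) => //.
  - by move=> N; have [] := bddM (bdd_trunc N) bp.
  - move=> l; rewrite -[l * psi l]mulr1.
    rewrite (_ : (fun N : nat => _) = fun N : nat => l * psi l * (l ^+ 2 <= N%:R)%R%:R).
      by apply: cvgM; [exact: cvg_cst|exact: trunc_cvg].
    by apply/funext => N; ring.
  - by apply: bdd_intg; [exact: L2D|exact: bdd_cst].
  - by apply: bdd_intg; [exact: L2B|exact: bdd_cst].
  - move=> N l; rewrite mulrAC normrM -[M]mulr1; apply: ler_pM => //.
    by case: (l ^+ 2 <= N%:R); rewrite ?normr1 ?normr0.
apply: (cvg_unique (@Rhausdorff R) c2); move: c1; apply: cvg_trans.
apply: near_eq_cvg; near=> N.
have [v bv] := bfc_ex hE Lh (bdd_trunc N).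
by rewrite -bv.2// (bfc_comp Lf bp (bdd_trunc N) bh bv).2.
Unshelve. all: by end_near. Qed.

(** For h = 1_B(L) f with B = [-N, 0), the number <L h, h> is the integral over B of the negative
    function l, yet nonnegative by positivity of L. Hence B has no mass. *)
Lemma sm_lt0 f : L2 f -> sm f [set l | l < 0] = 0%E.
Proof.
move=> Lf.
pose B (N : nat) : set (measurableTypeR R) := `[- N%:R, 0[%classic.
have mB N : measurable (B N) by exact: measurable_itv.
suff H N : sm f (B N) = 0%E.
  have -> : [set l : R | l < 0] = \bigcup_N B N.
    apply/seteqP; split => [l /= l0|l [N _]]; last by rewrite /B /= in_itv/= => /andP[].
    exists (Num.truncn (- l)).+1 => //; rewrite /B /= in_itv/= l0 andbT lerNl.
    exact/ltW/truncnS_gt.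
  apply/negligibleP; first exact: bigcupT_measurable.
  by apply: negligible_bigcup => N; exists (B N); split => //; exact: H.
pose psi : R -> R := \1_(B N).
have bp : bdd psi by exact: bdd_indic (mB N).
have psiN l : psi l = 0 \/ (psi l = 1 /\ - N%:R <= l < 0).
  rewrite /psi indicE; case: (boolP (l \in B N)) => h; [right|by left].
  by split=> //; move: h; rewrite inE /B /= in_itv.
have bq : bdd (fun l => l * psi l).
  split.
    by apply: measurable_funM => //; case: bp.
  exists N%:R => l; case: (psiN l) => [->|[-> /andP[l1 l2]]]; first by rewrite mulr0 normr0.
  by rewrite mulr1 ltr0_norm// lerNl.
have [h bh] := bfc_ex hE Lf bp; have [k bk] := bfc_ex hE Lf bq.
have := hpos (bfc_op Lf bp bq bh bk).
rewrite (bfc_inner Lf bq bp bk bh) pol_diag//; last exact: bddM.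
move=> I0.
have ib : intg (sm f) (fun l => l * psi l * psi l) by apply: bdd_intg => //; exact: bddM.
have neg l : 0 <= - (l * psi l * psi l).
  by case: (psiN l) => [->|[-> /andP[l1 l2]]]; rewrite ?mulr0 ?oppr0// !mulr1 oppr_ge0 ltW.
have I1 : \int[sm f]_l (- (l * psi l * psi l)) = 0.
  apply/eqP; rewrite eq_le Rint_ge0// andbT.
  have -> : \int[sm f]_l (- (l * psi l * psi l)) = - \int[sm f]_l (l * psi l * psi l).
    by rewrite -mulN1r -RintZ//; apply: eq_Rintegral => l _; rewrite mulN1r.
  by rewrite oppr_le0.
have /negligibleP -> // : (sm f).-negligible (B N).
have [Z [mZ Z0 HZ]] := Rint_eq0_ae (intgN ib) neg I1.
exists Z; split => // l Bl; apply: HZ => /=.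
have p1 : psi l = 1 by rewrite /psi indicE mem_set.
rewrite p1 !mulr1 => /eqP; rewrite oppr_eq0 => /eqP l0.
by move: Bl; rewrite /B /= in_itv/= l0 ltxx andbF.
Qed.

Lemma mlt0 : measurable ([set l | l < 0] : set (measurableTypeR R)).
Proof.
have -> : [set l | l < 0] = `]-oo, 0[%classic :> set R.
  by apply/seteqP; split => l; rewrite /= in_itv.
exact: measurable_itv.
Qed.

Lemma sm_eq_ge0 (f : V -> R) (p q : R -> R) : L2 f -> measurable_fun setT p -> measurable_fun setT q ->
  (forall l, 0 <= l -> p l = q l) -> \int[sm f]_l p l = \int[sm f]_l q l.
Proof.
move=> Lf mp mq pq; apply: (ae_intgl mlt0 (sm_lt0 Lf)) => // l /negP.
by rewrite -leNgt => /pq.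
Qed.

Lemma pol_eq_ge0 (p q : R -> R) (f g : V -> R) : L2 f -> L2 g -> measurable_fun setT p -> measurable_fun setT q ->
  (forall l, 0 <= l -> p l = q l) -> pol p f g = pol q f g.
Proof.
move=> Lf Lg mp mq pq; rewrite /polar.
by rewrite (sm_eq_ge0 (L2D Lf Lg) mp mq pq) (sm_eq_ge0 (L2B Lf Lg) mp mq pq).
Qed.

(** The symbols of (1 + hL)^-m and, with [ep], of exp(-tL). The indicator of l >= 0 and the absolute
    value keep them bounded and free of poles on the whole line; spectral measures do not see the
    change. *)
Definition rp h m (l : R) : R := (0 <= l)%R%:R * ((1 + h * `|l|)^-1) ^+ m.
Definition ep t (l : R) : R := (0 <= l)%R%:R * expR (- (t * `|l|)).

Lemma measurable_ge0 : measurable_fun setT (fun l : R => (0 <= l)%R%:R : R).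
Proof.
have mN : measurable_fun setT (fun l : R => - l).
  by apply: continuous_measurable_fun => l; exact: opp_continuous.
have := @measurable_fun_ler_cst _ _ R (fun l : R => - l) 0 mN.
by congr measurable_fun; apply/funext => l; rewrite oppr_le0.
Qed.

Lemma ge0_01 (l : R) : (0 <= l)%R%:R = 0 :> R \/ ((0 <= l)%R%:R = 1 :> R /\ 0 <= l).
Proof. by case: (leP 0 l) => h; [right|left]. Qed.

Lemma measurable_rp (h : R) (m : nat) : 0 <= h -> measurable_fun setT (rp h m).
Proof.
move=> h0; apply: measurable_funM; first exact: measurable_ge0.
apply: measurable_funX; apply: continuous_measurable_fun => l.
apply: cvgV; first by rewrite gt_eqF// ltr_wpDr// mulr_ge0.
apply: cvgD; first exact: cvg_cst.
by apply: cvgM; [exact: cvg_cst|exact: norm_continuous].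
Qed.

Lemma rp_le1 (h : R) (m : nat) (l : R) : 0 <= h -> 0 <= rp h m l <= 1.
Proof.
move=> h0; rewrite /rp; case: (ge0_01 l) => [->|[-> l0]]; first by rewrite mul0r lexx ler01.
rewrite mul1r exprn_ge0 ?invr_ge0 ?addr_ge0 ?mulr_ge0//= exprn_ile1 ?invr_ge0 ?addr_ge0 ?mulr_ge0//.
by rewrite invf_le1 ?lerDl ?mulr_ge0// ltr_wpDr// mulr_ge0.
Qed.

Lemma bdd_rp (h : R) (m : nat) : 0 <= h -> bdd (rp h m).
Proof.
move=> h0; split; first exact: measurable_rp.
by exists 1 => l; have /andP[? ?] := rp_le1 m l h0; rewrite ger0_norm.
Qed.

Lemma bdd_lrp (h : R) (m : nat) : 0 < h -> bdd (fun l => l * rp h m.+1 l).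
Proof.
move=> h0; split; first by apply: measurable_funM => //; apply: measurable_rp; exact: ltW.
exists h^-1 => l; have [r0 _] := andP (rp_le1 m l (ltW h0)).
have e : rp h m.+1 l = (1 + h * `|l|)^-1 * rp h m l by rewrite /rp exprS; ring.
have p0 : 0 < 1 + h * `|l| by rewrite ltr_wpDr// mulr_ge0// ltW.
rewrite e mulrA normrM (ger0_norm r0); apply: (@le_trans _ _ (h^-1 * 1)); last by rewrite mulr1.
apply: ler_pM => //; last by have [_] := andP (rp_le1 m l (ltW h0)).
rewrite normrM (@ger0_norm _ (_^-1)) ?invr_ge0 ?(ltW p0)// ler_pdivrMr//.
by rewrite ler_pdivlMl// lerDr.
Qed.

(** Induction on m through the scalar identity (1 + h l) (1 + h l)^-(m+1) = (1 + h l)^-m on l >=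
    0. *)
Lemma riter_bfc (h : R) m f w : 0 < h -> L2 f -> bfc (rp h m) f w -> riter h m f w.
Proof.
move=> h0 Lf; have h0' := ltW h0; elim: m w => [|m IH] w bw /=.
  split; first exact: bw.1.
  apply: inner_ext => //; first exact: bw.1.
  move=> g Lg; rewrite bw.2// -[LHS]mul1r -(pol_cst hE 1 Lf Lg).
  apply: pol_eq_ge0 => //; first exact: measurable_rp.
  by move=> l l0; rewrite /rp l0 expr0 mulr1.
have [v bv] := bfc_ex hE Lf (bdd_rp m h0').
exists v; split; first exact: IH.
have [k bk] := bfc_ex hE Lf (bdd_lrp m h0).
exists k; split; first exact: bfc_op (bdd_rp _ h0') (bdd_lrp _ h0) bw bk.
have := bfc_lin h Lf (bdd_lrp m h0) (bdd_rp m.+1 h0') bk bw.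
rewrite (_ : (fun l => _) = rp h m); last first.
  apply/funext => l; rewrite /rp exprS; case: (ge0_01 l) => [->|[-> l0]]; first by ring.
  rewrite (ger0_norm l0) !mul1r.
  have p0 : 0 < 1 + h * l by rewrite ltr_wpDr// mulr_ge0.
  by move: (_ ^+ m) => X; field; rewrite gt_eqF.
move=> bv'; apply: inner_ext; [exact: bv.1|exact: L2D bw.1 (L2Z _ bk.1)|].
move=> g Lg; rewrite bv.2// -bv'.2//; congr inner; apply/funext => x; exact: addrC.
Qed.

(** With y = t l / (m+1), the bounds 1 + y <= exp y and 1/(1+y) <= exp(-y/(1+y)) squeeze the power
    between exp(-t l) and exp(-t l/(1 + y)). *)
Lemma rp_cvg (t l : R) : 0 < t -> rp (t / m.+1%:R) m.+1 l @[m --> \oo] --> ep t l.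
Proof.
move=> t0; rewrite /rp /ep; case: (ge0_01 l) => [->|[-> l0]].
  by under eq_fun do rewrite mul0r; rewrite mul0r; exact: cvg_cst.
rewrite (ger0_norm l0) mul1r; under eq_fun do rewrite mul1r.
have y0 (m : nat) : 0 <= t / m.+1%:R * l by rewrite !mulr_ge0 ?invr_ge0// ltW.
have p0 (m : nat) : 0 < 1 + t / m.+1%:R * l by rewrite ltr_wpDr.
have ty (m : nat) : m.+1%:R * (t / m.+1%:R * l) = t * l by rewrite mulrA [_ * (t / _)]mulrC divfK ?pnatr_eq0.
apply: (@squeeze_cvgr _ _ _ _ (cst (expR (- (t * l)))) (fun m : nat => expR (- (t * l) / (1 + t * l * m.+1%:R^-1)))).
- apply: nearW => m; apply/andP; split.
    rewrite /cst expRN exprVn lef_pV2 ?posrE ?expR_gt0 ?exprn_gt0//.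
    rewrite -(ty m) expRM_natl lerXn2r ?nnegrE ?expR_ge0 ?(ltW (p0 m))//.
    exact: expR_ge1Dx.
  have -> : - (t * l) / (1 + t * l * m.+1%:R^-1) = m.+1%:R * (- (t / m.+1%:R * l) / (1 + t / m.+1%:R * l)).
    have tl0 : 0 <= t * l by rewrite mulr_ge0// ltW.
    have : 0 < m.+1%:R :> R by rewrite ltr0n.
    by move: (m.+1%:R : R) => c c0; field; rewrite !gt_eqF//; lra.
  rewrite expRM_natl lerXn2r ?nnegrE ?expR_ge0 ?invr_ge0 ?(ltW (p0 m))//.
  apply: le_trans (expR_ge1Dx _); rewrite le_eqVlt; apply/orP; left; apply/eqP.
  by move: (y0 m); move: (t / m.+1%:R * l) => y y00; field; rewrite gt_eqF// ltr_wpDr.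
- exact: cvg_cst.
- suff cf : (fun m : nat => - (t * l) / (1 + t * l * m.+1%:R^-1)) @ \oo --> - (t * l).
    exact: (cvg_comp _ _ cf (@continuous_expR R _)).
  rewrite -[X in _ --> X]mulr1; apply: cvgM; first exact: cvg_cst.
  rewrite -[X in _ --> X]invr1; apply: cvgV; first exact: oner_neq0.
  rewrite -[X in _ --> X]addr0; apply: cvgD; first exact: cvg_cst.
  rewrite -[X in _ --> X](mulr0 (t * l)); apply: cvgM; [exact: cvg_cst|exact: cvg_harmonic].
Qed.

Lemma measurable_ep (t : R) : measurable_fun setT (ep t).
Proof.
apply: measurable_funM; first exact: measurable_ge0.
apply: measurableT_comp => //; apply: continuous_measurable_fun => l.
by apply: cvgN; apply: cvgM; [exact: cvg_cst|exact: norm_continuous].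
Qed.

Lemma ep_le1 (t l : R) : 0 <= t -> 0 <= ep t l <= 1.
Proof.
move=> t0; rewrite /ep; case: (ge0_01 l) => [->|[-> l0]]; first by rewrite mul0r lexx ler01.
by rewrite mul1r expR_ge0/= -expR0 ler_expR oppr_le0 mulr_ge0.
Qed.

Lemma bdd_ep (t : R) : 0 <= t -> bdd (ep t).
Proof.
move=> t0; split; first exact: measurable_ep.
by exists 1 => l; have /andP[? ?] := ep_le1 l t0; rewrite ger0_norm.
Qed.

Lemma riter_ex (h : R) (m : nat) (f : V -> R) : 0 < h -> L2 f -> exists w, riter h m f w.
Proof.
move=> h0 Lf; have [w bw] := bfc_ex hE Lf (bdd_rp m (ltW h0)).
by exists w; exact: riter_bfc bw.
Qed.

(** The exponential formula in weak form. The left side mentions no resolution, so properties of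
    resolvents pass to the semigroup and the semigroup depends on the graph of L only. *)
Lemma heat_limit f g w_ (t : R) : 0 < t -> L2 f -> L2 g ->
  (forall m, riter (t / m.+1%:R) m.+1 f (w_ m)) ->
  inner (w_ m) g @[m --> \oo] --> pol (ep t) f g.
Proof.
move=> t0 Lf Lg rw.
have h0 (m : nat) : 0 < t / m.+1%:R by rewrite divr_gt0.
have -> : (fun m => inner (w_ m) g) = fun m => pol (rp (t / m.+1%:R) m.+1) f g.
  apply/funext => m; have [w bw] := bfc_ex hE Lf (bdd_rp m.+1 (ltW (h0 m))).
  rewrite -bw.2//; apply: inner_ae => //; [exact: riter_L2 (rw m)|exact: bw.1|].
  exact: (riter_uniq (h0 m) (rw m) (riter_bfc (h0 m) Lf bw)).
apply: (pol_dct (b := fun=> 1)) => //.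
- by move=> m; apply: measurable_rp; exact: ltW.
- by move=> l; exact: rp_cvg.
- by apply: bdd_intg; [exact: L2D|exact: bdd_cst].
- by apply: bdd_intg; [exact: L2B|exact: bdd_cst].
- by move=> m l; have /andP[? ?] := rp_le1 m.+1 l (ltW (h0 m)); rewrite ger0_norm.
Qed.

Lemma measurable_exp (t : R) : measurable_fun setT (fun l : R => expR (- (t * l))).
Proof.
apply: measurableT_comp => //; apply: continuous_measurable_fun => l.
by apply: cvgN; apply: cvgM; [exact: cvg_cst|exact: cvg_id].
Qed.

(** The function exp(-t l) is unbounded at minus infinity, so it is first exchanged for [ep t],
    which agrees with it on the half-line that carries the spectral measures. *)
Lemma spectral_heat f h (t : R) : 0 < t -> spectral_integral E (fun l => expR (- (t * l))) f h ->
  bfc (ep t) f h.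
Proof.
move=> t0 [[Lf _] Lh hh]; split=> // g Lg.
have eE l : 0 <= l -> expR (- (t * l)) = ep t l by move=> l0; rewrite /ep l0 mul1r ger0_norm.
rewrite hh; last first.
  split=> //; rewrite (spectral_mass_integral hE _ Lg).
  rewrite (@ge0_ae_eq_integral _ (measurableTypeR R) R (sm g) setT _ (fun l => (ep t l ^+ 2)%:E))//.
  - apply: intg_lty; apply: (bdd_intg hE Lg); have := bddM (bdd_ep (ltW t0)) (bdd_ep (ltW t0)).
    by congr bdd; apply/funext => l; rewrite expr2.
  - by apply/measurable_EFinP; apply: measurable_funX; exact: measurable_exp.
  - by apply/measurable_EFinP; apply: measurable_funX; exact: measurable_ep.
  - by move=> l _; rewrite lee_fin sqr_ge0.
  - exists [set l | l < 0]; split; [exact: mlt0|exact: sm_lt0|].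
    move=> l /= H; rewrite ltNge; apply/negP => l0; apply: H => _; by rewrite eE.
have LD : L2 (f \+ g)%R := L2D Lf Lg; have LB : L2 (f \- g)%R := L2B Lf Lg.
rewrite (spectral_mass_integral hE _ LD) (spectral_mass_integral hE _ LB).
apply: pol_eq_ge0 => //; [exact: measurable_exp|exact: measurable_ep].
Qed.

End resolution.

(** [functional_calculus] hides a resolution of its own for each t and f. The same resolvent
    iterates converge to both versions of exp(-tL) f, which are therefore equal. *)
Lemma heat_bfc E (hE : spectral_resolution L E) f h (t : R) : 0 < t -> L2 f ->
  functional_calculus L (fun l => expR (- (t * l))) f h -> bfc hE.1 (ep t) f h.
Proof.
move=> t0 Lf [E' hE' /(spectral_heat hE' t0) b']; split; first exact: b'.1.
move=> g Lg; rewrite b'.2//.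
have h0 (m : nat) : 0 < t / m.+1%:R by rewrite divr_gt0.
have /choice[w_ rw] : forall m : nat, exists w, riter (t / m.+1%:R) m.+1 f w.
  by move=> m; exact: (riter_ex hE).
have c1 : inner (w_ m) g @[m --> \oo] --> polar hE'.1 (ep t) f g by exact: heat_limit.
have c2 : inner (w_ m) g @[m --> \oo] --> polar hE.1 (ep t) f g by exact: heat_limit.
by rewrite (cvg_unique (@Rhausdorff R) c1 c2).
Qed.

End operator.

(** * Vanishing moments *)

Section step_polynomials.
Context {R : realType}.
Implicit Types (x y z a : R).

Lemma bernoulli_le (k : nat) z : 0 <= z <= 1 -> 1 - k%:R * z <= (1 - z) ^+ k.
Proof.
move=> /andP[z0 z1]; elim: k => [|k IH]; first by rewrite mul0r subr0 expr0.
rewrite exprS; apply: (@le_trans _ _ ((1 - z) * (1 - k%:R * z))).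
  have h : 0 <= k%:R * z * z by rewrite !mulr_ge0.
  by rewrite -natr1; move: h; move: (k%:R : R) => K h; nra.
by rewrite ler_wpM2l// subr_ge0.
Qed.

Lemma bernoulli_ge (k : nat) z : 0 <= z -> 1 + k%:R * z <= (1 + z) ^+ k.
Proof.
move=> z0; elim: k => [|k IH]; first by rewrite mul0r addr0 expr0.
rewrite exprS; apply: (@le_trans _ _ ((1 + z) * (1 + k%:R * z))).
  have h : 0 <= k%:R * z * z by rewrite !mulr_ge0.
  by rewrite -natr1; move: h; move: (k%:R : R) => K h; nra.
by rewrite ler_wpM2l// addr_ge0.
Qed.

Lemma pow_one_minus_le (k : nat) z : 0 <= z <= 1 -> (1 - z) ^+ k <= (1 + k%:R * z)^-1.
Proof.
move=> /andP[z0 z1]; have p : 0 < 1 + k%:R * z by rewrite ltr_wpDr// mulr_ge0.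
rewrite -[leRHS]mul1r ler_pdivlMr//.
apply: (@le_trans _ _ ((1 - z) ^+ k * (1 + z) ^+ k)).
  by rewrite ler_wpM2l ?exprn_ge0 ?subr_ge0//; exact: bernoulli_ge.
rewrite -exprMn exprn_ile1//; nra.
Qed.

(* [(1 - y^N)^(2^N)] tends to 1 for y < 1/2 and to 0 for y > 1/2: on [0, 1] these
   polynomials converge boundedly to the indicator of [x <= a]. *)
Definition stepN (m : nat) := (2 * m.+2 ^ 2)%N.
Definition stepy a (m : nat) x := (1 + x - a - m.+2%:R^-1) / 2.
Definition stepq a (m : nat) x := (1 - stepy a m x ^+ stepN m) ^+ (2 ^ stepN m).
Definition stepp a (m : nat) : {poly R} :=
  (1 - (2^-1 *: ('X + (1 - a - m.+2%:R^-1)%:P)) ^+ stepN m) ^+ (2 ^ stepN m).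

Lemma steppE a m x : (stepp a m).[x] = stepq a m x.
Proof.
rewrite /stepp /stepq /stepy !hornerE; congr ((1 - _ ^+ _) ^+ _).
by rewrite mulrC /=; congr (_ * _); ring.
Qed.

Lemma stepy_bd a m x : 0 <= a <= 1 -> 0 <= x <= 1 -> `|stepy a m x| <= 1.
Proof.
move=> /andP[a0 a1] /andP[x0 x1].
have i0 : 0 <= m.+2%:R^-1 :> R by rewrite invr_ge0.
have i1 : m.+2%:R^-1 <= 1 :> R by rewrite invf_le1// ler1n.
rewrite /stepy ler_norml; move: i0 i1; move: (m.+2%:R^-1 : R) => e e0 e1.
by apply/andP; split; lra.
Qed.

Lemma stepyN_bd a m x : 0 <= a <= 1 -> 0 <= x <= 1 -> 0 <= stepy a m x ^+ stepN m <= 1.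
Proof.
move=> ha hx; have := stepy_bd m ha hx => h.
rewrite /stepN exprM; have : 0 <= stepy a m x ^+ 2 <= 1.
  by rewrite sqr_ge0/= -[_ ^+ 2]real_normK ?num_real// exprn_ile1.
by move=> /andP[? ?]; rewrite exprn_ge0// exprn_ile1.
Qed.

Lemma stepq_bd a m x : 0 <= a <= 1 -> 0 <= x <= 1 -> 0 <= stepq a m x <= 1.
Proof.
move=> ha hx; have /andP[? ?] := stepyN_bd m ha hx.
by rewrite /stepq exprn_ge0 ?subr_ge0// exprn_ile1 ?subr_ge0// gerBl.
Qed.

Lemma cvg_inv_nat (c : R) : 0 < c -> (fun m : nat => (1 + m.+2%:R * c)^-1) @ \oo --> (0 : R).
Proof.
move=> c0; apply: (@squeeze_cvgr _ _ _ _ (cst 0) (fun m : nat => c^-1 * m.+1%:R^-1)).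
- apply: nearW => m; have p : 0 < 1 + m.+2%:R * c by rewrite ltr_wpDr// mulr_ge0// ltW.
  rewrite invr_ge0 (ltW p)/= -invfM lef_pV2 ?posrE ?mulr_gt0//.
  by rewrite -(natr1 m.+1); move: (m.+1%:R : R) => M; nra.
- exact: cvg_cst.
- rewrite -[X in _ --> X](mulr0 c^-1); apply: cvgM; [exact: cvg_cst|exact: cvg_harmonic].
Qed.

(** With d = 1/(m+2), twice [stepy] is 1 + x - a - d: at most 1 - d in modulus if x <= a, and above
    some 1 + c for large m if x > a. Since 2^N y^N = (2y)^N, Bernoulli's inequality gives both
    limits. The shift by d secures the value 1 at x = a, and N = 2 (m+2)^2 makes N d diverge. *)
Lemma stepq_cvg a x : 0 <= a <= 1 -> 0 <= x <= 1 ->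
  stepq a m x @[m --> \oo] --> ((x <= a)%R%:R : R).
Proof.
move=> ha hx; have /andP[a0 a1] := ha; have /andP[x0 x1] := hx.
have E m : (2 ^ stepN m)%:R * stepy a m x ^+ stepN m = (1 + x - a - m.+2%:R^-1) ^+ stepN m.
  by rewrite natrX -exprMn /stepy mulrC divfK// pnatr_eq0.
have i0 m : 0 <= m.+2%:R^-1 :> R by rewrite invr_ge0.
have i2 m : m.+2%:R^-1 <= 2^-1 :> R by rewrite lef_pV2 ?posrE// ler_nat.
case: (leP x a) => xa /=.
- apply: (@squeeze_cvgr _ _ _ _ (fun m : nat => 1 - (1 + m.+2%:R * 2)^-1) (cst 1)).
  + apply: nearW => m; have /andP[_ ->] := stepq_bd m ha hx; rewrite andbT.
    apply: le_trans (bernoulli_le _ (stepyN_bd m ha hx)).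
    rewrite E lerD2l lerN2.
    have n1 : `|1 + x - a - m.+2%:R^-1| <= 1 - m.+2%:R^-1.
      have := i0 m; have := i2 m; rewrite ler_norml; move: (m.+2%:R^-1 : R) => e ? ?.
      by apply/andP; split; lra.
    rewrite (le_trans (ler_norm _))// normrX.
    apply: (@le_trans _ _ ((1 - m.+2%:R^-1) ^+ stepN m)); first by apply: lerXn2r; rewrite ?nnegrE// (le_trans _ n1).
    apply: le_trans (pow_one_minus_le _ _) _; first by rewrite i0/= (le_trans (i2 m))// invf_le1// ler1n.
    rewrite /stepN natrM natrX expr2 (_ : 2 * _ * _ = m.+2%:R * 2)//.
    by rewrite -mulrA mulfK ?pnatr_eq0// mulrC.
  + rewrite -[X in _ --> X]subr0; apply: cvgB; first exact: cvg_cst.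
    exact: cvg_inv_nat.
  + exact: cvg_cst.
- pose c := (x - a) / 2.
  have c0 : 0 < c by rewrite divr_gt0// subr_gt0.
  have K : \forall m \near \oo, m.+2%:R^-1 <= c.
    have : (fun m : nat => m.+1%:R^-1) @ \oo --> (0 : R) by exact: cvg_harmonic.
    move=> /cvgr0Pnorm_le/(_ _ c0) [M _ HM]; exists M => // m /= Mm.
    have := HM m.+1 (leqW Mm); rewrite ger0_norm ?invr_ge0//.
  apply: (@squeeze_cvgr _ _ _ _ (cst 0) (fun m : nat => (1 + m.+2%:R * c)^-1)).
  + apply: filterS K => m Km; have /andP[-> _] := stepq_bd m ha hx; rewrite andTb.
    apply: le_trans (pow_one_minus_le _ (stepyN_bd m ha hx)) _; rewrite E.
    have p1 : 0 < 1 + m.+2%:R * c by rewrite ltr_wpDr// mulr_ge0// ltW.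
    have q1 : 1 + c <= 1 + x - a - m.+2%:R^-1 by move: Km; rewrite /c; move: (m.+2%:R^-1 : R) => e; lra.
    have q2 : m.+2%:R * c <= (1 + x - a - m.+2%:R^-1) ^+ stepN m.
      apply: (@le_trans _ _ ((1 + c) ^+ stepN m)); last first.
        by apply: lerXn2r => //; rewrite nnegrE; [rewrite addr_ge0// ltW|rewrite (le_trans _ q1)// addr_ge0// ltW].
      apply: le_trans (bernoulli_ge _ (ltW c0)).
      apply: (@le_trans _ _ ((stepN m)%:R * c)); last by rewrite lerDr.
      rewrite ler_wpM2r ?(ltW c0)// ler_nat /stepN; nia.
    by rewrite lef_pV2 ?posrE// ?lerD2l// (lt_le_trans p1)// lerD2l.
  + exact: cvg_cst.
  + exact: cvg_inv_nat.
Qed.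

End step_polynomials.

Section moments.
Context d (T : measurableType d) {R : realType} (mu : {measure set T -> \bar R}).
Implicit Types (g X : T -> R).

(** The moments kill every polynomial in X, in particular the step polynomials, which tend boundedly
    to the indicator of X <= a. *)
Lemma moments_indic g X (a : R) : intg mu g -> measurable_fun setT X ->
  (forall x, 0 <= X x <= 1) -> (forall k, \int[mu]_x (g x * X x ^+ k) = 0) ->
  0 <= a <= 1 -> \int[mu]_x (g x * (X x <= a)%R%:R) = 0.
Proof.
move=> ig mX X01 mom ha.
have mg := intg_meas ig.
have bX (h : T -> R) : measurable_fun setT h -> (forall x, `|h x| <= 1) -> intg mu (fun x => g x * h x).
  move=> mh h1; apply: intg_le (intg_norm ig); first exact: measurable_funM.
  by move=> x; rewrite normrM ler_piMr.
have iX k : intg mu (fun x => g x * X x ^+ k).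
  apply: bX; first exact: measurable_funX.
  by move=> x; have /andP[? ?] := X01 x; rewrite ger0_norm ?exprn_ge0// exprn_ile1.
have P (q : {poly R}) : \int[mu]_x (g x * q.[X x]) = 0.
  transitivity (\int[mu]_x (\sum_(i < size q) q`_i * (g x * X x ^+ i))).
    apply: eq_Rintegral => x _; rewrite horner_coef mulr_sumr; apply: eq_bigr => i _; ring.
  rewrite Rint_sum; last by move=> i; exact/intgZ/iX.
  by rewrite big1// => i _; rewrite RintZ// mom mulr0.
have mq m : measurable_fun setT (fun x => stepq a m (X x)).
  apply: measurable_funX; apply: measurable_funB => //; apply: measurable_funX.
  apply: measurable_funM => //; apply: measurable_funB => //; apply: measurable_funB => //.
  exact: measurable_funD.
have [] := @Rint_dct _ _ _ mu (fun m x => g x * stepq a m (X x)) (fun x => g x * (X x <= a)%R%:R) (fun x => `|g x|).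
- by move=> m; exact: measurable_funM.
- by move=> x; apply: cvgM; [exact: cvg_cst|exact: stepq_cvg].
- exact: intg_norm.
- move=> m x; rewrite normrM ler_piMr//; have /andP[? ?] := stepq_bd m ha (X01 x).
  by rewrite ger0_norm.
- move=> _; rewrite (_ : (fun m => _) = cst 0); last first.
    apply/funext => m; rewrite -[RHS](P (stepp a m)); apply: eq_Rintegral => x _.
    by rewrite steppE.
  by move=> h; apply/esym; apply: (cvg_unique (@Rhausdorff R) _ h); exact: cvg_cst.
Qed.

Lemma expR_series_bound (x : R) (N : nat) :
  `|\sum_(j < N) (x ^+ j / j`!%:R)| <= expR `|x|.
Proof.
apply: le_trans (ler_norm_sum _ _ _) _.
have -> : \sum_(j < N) `|x ^+ j / j`!%:R| = series (exp_coeff `|x|) N.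
  rewrite /series/= big_mkord; apply: eq_bigr => j _.
  by rewrite /exp_coeff /= normrM normrX (@ger0_norm _ (_^-1)).
rewrite /expR; apply: nondecreasing_cvgn_le; last exact: is_cvg_series_exp_coeff.
apply: nondecreasing_series => j _ _; exact: exp_coeff_ge0.
Qed.

Lemma expR_series_cvg (x : R) : (fun N : nat => \sum_(j < N) (x ^+ j / j`!%:R)) @ \oo --> expR x.
Proof.
have := is_cvg_series_exp_coeff x; rewrite /expR.
rewrite (_ : series (exp_coeff x) = fun N : nat => \sum_(j < N) (x ^+ j / j`!%:R))//.
by apply/funext => N; rewrite /series/= big_mkord.
Qed.

Lemma pow_le_expR (x c : R) k : 0 <= x -> 0 < c -> x ^+ k <= k`!%:R / c ^+ k * expR (c * x).
Proof.
move=> x0 c0; have cx : 0 <= c * x by rewrite mulr_ge0// ltW.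
have H : (c * x) ^+ k / k`!%:R <= expR (c * x).
  case: k => [|k]; first by rewrite expr0 fact0 invr1 mulr1 -[leLHS]addr0 (le_trans _ (expR_ge1Dx _))// lerD2l.
  by apply: le_trans (expR_ge1Dxn k cx); rewrite lerDr.
rewrite mulrAC ler_pdivlMr ?exprn_gt0// -exprMn mulrC -ler_pdivrMl ?ltr0n ?fact_gt0//.
by rewrite [leLHS]mulrC.
Qed.

(** Each further factor exp(-cX/2) is expanded in its power series, whose terms integrate to 0 by
    the previous case. Half of the weight exp(cX) dominates the partial sums and the other half
    dominates the power X^k. *)
Lemma exp_moments g X (c : R) : 0 < c -> measurable_fun setT g -> measurable_fun setT X ->
  (forall x, 0 <= X x) -> intg mu (fun x => `|g x| * expR (c * X x)) ->
  (forall k, \int[mu]_x (g x * X x ^+ k) = 0) ->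
  forall m k, \int[mu]_x (g x * expR (- (c / 2) * X x) ^+ m * X x ^+ k) = 0.
Proof.
move=> c0 mg mX X0 ig mom; pose e := c / 2; have e0 : 0 < e by rewrite divr_gt0.
have mE (r : R) : measurable_fun setT (fun x => expR (r * X x)).
  by apply: measurableT_comp => //; exact: measurable_funM.
elim=> [|m IH] k.
  by rewrite -[RHS](mom k); apply: eq_Rintegral => x _; rewrite expr0 mulr1.
have mF j : measurable_fun setT (fun x => g x * expR (- (c / 2) * X x) ^+ m * X x ^+ j).
  apply: measurable_funM; last exact: measurable_funX.
  by apply: measurable_funM => //; apply: measurable_funX; exact: mE.
have E1 x : expR (- (c / 2) * X x) ^+ m <= 1.
  apply: exprn_ile1; first exact: expR_ge0.
  by rewrite -[leRHS]expR0 ler_expR mulNr oppr_le0; exact: mulr_ge0 (ltW e0) (X0 x).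
have bF j x : `|g x * expR (- (c / 2) * X x) ^+ m * X x ^+ j| * expR (e * X x)
    <= j`!%:R / e ^+ j * (`|g x| * expR (c * X x)).
  rewrite !normrM [`|X x ^+ j|]ger0_norm ?exprn_ge0// [`|expR _ ^+ m|]ger0_norm ?exprn_ge0 ?expR_ge0//.
  have -> : expR (c * X x) = expR (e * X x) * expR (e * X x) by rewrite -expRD; congr expR; rewrite /e; field.
  have h1 := pow_le_expR j (X0 x) e0.
  have h2 : `|g x| * expR (- (c / 2) * X x) ^+ m <= `|g x| by rewrite ler_piMr.
  rewrite [leRHS](_ : _ = `|g x| * (j`!%:R / e ^+ j * expR (e * X x)) * expR (e * X x)); last by ring.
  by rewrite ler_wpM2r ?expR_ge0// ler_pM ?mulr_ge0 ?exprn_ge0 ?expR_ge0.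
have iF j : intg mu (fun x => g x * expR (- (c / 2) * X x) ^+ m * X x ^+ j).
  apply: intg_le (mF j) _ (intgZ (j`!%:R / e ^+ j) ig) => x.
  apply: le_trans (bF j x); rewrite ler_peMr//.
  by rewrite -expR0 ler_expR mulr_ge0// ltW.
have [] := @Rint_dct _ _ _ mu
  (fun N x => \sum_(j < N) ((- e) ^+ j / j`!%:R * (g x * expR (- (c / 2) * X x) ^+ m * X x ^+ (k + j))))
  (fun x => g x * expR (- (c / 2) * X x) ^+ m.+1 * X x ^+ k)
  (fun x => k`!%:R / e ^+ k * (`|g x| * expR (c * X x))).
- by move=> N; apply: measurable_sum => j; apply: measurable_funM.
- move=> x; pose G := g x * expR (- (c / 2) * X x) ^+ m * X x ^+ k.
  have cG : (fun N : nat => G * \sum_(j < N) ((- e * X x) ^+ j / j`!%:R)) @ \oo --> G * expR (- e * X x).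
    by apply: cvgM; [exact: cvg_cst|exact: expR_series_cvg].
  have -> : g x * expR (- (c / 2) * X x) ^+ m.+1 * X x ^+ k = G * expR (- e * X x).
    by rewrite exprSr /G /e; ring.
  rewrite (_ : (fun N : nat => _) = fun N : nat => G * \sum_(j < N) ((- e * X x) ^+ j / j`!%:R))//.
  apply/funext => N; rewrite mulr_sumr; apply: eq_bigr => j _.
  by rewrite /G exprD exprMn; ring.
- exact: intgZ.
- move=> N x; apply: le_trans (bF k x).
  rewrite (_ : \sum_(j < N) _ = g x * expR (- (c / 2) * X x) ^+ m * X x ^+ k * \sum_(j < N) ((- e * X x) ^+ j / j`!%:R)).
    rewrite normrM ler_wpM2l//; apply: le_trans (expR_series_bound _ _) _.
    by rewrite normrM normrN (gtr0_norm e0) (ger0_norm (X0 x)).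
  rewrite mulr_sumr; apply: eq_bigr => j _; by rewrite exprD exprMn; ring.
- move=> _; rewrite (_ : (fun N => _) = cst 0); last first.
    apply/funext => N; rewrite Rint_sum; last by move=> j; exact/intgZ/iF.
    by rewrite big1// => j _; rewrite RintZ// IH mulr0.
  by move=> h; apply/esym; apply: (cvg_unique (@Rhausdorff R) _ h); exact: cvg_cst.
Qed.

(** The unbounded X is exchanged for Y = exp(-cX/2) with values in [0, 1]: [exp_moments] gives the
    vanishing of the moments of Y, and b <= X means Y <= exp(-cb/2). *)
Lemma exp_moments_indic g X (c b : R) : 0 < c -> measurable_fun setT g -> measurable_fun setT X ->
  (forall x, 0 <= X x) -> intg mu (fun x => `|g x| * expR (c * X x)) ->
  (forall k, \int[mu]_x (g x * X x ^+ k) = 0) -> 0 <= b ->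
  \int[mu]_x (g x * (b <= X x)%R%:R) = 0.
Proof.
move=> c0 mg mX X0 ig mom b0.
have c20 : 0 < c / 2 by rewrite divr_gt0.
have gi : intg mu g.
  apply: intg_le ig => // x; rewrite ler_peMr// -expR0 ler_expR.
  exact: mulr_ge0 (ltW c0) (X0 x).
rewrite -[RHS](@moments_indic g (fun x => expR (- (c / 2) * X x)) (expR (- (c / 2) * b)) gi).
- apply: eq_Rintegral => x _; congr (_ * (nat_of_bool _)%:R).
  by rewrite ler_expR !mulNr lerN2 ler_pM2l.
- by apply: measurableT_comp => //; exact: measurable_funM.
- move=> x; rewrite expR_ge0/= -[leRHS]expR0 ler_expR mulNr oppr_le0; exact: mulr_ge0 (ltW c20) (X0 x).
- move=> k; rewrite -[RHS](exp_moments c0 mg mX X0 ig mom k 0).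
  by apply: eq_Rintegral => x _; rewrite expr0 mulr1.
- rewrite expR_ge0/= -[leRHS]expR0 ler_expR mulNr oppr_le0; exact: mulr_ge0 (ltW c20) b0.
Qed.

End moments.

(** * Smooth functions *)

Section directional.
Context {R : realType} {V : normedModType R}.
Implicit Types (f g : V -> R) (x v : V).

Lemma deriveE1 f x v : 'D_v f x = derive1 (fun h : R => f (h *: v + x)) 0.
Proof.
rewrite derive1E /derive.
have -> : (fun h : R => h^-1 *: ((f \o shift x) (h *: v) - f x)) =
  (fun h => h^-1 *: (((fun h : R => f (h *: v + x)) \o shift 0) (h *: 1) - f (0 *: v + x))).
  by apply/funext => h /=; rewrite addr0 scale0r add0r [h *: 1]mulr1.
by [].
Qed.

Lemma chain_rule f (g : R -> R) x v : derivable f x v -> derivable g (f x) 1 ->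
  derivable (g \o f) x v /\ 'D_v (g \o f) x = derive1 g (f x) * 'D_v f x.
Proof.
move=> df dg; pose F h := f (h *: v + x).
have dF : derivable F 0 1 := (derivable1P f x v).1 df.
have F0 : F 0 = f x by rewrite /F scale0r add0r.
have dgF : derivable g (F 0) 1 by rewrite F0.
have dgF' : derivable (g \o F) 0 1.
  by apply/derivable1_diffP; apply: differentiable_comp; exact/derivable1_diffP.
split; first exact: (derivable1P (g \o f) x v).2 dgF'.
rewrite (deriveE1 (g \o f)) (deriveE1 f).
by have := derive1_comp dF dgF; rewrite F0.
Qed.

End directional.

Definition smooth1 {R : realType} (g : R -> R) :=
  forall k x, derivable (derive1n k g) x 1.

Lemma smooth1_derive {R : realType} (g : R -> R) : smooth1 g -> smooth1 (derive1 g).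
Proof. by move=> sg k x; have := sg k.+1 x; rewrite derive1Sn. Qed.

Section smooth_closure.
Context {R : realType} {n : nat}.
Local Notation V := 'rV[R]_n.
Implicit Types (f g : V -> R).

(** A coinduction principle: to be smooth it is enough to lie in some class of continuous functions
    with partial derivatives that [partial] maps into itself. *)
Lemma smooth_coind (P : (V -> R) -> Prop) :
  (forall f, P f -> [/\ continuous f, forall i x, derivable f x (delta_mx 0 i) &
     forall i, P (partial i f)]) ->
  forall f, P f -> smooth f.
Proof.
move=> H f Pf l; have {Pf}: P (foldr partial f l).
  by elim: l => //= i l IH; have [_ _] := H _ IH; apply.
by move=> /H[].
Qed.

Lemma smooth_cont f : smooth f -> continuous f.
Proof. by move=> /(_ [::])[]. Qed.

Lemma smooth_der f i x : smooth f -> derivable f x (delta_mx 0 i).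
Proof. by move=> /(_ [::])[_]; apply. Qed.

Lemma smooth_partial f i : smooth f -> smooth (partial i f).
Proof. by move=> sf l; have := sf (rcons l i); rewrite -cats1 foldr_cat. Qed.

(** The derivative of a product is a sum of products, that of an inverse is a product of inverses,
    and so on: no operation gives a class stable under [partial] by itself. Closing under all of
    them at once does, and [smooth_coind] then applies. *)
Inductive smcl : (V -> R) -> Prop :=
| smcl_base f : smooth f -> smcl f
| smcl_add f g : smcl f -> smcl g -> smcl (fun x => f x + g x)
| smcl_mul f g : smcl f -> smcl g -> smcl (fun x => f x * g x)
| smcl_comp (h : R -> R) f : smooth1 h -> smcl f -> smcl (fun x => h (f x))
| smcl_inv f : smcl f -> (forall x, f x != 0) -> smcl (fun x => (f x)^-1).

Lemma partialD i f g x : derivable f x (delta_mx 0 i) -> derivable g x (delta_mx 0 i) ->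
  partial i (fun x => f x + g x) x = partial i f x + partial i g x.
Proof. by move=> df dg; rewrite /partial -deriveD. Qed.

Lemma partialM i f g x : derivable f x (delta_mx 0 i) -> derivable g x (delta_mx 0 i) ->
  partial i (fun x => f x * g x) x = f x * partial i g x + g x * partial i f x.
Proof. by move=> df dg; exact: (deriveM df dg). Qed.

Lemma partial_comp i (h : R -> R) f x : derivable f x (delta_mx 0 i) -> derivable h (f x) 1 ->
  partial i (fun x => h (f x)) x = derive1 h (f x) * partial i f x.
Proof. by move=> df dh; have [_] := chain_rule df dh. Qed.

Lemma partial_inv i f x : derivable f x (delta_mx 0 i) -> f x != 0 ->
  partial i (fun x => (f x)^-1) x = - ((f x)^-1 * (f x)^-1) * partial i f x.
Proof.
move=> df fx; rewrite /partial deriveV//; congr (_ * _).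
by rewrite expr2 invfM.
Qed.

Lemma smooth_cst a : smooth (fun _ : V => a).
Proof.
apply: (@smooth_coind (fun f => exists a, f = fun=> a)); last by exists a.
move=> _ [b ->]; split; [exact: cst_continuous|move=> i x; exact: derivable_cst|].
by move=> i; exists 0; apply/funext => x; exact: derive_cst.
Qed.

Lemma smcl_smooth f : smcl f -> smooth f.
Proof.
apply: smooth_coind => {}f; elim=> {f} [f sf|f g _ [cf df pf] _ [cg dg pg]|
  f g sf [cf df pf] sg [cg dg pg]|h f sh sf [cf df pf]|f sf [cf df pf] f0].
- split; [exact: smooth_cont|by move=> i x; exact: smooth_der|].
  by move=> i; apply/smcl_base/smooth_partial.
- split; [by move=> x; exact: cvgD (cf x) (cg x)|by move=> i x; exact: derivableD (df i x) (dg i x)|].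
  move=> i; rewrite (_ : partial i _ = fun x => partial i f x + partial i g x).
    exact: smcl_add.
  by apply/funext => x; exact: partialD.
- split; [by move=> x; exact: cvgM (cf x) (cg x)|by move=> i x; exact: derivableM (df i x) (dg i x)|].
  move=> i; rewrite (_ : partial i _ = fun x => f x * partial i g x + g x * partial i f x).
    by apply: smcl_add; apply: smcl_mul.
  by apply/funext => x; exact: partialM.
- have dh y : derivable h y 1 by exact: (sh 0%N y).
  split.
  + move=> x; apply: (@continuous_comp _ _ _ f h); first exact: cf.
    by apply: differentiable_continuous; exact/derivable1_diffP.
  + by move=> i x; have [] := chain_rule (df i x) (dh (f x)).
  + move=> i; rewrite (_ : partial i _ = fun x => derive1 h (f x) * partial i f x).
      by apply: smcl_mul => //; apply: smcl_comp => //; exact: smooth1_derive.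
    by apply/funext => x; exact: partial_comp.
- split.
  + by move=> x; exact: (cvgV (f0 x) (cf x)).
  + by move=> i x; apply: derivableV.
  + move=> i; rewrite (_ : partial i _ = fun x => (-1) * ((f x)^-1 * (f x)^-1) * partial i f x).
      have si := smcl_inv sf f0.
      apply: smcl_mul => //; apply: smcl_mul; first exact/smcl_base/smooth_cst.
      exact: smcl_mul.
    by apply/funext => x; rewrite partial_inv// mulN1r.
Qed.

Lemma smoothD f g : smooth f -> smooth g -> smooth (fun x => f x + g x).
Proof. by move=> *; apply/smcl_smooth/smcl_add; exact: smcl_base. Qed.

Lemma smoothM f g : smooth f -> smooth g -> smooth (fun x => f x * g x).
Proof. by move=> *; apply/smcl_smooth/smcl_mul; exact: smcl_base. Qed.

Lemma smoothZ a f : smooth f -> smooth (fun x => a * f x).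
Proof. by move=> sf; apply: smoothM; [exact: smooth_cst|exact: sf]. Qed.

Lemma smoothN f : smooth f -> smooth (fun x => - f x).
Proof. by move=> /(smoothZ (-1)); congr smooth; apply/funext => x; rewrite mulN1r. Qed.

Lemma smoothB f g : smooth f -> smooth g -> smooth (fun x => f x - g x).
Proof. by move=> sf sg; exact: (smoothD sf (smoothN sg)). Qed.

Lemma smooth_comp (h : R -> R) f : smooth1 h -> smooth f -> smooth (fun x => h (f x)).
Proof. by move=> *; apply/smcl_smooth/smcl_comp => //; exact: smcl_base. Qed.

Lemma smoothV f : smooth f -> (forall x, f x != 0) -> smooth (fun x => (f x)^-1).
Proof. by move=> *; apply/smcl_smooth/smcl_inv => //; exact: smcl_base. Qed.

Lemma smooth_sum I (s : seq I) (F : I -> V -> R) : (forall i, smooth (F i)) ->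
  smooth (fun x => \sum_(i <- s) F i x).
Proof.
move=> sF; elim: s => [|i s IH].
  by have := smooth_cst 0; congr smooth; apply/funext => x; rewrite big_nil.
by have := smoothD (sF i) IH; congr smooth; apply/funext => x; rewrite big_cons.
Qed.

Lemma smooth_prod I (s : seq I) (F : I -> V -> R) : (forall i, smooth (F i)) ->
  smooth (fun x => \prod_(i <- s) F i x).
Proof.
move=> sF; elim: s => [|i s IH].
  by have := smooth_cst 1; congr smooth; apply/funext => x; rewrite big_nil.
by have := smoothM (sF i) IH; congr smooth; apply/funext => x; rewrite big_cons.
Qed.

Lemma coord_derive (j i : 'I_n) (x : V) :
  is_derive x (delta_mx 0 i : V) (fun x : V => x 0 j) ((i == j)%:R).
Proof.
have E (h : R) : (h *: (delta_mx 0 i : V) + x) 0 j - x 0 j = h * (i == j)%:R.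
  by rewrite !mxE eqxx/= eq_sym addrK.
have C : h^-1 *: ((h *: (delta_mx 0 i : V) + x) 0 j - x 0 j) @[h --> 0^'] --> ((i == j)%:R : R).
  apply: cvg_near_cst; near=> h; rewrite E /GRing.scale/= mulrA mulVf ?mul1r//.
  by near: h; exact: nbhs_dnbhs_neq.
by split; [apply/cvg_ex; eexists; exact: C|exact: cvg_lim C].
Unshelve. all: by end_near. Qed.

Lemma smooth_coord (j : 'I_n) : smooth (fun x : V => x 0 j).
Proof.
apply: (@smooth_coind (fun f => f = (fun x : V => x 0 j) \/ exists a, f = fun=> a)); last by left.
move=> f [->|[a ->]].
  split; [exact: coord_continuous|by move=> i x; have [] := coord_derive j i x|].
  by move=> i; right; exists ((i == j)%:R); apply/funext => x; have [] := coord_derive j i x.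
have sc := smooth_cst a; split; [exact: smooth_cont|by move=> i x; exact: smooth_der|].
by move=> i; right; exists 0; apply/funext => x; exact: derive_cst.
Qed.

Lemma partial_coord (i j : 'I_n) x : partial i (fun x : V => x 0 j) x = (i == j)%:R.
Proof. by have [] := coord_derive j i x. Qed.

Lemma smooth_sqnorm (x0 : V) : smooth (fun x => sqnorm (x - x0)).
Proof.
apply: smooth_sum => i.
rewrite (_ : (fun x => _) = fun x : V => (x 0 i + (- x0 0 i)) * (x 0 i + (- x0 0 i))).
  have s1 : smooth (fun x : V => x 0 i + (- x0 0 i)).
    by apply: smoothD; [exact: smooth_coord|exact: smooth_cst].
  exact: smoothM.
by apply/funext => x; rewrite !mxE expr2.
Qed.

End smooth_closure.

Section flat.
Context {R : realType}.
Implicit Types (p : {poly R}) (x : R).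

(** The functions p(1/x) exp(-1/x), extended by 0: a family stable under differentiation that
    contains the classical flat function, for p = 1. *)
Definition flat p x : R := if 0 < x then p.[x^-1] * expR (- x^-1) else 0.

Lemma poly_exp_bound p : exists C : R, forall y, 0 <= y -> `|p.[y] * expR (- y)| <= C.
Proof.
exists (\sum_(i < size p) `|p`_i| * i`!%:R) => y y0.
rewrite horner_coef mulr_suml; apply: le_trans (ler_norm_sum _ _ _) _.
apply: ler_sum => i _; rewrite -mulrA normrM ler_wpM2l//.
rewrite ger0_norm ?mulr_ge0 ?exprn_ge0 ?expR_ge0//.
have := pow_le_expR i y0 (@ltr01 R); rewrite expr1n divr1 mul1r => h.
by rewrite expRN ler_pdivrMr ?expR_gt0.
Qed.

Lemma flat_bound p : exists C : R, forall x, `|flat p x| <= C * x ^+ 2.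
Proof.
have [C HC] := poly_exp_bound (p * 'X^2).
have C0 : 0 <= C by apply: le_trans (HC 0 (lexx 0)).
exists C => x; rewrite /flat; case: ifP => x0; last by rewrite normr0 mulr_ge0// sqr_ge0.
have xi : 0 <= x^-1 by rewrite invr_ge0 ltW.
have := HC _ xi; rewrite hornerM hornerXn -mulrA [_ ^+ 2 * _]mulrC mulrA normrM.
by rewrite [`|_ ^+ 2|]ger0_norm ?exprn_ge0// exprVn ler_pdivrMr ?exprn_gt0.
Qed.

(** For x > 0, differentiating p(1/x) exp(-1/x) yields x^-2 (p - p')(1/x) exp(-1/x). At the origin
    the quadratic bound of [flat_bound] makes the difference quotient O(|h|). *)
Lemma flat_derive p x : is_derive x 1 (flat p) (flat ('X^2 * (p - p^`())) x).
Proof.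
have [x0|x0|->] := ltgtP x 0.
- have -> : flat ('X^2 * (p - p^`())) x = 0 by rewrite /flat ltNge (ltW x0).
  have H : \forall y \near x, cst 0 y = flat p y.
    near=> y; have : y < 0 by near: y; exact: lt_nbhsl.
    by move=> y0; rewrite /flat ltNge (ltW y0).
  by apply: (near_eq_is_derive H); exact: is_derive_cst.
- have xn0 : x != 0 by rewrite gt_eqF.
  have H : \forall y \near x, (horner p \o (fun y : R => y^-1)) y * (expR \o (fun y : R => - y^-1)) y = flat p y.
    near=> y; have : 0 < y by near: y; exact: lt_nbhsr.
    by move=> y0; rewrite /flat y0.
  apply: (near_eq_is_derive H).
  have di : is_derive x 1 (fun y : R => y^-1) (- x ^- 2).
    have d1 : derivable (fun y : R => y^-1) x 1 by apply: derivableV.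
    split => //; have := @deriveV R R id x 1 xn0 (@derivable_id R R x 1).
    by move=> /= ->; rewrite derive_id [_ *: _]mulr1.
  have dn : is_derive x 1 (fun y : R => - y^-1) (x ^- 2).
    by rewrite -[x ^- 2]opprK; exact: is_deriveN.
  have d1 := is_derive1_comp (is_derive_poly p x^-1) di.
  have d2 := @is_derive1_comp R expR (fun y => - y^-1) x _ _ (is_derive_expR (- x^-1)) dn.
  have d3 := is_deriveM d1 d2.
  apply: (is_derive_eq d3).
  rewrite /flat x0 !hornerE /= exprVn /GRing.scale/=; ring.
- have -> : flat ('X^2 * (p - p^`())) 0 = 0 by rewrite /flat ltxx.
  have [C HC] := flat_bound p.
  have f0 : flat p 0 = 0 by rewrite /flat ltxx.
  have cv : h^-1 *: ((flat p \o shift 0) (h *: 1) - flat p 0) @[h --> 0^'] --> (0 : R).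
    apply: (@cvg_to_0_linear _ _ C 1) => // h /andP[h0 _] /=.
    rewrite addr0 f0 subr0 [h *: 1]mulr1 /GRing.scale/= normrM normfV ler_pdivrMl//.
    apply: le_trans (HC h) _; by rewrite [leRHS]mulrCA -expr2 real_normK ?num_real.
  by split; [apply/cvg_ex; exists 0; exact: cv|exact: cvg_lim cv].
Unshelve. all: by end_near. Qed.

Lemma flat_smooth1 p : smooth1 (flat p).
Proof.
move=> k; suff [q ->] : exists q, derive1n k (flat p) = flat q.
  by move=> x; have [] := flat_derive q x.
elim: k => [|k [q IH]]; first by exists p.
exists ('X^2 * (q - q^`())); rewrite derive1nS IH; apply/funext => x.
by rewrite derive1E; have [] := flat_derive q x.
Qed.

Definition eta1 x := flat 1 x.

Lemma eta1E x : eta1 x = if 0 < x then expR (- x^-1) else 0.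
Proof. by rewrite /eta1 /flat; case: ifP => // _; rewrite hornerC mul1r. Qed.

Lemma eta1_ge0 x : 0 <= eta1 x.
Proof. by rewrite eta1E; case: ifP => // _; exact: expR_ge0. Qed.

Lemma eta1_gt0 x : (0 < eta1 x) = (0 < x).
Proof. by rewrite eta1E; case: ifP; rewrite ?ltxx// expR_gt0. Qed.

Lemma eta1_le0 x : x <= 0 -> eta1 x = 0.
Proof. by rewrite eta1E leNgt => /negbTE ->. Qed.

Lemma eta1_smooth1 : smooth1 eta1.
Proof. exact: flat_smooth1. Qed.

End flat.

Section cutoff.
Context {R : realType} {n : nat}.
Local Notation V := 'rV[R]_n.
Implicit Types (s : V -> R).

(** The smooth transition from 0 where s <= 0 to 1 where s >= 1. The denominator is positive because
    s and 1 - s are never both nonpositive. *)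
Definition cutoff s (x : V) : R := eta1 (s x) / (eta1 (s x) + eta1 (1 - s x)).

Lemma cutoff_den s x : 0 < eta1 (s x) + eta1 (1 - s x).
Proof.
have [s0|s0] := ltP 0 (s x); first by rewrite ltr_pwDl ?eta1_gt0// eta1_ge0.
by rewrite ltr_wpDl ?eta1_ge0// eta1_gt0 subr_gt0 (le_lt_trans s0).
Qed.

Lemma smooth_cutoff s : smooth s -> smooth (cutoff s).
Proof.
move=> ss; have s1 := smooth_comp eta1_smooth1 ss.
have s2 := smooth_comp eta1_smooth1 (smoothB (smooth_cst 1) ss).
apply: (smoothM s1); apply: (smoothV (smoothD s1 s2)) => x.
by rewrite gt_eqF// cutoff_den.
Qed.

Lemma cutoff_01 s x : 0 <= cutoff s x <= 1.
Proof.
rewrite /cutoff divr_ge0 ?eta1_ge0 ?(ltW (cutoff_den s x))//=.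
by rewrite ler_pdivrMr ?cutoff_den// mul1r lerDl eta1_ge0.
Qed.

Lemma cutoff_eq1 s x : 1 <= s x -> cutoff s x = 1.
Proof.
move=> s1; rewrite /cutoff [eta1 (1 - _)]eta1_le0 ?subr_le0// addr0 divff//.
by rewrite gt_eqF// eta1_gt0 (lt_le_trans ltr01).
Qed.

Lemma cutoff_eq0 s x : s x <= 0 -> cutoff s x = 0.
Proof. by move=> s0; rewrite /cutoff eta1_le0// mul0r. Qed.

End cutoff.

Lemma pushforward_spec (R : realType) d1 d2 (X : measurableType d1) (Y : measurableType d2)
  (phi : X -> Y) (mphi : measurable_fun setT phi) (mu : {measure set X -> \bar R}) :
  exists m : {measure set Y -> \bar R}, pushforward mu phi = m.
Proof.
by exists (measure_function_pushforward__canonical__measure_function_Measure mu mphi).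
Qed.

(** * Lebesgue measure and test functions *)

Section preserving.
Context {R : realType} d (X : measurableType d) (phi : X -> X) (mphi : measurable_fun setT phi)
  (mu : {measure set X -> \bar R}).
Hypothesis pres : forall B, measurable B -> mu (phi @^-1` B) = mu B.

Lemma ge0_integral_preserving (f : X -> \bar R) : measurable_fun setT f ->
  (forall x, 0 <= f x)%E -> (\int[mu]_x f (phi x) = \int[mu]_x f x)%E.
Proof.
move=> mf f0.
have := ge0_integral_pushforward mphi mu measurableT mf (fun x _ => f0 x).
rewrite preimage_setT => <-; have [m E] := pushforward_spec mphi mu.
rewrite E; apply/esym/eq_measure_integral => B mB _.
by rewrite -E /pushforward pres.
Qed.

Lemma intg_preserving (f : X -> R) : intg mu f -> intg mu (f \o phi).
Proof.
move=> fi; have mf := intg_meas fi; apply/integrableP; split.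
  by apply/measurable_EFinP; exact: (measurableT_comp mf mphi).
rewrite (@ge0_integral_preserving (fun x => `|(f x)%:E|%E))//; first by case/integrableP: fi.
by apply: measurableT_comp => //; apply/measurable_EFinP.
Qed.

Lemma Rint_preserving (f : X -> R) : intg mu f ->
  \int[mu]_x f (phi x) = \int[mu]_x f x.
Proof.
move=> fi; have mf := intg_meas fi; rewrite /Rintegral; congr fine.
have mF : measurable_fun setT (EFin \o f) by apply/measurable_EFinP.
have iF : mu.-integrable (phi @^-1` setT) ((EFin \o f) \o phi).
  by rewrite preimage_setT; exact: intg_preserving.
have := integral_pushforward mphi mF iF measurableT.
rewrite preimage_setT => <-; have [m E] := pushforward_spec mphi mu.
rewrite E; apply/esym/eq_measure_integral => B mB _.
by rewrite -E /pushforward pres.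
Qed.

End preserving.

Section rV_structure.
Context {R : realType}.

Lemma cons_rV0 n (q : measurableTypeR R * 'rV[R]_n) : cons_rV q 0 ord0 = q.1.
Proof.
rewrite (_ : ord0 = lshift n ord0 :> 'I_(1 + n)); last exact: val_inj.
by apply: (etrans (row_mxEl _ _ _ _)); rewrite mxE eqxx mulr1n.
Qed.

Lemma cons_rVS n (q : measurableTypeR R * 'rV[R]_n) i :
  cons_rV q 0 (lift ord0 i) = q.2 0 i.
Proof.
rewrite (_ : lift ord0 i = rshift 1 i :> 'I_(1 + n)); last exact: val_inj.
exact: (etrans (row_mxEr _ _ _ _)).
Qed.

Lemma measurable_box n (c : 'rV[R]_n) (r : R) :
  measurable [set x : 'rV[R]_n | forall i, c 0 i - r < x 0 i < c 0 i + r].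
Proof.
have -> : [set x : 'rV[R]_n | forall i, c 0 i - r < x 0 i < c 0 i + r] =
    \bigcap_(i in [set: 'I_n]) ((fun x : 'rV[R]_n => x 0 i) @^-1` `]c 0 i - r, c 0 i + r[%classic).
  apply/seteqP; split => x /= h i; first by move=> _; rewrite /= in_itv/=.
  by have := h i I; rewrite /= in_itv.
apply: fin_bigcap_measurable; first exact: finite_finset.
move=> i _; have := @measurable_coord R n i measurableT _ (@measurable_itv R `]c 0 i - r, c 0 i + r[).
by rewrite setTI.
Qed.

(** U is the countable union of the open cubes with rational centre and half-side that it contains.
    Around x the half-side is chosen below e/2 and the centre closer to x than that, so the cube
    stays in the ball of radius e. *)
Lemma open_measurable_rV n (U : set 'rV[R]_n) : open U -> measurable U.
Proof.
move=> oU.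
pose C (q : 'rV[rat]_n) : 'rV[R]_n := \row_i ratr (q 0 i).
pose B (q : 'rV[rat]_n * rat) : set 'rV[R]_n := if `[< [set x : 'rV[R]_n | forall i, C q.1 0 i - ratr q.2 < x 0 i < C q.1 0 i + ratr q.2] `<=` U >]
   then [set x | forall i, C q.1 0 i - ratr q.2 < x 0 i < C q.1 0 i + ratr q.2] else set0.
have -> : U = \bigcup_(q in [set: 'rV[rat]_n * rat]) B q.
  apply/seteqP; split => [x Ux|x [q _]]; last by rewrite /B; case: asboolP => // h /h.
  have /nbhs_ballP[e /= e0 eU] := open_nbhs_nbhs (conj oU Ux).
  have [r /= re] : exists r : rat, ratr r \in `](e / 4), (e / 2)[.
    by apply: rat_in_itvoo; lra.
  rewrite in_itv/= in re; case/andP: re => r1 r2.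
  have /choice[q Hq] : forall i, exists q : rat, x 0 i - ratr r < ratr q < x 0 i + ratr r.
    move=> i; have [q] : exists q : rat, ratr q \in `](x 0 i - ratr r), (x 0 i + ratr r)[.
      by apply: rat_in_itvoo; lra.
    by rewrite in_itv/= => ?; exists q.
  exists (\row_i q i, r) => //; rewrite /B; case: asboolP => [_ i|].
    by rewrite /C !mxE; have /andP[? ?] := Hq i; apply/andP; split; lra.
  case=> y /= Hy; apply: eU; split => // i j; rewrite ord1 /ball/=.
  have := Hy j; rewrite !mxE => /andP[? ?]; have /andP[? ?] := Hq j.
  by rewrite ltr_norml; apply/andP; split; lra.
apply: countable_bigcupT_measurable => [|q]; first exact: countableP.
rewrite /B; case: asboolP => _; [exact: (@measurable_box n (C q.1) (ratr q.2))|exact: measurable0].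
Qed.

Lemma continuous_measurable_rV n (f : 'rV[R]_n -> R) : continuous f ->
  measurable_fun setT f.
Proof.
move=> cf; apply: (measurability (@RGenOInfty.G R) (RGenOInfty.measurableE R)).
move=> _ [_ [x ->] <-]; rewrite setTI; apply: open_measurable_rV.
by apply: open_comp; [move=> y _; exact: cf|exact: interval_open].
Qed.

Lemma ge0_integral_rVS n (f : 'rV[R]_n.+1 -> \bar R) : measurable_fun setT f ->
  (forall x, 0 <= f x)%E ->
  (\int[@lebesgue_rV R n.+1]_x f x =
   \int[lebesgue_measure]_a \int[@lebesgue_rV R n]_x f (cons_rV (a, x)))%E.
Proof.
move=> mf f0.
have mc := @measurable_cons_rV R n.
transitivity (\int[(lebesgue_measure \x @lebesgue_rV R n)%E]_q f (cons_rV q))%E.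
  by have := ge0_integral_pushforward mc (lebesgue_measure \x @lebesgue_rV R n)%E measurableT mf (fun x _ => f0 x).
have mfc := measurableT_comp mf mc.
exact: (@fubini_tonelli1 _ _ _ _ _ lebesgue_measure (@lebesgue_rV R n) _ mfc (fun q => f0 _)).
Qed.

Lemma box_lty n (M : R) : (@lebesgue_rV R n [set x : 'rV[R]_n | forall i, (`|x 0 i| <= M)%R] < +oo)%E.
Proof.
elim: n => [|n IH]; first by rewrite /lebesgue_rV diracE; case: (_ \in _); rewrite ltry.
have mb m : measurable [set x : 'rV[R]_m | forall i, (`|x 0 i| <= M)%R].
  have -> : [set x : 'rV[R]_m | forall i, (`|x 0 i| <= M)%R] =
    \bigcap_(i in [set: 'I_m]) ((fun x : 'rV[R]_m => x 0 i) @^-1` `[- M, M]%classic).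
    by apply/seteqP; split => x /= h i; [move=> _|]; have := h i; rewrite /= in_itv/= ler_norml//; apply.
  apply: fin_bigcap_measurable; first exact: finite_finset.
  move=> i _; have := @measurable_coord R m i measurableT _ (@measurable_itv R `[- M, M]).
  by rewrite setTI.
rewrite [X in (X < _)%E](_ : _ = (lebesgue_measure \x @lebesgue_rV R n)%E (`[- M, M]%classic `*` [set x : 'rV[R]_n | forall i, (`|x 0 i| <= M)%R])).
  have L := @lebesgue_measure_itv R `[- M, M].
  have fL : (lebesgue_measure (`[(- M)%R, M%R]%classic : set R) \is a fin_num)%E by rewrite L/=; case: ifP.
  have := @product_measure1E _ _ _ _ _ lebesgue_measure (@lebesgue_rV R n) `[(- M)%R, M]%classic _ (measurable_itv _) (mb n).
  by move=> ->; apply: lte_mul_pinfty.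
rewrite /= /pushforward; congr (_ _); apply/seteqP; split => [[a x] /= h|[a x] /= [h1 h2] i].
  split; first by have := h ord0; rewrite cons_rV0 in_itv/= ler_norml.
  by move=> i; have := h (lift ord0 i); rewrite cons_rVS.
case: (unliftP ord0 i) => [j|] ->; first by rewrite cons_rVS.
by rewrite cons_rV0 ler_norml; rewrite in_itv in h1.
Qed.

Lemma measurable_shift1 (h : R) :
  measurable_fun setT ((fun x => x + h) : measurableTypeR R -> measurableTypeR R).
Proof. by apply: measurable_funD => //; exact: measurable_cst. Qed.

Lemma lebesgue_shift (h : R) (B : set (measurableTypeR R)) : measurable B ->
  lebesgue_measure ((fun x : measurableTypeR R => (x + h : measurableTypeR R)) @^-1` B) = lebesgue_measure B.
Proof.
move=> mB.
have [m E] := pushforward_spec (measurable_shift1 h) (@lebesgue_measure R).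
have := @lebesgue_measure_unique R m.
move=> H; have {H} := H _ _ mB; rewrite -E /pushforward => <- // X [[a b] _ <-] /=.
rewrite [X in lebesgue_measure X = _](_ : _ = `]a, b]%classic)//.
rewrite [X in _ = lebesgue_measure X](_ : _ = `]a - h, b - h]%classic).
  by rewrite !lebesgue_measure_itv/= !lte_fin; clear; case: ltP => ab; case: ltP => ab'; rewrite -?EFinD; try (congr EFin; ring); exfalso; lra.
by apply/seteqP; split => x /=; rewrite !in_itv/= => /andP[? ?]; apply/andP; split; lra.
Qed.

Lemma measurable_shift n (h : 'rV[R]_n) : measurable_fun setT (fun x : 'rV[R]_n => x + h).
Proof.
apply: measurable_fun_rV => i.
rewrite (_ : (fun _ => _) = (fun x : 'rV[R]_n => x 0 i + h 0 i)); last by apply/funext => x; rewrite !mxE.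
by apply: measurable_funD; [exact: measurable_coord|exact: measurable_cst].
Qed.

(** Induction on the dimension: Tonelli splits off one coordinate, where the one-dimensional
    invariance applies. *)
Lemma ge0_integral_shift n (h : 'rV[R]_n) (f : 'rV[R]_n -> \bar R) : measurable_fun setT f ->
  (forall x, 0 <= f x)%E ->
  (\int[@lebesgue_rV R n]_x f (x + h)%R = \int[@lebesgue_rV R n]_x f x)%E.
Proof.
elim: n => [|n IH] in h f *.
  by move=> _ _; apply: eq_integral => x _; congr f; apply/rowP; case.
move=> mf f0.
have mc := @measurable_cons_rV R n.
have mfs := measurableT_comp mf (measurable_shift h); have mfc := measurableT_comp mf mc.
rewrite (ge0_integral_rVS mf f0) (ge0_integral_rVS mfs (fun x => f0 _)).
pose h' : 'rV[R]_n := \row_i h 0 (lift ord0 i).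
have E a x : cons_rV (a, x) + h = cons_rV (a + h 0 ord0, x + h') :> 'rV[R]_n.+1.
  apply/rowP => i; rewrite [LHS]mxE.
  by case: (unliftP ord0 i) => [j|] ->; rewrite ?cons_rV0 ?cons_rVS/= ?mxE.
pose G (a : measurableTypeR R) := (\int[@lebesgue_rV R n]_x f (cons_rV (a, x)))%E.
transitivity (\int[lebesgue_measure]_a G (a + h 0 ord0)%R)%E.
  apply: eq_integral => a _; rewrite /G -(IH h' (fun x => f (cons_rV (a + h 0 ord0, x)))) //.
    by apply: eq_integral => x _; rewrite /= E.
  by apply: (measurableT_comp mf); apply: (measurableT_comp mc); exact: pair1_measurable.
rewrite (ge0_integral_preserving (measurable_shift1 _) (lebesgue_shift _)) //; last by move=> a; exact: integral_ge0.
exact: (@measurable_fun_fubini_tonelli_F _ _ _ _ _ (@lebesgue_rV R n) _ mfc (fun q => f0 _)).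
Qed.

Lemma lebesgue_rV_shift n (h : 'rV[R]_n) (B : set 'rV[R]_n) : measurable B ->
  @lebesgue_rV R n ((fun x => x + h) @^-1` B) = @lebesgue_rV R n B.
Proof.
move=> mB.
have := @ge0_integral_shift n h (fun x => (\1_B x)%:E).
have mB' : measurable ((fun x => x + h) @^-1` B) by rewrite -[_ @^-1` _]setTI; exact: measurable_shift.
have /= := @integral_indic _ _ _ (@lebesgue_rV R n) _ measurableT _ mB; rewrite setIT => -> H.
have /= := @integral_indic _ _ _ (@lebesgue_rV R n) _ measurableT _ mB'; rewrite setIT => <-; apply: H; last by move=> x; rewrite lee_fin.
by apply/measurable_EFinP; exact: measurable_indic.
Qed.

Lemma intg_shift n (h : 'rV[R]_n) (f : 'rV[R]_n -> R) : intg (@lebesgue_rV R n) f ->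
  intg (@lebesgue_rV R n) (fun x => f (x + h)).
Proof. exact: (intg_preserving (measurable_shift h) (lebesgue_rV_shift h)). Qed.

Lemma Rint_shift n (h : 'rV[R]_n) (f : 'rV[R]_n -> R) : intg (@lebesgue_rV R n) f ->
  \int[@lebesgue_rV R n]_x f (x + h) = \int[@lebesgue_rV R n]_x f x.
Proof. exact: (Rint_preserving (measurable_shift h) (lebesgue_rV_shift h)). Qed.

End rV_structure.

Section test_functions.
Context {R : realType} {n : nat}.
Local Notation V := 'rV[R]_n.
Implicit Types (f g : V -> R) (O K : set V).

Definition box (M : R) : set V := [set x | forall i, `|x 0 i| <= M].

Lemma box_compact M : compact (box M).
Proof.
have -> : box M = [set v : V | forall i, `[- M, M]%classic (v ord0 i)].
  by apply/seteqP; split => x /= h i; have := h i; rewrite in_itv/= ler_norml.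
by apply: (@rV_compact R n (fun=> `[- M, M]%classic)) => i; exact: segment_compact.
Qed.

Lemma compact_closed_rV K : compact K -> closed K.
Proof. by apply: compact_closed; exact: norm_hausdorff. Qed.

Lemma measurable_sqbox M : measurable (box M).
Proof.
rewrite -[box M]setCK; apply: measurableC; apply: open_measurable_rV.
have cb : closed (box M) by apply: compact_closed_rV; exact: box_compact.
by rewrite openC.
Qed.

Lemma coord_le_norm (x : V) i : `|x 0 i| <= `|x|.
Proof.
rewrite [leRHS]mx_normrE.
exact: (@le_bigmax _ _ _ 0 (fun ij : 'I_1 * 'I_n => `|x ij.1 ij.2|) (0, i)).
Qed.

Lemma compact_box K : compact K -> exists M : R, K `<=` box M.
Proof.
move=> /compact_bounded[M0 [_ H]]; exists (M0 + 1) => x Kx i.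
by apply: le_trans (coord_le_norm x i) _; apply: (H (M0 + 1)) => //; rewrite ltrDl.
Qed.

Lemma L2_box M : L2 (\1_(box M) : V -> R).
Proof.
have mi : measurable_fun setT (\1_(box M) : V -> R) by apply: measurable_indic; exact: measurable_sqbox.
apply: L2P => //; apply: intg_ge0 => [|x|]; first by apply: measurable_funX.
  exact: sqr_ge0.
rewrite [X in (X < _)%E](_ : _ = mu (box M)); first exact: box_lty.
rewrite -[in RHS](setIT (box M)) -(integral_indic _ _ (measurable_sqbox M))//.
by apply: eq_integral => x _; rewrite indicE; case: (_ \in _); rewrite ?expr1n ?expr0n.
Qed.

Lemma intg_box M : intg mu (\1_(box M) : V -> R).
Proof.
apply: eq_intg (L2_intg_sqr (L2_box M)) => x.
by rewrite indicE; case: (_ \in _); rewrite ?expr1n ?expr0n.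
Qed.

Lemma cpt_bounded K f : compact K -> continuous f -> (forall x, ~ K x -> f x = 0) ->
  exists2 C : R, 0 <= C & forall x, `|f x| <= C.
Proof.
move=> cK cf f0.
have : compact (f @` K) by apply: continuous_compact => //; exact: continuous_subspaceT.
move=> /compact_bounded[M0 [_ H]]; exists (Num.max 0 (M0 + 1)); first by rewrite le_max lexx.
move=> x; rewrite le_max; have [Kx|/f0 ->] := pselect (K x); last by rewrite normr0 lexx.
by apply/orP; right; apply: (H (M0 + 1)); [rewrite ltrDl|exists x].
Qed.

Lemma le_box K f M C : K `<=` box M -> (forall x, ~ K x -> f x = 0) ->
  (forall x, `|f x| <= C) -> forall x, `|f x| <= C * \1_(box M) x.
Proof.
move=> KM f0 fC x; rewrite indicE; have [xM|xM] := boolP (x \in box M); rewrite ?mulr1//.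
rewrite mulr0 f0 ?normr0//; apply: contraNnot xM => /KM; exact: mem_set.
Qed.

Lemma cpt_L2 K f : compact K -> continuous f -> (forall x, ~ K x -> f x = 0) -> L2 f.
Proof.
move=> cK cf f0; have [C C0 fC] := cpt_bounded cK cf f0; have [M KM] := compact_box cK.
apply: (L2_le _ (le_box KM f0 fC)); first exact: continuous_measurable_rV.
exact: L2Z (L2_box M).
Qed.

Lemma cpt_intg K f : compact K -> continuous f -> (forall x, ~ K x -> f x = 0) -> intg mu f.
Proof.
move=> cK cf f0; have [C C0 fC] := cpt_bounded cK cf f0; have [M KM] := compact_box cK.
apply: (intg_le _ (le_box KM f0 fC)); first exact: continuous_measurable_rV.
exact: intgZ (intg_box M).
Qed.

Lemma partial_vanish K f i : closed K -> (forall x, ~ K x -> f x = 0) ->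
  forall x, ~ K x -> partial i f x = 0.
Proof.
move=> cK f0 x Kx; rewrite /partial (@near_eq_derive _ _ _ f (fun=> 0)) ?derive_cst//.
have : nbhs x (~` K) by apply: open_nbhs_nbhs; split => //; exact: closed_openC.
by apply: filterS => y; exact: f0.
Qed.

Lemma tf_smooth O f : test_function O f -> smooth f. Proof. by case. Qed.

Lemma tf_cont O f : test_function O f -> continuous f.
Proof. by case=> /smooth_cont. Qed.

Lemma tf_mono O O' f : O `<=` O' -> test_function O f -> test_function O' f.
Proof. by move=> OO [sf [K [cK KO f0]]]; split => //; exists K; split => // x /KO/OO. Qed.

Lemma tf_setT O f : test_function O f -> test_function setT f.
Proof. by apply: tf_mono. Qed.

Lemma tf_L2 O f : test_function O f -> L2 f.
Proof. by case=> sf [K [cK _ f0]]; apply: (cpt_L2 cK _ f0); exact: smooth_cont. Qed.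

Lemma tf_intg O f : test_function O f -> intg mu f.
Proof. by case=> sf [K [cK _ f0]]; apply: (cpt_intg cK _ f0); exact: smooth_cont. Qed.

Lemma tf_bounded O f : test_function O f -> exists2 C : R, 0 <= C & forall x, `|f x| <= C.
Proof. by case=> sf [K [cK _ f0]]; apply: (cpt_bounded cK _ f0); exact: smooth_cont. Qed.

Lemma tf_partial O f i : test_function O f -> test_function O (partial i f).
Proof.
case=> sf [K [cK KO f0]]; split; first exact: smooth_partial.
exists K; split => //; apply: partial_vanish => //; exact: compact_closed_rV.
Qed.

Lemma tf_Ml O f g : smooth g -> test_function O f -> test_function O (fun x => g x * f x).
Proof.
move=> sg [sf [K [cK KO f0]]]; split; first exact: smoothM.
by exists K; split => // x /f0 ->; rewrite mulr0.
Qed.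

Lemma tf_Mr O f g : smooth g -> test_function O f -> test_function O (fun x => f x * g x).
Proof.
move=> sg [sf [K [cK KO f0]]]; split; first exact: smoothM.
by exists K; split => // x /f0 ->; rewrite mul0r.
Qed.

Lemma tfZ O a f : test_function O f -> test_function O (fun x => a * f x).
Proof. exact: (@tf_Ml O f (fun=> a) (smooth_cst a)). Qed.

Lemma tf0 O : test_function O (fun=> 0 : R).
Proof. by split; [exact: smooth_cst|exists set0; split => //; exact: compact0]. Qed.

Lemma tfD O f g : test_function O f -> test_function O g -> test_function O (fun x => f x + g x).
Proof.
move=> [sf [K [cK KO f0]]] [sg [K' [cK' KO' g0]]]; split; first exact: smoothD.
exists (K `|` K'); split; first exact: compactU.
- by move=> x [/KO|/KO'].
- by move=> x nK; rewrite f0 ?g0 ?addr0// => ?; apply: nK; [right|left].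
Qed.

Lemma tfN O f : test_function O f -> test_function O (fun x => - f x).
Proof. by move=> /(tfZ (-1)); under eq_fun do rewrite mulN1r. Qed.

Lemma tfB O f g : test_function O f -> test_function O g -> test_function O (fun x => f x - g x).
Proof. by move=> tf /tfN; exact: tfD. Qed.

Lemma tf_sum O I (s : seq I) (F : I -> V -> R) : (forall i, test_function O (F i)) ->
  test_function O (fun x => \sum_(i <- s) F i x).
Proof.
move=> tF; elim: s => [|i s IH]; first by under eq_fun do rewrite big_nil; exact: tf0.
by under eq_fun do rewrite big_cons; exact: tfD.
Qed.

Section partial_zero.
Variables (i : 'I_n) (f : V -> R).
Hypothesis df : forall x, derivable f x (delta_mx 0 i).

Lemma partial_line (x : V) (h : R) :
  is_derive h 1 (fun h : R => f (h *: delta_mx 0 i + x)) (partial i f (h *: delta_mx 0 i + x)).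
Proof.
set e := delta_mx 0 i; pose F (h : R) := f (h *: e + x).
pose G (k : R) := f (k *: e + (h *: e + x)).
have dG : derivable G 0 1 := (derivable1P f (h *: e + x) e).1 (@df _).
have E k : F k = G (k - h) by rewrite /F /G addrA -scalerDl subrK.
have isG : is_derive (0 : R) (1 : R) G (partial i f (h *: e + x)).
  by rewrite /partial deriveE1 derive1E; exact: DeriveDef.
have isG' : is_derive (h - h) (1 : R) G (partial i f (h *: e + x)) by rewrite subrr.
have isS : is_derive h (1 : R) (fun k : R => k - h) (1 - 0) by apply: is_deriveB.
have := @is_derive1_comp _ G (fun k : R => k - h) h _ _ isG' isS; rewrite subr0 mulr1 => H.
by rewrite (_ : (fun _ => _) = G \o (fun k => k - h)) //; apply/funext => k; exact: E.
Qed.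

Lemma partial_cont_line (x : V) (h : R) :
  {for h, continuous (fun h : R => f (h *: delta_mx 0 i + x))}.
Proof.
apply/differentiable_continuous/derivable1_diffP.
by have [] := partial_line x h.
Qed.

Lemma partial_lip (C : R) (x : V) (h : R) : 0 < h -> (forall x, `|partial i f x| <= C) ->
  `|f (h *: delta_mx 0 i + x) - f x| <= C * h.
Proof.
move=> h0 hC; set e := delta_mx 0 i.
have [c _] := @MVT R (fun h : R => f (h *: e + x)) (fun h => partial i f (h *: e + x)) 0 h h0
  (fun y _ => partial_line x y) (continuous_subspaceT (fun y => @partial_cont_line x y)).
rewrite scale0r add0r subr0 => ->; rewrite normrM (gtr0_norm h0).
by apply: ler_wpM2r; [exact: ltW|exact: hC].
Qed.

Lemma partial_seq (x : V) :
  (fun k : nat => k.+1%:R * (f (k.+1%:R^-1 *: delta_mx 0 i + x) - f x)) @ \oo --> partial i f x.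
Proof.
have := @df x; rewrite /derivable => /cvg_ex[l Hl].
have := Hl; rewrite -/(derive _ _ _); have -> : partial i f x = l by exact: (cvg_lim (@Rhausdorff R) Hl).
move=> {}Hl; have H : (fun k : nat => (k.+1%:R^-1 : R)) @ \oo --> (0 : R)^'.
  move=> P; rewrite /dnbhs /within => HP.
  have := (@cvg_harmonic R) _ HP.
  change ((\forall k \near \oo, (k.+1%:R^-1 : R) != 0 -> P (k.+1%:R^-1)) -> \forall k \near \oo, P (k.+1%:R^-1)).
  apply: filterS => k; apply.
  by rewrite invr_eq0 pnatr_eq0.
have := cvg_comp _ _ H Hl; apply: cvg_trans; apply: near_eq_cvg; near=> k => /=.
by rewrite invrK.
Unshelve. all: by end_near. Qed.

(** Translation invariance makes the integral of every difference quotient vanish, and these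
    quotients are dominated thanks to the mean value theorem. Only a bounded derivative is asked of
    f, so that compositions with a C^1 truncation are covered as well as test functions. *)
Lemma Rint_partial0 (M C : R) : measurable_fun setT f -> measurable_fun setT (partial i f) ->
  (forall x, ~ box M x -> f x = 0) -> (forall x, `|f x| <= C) ->
  (forall x, `|partial i f x| <= C) ->
  \int[mu]_x partial i f x = 0.
Proof.
move=> mf mp f0 fC pC; pose e : V := delta_mx 0 i.
have fi : intg mu f by apply: (intg_le mf (le_box (@subset_refl _ _) f0 fC)); exact: intgZ (intg_box M).
pose g (k : nat) x := k.+1%:R * (f (k.+1%:R^-1 *: e + x) - f x).
have fis k : intg mu (fun x => f (k.+1%:R^-1 *: e + x)).
  by apply: eq_intg (intg_shift (k.+1%:R^-1 *: e) fi) => x; rewrite addrC.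
have gi k : intg mu (g k) by apply: intgZ; exact: intgB.
have g0 k : \int[mu]_x g k x = 0.
  rewrite RintZ; last exact: intgB.
  rewrite RintB// (_ : \int[mu]_x f (k.+1%:R^-1 *: e + x) = \int[mu]_x f x) ?subrr ?mulr0//.
  by rewrite -[RHS](Rint_shift (k.+1%:R^-1 *: e) fi); apply: eq_Rintegral => x _; rewrite addrC.
(* The increments are at most 1, so all quotients live in the box enlarged by 1. *)
have gb k x : `|g k x| <= C * \1_(box (M + 1)) x.
  rewrite indicE; have [xM|xM] := boolP (x \in box (M + 1)).
    rewrite mulr1 normrM ger0_norm//.
    have := @partial_lip C x k.+1%:R^-1; rewrite invr_gt0 ltr0Sn => /(_ isT pC).
    by rewrite -/e -ler_pdivlMl// [k.+1%:R^-1 * _]mulrC.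
  have [j Mj] : exists j, M + 1 < `|x 0 j|.
    apply: contrapT => H; move/negP: xM; apply; apply/mem_set => j.
    by rewrite leNgt; apply/negP => ?; apply: H; exists j.
  have nb : ~ box M x by move=> /(_ j); move: Mj; set t := `|_| => ? ?; lra.
  rewrite /g (f0 x nb) f0 ?subrr ?mulr0 ?normr0// => /(_ j).
  rewrite !mxE => H; have h1 : `|(k.+1%:R^-1 : R) * (((0 : 'I_1) == 0) && (j == i))%:R| <= 1.
    rewrite normrM; apply: mulr_ile1; rewrite ?normr_ge0//.
      by rewrite ger0_norm ?invr_ge0// invf_le1// ler1n.
    by case: (_ && _); rewrite ?normr1 ?normr0.
  have := ler_normB ((k.+1%:R^-1 : R) * (((0 : 'I_1) == 0) && (j == i))%:R + x 0 j) ((k.+1%:R^-1 : R) * (((0 : 'I_1) == 0) && (j == i))%:R).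
  rewrite addrAC subrr add0r; move: h1 H Mj.
  by set a := `|_|; set b := `|_|; set c := `|_| => ? ? ? ?; lra.
have mlim : measurable_fun setT (partial i f) by [].
have [/= c] := Rint_dct (fun k => intg_meas (gi k)) (fun x => @partial_seq x) (intgZ C (intg_box (M + 1))) gb.
move=> H; have H0 : (fun k : nat => \int[mu]_x g k x) @ \oo --> (0 : R).
  by under eq_fun do rewrite g0; exact: cvg_cst.
exact: (cvg_unique (@Rhausdorff R) H H0).
Qed.

End partial_zero.

Lemma tf_partial0 O f i : test_function O f -> \int[mu]_x partial i f x = 0.
Proof.
move=> tf; have [C1 C10 fC1] := tf_bounded tf; have tp := tf_partial i tf.
have [C2 C20 fC2] := tf_bounded tp; case: (tf) => sf [K [cK KO f0]].
have [M KM] := compact_box cK.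
apply: (@Rint_partial0 i f (fun x => @smooth_der R n f i x sf) M (C1 + C2)).
- by apply: continuous_measurable_rV; exact: tf_cont tf.
- by apply: continuous_measurable_rV; exact: tf_cont tp.
- by move=> x nx; apply: f0 => /KM.
- by move=> x; apply: le_trans (fC1 x) _; rewrite lerDl.
- by move=> x; apply: le_trans (fC2 x) _; rewrite lerDr.
Qed.

Lemma ibp O f g i : smooth f -> test_function O g ->
  \int[mu]_x (partial i f x * g x) = - \int[mu]_x (f x * partial i g x).
Proof.
move=> sf tg; have sg := tf_smooth tg.
have := tf_partial0 i (tf_Ml sf tg).
have E x : partial i (fun x => f x * g x) x = f x * partial i g x + partial i f x * g x.
  by rewrite (partialM (@smooth_der _ _ _ i x sf) (@smooth_der _ _ _ i x sg)) [g x * _]mulrC.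
rewrite (eq_Rintegral _ (fun x _ => E x)) RintD; first lra.
- exact: tf_intg (tf_Ml sf (tf_partial i tg)).
- exact: tf_intg (tf_Ml (smooth_partial i sf) tg).
Qed.

End test_functions.

(** * Density of test functions in L^2 *)

Section density.
Context {R : realType} {n : nat}.
Local Notation V := 'rV[R]_n.
Implicit Types (f g : V -> R).

Lemma L2_norm f : L2 f -> L2 (fun x => `|f x|).
Proof.
move=> Lf; apply: L2P; first by apply: measurableT_comp => //; exact: L2_meas.
by apply: eq_intg (L2_intg_sqr Lf) => x; rewrite real_normK ?num_real.
Qed.

Lemma L2_dct (f_ : nat -> V -> R) f g : (forall k, measurable_fun setT (f_ k)) ->
  (forall x, f_ k x @[k --> \oo] --> f x) -> L2 g -> (forall k x, `|f_ k x| <= g x) ->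
  L2 f /\ (inner (fun x => f_ k x - f x) (fun x => f_ k x - f x) @[k --> \oo] --> (0 : R)).
Proof.
move=> mf cf Lg fg.
have mlim : measurable_fun setT f by apply: (measurable_fun_cvg mf) => x _; exact: cf.
have fg' x : `|f x| <= g x.
  by apply: (cvgr_to_le (cvg_norm (cf x))); exact: nearW.
have Lf : L2 f by exact: (L2_le mlim fg' Lg).
split => //.
have m2 k : measurable_fun setT (fun x => (f_ k x - f x) ^+ 2).
  by apply: measurable_funX; exact: measurable_funB.
have [|k x|_] := Rint_dct m2 (f := fun=> 0) _ (intgZ 4 (L2_intg_sqr Lg)).
- move=> x; rewrite -[X in _ --> X](_ : (f x - f x) ^+ 2 = 0); last by rewrite subrr expr0n.
  by under eq_fun do rewrite expr2; rewrite expr2; apply: cvgM; apply: cvgB => //; exact: cvg_cst.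
- have h1 := fg k x; have h2 := fg' x; rewrite ger0_norm ?sqr_ge0//; move: h1 h2.
  rewrite !ler_norml => /andP[? ?] /andP[? ?]; nra.
rewrite (_ : \int[mu]_x 0 = 0); last by have := inner0l (fun _ : V => 0); rewrite /inner; under eq_Rintegral do rewrite mulr0.
by apply: cvg_trans; apply: near_eq_cvg; near=> k; rewrite inner_sqr.
Unshelve. all: by end_near. Qed.

Definition tf_dense f := forall e : R, 0 < e ->
  exists2 phi, test_function setT phi & inner (fun x => f x - phi x) (fun x => f x - phi x) < e.

Lemma tf_dense_lim f : L2 f -> (forall e : R, 0 < e -> exists g, [/\ L2 g, tf_dense g &
  inner (fun x => f x - g x) (fun x => f x - g x) < e]) -> tf_dense f.
Proof.
move=> Lf H e e0; have e4 : 0 < e / 4 by lra.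
have [g [Lg dg fg]] := H _ e4; have [phi tphi gphi] := dg _ e4.
exists phi => //; have := inner_add_le (L2B Lf Lg) (L2B Lg (tf_L2 tphi)).
have E : (fun x => f x - g x + (g x - phi x)) = (fun x => f x - phi x).
  by apply/funext => x; rewrite addrA subrK.
by rewrite E => ?; lra.
Qed.

Lemma tf_dense_lin (a b : R) f g : L2 f -> L2 g -> tf_dense f -> tf_dense g ->
  tf_dense (fun x => a * f x + b * g x).
Proof.
move=> Lf Lg df dg e e0; pose c := 4 * (1 + a ^+ 2 + b ^+ 2).
have c0 : 0 < c by rewrite /c; have := sqr_ge0 a; have := sqr_ge0 b; lra.
have ec : 0 < e / c by rewrite divr_gt0.
have [p tp fp] := df _ ec; have [q tq gq] := dg _ ec.
exists (fun x => a * p x + b * q x); first by apply: tfD; exact: tfZ.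
have Lfp := L2B Lf (tf_L2 tp); have Lgq := L2B Lg (tf_L2 tq).
have := inner_add_le (L2Z a Lfp) (L2Z b Lgq).
rewrite (_ : (fun x => a * (f x - p x) + b * (g x - q x)) = (fun x => a * f x + b * g x - (a * p x + b * q x))); last by apply/funext => x; ring.
rewrite !innerZl ?innerZr//; try exact: L2Z.
move=> H; apply: le_lt_trans H _.
have := inner_ge0 (fun x => f x - p x); have := inner_ge0 (fun x => g x - q x).
move: fp gq; set P := inner _ _; set Q := inner _ _ => P1 Q1 Q0 P0.
have Pe : c * P < e by rewrite mulrC -ltr_pdivlMr.
have Qe : c * Q < e by rewrite mulrC -ltr_pdivlMr.
have := sqr_ge0 a; have := sqr_ge0 b; rewrite /c in Pe Qe; nra.
Qed.

Lemma tf_dense0 : tf_dense (fun=> 0).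
Proof.
by move=> e e0; exists (fun=> 0); [exact: tf0|under [X in inner X]eq_fun do rewrite subrr; rewrite inner0l].
Qed.

Definition obox (l r : V) : set V := [set x | forall i, l 0 i < x 0 i < r 0 i].

Lemma obox_open l r : open (obox l r).
Proof.
move=> x Hx; have : \forall y \near (x : V), forall i : 'I_n, `]l 0 i, r 0 i[%classic ((y : V) 0 i).
  refine (@filter_forall _ _ (fun i (y : V) => `]l 0 i, r 0 i[%classic (y 0 i)) (nbhs (x : V)) _ _) => i.
  have oi : nbhs (x 0 i) `]l 0 i, r 0 i[%classic.
    by apply: open_nbhs_nbhs; split; [exact: interval_open|have := Hx i; rewrite /= in_itv].
  exact: (@coord_continuous R 1 n 0 i x _ oi).
by apply: filterS => y H i; have := H i; rewrite /= in_itv.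
Qed.

Lemma measurable_obox l r : measurable (obox l r).
Proof. by apply: open_measurable_rV; exact: obox_open. Qed.

(** A product of one-dimensional transitions of slope k, supported in the closed box, that tends to
    the indicator of the open box as k grows. *)
Definition bump (l r : V) (k : nat) (x : V) : R :=
  \prod_(i < n) (cutoff (fun x => k%:R * (x 0 i - l 0 i)) x * cutoff (fun x => k%:R * (r 0 i - x 0 i)) x).

Lemma tf_bump l r k : test_function setT (bump l r k).
Proof.
split.
  apply: smooth_prod => i; apply: smoothM; apply: smooth_cutoff; apply: smoothZ; apply: smoothB;
    by [exact: smooth_coord|exact: smooth_cst].
exists [set v : V | forall i, `[l 0 i, r 0 i]%classic (v ord0 i)]; split => //.
  by apply: (@rV_compact R n (fun i => `[l 0 i, r 0 i]%classic)) => i; exact: segment_compact.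
move=> x nx; have [i ni] : exists i, ~ (l 0 i <= x 0 i <= r 0 i).
  by apply: contrapT => H; apply: nx => i /=; rewrite in_itv/=; apply: contrapT => h; apply: H; exists i.
rewrite /bump (bigD1 i)//=; have k0 : 0 <= k%:R :> R by [].
have [xl|lx] := ltP (x 0 i) (l 0 i); first by rewrite cutoff_eq0 ?mul0r//; nra.
have [rx|xr] := ltP (r 0 i) (x 0 i); last by case: ni; rewrite lx xr.
by rewrite [X in _ * X * _]cutoff_eq0 ?mulr0 ?mul0r//; nra.
Qed.

Lemma bump_cvg l r x : bump l r k x @[k --> \oo] --> (\1_(obox l r) x : R).
Proof.
rewrite indicE; have [xB|/negP xB] := boolP (x \in obox l r).
  have {}xB := set_mem xB; apply: cvg_near_cst => /=.
  have key (a : R) : 0 < a -> \forall k \near \oo, 1 <= k%:R * a.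
    move=> a0; near=> k; rewrite -ler_pdivrMr//; near: k; exact: nbhs_infty_ger.
  have : \forall k \near \oo, forall i, 1 <= k%:R * (x 0 i - l 0 i) /\ 1 <= k%:R * (r 0 i - x 0 i).
    apply: filter_forall => i; have /andP[h1 h2] := xB i.
    by near=> k; split; near: k; apply: key; rewrite subr_gt0.
  by apply: filterS => k H; rewrite /bump big1// => i _; have [? ?] := H i; rewrite !cutoff_eq1 ?mulr1.
apply: cvg_near_cst; apply: nearW => k.
have [i ni] : exists i, ~ (l 0 i < x 0 i < r 0 i).
  by apply: contrapT => H; apply: xB; apply/mem_set => i; apply: contrapT => h; apply: H; exists i.
rewrite /bump (bigD1 i)//=; have k0 : 0 <= k%:R :> R by [].
have [xl|lx] := leP (x 0 i) (l 0 i); first by rewrite cutoff_eq0 ?mul0r//; nra.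
have [rx|xr] := leP (r 0 i) (x 0 i); last by case: ni; rewrite lx xr.
by rewrite [X in _ * X * _]cutoff_eq0 ?mulr0 ?mul0r//; nra.
Unshelve. all: by end_near. Qed.

Lemma obox_box l r : exists M : R, obox l r `<=` box M.
Proof.
have [M HM] : exists M : R, [set v : V | forall i, `[l 0 i, r 0 i]%classic (v ord0 i)] `<=` box M.
  by apply: compact_box; apply: (@rV_compact R n (fun i => `[l 0 i, r 0 i]%classic)) => i; exact: segment_compact.
exists M => x Hx; apply: HM => i /=; rewrite in_itv/=; have /andP[? ?] := Hx i.
by apply/andP; split; exact: ltW.
Qed.

Lemma L2_indic S M : measurable S -> S `<=` box M -> L2 (\1_S : V -> R).
Proof.
move=> mS SM; apply: (L2_le _ _ (L2_box M)); first exact: measurable_indic.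
move=> x; rewrite !indicE; have [xS|xS] := boolP (x \in S); last by rewrite normr0.
by rewrite normr1 mem_set//; apply: SM; exact: set_mem.
Qed.

Lemma tf_dense_obox l r : tf_dense (\1_(obox l r)).
Proof.
have [M HM] := obox_box l r; have Lb := L2_indic (measurable_obox l r) HM.
have mb k : measurable_fun setT (bump l r k).
  by apply: continuous_measurable_rV; exact: tf_cont (tf_bump l r k).
have bd k x : `|bump l r k x| <= (\1_(obox l r) x : R).
  rewrite indicE; have [xB|/negP xB] := boolP (x \in obox l r).
    rewrite normr_prod; apply: prodr_ile1 => i _; rewrite normr_ge0 normrM/=.
    have /andP[? ?] := cutoff_01 (fun x : V => k%:R * (x 0 i - l 0 i)) x.
    have /andP[? ?] := cutoff_01 (fun x : V => k%:R * (r 0 i - x 0 i)) x.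
    by rewrite !ger0_norm// mulr_ile1.
  have [i ni] : exists i, ~ (l 0 i < x 0 i < r 0 i).
    by apply: contrapT => H; apply: xB; apply/mem_set => i; apply: contrapT => h; apply: H; exists i.
  rewrite /bump (bigD1 i)//=; have k0 : 0 <= k%:R :> R by [].
  have [xl|lx] := leP (x 0 i) (l 0 i); first by rewrite cutoff_eq0 ?mul0r ?normr0//; nra.
  have [rx|xr] := leP (r 0 i) (x 0 i); last by case: ni; rewrite lx xr.
  by rewrite [X in _ * X * _]cutoff_eq0 ?mulr0 ?mul0r ?normr0//; nra.
have [_ H] := L2_dct mb (fun x => @bump_cvg l r x) Lb bd.
move=> e e0; have := H (ball 0 e) (nbhsx_ballx _ _ e0).
case=> N _ /(_ N (leqnn N)); rewrite /ball/= sub0r normrN => HN.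
exists (bump l r N); first exact: tf_bump.
apply: le_lt_trans HN; apply: le_trans (ler_norm _).
rewrite le_eqVlt; apply/orP; left; apply/eqP; rewrite !inner_sqr.
by apply: eq_Rintegral => x _; rewrite -sqrrN opprB.
Qed.

Definition oboxes : set (set V) := [set S | exists l r, S = obox l r].

Lemma oboxI l r l' r' : exists l2 r2, obox l r `&` obox l' r' = obox l2 r2.
Proof.
exists (\row_i Num.max (l 0 i) (l' 0 i)), (\row_i Num.min (r 0 i) (r' 0 i)).
apply/seteqP; split => x; rewrite /obox /=.
  by move=> [h1 h2] i; rewrite !mxE gt_max lt_min; have /andP[-> ->] := h1 i; have /andP[-> ->] := h2 i.
move=> h; split => i; have := h i; rewrite !mxE gt_max lt_min => /andP[/andP[? ?] /andP[? ?]];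
  by apply/andP.
Qed.

Lemma oboxes_gen : @measurable _ V = <<s oboxes >>.
Proof.
apply/seteqP; split; last first.
  by apply: smallest_sub; [exact: sigma_algebra_measurable|move=> _ [l [r ->]]; exact: measurable_obox].
apply: smallest_sub; first exact: smallest_sigma_algebra.
rewrite -bigcup_seq => Y [i _ [Z mZ <-]].
suff H : measurable_fun setT ((fun x => x 0 i) : g_sigma_algebraType oboxes -> measurableTypeR R).
  by have := H measurableT _ mZ.
apply: (measurability (@RGenOInfty.G R) (RGenOInfty.measurableE R)).
move=> _ [_ [a ->] <-]; rewrite setTI.
have -> : ((fun x : V => x 0 i) @^-1` `]a, +oo[%classic) =
    \bigcup_m obox (\row_j (if j == i then a else - m%:R)) (\row_j m%:R).
  apply/seteqP; split => x /=; rewrite in_itv/= ?andbT.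
    move=> ax; have [m Hm] : exists m : nat, forall j, `|x 0 j| < m%:R.
      exists (Num.bound `|x|) => j; apply: le_lt_trans (coord_le_norm x j) _.
      exact: archi_boundP.
    exists m => // j; rewrite !mxE; have := Hm j; rewrite ltr_norml => /andP[h1 h2]; rewrite h2 andbT.
    by case: eqP => // ->.
  by case=> m _ /(_ i); rewrite !mxE eqxx => /andP[].
apply: bigcup_measurable => m _; apply: sub_sigma_algebra.
by exists (\row_j (if j == i then a else - m%:R)), (\row_j m%:R).
Qed.

(** Dynkin's induction from open boxes. The intersection with a fixed cube keeps complements and
    countable unions in L^2. *)
Lemma tf_dense_indic M S : measurable S -> tf_dense (\1_(S `&` obox (\row__ - M) (\row__ M))).
Proof.
set Q := obox _ _ => mS; have mQ : measurable Q by exact: measurable_obox.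
have [M' HM'] := obox_box (\row__ - M) (\row__ M).
have LQ B : measurable B -> L2 (\1_(B `&` Q) : V -> R).
  by move=> mB; apply: (@L2_indic _ M'); [exact: measurableI|move=> x [_ /HM']].
apply: (@dynkin_induction _ V oboxes (fun S => tf_dense (\1_(S `&` Q)))).
- exact: oboxes_gen.
- move=> _ _ [l [r ->]] [l' [r' ->]]; have [l2 [r2 ->]] := oboxI l r l' r'.
  by exists l2, r2.
- by rewrite setTI; exact: tf_dense_obox.
- move=> _ [l [r ->]]; have [l2 [r2 ->]] := oboxI l r (\row__ - M) (\row__ M).
  exact: tf_dense_obox.
- move=> B mB dB.
  have -> : (\1_(~` B `&` Q) : V -> R) = fun x => 1 * \1_(setT `&` Q) x + -1 * \1_(B `&` Q) x.
    apply/funext => x; rewrite !indicE !in_setI in_setC in_setT.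
    by case: (x \in B); case: (x \in Q) => /=; lra.
  apply: tf_dense_lin => //; [exact: LQ|exact: LQ|rewrite setTI; exact: tf_dense_obox].
- move=> F mF tF dF.
  pose g m (x : V) : R := \sum_(k < m) \1_(F k `&` Q) x.
  have gE m x : g m x = \1_((\bigcup_(k < m) F k) `&` Q) x.
    elim: m => [|m IH]; first by rewrite /g big_ord0 bigcup_mkord big_ord0 set0I indic0.
    rewrite /g big_ord_recr/= -/(g m x) IH !bigcup_mkord big_ord_recr/= setIUl.
    have disj : x \in F m -> x \in \big[setU/set0]_(i < m) F i = false.
      move=> /set_mem Fm; apply: memNset; rewrite -bigcup_mkord => -[k /= km Fk].
      have := tF k m I I; rewrite (_ : (k = m) = False).
        by apply; exists x.
      by apply/propext; split=> // E; rewrite E ltnn in km.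
    rewrite !indicE in_setU !in_setI; move: disj.
    by move: (x \in \big[setU/set0]_(i < m) F i) (x \in F m) (x \in Q) => [] [] [] //= H; rewrite ?addr0 ?add0r//; have := H isT.
  have gm m : L2 (g m) by apply: L2_sum => k; exact: LQ.
  have gd m : tf_dense (g m).
    elim: m => [|m IH].
      by rewrite (_ : g 0%N = fun=> 0); [exact: tf_dense0|apply/funext => x; rewrite /g big_ord0].
    rewrite (_ : g m.+1 = fun x => 1 * g m x + 1 * \1_(F m `&` Q) x); last first.
      by apply/funext => x; rewrite /g big_ord_recr/= !mul1r.
    by apply: tf_dense_lin => //; exact: LQ.
  have cv x : g m x @[m --> \oo] --> (\1_((\bigcup_k F k) `&` Q) x : R).
    have [[[k _ Fk] Qx]|nx] := pselect (((\bigcup_k F k) `&` Q) x).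
      apply: cvg_near_cst; exists k.+1 => // m /= km; rewrite gE !indicE !mem_set//.
        by split => //; exists k.
      by split => //; exists k.
    apply: cvg_near_cst; apply: nearW => m; rewrite gE !indicE !memNset// => -[[k _ Fk] Qx].
    by apply: nx; split => //; exists k.
  have bd m x : `|g m x| <= \1_(setT `&` Q) x.
    rewrite gE !indicE normr_nat ler_nat !in_setI in_setT/=; case: (_ \in Q); last by rewrite andbF.
    by rewrite andbT; exact: leq_b1.
  have [LF H] := L2_dct (fun m => L2_meas (gm m)) cv (LQ _ measurableT) bd.
  apply: tf_dense_lim LF _ => e e0.
  have := H _ (nbhsx_ballx _ _ e0).
  case=> N _ /(_ N (leqnn N)); rewrite /ball/= sub0r normrN => HN.
  exists (g N); split => //; apply: le_lt_trans HN; apply: le_trans (ler_norm _).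
  rewrite le_eqVlt; apply/orP; left; apply/eqP; rewrite !inner_sqr.
  by apply: eq_Rintegral => x _; rewrite -sqrrN opprB.
- by rewrite -oboxes_gen.
Qed.

Lemma cvg_lt_ex (u : nat -> R) : u @ \oo --> (0 : R) -> forall e, 0 < e -> exists k, u k < e.
Proof.
move=> H e e0; have := H _ (nbhsx_ballx _ _ e0).
case=> N _ /(_ N (leqnn N)); rewrite /ball/= sub0r normrN => HN.
by exists N; apply: le_lt_trans HN; exact: ler_norm.
Qed.

(** Cutting f to a cube and clamping its values costs little by dominated convergence. The clamped
    function is uniformly close to a staircase in f, and the level sets, intersected with the cube,
    fall under [tf_dense_indic]. *)
Theorem L2_tf_dense f : L2 f -> tf_dense f.
Proof.
move=> Lf; have mf := L2_meas Lf.
pose clamp (k : nat) (y : R) := Num.max (- k%:R) (Num.min y k%:R) : R.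
have mclamp k : measurable_fun setT (clamp k).
  by apply: measurable_funTS; apply: measurable_maxr => //; exact: measurable_minr.
have clampk k y : `|clamp k y| <= k%:R.
  have k0 : 0 <= k%:R :> R by []; rewrite /clamp ler_norml le_max ge_max ge_min lexx lexx/= orbT andbT.
  by move: (k%:R : R) k0 => a a0; lra.
have clampy k y : `|clamp k y| <= `|y|.
  have k0 : 0 <= k%:R :> R by []; rewrite /clamp; move: (k%:R : R) k0 => a a0.
  by rewrite ler_norml le_max ge_max le_min ge_min; move: (ler_norm y) (ler_normB 0 y); rewrite -[in `|0 - y|]normrN; case: (leP 0 y) => y0; rewrite ?(ger0_norm y0) ?(ltr0_norm y0); lra.
pose Q k := obox (\row__ - k%:R) (\row__ k%:R) : set V.
pose f_ k x := \1_(Q k) x * clamp k (f x) : R.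
have mQ k : measurable (Q k) by exact: measurable_obox.
have mf_ k : measurable_fun setT (f_ k).
  apply: measurable_funM; first exact: measurable_indic.
  exact: (measurableT_comp (mclamp k) mf).
have bd k x : `|f_ k x| <= `|f x|.
  rewrite normrM indicE; case: (x \in _); rewrite ?normr1 ?mul1r// normr0 mul0r//.
have cv x : f_ k x @[k --> \oo] --> f x.
  apply: cvg_near_cst; near=> k.
  have h1 : `|f x| <= k%:R by near: k; exact: nbhs_infty_ger.
  have h2 : `|x| < k%:R by near: k; exact: nbhs_infty_gtr.
  rewrite /f_ indicE mem_set ?mul1r; last first.
    move=> i; rewrite !mxE; have := le_lt_trans (coord_le_norm x i) h2.
    by rewrite ltr_norml.
  by move: h1; rewrite /clamp ler_norml => /andP[h1 h3]; rewrite (min_idPl h3) (max_idPr h1).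
have Labs := L2_norm Lf.
have [_ H] := L2_dct mf_ cv Labs bd.
apply: tf_dense_lim Lf _ => e e0; have [k Hk] := cvg_lt_ex H e0.
exists (f_ k); split; first exact: (L2_le (mf_ k) (bd k) Labs).
  apply: tf_dense_lim; first exact: (L2_le (mf_ k) (bd k) Labs).
  move=> d d0.
  have [M HM] := obox_box (\row__ - k%:R : V) (\row__ k%:R : V).
  have LQ : L2 (\1_(Q k) : V -> R) by exact: (L2_indic (mQ k) HM).
  pose c := inner (\1_(Q k) : V -> R) (\1_(Q k)) + 1.
  have c0 : 0 < c by rewrite /c; have := inner_ge0 (\1_(Q k) : V -> R); lra.
  (* A uniform error d' on the cube, whose measure is less than c, costs less than d in squared
     norm. *)
  pose d' := Num.sqrt (d / 2 / c).
  have d'0 : 0 < d' by rewrite sqrtr_gt0 !divr_gt0.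
  have [N [a [b [B [mB HB]]]]] := bounded_staircase (mclamp k) d'0 (clampk k).
  pose S i := f @^-1` B i.
  have mS i : measurable (S i) by have := mf measurableT _ (mB i); rewrite setTI.
  pose g x := a * \1_(setT `&` Q k) x + b * \sum_(i < N) \1_(S i `&` Q k) x : R.
  have LSQ T : measurable T -> L2 (\1_(T `&` Q k) : V -> R).
    by move=> mT; apply: (@L2_indic _ M); [exact: measurableI|move=> x [_ /HM]].
  have Lsum : L2 (fun x => \sum_(i < N) \1_(S i `&` Q k) x : R) by apply: L2_sum => i; exact: LSQ.
  exists g; split.
  - by apply: L2D; apply: L2Z => //; exact: LSQ.
  - apply: tf_dense_lin => //; first exact: LSQ.
      exact: tf_dense_indic.
    elim: {Lsum} N {HB g} => [|N IH]; first by under eq_fun do rewrite big_ord0; exact: tf_dense0.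
    have LN : L2 (fun x => \sum_(i < N) \1_(S i `&` Q k) x : R) by apply: L2_sum => i; exact: LSQ.
    rewrite (_ : (fun x => _) = fun x => 1 * (\sum_(i < N) \1_(S i `&` Q k) x) + 1 * \1_(S N `&` Q k) x); last first.
      by apply/funext => x; rewrite big_ord_recr/= !mul1r.
    by apply: tf_dense_lin => //; [exact: LSQ|exact: tf_dense_indic].
  have gE x : g x = \1_(Q k) x * (a + b * \sum_(i < N) \1_(B i) (f x)).
    rewrite /g setTI mulrDr [_ * a]mulrC; congr (_ + _); rewrite mulrCA; congr (_ * _).
    rewrite mulr_sumr; apply: eq_bigr => i _; rewrite !indicE in_setI -natrM mulnb andbC.
    by congr (_ && _)%:R; apply/idP/idP => /set_mem ?; apply/mem_set.
  have le x : (f_ k x - g x) ^+ 2 <= d / 2 / c * (\1_(Q k) x ^+ 2).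
    rewrite gE /f_ -mulrBr exprMn mulrC; apply: ler_wpM2r; first exact: sqr_ge0.
    have := HB (f x); move: (clamp _ _ - _) => y yd; rewrite -(sqr_sqrtr (a := d / 2 / c)); last first.
      by rewrite ltW// !divr_gt0.
    by rewrite -real_normK ?num_real// ler_sqr ?nnegrE// ltW.
  have Lg : L2 g by apply: L2D; apply: L2Z => //; exact: LSQ.
  have Lfk : L2 (f_ k) by exact: (L2_le (mf_ k) (bd k) Labs).
  rewrite inner_sqr; apply: (@le_lt_trans _ _ (d / 2 / c * inner (\1_(Q k) : V -> R) (\1_(Q k)))).
    rewrite inner_sqr -RintZ; last exact: L2_intg_sqr.
    apply: Rint_le => //; first exact: L2_intg_sqr (L2B Lfk Lg).
    by apply: intgZ; exact: L2_intg_sqr.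
  rewrite mulrAC ltr_pdivrMr// /c; have := inner_ge0 (\1_(Q k) : V -> R); nra.
move: Hk; rewrite !inner_sqr; apply: le_lt_trans; rewrite le_eqVlt; apply/orP; left; apply/eqP.
by apply: eq_Rintegral => x _; rewrite -sqrrN opprB.
Unshelve. all: by end_near. Qed.

End density.

Section sequential.
Context {R : realType}.

(** Dominated convergence is stated for sequences; this lemma and [seq_cvg_dnbhs] make it available
    for continuity and for derivatives of integrals with a parameter. *)
Lemma seq_cvg (T : pseudoMetricType R) (f : T -> R) (x : T) (l : R) :
  (forall u : nat -> T, u @ \oo --> x -> f (u k) @[k --> \oo] --> l) ->
  f @ nbhs x --> l.
Proof.
move=> H; apply: contrapT => nc.
have /existsNP[e /not_implyP[e0 He]] : ~ (forall e : R, 0 < e -> \forall y \near x, `|l - f y| < e).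
  by move=> h; apply: nc; apply/cvgrPdist_lt.
have {He} : forall k : nat, exists y, ball x (k.+1%:R^-1) y /\ ~ (`|l - f y| < e).
  move=> k; apply: contrapT => hk; apply: He; apply/nbhs_ballP; exists (k.+1%:R^-1) => /=; first by rewrite invr_gt0.
  by move=> y xy; apply: contrapT => h; apply: hk; exists y.
move=> /choice[u Hu].
have ux : u @ \oo --> x.
  apply/cvg_ballP => d d0; have := @cvg_harmonic R; move=> /cvgrPdist_lt/(_ d d0).
  apply: filterS => k; rewrite sub0r normrN ger0_norm; last by rewrite /harmonic/= invr_ge0.
  by move=> kd; have [h _] := Hu k; exact: le_ball (ltW kd) _ h.
have := H u ux => /cvgrPdist_lt/(_ e e0)[N _ /(_ N (leqnn N))] /=.
by have [_] := Hu N.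
Qed.

Lemma seq_cvg_dnbhs (f : R -> R) (l : R) :
  (forall u : nat -> R, (forall k, u k != 0) -> u @ \oo --> (0 : R) -> f (u k) @[k --> \oo] --> l) ->
  f @ (0 : R)^' --> l.
Proof.
move=> H; apply: contrapT => nc.
have /existsNP[e /not_implyP[e0 He]] : ~ (forall e : R, 0 < e -> \forall y \near (0 : R)^', `|l - f y| < e).
  by move=> h; apply: nc; apply/cvgrPdist_lt.
have {He} : forall k : nat, exists y, [/\ `|y| < k.+1%:R^-1, y != 0 & ~ (`|l - f y| < e)].
  move=> k; apply: contrapT => hk; apply: He; rewrite near_withinE; apply/nbhs_ballP.
  exists (k.+1%:R^-1) => /=; first by rewrite invr_gt0.
  move=> y xy y0; apply: contrapT => h; apply: hk; exists y; split => //.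
  by move: xy; rewrite /ball/= sub0r normrN.
move=> /choice[u Hu].
have ux : u @ \oo --> (0 : R).
  apply/cvgrPdist_lt => d d0; have := @cvg_harmonic R; move=> /cvgrPdist_lt/(_ d d0).
  apply: filterS => k; rewrite !sub0r !normrN ger0_norm; last by rewrite /harmonic/= invr_ge0.
  by have [h _ _] := Hu k; exact: lt_trans.
have u0 k : u k != 0 by have [] := Hu k.
have := H u u0 ux => /cvgrPdist_lt/(_ e e0)[N _ /(_ N (leqnn N))] /=.
by have [_ _] := Hu N.
Qed.

End sequential.

(** * Mollification *)

Section convolution.
Context {R : realType} {n : nat}.
Local Notation V := 'rV[R]_n.
Implicit Types (f g h : V -> R).

Lemma L2_shift f y : L2 f -> L2 (fun x => f (x + y)).
Proof.
move=> Lf; apply: L2P; first exact: (measurableT_comp (L2_meas Lf) (measurable_shift y)).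
exact: (intg_shift y (L2_intg_sqr Lf)).
Qed.

Definition kern h := measurable_fun setT h /\ exists M C, forall x, `|h x| <= C * \1_(box M) x.

Lemma tf_kern O h : test_function O h -> kern h.
Proof.
move=> th; split; first by apply: continuous_measurable_rV; exact: tf_cont th.
have [C C0 hC] := tf_bounded th; case: th => sh [K [cK _ h0]]; have [M KM] := compact_box cK.
by exists M, C; exact: le_box KM h0 hC.
Qed.

Lemma kern_L2 h : kern h -> L2 h.
Proof. by case=> mh [M [C hM]]; apply: (L2_le mh hM); exact: L2Z (L2_box M). Qed.

Lemma kern_intg h : kern h -> intg mu h.
Proof. by case=> mh [M [C hM]]; apply: (intg_le mh hM); exact: intgZ (intg_box M). Qed.

Lemma kern_norm h : kern h -> kern (fun x => `|h x|).
Proof.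
case=> mh [M [C hM]]; split; first exact: measurableT_comp.
by exists M, C => x; rewrite normr_id.
Qed.

Lemma kern_bounded h : kern h -> exists2 C, 0 <= C & forall x, `|h x| <= C.
Proof.
case=> mh [M [C hM]]; exists (`|C|) => // x; apply: le_trans (hM x) _.
by rewrite indicE; case: (_ \in _); rewrite ?mulr1 ?mulr0// ler_norm.
Qed.

(** A convolution with the reflected kernel h(z - x): each derivative in x that is passed to h
    changes the sign. *)
Definition conv h g x : R := \int[mu]_z (h (z - x) * g z).

Lemma conv_intg h g x : L2 h -> L2 g -> intg mu (fun z => h (z - x) * g z).
Proof. by move=> Lh Lg; apply: L2M => //; exact: (L2_shift (- x) Lh). Qed.

Lemma convE h g x : L2 h -> L2 g -> conv h g x = \int[mu]_y (h y * g (y + x)).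
Proof.
move=> Lh Lg; rewrite /conv -(Rint_shift x (conv_intg x Lh Lg)).
by apply: eq_Rintegral => y _; rewrite addrK.
Qed.

Lemma conv_intg' h g x : L2 h -> L2 g -> intg mu (fun y => h y * g (y + x)).
Proof. by move=> Lh Lg; apply: L2M => //; exact: (L2_shift x Lg). Qed.

Lemma measurable_param (f : V * V -> R) : measurable_fun setT f ->
  measurable_fun setT (fun x => \int[mu]_z f (x, z)).
Proof.
move=> mf; rewrite /Rintegral; apply: measurableT_comp => //.
under eq_fun do rewrite integralE.
have mF : measurable_fun setT (EFin \o f) by apply/measurable_EFinP.
apply: emeasurable_funB.
- have H := @measurable_fun_fubini_tonelli_F _ _ _ _ _ mu _ (measurable_funepos mF) (funepos_ge0 _).
  rewrite (_ : (fun x => _) = fubini_F mu ((EFin \o f)^\+)%E) //.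
  by apply/funext => x; apply: eq_integral => z _; rewrite !funeposE.
- have H := @measurable_fun_fubini_tonelli_F _ _ _ _ _ mu _ (measurable_funeneg mF) (funeneg_ge0 _).
  rewrite (_ : (fun x => _) = fubini_F mu ((EFin \o f)^\-)%E) //.
  by apply/funext => x; apply: eq_integral => z _; rewrite !funenegE.
Qed.

Lemma measurable_add2 : measurable_fun setT (fun q : V * V => q.2 + q.1).
Proof.
apply: measurable_fun_rV => i.
rewrite (_ : (fun _ => _) = (fun q : V * V => q.2 0 i + q.1 0 i)); last by apply/funext => q; rewrite mxE.
by apply: measurable_funD; apply: (measurableT_comp (measurable_coord i)).
Qed.

Lemma measurable_conv_fun h g : measurable_fun setT h -> measurable_fun setT g ->
  measurable_fun setT (fun q : V * V => h q.2 * g (q.2 + q.1)).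
Proof.
move=> mh mg; apply: measurable_funM; first by apply: (measurableT_comp mh); exact: measurable_snd.
exact: (measurableT_comp mg measurable_add2).
Qed.

Lemma measurable_conv h g : L2 h -> L2 g -> measurable_fun setT (conv h g).
Proof.
move=> Lh Lg; rewrite (_ : conv h g = fun x => \int[mu]_y (h y * g (y + x))).
  exact: (measurable_param (measurable_conv_fun (L2_meas Lh) (L2_meas Lg))).
by apply/funext => x; exact: convE.
Qed.

Lemma kern_sqr h g x : kern h -> L2 g -> intg mu (fun y => `|h y| * g (y + x) ^+ 2).
Proof.
move=> kh Lg; have [C C0 hC] := kern_bounded kh; have [mh _] := kh.
have Lgx := L2_shift x Lg.
apply: (@intg_le _ _ _ _ _ (fun y : V => C * g (y + x) ^+ 2)).
- by apply: measurable_funM; [exact: measurableT_comp|apply: measurable_funX; exact: L2_meas].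
- move=> y; rewrite normrM normr_id [X in _ * X]ger0_norm ?sqr_ge0//.
  by apply: ler_wpM2r => //; exact: sqr_ge0.
- by apply: intgZ; exact: L2_intg_sqr.
Qed.

(** Cauchy-Schwarz for the measure |h| dy: the quadratic in [key] is the integral of |h| (|g| -
    c)^2, and its minimum over c gives the inequality. *)
Lemma conv_sqr_le h g x : kern h -> L2 g ->
  conv h g x ^+ 2 <= (\int[mu]_y `|h y|) * \int[mu]_y (`|h y| * g (y + x) ^+ 2).
Proof.
move=> kh Lg; have Lh := kern_L2 kh; rewrite convE//.
have kH := kern_norm kh; have iH := kern_intg kH.
set I := \int[mu]_y `|h y|; set J := \int[mu]_y (`|h y| * _).
have LH := kern_L2 kH; have LG := L2_norm Lg.
pose P := \int[mu]_y (`|h y| * `|g (y + x)|).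
have iP := conv_intg' x LH LG; have iJ := kern_sqr x kh Lg.
have P1 : `|\int[mu]_y (h y * g (y + x))| <= P.
  apply: le_trans (Rint_norm (conv_intg' x Lh Lg)) _; apply: Rint_le => //.
  - by apply: intg_norm; exact: conv_intg'.
  - by move=> y; rewrite normrM.
have I0 : 0 <= I by apply: Rint_ge0.
have J0 : 0 <= J by apply: Rint_ge0 => y; rewrite mulr_ge0 ?sqr_ge0.
have P0 : 0 <= P by apply: Rint_ge0 => y; rewrite mulr_ge0.
have key c : 0 <= J - 2 * c * P + c ^+ 2 * I.
  have -> : J - 2 * c * P + c ^+ 2 * I = \int[mu]_y (`|h y| * (`|g (y + x)| - c) ^+ 2).
    rewrite /J /P /I -!RintZ// -RintB//; last exact: intgZ.
    rewrite -RintD//; [|by apply: intgB => //; exact: intgZ|exact: intgZ].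
    by apply: eq_Rintegral => y _; rewrite -[in LHS](real_normK (num_real (g (y + x)))); ring.
  by apply: Rint_ge0 => y; rewrite mulr_ge0 ?sqr_ge0.
have PIJ : P ^+ 2 <= I * J.
  have [I00|In] := eqVneq I 0.
    have := key ((J + 1) / (2 * P)); rewrite I00 mulr0 addr0 mul0r => H.
    have [->|Pn] := eqVneq P 0; first by rewrite expr0n.
    move: H; rewrite (_ : 2 * ((J + 1) / (2 * P)) * P = J + 1); last by field; rewrite Pn.
    by lra.
  have Ip : 0 < I by rewrite lt_neqAle eq_sym In.
  have := key (P / I); rewrite (_ : J - 2 * (P / I) * P + (P / I) ^+ 2 * I = J - P ^+ 2 / I); last by field.
  by rewrite subr_ge0 ler_pdivrMr// mulrC.
by apply: le_trans PIJ; rewrite -[leLHS]real_normK ?num_real// ler_sqr ?nnegrE.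
Qed.

(** Young's inequality for L^1 and L^2, from the pointwise bound [conv_sqr_le] by Tonelli. *)
Lemma conv_L2 h g : kern h -> L2 g -> L2 (conv h g) /\
  inner (conv h g) (conv h g) <= (\int[mu]_y `|h y|) ^+ 2 * inner g g.
Proof.
move=> kh Lg; have Lh := kern_L2 kh; have mc := measurable_conv Lh Lg; have [mh _] := kh.
have iH := kern_intg (kern_norm kh).
set I := \int[mu]_y `|h y|; have I0 : 0 <= I by apply: Rint_ge0.
pose F (q : V * V) := (`|h q.2| * g (q.2 + q.1) ^+ 2)%:E.
have mF : measurable_fun setT F.
  apply/measurable_EFinP; apply: (@measurable_conv_fun (fun y => `|h y|) (fun y => g y ^+ 2)).
    exact: measurableT_comp.
  by apply: measurable_funX; exact: L2_meas.
have F0 q : (0 <= F q)%E by rewrite lee_fin mulr_ge0 ?sqr_ge0.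
have Ff : (\int[mu]_x \int[mu]_y F (x, y) = (I * inner g g)%:E)%E.
  rewrite (@fubini_tonelli _ _ _ _ _ mu mu F mF F0) /F/=.
  transitivity (\int[mu]_y (`|h y| * inner g g)%:E)%E.
    apply: eq_integral => y _.
    have Ly := L2_intg_sqr (L2_shift y Lg).
    rewrite inner_sqr -(Rint_shift y (L2_intg_sqr Lg)) -RintZ// Rint_EFin; last exact: intgZ.
    by apply: eq_integral => x _; rewrite addrC.
  rewrite -Rint_EFin; last by apply: eq_intg (intgZ (inner g g) iH) => y; rewrite mulrC.
  congr EFin; rewrite mulrC /I -RintZ//; apply: eq_Rintegral => y _; exact: mulrC.
pose J x := \int[mu]_y (`|h y| * g (y + x) ^+ 2).
have JE x : (J x)%:E = (\int[mu]_y F (x, y))%E by rewrite /J Rint_EFin//; exact: kern_sqr.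
have J0 x : 0 <= J x by apply: Rint_ge0 => y; rewrite mulr_ge0 ?sqr_ge0.
have mJ : measurable_fun setT J.
  by apply: (@measurable_param (fun q => `|h q.2| * g (q.2 + q.1) ^+ 2)); exact/measurable_EFinP.
have JI : (\int[mu]_x (J x)%:E = (I * inner g g)%:E)%E by rewrite -Ff; apply: eq_integral => x _; exact: JE.
have iJ : intg mu J by apply: intg_ge0 => //; rewrite JI ltry.
have RJ : \int[mu]_x J x = I * inner g g by apply: EFin_inj; rewrite Rint_EFin.
have bd x : `|conv h g x ^+ 2| <= I * J x by rewrite ger0_norm ?sqr_ge0//; exact: conv_sqr_le.
have Lc : L2 (conv h g).
  by apply: L2P => //; apply: (intg_le _ bd); [exact: measurable_funX|exact: intgZ].
split => //; rewrite inner_sqr expr2 -mulrA -RJ -RintZ//; apply: Rint_le => //.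
- exact: L2_intg_sqr.
- exact: intgZ.
- by move=> x; apply: le_trans (bd x); exact: ler_norm.
Qed.

Lemma convBr h g g' x : L2 h -> L2 g -> L2 g' ->
  conv h (fun z => g z - g' z) x = conv h g x - conv h g' x.
Proof.
move=> Lh Lg Lg'; rewrite /conv -RintB; [|exact: conv_intg..].
by apply: eq_Rintegral => z _; rewrite mulrBr.
Qed.

Lemma box_far M h (x z : V) (r : R) : (forall x, ~ box M x -> h x = 0) -> box r x -> ~ box (M + r) z ->
  h (z - x) = 0.
Proof.
move=> h0 xr zM; apply: h0 => H; apply: zM => i.
have := H i; have := xr i; rewrite !mxE.
have := ler_normD (z 0 i - x 0 i) (x 0 i); rewrite subrK; lra.
Qed.

Lemma conv_cont h g : test_function setT h -> L2 g -> continuous (conv h g).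
Proof.
move=> th Lg x; apply: (@seq_cvg R V) => u ux.
have [C C0 hC] := tf_bounded th; case: (th) => sh [K [cK _ h0]]; have [M KM] := compact_box cK.
have h0' y : ~ box M y -> h y = 0 by move=> nb; apply: h0 => /KM.
have Lh := tf_L2 th; have ch := tf_cont th.
have [r Hr] : exists r : R, forall k, box r (u k) /\ box r x.
  have [r0 [_ H]] := cvg_seq_bounded (cvgP _ ux).
  exists (Num.max (r0 + 1) `|x|) => k; split => i; rewrite le_max.
    by rewrite (le_trans (coord_le_norm (u k) i)) ?(H (r0 + 1))// ltrDl.
  by rewrite (coord_le_norm x i) orbT.
pose B : V -> R := fun z => C * \1_(box (M + r)) z.
have LB : L2 B := L2Z C (L2_box (M + r)).
have [|||_ +] := Rint_dct (f_ := fun k (z : V) => h (z - u k) * g z) (f := fun z : V => h (z - x) * g z)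
   (g := fun z : V => B z * `|g z|) _ _ (L2M LB (L2_norm Lg)) _; last by apply.
- by move=> k; apply: intg_meas; exact: conv_intg.
- move=> z; apply: cvgM; last exact: cvg_cst.
  apply: (cvg_comp (fun k => z - u k) h (G := nbhs (z - x))); last exact: ch.
  by apply: cvgB => //; exact: cvg_cst.
- move=> k z; rewrite normrM; apply: ler_wpM2r => //; rewrite /B indicE.
  have [zB|zB] := boolP (z \in box (M + r)); first by rewrite mulr1.
  rewrite (@box_far M h (u k) z r h0') ?normr0 ?mulr0//; first by have [] := Hr k.
  by move=> H; move/negP: zB; apply; exact: mem_set.
Qed.

(** The quotients of h are bounded by the supremum of its partial derivative and vanish outside one
    common box, hence the limit may be taken under the integral. The increment of the kernel is -u,
    which accounts for the sign. *)
Lemma conv_partial h g i x : test_function setT h -> L2 g ->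
  derivable (conv h g) x (delta_mx 0 i) /\
  partial i (conv h g) x = - conv (partial i h) g x.
Proof.
move=> th Lg; set e := delta_mx 0 i : V.
have tp := tf_partial i th.
have [C C0 hC] := tf_bounded tp; case: (th) => sh [K [cK _ h0]]; have [M KM] := compact_box cK.
have h0' y : ~ box M y -> h y = 0 by move=> nb; apply: h0 => /KM.
have Lh := tf_L2 th; have Lp := tf_L2 tp.
have dh y : derivable h y e by exact: smooth_der.
suff H : (fun k : R => k^-1 *: ((conv h g \o shift x) (k *: e) - conv h g x)) @ (0 : R)^' -->
    - conv (partial i h) g x.
  split; first by apply: cvgP; exact: H.
  exact: (cvg_lim (@Rhausdorff R) H).
apply: seq_cvg_dnbhs => u un u0.
have [r0 [_ Hr0]] := cvg_seq_bounded (cvgP _ u0).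
pose r := r0 + 1; have ur k : `|u k| <= r by apply: (Hr0 r) => //; rewrite ltrDl.
pose s := r + `|x|.
have bs k : box s (x + u k *: e) /\ box s x.
  have r00 : 0 <= r by apply: le_trans (normr_ge0 _) (ur 0%N).
  split => j; rewrite /s; last by apply: le_trans (coord_le_norm x j) _; rewrite lerDr.
  rewrite !mxE; apply: le_trans (ler_normD _ _) _; rewrite addrC; apply: lerD; last exact: coord_le_norm.
  rewrite normrM; apply: le_trans (ur k); rewrite -[leRHS]mulr1; apply: ler_wpM2l => //.
  by case: (_ && _); rewrite ?normr1 ?normr0.
pose B : V -> R := fun z => C * \1_(box (M + s)) z.
have LB : L2 B := L2Z C (L2_box (M + s)).
pose D k (z : V) := (u k)^-1 * (h (z - (x + u k *: e)) - h (z - x)).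
have DE k : (u k)^-1 *: ((conv h g \o shift x) (u k *: e) - conv h g x) = \int[mu]_z (D k z * g z).
  rewrite /= /conv -RintB; [|exact: conv_intg..].
  rewrite [LHS]/(_ *: _)/= -RintZ; last by apply: intgB; exact: conv_intg.
  by apply: eq_Rintegral => z _; rewrite /D [u k *: e + x]addrC; ring.
have iD k : intg mu (fun z => D k z * g z).
  have := intgZ (u k)^-1 (intgB (conv_intg (x + u k *: e) Lh Lg) (conv_intg x Lh Lg)).
  by apply: eq_intg => z; rewrite /D; ring.
have lip k z : `|D k z| <= C.
  rewrite normrM normfV ler_pdivrMl ?normr_gt0 ?un// mulrC.
  have [up|um] := ltP 0 (u k).
    have := @partial_lip R n i h dh C (z - (x + u k *: e)) (u k) up hC.
    rewrite (_ : u k *: e + (z - (x + u k *: e)) = z - x); last by rewrite addrC opprD addrA subrK.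
    by rewrite distrC (gtr0_norm up).
  have up : 0 < - u k by rewrite oppr_gt0 lt_neqAle un.
  have := @partial_lip R n i h dh C (z - x) (- u k) up hC.
  rewrite (_ : - u k *: e + (z - x) = z - (x + u k *: e)); last by rewrite scaleNr opprD [LHS]addrC addrA.
  by rewrite (ler0_norm um).
have cD z : D k z @[k --> \oo] --> - partial i h (z - x).
  have := dh (z - x); rewrite /derivable => /cvg_ex[l Hl].
  have El : partial i h (z - x) = l by exact: (cvg_lim (@Rhausdorff R) Hl).
  have un' k : - u k != 0 by rewrite oppr_eq0.
  have u0' : (fun k => - u k) @ \oo --> (0 : R)^'.
    move=> P; rewrite /dnbhs /within => HP.
    have : (fun k => - u k) @ \oo --> (0 : R) by rewrite -oppr0; exact: cvgN.
    move=> /(_ _ HP).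
    change ((\forall k \near \oo, - u k != 0 -> P (- u k)) -> \forall k \near \oo, P (- u k)).
    by apply: filterS => k; apply.
  have c := cvgN (cvg_comp _ _ u0' Hl); rewrite El.
  rewrite (_ : (fun k => D k z) = fun k => - ((- u k)^-1 *: ((h \o shift (z - x)) (- u k *: e) - h (z - x)))); first exact: (c _).
  apply/funext => k; rewrite /D /= (_ : - u k *: e + (z - x) = z - (x + u k *: e)); last first.
    by rewrite scaleNr opprD [LHS]addrC addrA.
  transitivity (- ((- u k)^-1 * (h (z - (x + u k *: e)) - h (z - x)))) => //.
  by rewrite invrN mulNr opprK.
have [|||_ +] := Rint_dct (f_ := fun k (z : V) => D k z * g z) (f := fun z : V => - partial i h (z - x) * g z)
   (g := fun z : V => B z * `|g z|) _ _ (L2M LB (L2_norm Lg)) _.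
- by move=> k; exact: intg_meas (iD k).
- by move=> z; apply: cvgM => //; exact: cvg_cst.
- move=> k z; rewrite normrM; apply: ler_wpM2r => //; rewrite /B indicE.
  have [zB|zB] := boolP (z \in box (M + s)); first by rewrite mulr1.
  have nz : ~ box (M + s) z by move=> H; move/negP: zB; apply; exact: mem_set.
  have [b1 b2] := bs k.
  by rewrite /D (box_far h0' b1 nz) (box_far h0' b2 nz) subrr mulr0 normr0 mulr0.
- have -> : - conv (partial i h) g x = \int[mu]_z (- partial i h (z - x) * g z).
    rewrite /conv -mulN1r -RintZ; last exact: conv_intg.
    by apply: eq_Rintegral => z _; rewrite mulN1r mulNr.
  by apply: cvg_trans; apply: near_eq_cvg; near=> k; rewrite DE.
Unshelve. all: by end_near. Qed.

Lemma conv_smooth h g : test_function setT h -> L2 g -> smooth (conv h g).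
Proof.
move=> th Lg.
apply: (@smooth_coind _ _ (fun f => exists2 h, test_function setT h & f = conv h g)); last by exists h.
move=> _ [k tk ->]; split => [|i x|i].
- exact: conv_cont.
- by have [] := conv_partial i x tk Lg.
- exists (fun y => - partial i k y); first exact/tfN/tf_partial.
  apply/funext => x; have [_ ->] := conv_partial i x tk Lg.
  rewrite /conv -mulN1r -RintZ; last by apply: conv_intg => //; exact: tf_L2 (tf_partial i tk).
  by apply: eq_Rintegral => z _; rewrite mulN1r mulNr.
Qed.

End convolution.

Section affine.
Context {R : realType} {n : nat}.
Local Notation V := 'rV[R]_n.
Implicit Types (f g h a : V -> R).

Lemma affine_partial f (c : R) (b : V) i : (forall x, derivable f x (delta_mx 0 i)) ->
  forall x, derivable (fun z => f (c *: z + b)) x (delta_mx 0 i) /\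
   partial i (fun z => f (c *: z + b)) x = c * partial i f (c *: x + b).
Proof.
move=> df x; set e := delta_mx 0 i.
pose G (t : R) := f (t *: e + (c *: x + b)).
have isG : is_derive (c * 0) (1 : R) G (partial i f (c *: x + b)).
  by have := partial_line df (c *: x + b) 0; rewrite scale0r add0r mulr0.
have isL : is_derive (0 : R) (1 : R) (fun t : R => c * t) (c * 1).
  have := @is_deriveZ _ _ _ (@id R) c 0 1 1 (is_derive_id _ _).
  exact.
have := @is_derive1_comp _ G (fun t => c * t) 0 _ _ isG isL; rewrite mulr1 => H.
have E : (fun t : R => f (c *: (t *: e + x) + b)) = G \o (fun t => c * t).
  by apply/funext => t; rewrite /G /= scalerDr scalerA addrA.
have dF : is_derive (0 : R) (1 : R) (fun t : R => f (c *: (t *: e + x) + b)) (partial i f (c *: x + b) * c).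
  by rewrite E.
split.
  by apply/(derivable1P (fun z => f (c *: z + b)) x e); have [] := dF.
by rewrite /partial deriveE1 derive1E (@derive_val _ _ _ _ _ _ _ dF) mulrC.
Qed.

Lemma continuous_affine (c : R) (b : V) : continuous (fun z : V => c *: z + b).
Proof.
move=> x; apply: (@continuousD _ _ _ (fun z : V => c *: z) (fun=> b) x).
  exact: scaler_continuous.
exact: cst_continuous.
Qed.

Lemma smooth_affine f c b : smooth f -> smooth (fun z : V => f (c *: z + b)).
Proof.
move=> sf.
pose P (g : V -> R) := exists h, smooth h /\ exists m, g = fun z => c ^+ m * h (c *: z + b).
apply: (@smooth_coind _ _ P); last by exists f; split => //; exists 0%N; apply/funext => z; rewrite mul1r.
move=> _ [h [sh [m ->]]].
have d i x := @affine_partial h c b i (fun x => @smooth_der _ _ _ i x sh) x.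
have dc i (x : V) : derivable (fun _ : V => c ^+ m) x (delta_mx 0 i) by exact: derivable_cst.
split => [x|i x|i].
- apply: (@continuousM _ _ (fun=> c ^+ m) (fun z : V => h (c *: z + b)) x).
    exact: cst_continuous.
  apply: (@continuous_comp _ _ _ (fun z : V => c *: z + b) h x); last exact: (smooth_cont sh).
  exact: continuous_affine.
- by apply: derivableM => //; have [] := d i x.
- exists (partial i h); split; first exact: smooth_partial.
  exists m.+1; apply/funext => x; have [dx Ex] := d i x.
  by rewrite partialM // Ex /partial derive_cst mulr0 addr0 exprSr mulrA.
Qed.

Lemma tf_shift f (x : V) : test_function setT f -> test_function setT (fun z => f (z - x)).
Proof.
move=> [sf [K [cK _ f0]]]; split.
  by have := smooth_affine 1 (- x) sf; under eq_fun do rewrite scale1r.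
exists ((fun y => y + x) @` K); split => //.
  apply: continuous_compact => //; apply: continuous_subspaceT.
  by have := @continuous_affine 1 x; under eq_fun do rewrite scale1r.
by move=> z nz; apply: f0 => Kz; apply: nz; exists (z - x) => //; rewrite subrK.
Qed.

Lemma partial_shift f (x : V) i z : smooth f -> partial i (fun z => f (z - x)) z = partial i f (z - x).
Proof.
move=> sf; have [_] := @affine_partial f 1 (- x) i (fun x => @smooth_der _ _ _ i x sf) z.
by rewrite scale1r mul1r; under eq_fun do rewrite scale1r.
Qed.

Lemma partial_lipn f i C (x : V) (h : R) : (forall x, derivable f x (delta_mx 0 i)) ->
  (forall x, `|partial i f x| <= C) ->
  `|f (h *: delta_mx 0 i + x) - f x| <= C * `|h|.
Proof.
move=> df hC; have [h0|h0|h0] := ltgtP 0 h.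
- by rewrite (gtr0_norm h0); exact: partial_lip.
- have hp : 0 < - h by rewrite oppr_gt0.
  have := partial_lip df (h *: delta_mx 0 i + x) hp hC.
  by rewrite addrA -scalerDl addNr scale0r add0r distrC (ltr0_norm h0).
- by rewrite -h0 scale0r add0r subrr normr0 mulr0.
Qed.

Lemma tf_lip a : test_function setT a -> exists2 L, 0 <= L & forall x y r, box r y ->
  `|a (y + x) - a x| <= L * r.
Proof.
move=> ta.
have /choice[C HC] : forall i, exists C, 0 <= C /\ forall x, `|partial i a x| <= C.
  by move=> i; have [C C0 HC] := tf_bounded (tf_partial i ta); exists C.
exists (\sum_i C i); first by apply: sumr_ge0 => i _; have [] := HC i.
move=> x y r yr.
have key (s : seq 'I_n) : `|a (\sum_(i <- s) y 0 i *: delta_mx 0 i + x) - a x| <= (\sum_(i <- s) C i) * r.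
  elim: s => [|i s IH]; first by rewrite !big_nil add0r subrr normr0 mul0r.
  rewrite !big_cons -addrA mulrDl; set X := _ + x in IH *.
  have := @partial_lipn a i (C i) X (y 0 i) (fun x => @smooth_der _ _ _ i x (tf_smooth ta)) (HC i).2.
  move=> H; apply: (@le_trans _ _ (`|a (y 0 i *: delta_mx 0 i + X) - a X| + `|a X - a x|)).
    exact: ler_distD.
  apply: lerD => //; apply: le_trans H _; apply: ler_wpM2l; [by have [] := HC i|exact: yr].
have := key (index_enum _); rewrite (_ : \sum_i _ = y) //.
by rewrite [RHS]row_sum_delta.
Qed.

Lemma partialZ f i (c : R) x : smooth f -> partial i (fun x => c * f x) x = c * partial i f x.
Proof.
move=> sf; have dc : derivable (fun _ : V => c) x (delta_mx 0 i) by exact: derivable_cst.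
by rewrite (partialM dc (@smooth_der _ _ _ i x sf)) [X in _ + _ * X]derive_cst mulr0 addr0.
Qed.

End affine.

Lemma box_vol (R : realType) n (M : R) : 0 <= M -> @lebesgue_rV R n (box M) = ((2 * M) ^+ n)%:E.
Proof.
move=> M0; elim: n => [|n IH]; first by rewrite /= diracE mem_set// => -[].
have -> : @lebesgue_rV R n.+1 (box M) = (lebesgue_measure \x @lebesgue_rV R n)%E (`[- M, M]%classic `*` box M).
  rewrite /= /pushforward; congr (_ _); apply/seteqP; split => [[a x] /= h|[a x] /= [h1 h2] i].
    split; first by have := h ord0; rewrite cons_rV0 in_itv/= ler_norml.
    by move=> i; have := h (lift ord0 i); rewrite cons_rVS.
  case: (unliftP ord0 i) => [j|] ->; first by rewrite cons_rVS.
  by rewrite cons_rV0 ler_norml; rewrite in_itv in h1.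
have := @product_measure1E _ _ _ _ _ lebesgue_measure (@lebesgue_rV R n) `[(- M)%R, M]%classic _ (measurable_itv _) (measurable_sqbox M).
move=> ->; have L := @lebesgue_measure_itv R `[- M, M].
rewrite [X in (_ * X)%E]IH [X in (X * _)%E]L /= lte_fin exprS EFinM.
case: ltP => h; first by rewrite -EFinD; congr (_%:E * _)%E; ring.
have -> : M = 0 by lra.
by rewrite mulr0 !mul0e.
Qed.

Lemma Rint_box (R : realType) n (M : R) : 0 <= M -> \int[@lebesgue_rV R n]_x \1_(box M) x = (2 * M) ^+ n.
Proof.
move=> M0; rewrite /Rintegral; have mB := @measurable_sqbox R n M.
have /= := @integral_indic _ _ _ (@lebesgue_rV R n) _ measurableT _ mB.
by rewrite setIT => ->; rewrite [X in fine X]box_vol.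
Qed.

Section mollifier.
Context {R : realType} {n : nat}.
Local Notation V := 'rV[R]_n.
Implicit Types (f g h a : V -> R).

(** Slope 2 makes it equal to 1 on the half-size box, whence the lower bound on the mass of its
    rescalings. *)
Definition beta : V -> R := bump (\row__ -1) (\row__ 1) 2.

Lemma tf_beta : test_function setT beta. Proof. exact: tf_bump. Qed.

Lemma beta_01 x : 0 <= beta x <= 1.
Proof.
have key i : 0 <= cutoff (fun x : V => 2%:R * (x 0 i - (\row__ -1 : V) 0 i)) x *
    cutoff (fun x : V => 2%:R * ((\row__ 1 : V) 0 i - x 0 i)) x <= 1.
  have /andP[? ?] := cutoff_01 (fun x : V => 2%:R * (x 0 i - (\row__ -1 : V) 0 i)) x.
  have /andP[? ?] := cutoff_01 (fun x : V => 2%:R * ((\row__ 1 : V) 0 i - x 0 i)) x.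
  by rewrite mulr_ge0// mulr_ile1.
rewrite /beta /bump; apply/andP; split; first by apply: prodr_ge0 => i _; have /andP[] := key i.
by apply: prodr_ile1 => i _; exact: key.
Qed.

Lemma beta1 x : box (2^-1) x -> beta x = 1.
Proof.
move=> bx; rewrite /beta /bump big1// => i _.
have := bx i; rewrite ler_norml => /andP[h1 h2].
by rewrite !cutoff_eq1 ?mulr1// !mxE; lra.
Qed.

Lemma beta0 x : ~ box 1 x -> beta x = 0.
Proof.
move=> nx; have [i ni] : exists i, 1 < `|x 0 i|.
  by apply: contrapT => H; apply: nx => i; rewrite leNgt; apply/negP => h; apply: H; exists i.
rewrite /beta /bump (bigD1 i)//=; move: ni; rewrite lter_normr => /orP[h|h].
  by rewrite [X in _ * X * _]cutoff_eq0 ?mulr0 ?mul0r// !mxE; lra.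
by rewrite cutoff_eq0 ?mul0r// !mxE; lra.
Qed.

Definition beta_ (k : nat) (x : V) : R := beta (k.+1%:R *: x).
Definition rho (k : nat) (x : V) : R := (\int[mu]_y beta_ k y)^-1 * beta_ k x.

Lemma beta_0 k x : ~ box (k.+1%:R^-1) x -> beta_ k x = 0.
Proof.
move=> nx; apply: beta0 => H; apply: nx => i; have := H i; rewrite mxE normrM ger0_norm//.
by rewrite mulrC -ler_pdivlMr// mul1r.
Qed.

Lemma tf_beta_ k : test_function setT (beta_ k).
Proof.
split.
  have := smooth_affine k.+1%:R 0 (tf_smooth tf_beta).
  by under eq_fun do rewrite addr0.
exists (box (k.+1%:R^-1)); split => //; [exact: box_compact|exact: beta_0].
Qed.

Lemma beta_int_ge k : (k.+1%:R^-1) ^+ n <= \int[mu]_y beta_ k y.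
Proof.
have k0 : 0 <= (2 * k.+1%:R)^-1 :> R by rewrite invr_ge0.
have -> : (k.+1%:R^-1) ^+ n = \int[mu]_y \1_(box ((2 * k.+1%:R)^-1)) (y : V) :> R.
  by rewrite Rint_box// invfM mulrA divff ?mul1r.
apply: Rint_le => [||x]; first exact: intg_box.
  exact: tf_intg (tf_beta_ k).
rewrite indicE; have /andP[h0 _] := beta_01 (k.+1%:R *: x).
have [/set_mem xB|//] := boolP (x \in _).
rewrite /beta_ beta1// => i; rewrite mxE normrM ger0_norm//.
have := xB i; rewrite invfM => h; rewrite mulrC -ler_pdivlMr//.
Qed.

Lemma beta_int_gt0 k : 0 < \int[mu]_y beta_ k y.
Proof. by apply: lt_le_trans (beta_int_ge k); rewrite exprn_gt0// invr_gt0. Qed.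

Lemma tf_rho k : test_function setT (rho k).
Proof. exact/tfZ/tf_beta_. Qed.

Lemma rho_ge0 k x : 0 <= rho k x.
Proof.
rewrite mulr_ge0// ?invr_ge0 ?(ltW (beta_int_gt0 k))//.
by have /andP[] := beta_01 (k.+1%:R *: x).
Qed.

Lemma rho_int k : \int[mu]_y rho k y = 1.
Proof.
rewrite RintZ; first by rewrite mulVf// gt_eqF// beta_int_gt0.
exact: tf_intg (tf_beta_ k).
Qed.

Lemma rho_0 k x : ~ box (k.+1%:R^-1) x -> rho k x = 0.
Proof. by move=> /beta_0; rewrite /rho => ->; rewrite mulr0. Qed.

(** Scaling: the gradient of the rescaled bump gains a factor k+1 while mass and support are
    normalized. In Friedrichs' lemma this growth meets a modulus of continuity of order 1/(k+1). *)
Lemma rho_partial : exists2 C : R, 0 <= C & forall k i,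
  \int[mu]_y `|partial i (rho k) y| <= C * k.+1%:R.
Proof.
have /choice[C HC] : forall i, exists C, 0 <= C /\ forall x, `|partial i beta x| <= C.
  by move=> i; have [C C0 HC] := tf_bounded (tf_partial i tf_beta); exists C.
exists ((\sum_i C i) * 2 ^+ n).
  by rewrite mulr_ge0// ?exprn_ge0// sumr_ge0// => i _; have [] := HC i.
move=> k i; set c := k.+1%:R : R.
have c0 : 0 < c by rewrite /c.
have tb := tf_beta_ k; have sb := tf_smooth tb.
have pE y : partial i (rho k) y = (\int[mu]_y beta_ k y)^-1 * partial i (beta_ k) y.
  exact: partialZ.
have pb y : `|partial i (beta_ k) y| <= c * C i * \1_(box (c^-1)) y.
  have [yB|yB] := pselect (box (c^-1) y); last first.
    have cb : closed (box (c^-1) : set V) by apply: compact_closed_rV; exact: box_compact.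
    by rewrite indicE memNset// mulr0 (@partial_vanish _ _ _ _ i cb (@beta_0 k) _ yB) normr0.
  rewrite indicE mem_set// mulr1.
  have [_] := @affine_partial R n beta c 0 i (fun x => @smooth_der _ _ _ i x (tf_smooth tf_beta)) y.
  rewrite addr0 (_ : (fun z => _) = beta_ k); last by apply/funext => z; rewrite addr0.
  move=> ->; rewrite normrM gtr0_norm//; apply: ler_wpM2l; [exact: ltW|exact: (HC i).2].
have ip := tf_intg (tf_partial i tb).
have I1 : \int[mu]_y `|partial i (beta_ k) y| <= c * C i * (2 / c) ^+ n.
  apply: (@le_trans _ _ (\int[mu]_y (c * C i * \1_(box (c^-1)) y))).
    apply: Rint_le => //; [exact: intg_norm|apply: intgZ; exact: intg_box].
  rewrite RintZ; last exact: intg_box.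
  by rewrite Rint_box// invr_ge0 ltW.
have bp := beta_int_gt0 k; have bg := beta_int_ge k.
under eq_Rintegral do rewrite pE normrM (gtr0_norm (_ : 0 < (\int[mu]_y beta_ k y)^-1)) ?invr_gt0//.
rewrite RintZ; last exact: intg_norm.
rewrite ler_pdivrMl//; apply: le_trans I1 _.
rewrite exprMn; have Ci : C i <= \sum_i C i.
  by rewrite (bigD1 i)//= lerDl sumr_ge0// => j _; have [] := HC j.
apply: (@le_trans _ _ (c^-1 ^+ n * ((\sum_i C i) * 2 ^+ n * c))); last first.
  apply: ler_wpM2r => //; apply: mulr_ge0; last exact: ltW.
  by rewrite mulr_ge0// ?exprn_ge0// sumr_ge0// => j _; have [] := HC j.
rewrite [leLHS](_ : _ = c^-1 ^+ n * (C i * 2 ^+ n * c)); last by ring.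
apply: ler_wpM2l; first by rewrite exprn_ge0// invr_ge0 ltW.
by apply: ler_wpM2r; [exact: ltW|apply: ler_wpM2r => //; rewrite exprn_ge0].
Qed.

Definition moll k g : V -> R := conv (rho k) g.

Lemma moll_L2 k g : L2 g -> L2 (moll k g).
Proof. by move=> Lg; have [] := conv_L2 (tf_kern (tf_rho k)) Lg. Qed.

Lemma moll_le k g : L2 g -> inner (moll k g) (moll k g) <= inner g g.
Proof.
move=> Lg; have [_] := conv_L2 (tf_kern (tf_rho k)) Lg.
have -> : \int[mu]_y `|rho k y| = 1.
  by rewrite -[RHS](rho_int k); apply: eq_Rintegral => y _; rewrite ger0_norm// rho_ge0.
by rewrite expr1n mul1r.
Qed.

Lemma moll_smooth k g : L2 g -> smooth (moll k g).
Proof. exact/conv_smooth/tf_rho. Qed.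

Lemma mollB k f g x : L2 f -> L2 g -> moll k (fun x => f x - g x) x = moll k f x - moll k g x.
Proof. by apply: convBr; exact: tf_L2 (tf_rho k). Qed.

Lemma moll_tf k g M : L2 g -> (forall x, ~ box M x -> g x = 0) ->
  test_function setT (moll k g) /\ forall x, ~ box (M + 1) x -> moll k g x = 0.
Proof.
move=> Lg g0.
have v x : ~ box (M + 1) x -> moll k g x = 0.
  move=> nx; rewrite /moll /conv.
  have H z : rho k (z - x) * g z = 0.
    have [zM|zM] := pselect (box M z); last by rewrite g0 ?mulr0.
    rewrite rho_0 ?mul0r// => bz; apply: nx => i.
    have := bz i; have := zM i; rewrite !mxE.
    have : k.+1%:R^-1 <= 1 :> R by rewrite invf_le1// ler1n.
    move: (k.+1%:R^-1 : R) => e; have := ler_normB (z 0 i) (z 0 i - x 0 i).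
    by rewrite (_ : z 0 i - (z 0 i - x 0 i) = x 0 i); [lra|ring].
  by under eq_Rintegral do rewrite H; rewrite -[RHS](@inner0l R n (fun=> 0)) /inner; apply: eq_Rintegral => z _; rewrite mulr0.
split => //; split; first exact: moll_smooth.
by exists (box (M + 1)); split => //; exact: box_compact.
Qed.

Lemma moll_close k g (x : V) (e : R) : L2 g -> (forall y, box (k.+1%:R^-1) y -> `|g (y + x) - g x| <= e) ->
  `|moll k g x - g x| <= e.
Proof.
move=> Lg He; have Lr := tf_L2 (tf_rho k); have ir := tf_intg (tf_rho k).
rewrite /moll convE//.
have ig := conv_intg' x Lr Lg.
have -> : g x = \int[mu]_y (g x * rho k y) by rewrite RintZ// rho_int mulr1.
rewrite -RintB//; last exact: intgZ.
apply: le_trans (Rint_norm (intgB ig (intgZ _ ir))) _.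
apply: (@le_trans _ _ (\int[mu]_y (e * rho k y))).
  apply: Rint_le => [||y].
  - by apply: intg_norm; apply: intgB => //; exact: intgZ.
  - exact: intgZ.
  have [yB|yB] := pselect (box (k.+1%:R^-1) y); last by rewrite rho_0// !mulr0 mul0r subr0 normr0.
  rewrite [g x * _]mulrC -mulrBr normrM (ger0_norm (rho_ge0 k y)) mulrC.
  by apply: ler_wpM2r; [exact: rho_ge0|exact: He].
by rewrite RintZ// rho_int mulr1.
Qed.

Lemma moll_cvg_tf g : test_function setT g ->
  inner (fun x => moll k g x - g x) (fun x => moll k g x - g x) @[k --> \oo] --> (0 : R).
Proof.
move=> tg; have Lg := tf_L2 tg; have [C C0 gC] := tf_bounded tg.
case: (tg) => sg [K [cK _ g0]]; have [M KM] := compact_box cK.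
have g0' x : ~ box M x -> g x = 0 by move=> nx; apply: g0 => /KM.
have [L L0 HL] := tf_lip tg.
have mm k : measurable_fun setT (moll k g).
  by apply: continuous_measurable_rV; apply: smooth_cont; exact: moll_smooth.
have cl k x : `|moll k g x - g x| <= L * k.+1%:R^-1 by apply: moll_close => // y; exact: HL.
have pc x : moll k g x @[k --> \oo] --> g x.
  apply/cvgrPdist_le => e e0; near=> k.
  rewrite distrC; apply: le_trans (cl k x) _.
  have : L / e <= k.+1%:R.
    apply: (@le_trans _ _ k%:R); last by rewrite ler_nat.
    by near: k; exact: nbhs_infty_ger.
  by rewrite ler_pdivrMr// ler_pdivrMr// mulrC.
have bd k x : `|moll k g x| <= (C + L) * \1_(box (M + 1)) x.
  rewrite indicE; have [xB|xB] := pselect (box (M + 1) x); last first.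
    by rewrite (moll_tf k Lg g0').2// normr0 memNset// mulr0.
  rewrite mem_set// mulr1; have := cl k x; have := gC x.
  have : L * k.+1%:R^-1 <= L.
    by rewrite -[leRHS]mulr1; apply: ler_wpM2l => //; rewrite invf_le1// ler1n.
  have := ler_normD (moll k g x - g x) (g x); rewrite subrK.
  by move: (L * _) => c; lra.
by have [] := L2_dct mm pc (L2Z (C + L) (L2_box (M + 1))) bd.
Unshelve. all: by end_near. Qed.

(** Uniform boundedness reduces strong convergence to the dense class of test functions. *)
Lemma op_cvg0 (T : nat -> (V -> R) -> V -> R) (K : R) :
  (forall k f, L2 f -> L2 (T k f)) ->
  (forall k f g x, L2 f -> L2 g -> T k (fun x => f x - g x) x = T k f x - T k g x) ->
  (forall k f, L2 f -> inner (T k f) (T k f) <= K * inner f f) ->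
  (forall f, test_function setT f -> inner (T k f) (T k f) @[k --> \oo] --> (0 : R)) ->
  forall f, L2 f -> inner (T k f) (T k f) @[k --> \oo] --> (0 : R).
Proof.
move=> LT TB TK Tt f Lf; apply/cvgrPdist_lt => e e0.
have K0 : 0 < `|K| + 1 by rewrite ltr_wpDl.
have e' : 0 < e / 4 / (`|K| + 1) by rewrite !divr_gt0.
have [phi tp Hp] := L2_tf_dense Lf e'; have Lp := tf_L2 tp.
have := Tt phi tp => /cvgrPdist_lt/(_ (e / 4)); rewrite divr_gt0// => /(_ isT).
apply: filterS => k; rewrite !sub0r !normrN !ger0_norm ?inner_ge0// => Hk.
have := inner_add_le (LT k _ (L2B Lf Lp)) (LT k _ Lp).
rewrite (_ : (fun x => _ + _) = T k f); last by apply/funext => x; rewrite TB// subrK.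
move=> H; apply: le_lt_trans H _; have := TK k _ (L2B Lf Lp).
have I0 := inner_ge0 (fun x => f x - phi x).
have : (`|K| + 1) * inner (fun x => f x - phi x) (fun x => f x - phi x) < e / 4.
  by rewrite mulrC -ltr_pdivlMr.
move: I0; set I := inner _ _ => I0; have := ler_norm K; nra.
Qed.

Lemma moll_cvg g : L2 g ->
  inner (fun x => moll k g x - g x) (fun x => moll k g x - g x) @[k --> \oo] --> (0 : R).
Proof.
apply: (@op_cvg0 (fun k g x => moll k g x - g x) 4) => [k f Lf|k f h x Lf Lh|k f Lf|].
- by apply: L2B => //; exact: moll_L2.
- by rewrite mollB//; ring.
- have := inner_add_le (moll_L2 k Lf) (L2N Lf); rewrite innerNl ?(innerC _ (fun x => - f x)) ?innerNl//; try exact: L2N.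
  by have := moll_le k Lf; lra.
- exact: moll_cvg_tf.
Qed.

Lemma moll_partial k i w G x : L2 w -> L2 G -> weak_partial i w G ->
  partial i (moll k w) x = moll k G x /\ conv (partial i (rho k)) w x = - moll k G x.
Proof.
move=> Lw LG wG; have [_ E] := conv_partial i x (tf_rho k) Lw.
have H : conv (partial i (rho k)) w x = - moll k G x.
  rewrite /moll /conv; have := wG _ (tf_shift x (tf_rho k)); rewrite /inner => h.
  have e1 : \int[mu]_z (partial i (rho k) (z - x) * w z) = \int[mu]_z (w z * partial i (fun z => rho k (z - x)) z).
    by apply: eq_Rintegral => z _; rewrite (partial_shift _ _ _ (tf_smooth (tf_rho k))) mulrC.
  by rewrite e1 h; congr (- _); apply: eq_Rintegral => z _; exact: mulrC.
by split => //; rewrite /moll E H opprK.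
Qed.

Lemma weak_partial_tf i g : test_function setT g -> weak_partial i g (partial i g).
Proof.
move=> tg phi tp; have := ibp i (tf_smooth tg) tp; rewrite /inner => ->.
by rewrite opprK.
Qed.

Lemma weak_partial_smooth i g phi : smooth g -> test_function setT phi ->
  inner g (partial i phi) = - inner (partial i g) phi.
Proof. by move=> sg tp; have := ibp i sg tp; rewrite /inner => ->; rewrite opprK. Qed.

Lemma partialM_tf i a g x : smooth a -> smooth g ->
  partial i (fun x => a x * g x) x = a x * partial i g x + g x * partial i a x.
Proof. by move=> sa sg; exact: (partialM (@smooth_der _ _ _ i x sa) (@smooth_der _ _ _ i x sg)). Qed.

Lemma tf_bM O a g : test_function O a -> L2 g -> L2 (fun x => a x * g x).
Proof.
move=> ta Lg; have [C C0 aC] := tf_bounded ta.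
by apply: L2_bM aC Lg; apply: continuous_measurable_rV; exact: tf_cont ta.
Qed.

(** The commutator of the mollifier with the operator that sends g to the i-th derivative of a g,
    that is D_i(a moll_k g) - D_i moll_k(a g), with all derivatives on the kernel or on a so that it
    makes sense for g in L^2. *)
Definition comm (i : 'I_n) a k g x : R :=
  partial i a x * moll k g x - a x * conv (partial i (rho k)) g x
  + conv (partial i (rho k)) (fun z => a z * g z) x.

(** Friedrichs' lemma. On the support of the kernel a(x + y) - a(x) is O(1/(k+1)), which compensates
    the L^1 norm O(k+1) of the gradient of the kernel: the commutators are bounded on L^2 uniformly
    in k. On test functions the derivative moves to g and the commutator is a combination of
    mollification errors. *)
Lemma friedrichs_cvg i a g : test_function setT a -> L2 g ->
  inner (comm i a k g) (comm i a k g) @[k --> \oo] --> (0 : R).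
Proof.
move=> ta; have [L L0 HL] := tf_lip ta; have tpa := tf_partial i ta.
have [Ca Ca0 HCa] := tf_bounded tpa; have [C C0 HC] := rho_partial.
have tr k := tf_partial i (tf_rho k); have Lr k := tf_L2 (tr k).
have [Cb Cb0 HCb] := tf_bounded ta.
pose T2 k g x := a x * conv (partial i (rho k)) g x - conv (partial i (rho k)) (fun z => a z * g z) x.
have T2L k f : L2 f -> L2 (T2 k f) /\ inner (T2 k f) (T2 k f) <= (L * C) ^+ 2 * inner f f.
  move=> Lf; have Laf := tf_bM ta Lf.
  have LT2 : L2 (T2 k f).
    apply: L2B; first by apply: (tf_bM ta); have [] := conv_L2 (tf_kern (tr k)) Lf.
    by have [] := conv_L2 (tf_kern (tr k)) Laf.
  split => //; set c := k.+1%:R : R; have c0 : 0 < c by rewrite /c.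
  pose h y := `|partial i (rho k) y|; have kh : kern h := kern_norm (tf_kern (tr k)).
  have [Lc bc] := conv_L2 kh (L2_norm Lf).
  have le x : `|T2 k f x| <= L / c * conv h (fun z => `|f z|) x.
    rewrite /T2 !convE// ?(L2_norm Lf)//; last exact: kern_L2.
    have i1 := conv_intg' x (Lr k) Lf; have i2 := conv_intg' x (Lr k) Laf.
    have i3 := conv_intg' x (kern_L2 kh) (L2_norm Lf).
    rewrite -RintZ// -RintB//; last exact: intgZ.
    apply: le_trans (Rint_norm _) _; first by apply: intgB => //; exact: intgZ.
    rewrite -RintZ//; apply: Rint_le; [by apply: intg_norm; apply: intgB => //; exact: intgZ|exact: intgZ|].
    move=> y; have [yB|yB] := pselect (box (c^-1) y); last first.
      have p0 : partial i (rho k) y = 0.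
        have cb : closed (box (c^-1) : set V) by apply: compact_closed_rV; exact: box_compact.
        by rewrite (@partial_vanish _ _ _ _ i cb (@rho_0 k) _ yB).
      by rewrite /h p0 !mul0r mulr0 subr0 normr0 mul0r mulr0.
    rewrite [leLHS](_ : _ = `|a (y + x) - a x| * (h y * `|f (y + x)|)); last first.
      by rewrite /h -!normrM -normrN; congr (`|_|); ring.
    by apply: ler_wpM2r; [rewrite mulr_ge0 ?normr_ge0|exact: HL].
  apply: (@le_trans _ _ ((L / c) ^+ 2 * inner (conv h (fun z => `|f z|)) (conv h (fun z => `|f z|)))).
    rewrite !inner_sqr -RintZ; last exact: L2_intg_sqr.
    apply: Rint_le => [||x]; [exact: L2_intg_sqr|by apply: intgZ; exact: L2_intg_sqr|].
    rewrite -exprMn -real_normK ?num_real// ler_sqr ?nnegrE//; last by apply: le_trans (le x).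
  have hC : \int[mu]_y `|h y| <= C * c.
    by rewrite (_ : \int[mu]_y `|h y| = \int[mu]_y `|partial i (rho k) y|) ?HC//; apply: eq_Rintegral => y _; rewrite normr_id.
  have h0 : 0 <= \int[mu]_y `|h y| by apply: Rint_ge0.
  have E : inner (fun z => `|f z|) (fun z => `|f z|) = inner f f.
    by rewrite !inner_sqr; apply: eq_Rintegral => z _; rewrite real_normK ?num_real.
  rewrite E in bc.
  apply: (@le_trans _ _ ((L / c) ^+ 2 * ((C * c) ^+ 2 * inner f f))).
    apply: ler_wpM2l; first exact: sqr_ge0.
    apply: le_trans bc _; apply: ler_wpM2r; first exact: inner_ge0.
    by rewrite ler_sqr ?nnegrE//; exact: le_trans hC.
  by rewrite mulrA -exprMn (_ : L / c * (C * c) = L * C) //; field; rewrite gt_eqF.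
have commE k f : comm i a k f = fun x => partial i a x * moll k f x + - T2 k f x.
  by apply/funext => x; rewrite /comm /T2; ring.
have LT1 k f : L2 f -> L2 (fun x => partial i a x * moll k f x).
  by move=> Lf; apply: (tf_bM tpa); exact: moll_L2.
apply: (@op_cvg0 (comm i a) (2 * Ca ^+ 2 + 2 * (L * C) ^+ 2)) => [k f Lf|k f h x Lf Lh|k f Lf|phi tphi].
- by rewrite commE; apply: L2D; [exact: LT1|apply: L2N; have [] := T2L k f Lf].
- rewrite /comm mollB// convBr// (_ : (fun z => a z * (f z - h z)) = fun z => a z * f z - a z * h z); last first.
    by apply/funext => z; rewrite mulrBr.
  by rewrite convBr//; [ring|exact: (tf_bM ta)|exact: (tf_bM ta)].
- rewrite commE; have [LT2 b2] := T2L k f Lf; apply: le_trans (inner_add_le (LT1 k f Lf) (L2N LT2)) _.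
  rewrite innerNl ?(innerC _ (fun x => - T2 k f x)) ?innerNl//; try exact: L2N.
  rewrite opprK.
  suff : inner (fun x => partial i a x * moll k f x) (fun x => partial i a x * moll k f x) <= Ca ^+ 2 * inner f f by lra.
  apply: (@le_trans _ _ (Ca ^+ 2 * inner (moll k f) (moll k f))); last first.
    by apply: ler_wpM2l; [exact: sqr_ge0|exact: moll_le].
  rewrite !inner_sqr -RintZ; last exact: L2_intg_sqr (moll_L2 k Lf).
  apply: Rint_le => [||x]; [exact: L2_intg_sqr (LT1 k f Lf)|by apply: intgZ; exact: L2_intg_sqr (moll_L2 k Lf)|].
  rewrite exprMn; apply: ler_wpM2r; first exact: sqr_ge0.
  by rewrite -real_normK ?num_real// ler_sqr ?nnegrE.
- have tp := tf_partial i tphi; have tap := tf_Ml (tf_smooth ta) tphi; have tpap := tf_partial i tap.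
  have Lphi := tf_L2 tphi; have Lp := tf_L2 tp; have Lpap := tf_L2 tpap; have Lap := tf_L2 tap.
  pose D (f : V -> R) k x := moll k f x - f x.
  have E k : comm i a k phi = fun x => (partial i a x * D phi k x + a x * D (partial i phi) k x) + - D (partial i (fun x => a x * phi x)) k x.
    apply/funext => x; rewrite /comm /D.
    have [_ ->] := moll_partial k x Lphi Lp (weak_partial_tf i tphi).
    have [_ ->] := moll_partial k x Lap Lpap (weak_partial_tf i tap).
    move: (moll k (partial i (fun x => a x * phi x)) x) => Z.
    rewrite (partialM_tf i x (tf_smooth ta) (tf_smooth tphi)).
    move: (moll k phi x) (moll k (partial i phi) x) (partial i a x) (partial i phi x) (a x) (phi x).
    by clear; move=> m1 m2 m3 m4 m5 m6; ring.
  have cD f : L2 f -> inner (D f k) (D f k) @[k --> \oo] --> (0 : R) by exact: moll_cvg.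
  have LD f k : L2 f -> L2 (D f k) by move=> Lf; apply: L2B => //; exact: moll_L2.
  have bM b Cx f k : test_function setT b -> (forall x, `|b x| <= Cx) -> L2 f ->
     inner (fun x => b x * D f k x) (fun x => b x * D f k x) <= Cx ^+ 2 * inner (D f k) (D f k).
    move=> tb bC Lf; rewrite !inner_sqr -RintZ; last exact: L2_intg_sqr (LD f k Lf).
    apply: Rint_le => [||x]; [exact: L2_intg_sqr (tf_bM tb (LD f k Lf))|by apply: intgZ; exact: L2_intg_sqr (LD f k Lf)|].
    rewrite exprMn; apply: ler_wpM2r; first exact: sqr_ge0.
    by rewrite -real_normK ?num_real// ler_sqr ?nnegrE// (le_trans _ (bC x)).
  have up k : 0 <= inner (comm i a k phi) (comm i a k phi) <=
      4 * Ca ^+ 2 * inner (D phi k) (D phi k) + 4 * Cb ^+ 2 * inner (D (partial i phi) k) (D (partial i phi) k)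
      + 2 * inner (D (partial i (fun x => a x * phi x)) k) (D (partial i (fun x => a x * phi x)) k).
    rewrite inner_ge0 E/=.
    have L1 := tf_bM tpa (LD phi k Lphi); have L2' := tf_bM ta (LD _ k Lp).
    apply: le_trans (inner_add_le (L2D L1 L2') (L2N (LD _ k Lpap))) _.
    rewrite innerNl ?(innerC _ (fun x => - D _ k x)) ?innerNl ?opprK//; try exact: L2N; try exact: LD; try exact: (L2N (LD _ k Lpap)).
    apply: lerD => //; have := inner_add_le L1 L2'.
    by have := bM _ _ phi k tpa HCa Lphi; have := bM _ _ (partial i phi) k ta HCb Lp; lra.
  apply: (squeeze_cvgr (nearW _ up)); first exact: cvg_cst.
  rewrite -[X in _ --> X](_ : 4 * Ca ^+ 2 * 0 + 4 * Cb ^+ 2 * 0 + 2 * 0 = 0 :> R); last by ring.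
  by apply: cvgD; [apply: cvgD|]; apply: cvgM; (exact: cvg_cst || exact: cD).
Qed.

End mollifier.

(** * The divergence-form operator *)

Section L2_limits.
Context {R : realType} {n : nat}.
Local Notation V := 'rV[R]_n.
Implicit Types (f g h : V -> R) (G H : 'I_n -> V -> R).

Lemma inner_sumr I (s : seq I) (F : I -> V -> R) h : (forall i, L2 (F i)) -> L2 h ->
  inner h (fun x => \sum_(i <- s) F i x) = \sum_(i <- s) inner h (F i).
Proof.
move=> LF Lh; rewrite innerC inner_suml//; apply: eq_bigr => i _; exact: innerC.
Qed.

Lemma inner_subE f g : L2 f -> L2 g ->
  inner (fun x => f x - g x) (fun x => f x - g x) = inner f f - 2 * inner f g + inner g g.
Proof.
by move=> Lf Lg; rewrite innerBl ?innerBr//; [rewrite (innerC g f); ring|exact: L2B].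
Qed.

Lemma test_ext f g : L2 f -> L2 g -> (forall phi, test_function setT phi -> inner f phi = inner g phi) ->
  {ae mu, forall x, f x = g x}.
Proof.
move=> Lf Lg H.
have LB := L2B Lf Lg.
suff : inner (fun x => f x - g x) (fun x => f x - g x) = 0.
  by move/(inner_eq0 LB); apply: filterS => x /eqP; rewrite subr_eq0 => /eqP.
apply/eqP; rewrite eq_le inner_ge0 andbT leNgt; apply/negP => I0.
have [phi tp Hp] := L2_tf_dense LB I0; have Lp := tf_L2 tp.
have z : inner (fun x => f x - g x) phi = 0 by rewrite innerBl// H// subrr.
by move: Hp; rewrite inner_subE// z; have := inner_ge0 phi; lra.
Qed.

Lemma L2cvg_moll f : L2 f -> L2cvg (fun k => moll k f) f.
Proof. by move=> Lf; split => //; [move=> k; exact: moll_L2|exact: moll_cvg]. Qed.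

Lemma L2cvg_dct (f_ : nat -> V -> R) f g : (forall k, measurable_fun setT (f_ k)) ->
  (forall x, f_ k x @[k --> \oo] --> f x) -> L2 g -> (forall k x, `|f_ k x| <= g x) ->
  L2cvg f_ f.
Proof.
move=> mf cf Lg bd; have [Lf H] := L2_dct mf cf Lg bd; split => // k.
exact: (L2_le (mf k) (bd k) Lg).
Qed.

Lemma L2cvg_innerr (f_ : nat -> V -> R) f g :
  L2cvg f_ f -> L2 g -> inner g (f_ k) @[k --> \oo] --> inner g f.
Proof.
by move=> c Lg; rewrite innerC; under eq_fun do rewrite innerC; exact: L2cvg_inner.
Qed.

Definition grad w G := L2 w /\ forall i, L2 (G i) /\ weak_partial i w (G i).

Lemma gradB w G v H : grad w G -> grad v H -> grad (fun x => w x - v x) (fun i x => G i x - H i x).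
Proof.
move=> [Lw hG] [Lv hH]; split; first exact: L2B.
move=> i; have [LG wG] := hG i; have [LH wH] := hH i; split; first exact: L2B.
move=> phi tp; have Lp := tf_L2 tp; have Lpp := tf_L2 (tf_partial i tp).
by rewrite !innerBl// wG// wH//; ring.
Qed.

(** Smooth multipliers of H^1, used as cutoffs and exponential weights. *)
Definition cbd (g : V -> R) := smooth g /\ (exists C : R, forall x, `|g x| <= C) /\
  forall i, exists C : R, forall x, `|partial i g x| <= C.

Lemma tf_cbd O g : test_function O g -> cbd g.
Proof.
move=> tg; split; first exact: tf_smooth tg.
split; first by have [C _ HC] := tf_bounded tg; exists C.
by move=> i; have [C _ HC] := tf_bounded (tf_partial i tg); exists C.
Qed.

Lemma smooth_bM g f (C : R) : smooth g -> (forall x, `|g x| <= C) -> L2 f -> L2 (fun x => g x * f x).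
Proof.
by move=> sg gC Lf; apply: L2_bM gC Lf; apply: continuous_measurable_rV; exact: smooth_cont.
Qed.

Lemma gradM g w G : cbd g -> grad w G ->
  grad (fun x => g x * w x) (fun i x => g x * G i x + partial i g x * w x).
Proof.
move=> [sg [[C gC] hp]] [Lw hG]; split; first exact: smooth_bM gC Lw.
move=> i; have [LG wG] := hG i; have [Cp pC] := hp i.
have L1 := smooth_bM sg gC LG; have L2' := smooth_bM (smooth_partial i sg) pC Lw.
split; first exact: L2D.
move=> phi tp; have Lp := tf_L2 tp; have Lpp := tf_L2 (tf_partial i tp).
rewrite innerDl//.
have tgp := tf_Ml sg tp.
have := wG _ tgp.
have E : partial i (fun x => g x * phi x) = fun x => g x * partial i phi x + partial i g x * phi x.
  by apply/funext => x; rewrite partialM_tf//; [congr (_ + _); exact: mulrC|exact: tf_smooth tp].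
have t1 := tf_Ml sg (tf_partial i tp); have t2 := tf_Ml (smooth_partial i sg) tp.
rewrite E innerDr//; try exact: tf_L2 t1; try exact: tf_L2 t2.
have -> : inner w (fun x => g x * partial i phi x) = inner (fun x => g x * w x) (partial i phi).
  by apply: eq_Rintegral => x _; ring.
have -> : inner w (fun x => partial i g x * phi x) = inner (fun x => partial i g x * w x) phi.
  by apply: eq_Rintegral => x _; ring.
have -> : inner (G i) (fun x => g x * phi x) = inner (fun x => g x * G i x) phi.
  by apply: eq_Rintegral => x _; ring.
by lra.
Qed.

(** Cutoffs at scale m+1: they tend to 1 while their gradients are O(1/(m+1)). *)
Definition chi (m : nat) (x : V) : R := beta (m.+1%:R^-1 *: x).

Lemma tf_chi m : test_function setT (chi m).
Proof.
split.
  have := smooth_affine (m.+1%:R^-1) 0 (tf_smooth (@tf_beta R n)).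
  by under eq_fun do rewrite addr0.
exists (box m.+1%:R); split => //; first exact: box_compact.
move=> x nx; apply: beta0 => H; apply: nx => i; have := H i.
by rewrite mxE normrM ger0_norm// mulrC ler_pdivrMr// mul1r.
Qed.

Lemma chi_01 m x : `|chi m x| <= 1.
Proof. by have /andP[h0 h1] := beta_01 (m.+1%:R^-1 *: x); rewrite /chi ger0_norm. Qed.

Lemma chi_cvg x : chi m x @[m --> \oo] --> (1 : R).
Proof.
apply: cvg_near_cst; near=> m; apply: beta1 => i.
rewrite mxE normrM ger0_norm// mulrC ler_pdivrMr//.
apply: le_trans (coord_le_norm x i) _.
have : 2 * `|x| <= m.+1%:R; last by lra.
apply: (@le_trans _ _ m%:R); last by rewrite ler_nat.
by near: m; exact: nbhs_infty_ger.
Unshelve. all: by end_near. Qed.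

Lemma chi_partial i : exists2 C : R, 0 <= C & forall m x, `|partial i (chi m) x| <= C * m.+1%:R^-1.
Proof.
have [C C0 HC] := tf_bounded (tf_partial i (@tf_beta R n)); exists C => // m x.
have [_] := @affine_partial R n beta (m.+1%:R^-1) 0 i (fun x => @smooth_der _ _ _ i x (tf_smooth (@tf_beta R n))) x.
rewrite addr0 (_ : (fun z => _) = chi m); last by apply/funext => z; rewrite addr0.
by move=> ->; rewrite normrM ger0_norm// mulrC; apply: ler_wpM2r.
Qed.

Lemma chi_L2cvg f : L2 f -> L2cvg (fun m x => chi m x * f x) f.
Proof.
move=> Lf; apply: L2cvg_dct (L2_norm Lf) _ => [m|x|m x].
- apply: measurable_funM; last exact: L2_meas.
  by apply: continuous_measurable_rV; exact: tf_cont (tf_chi m).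
- by rewrite -[X in _ --> X]mul1r; apply: cvgM; [exact: chi_cvg|exact: cvg_cst].
- by rewrite normrM -[leRHS]mul1r; apply: ler_wpM2r => //; exact: chi_01.
Qed.

Lemma chi_grad_L2cvg i w f : L2 f -> L2 w -> L2cvg (fun m x => chi m x * f x + partial i (chi m) x * w x) f.
Proof.
move=> Lf Lw; have [C C0 HC] := chi_partial i.
apply: (@L2cvg_dct _ _ (fun x => `|f x| + C * `|w x|)) => [m|x||m x].
- apply: measurable_funD; apply: measurable_funM; try exact: L2_meas;
    apply: continuous_measurable_rV; [exact: tf_cont (tf_chi m)|exact: tf_cont (tf_partial i (tf_chi m))].
- rewrite -[X in _ --> X]addr0 -[X in _ --> X + _]mul1r -[X in _ --> _ + X](mul0r (w x)).
  apply: cvgD; apply: cvgM; [exact: chi_cvg|exact: cvg_cst| |exact: cvg_cst].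
  apply: norm_cvg0; apply: (@squeeze_cvgr _ _ _ _ (cst 0) (fun m : nat => C * m.+1%:R^-1)).
  + by apply: nearW => m; rewrite normr_ge0 HC.
  + exact: cvg_cst.
  + by rewrite -[X in _ --> X](mulr0 C); apply: cvgM; [exact: cvg_cst|exact: cvg_harmonic].
- by apply: L2D; [exact: L2_norm|apply: L2Z; exact: L2_norm].
- apply: le_trans (ler_normD _ _) _; rewrite !normrM; apply: lerD.
    by rewrite -[leRHS]mul1r; apply: ler_wpM2r => //; exact: chi_01.
  apply: ler_wpM2r => //; apply: le_trans (HC m x) _.
  by rewrite -[leRHS]mulr1; apply: ler_wpM2l => //; rewrite invf_le1// ler1n.
Qed.

End L2_limits.

Definition bounded_entries {R : realType} {n : nat} (A : 'rV[R]_n -> 'M[R]_n) :=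
  exists M : R, forall x i j, `|A x i j| <= M.

Definition smooth_entries {R : realType} {n : nat} (A : 'rV[R]_n -> 'M[R]_n) :=
  forall i j, smooth (fun x => A x i j).

Definition elliptic {R : realType} {n : nat} (A : 'rV[R]_n -> 'M[R]_n) (Lambda : R) :=
  forall x xi : 'rV[R]_n, Lambda^-1 * sqnorm xi
    <= \sum_(i < n) \sum_(j < n) A x i j * xi 0 i * xi 0 j <= Lambda * sqnorm xi.

Section div_form.
Context {R : realType} {n : nat}.
Local Notation V := 'rV[R]_n.
Implicit Types (f g h k u v w : V -> R) (G H : 'I_n -> V -> R).
Variable A : V -> 'M[R]_n.
Hypothesis Abd : bounded_entries A.
Hypothesis Asm : smooth_entries A.

Definition flux G i x : R := \sum_(j < n) A x i j * G j x.
Definition aform G H : R := \sum_(i < n) inner (flux G i) (H i).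

Lemma L2_AG G i j : L2 (G j) -> L2 (fun x => A x i j * G j x).
Proof. by move=> LG; have [M HM] := Abd; exact: (smooth_bM (Asm i j) (fun x => HM x i j) LG). Qed.

Lemma L2_flux G i : (forall j, L2 (G j)) -> L2 (flux G i).
Proof. by move=> LG; apply: L2_sum => j; exact: L2_AG. Qed.

Lemma aformE G H : (forall i, L2 (G i)) -> (forall i, L2 (H i)) ->
  \int[mu]_x (\sum_(i < n) \sum_(j < n) A x i j * G j x * H i x) = aform G H.
Proof.
move=> LG LH; rewrite /aform /inner -Rint_sum.
  by apply: eq_Rintegral => x _; apply: eq_bigr => i _; rewrite /flux mulr_suml.
by move=> i; apply: L2M => //; exact: L2_flux.
Qed.

Lemma aform_intg G H : (forall i, L2 (G i)) -> (forall i, L2 (H i)) ->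
  intg mu (fun x => \sum_(i < n) \sum_(j < n) A x i j * G j x * H i x).
Proof.
move=> LG LH; apply: intg_sum => i; apply: intg_sum => j; apply: L2M => //; exact: L2_AG.
Qed.

Definition wdiv G k := forall phi, test_function setT phi -> aform G (fun i => partial i phi) = inner k phi.

Lemma div_opE w k : div_op A w k <-> L2 k /\ exists G, grad w G /\ wdiv G k.
Proof.
split=> [[Lw Lk [G [hG hk]]]|[Lk [G [[Lw hG] hk]]]].
  split => //; exists G; split => // phi tp; rewrite -hk// aformE// => i; first by have [] := hG i.
  exact: tf_L2 (tf_partial i tp).
split=> //; exists G; split => // phi tp; rewrite -hk// aformE// => i; first by have [] := hG i.
exact: tf_L2 (tf_partial i tp).
Qed.

Lemma cvg_sum (I : Type) (s : seq I) (u : nat -> I -> R) (l : I -> R) :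
  (forall i, u m i @[m --> \oo] --> l i) -> \sum_(i <- s) u m i @[m --> \oo] --> \sum_(i <- s) l i.
Proof.
move=> H; elim: s => [|i s IH].
  by under eq_fun do rewrite big_nil; rewrite big_nil; exact: cvg_cst.
by under eq_fun do rewrite big_cons; rewrite big_cons; exact: cvgD.
Qed.

Lemma aform_cvg G (H_ : nat -> 'I_n -> V -> R) H : (forall i, L2 (G i)) ->
  (forall i, L2cvg (fun m => H_ m i) (H i)) -> aform G (H_ m) @[m --> \oo] --> aform G H.
Proof.
by move=> LG cH; apply: cvg_sum => i; apply: (L2cvg_innerr (cH i)); exact: L2_flux.
Qed.

Lemma wdiv_box G k v H M : (forall i, L2 (G i)) -> L2 k -> wdiv G k -> grad v H ->
  (forall x, ~ box M x -> v x = 0) -> aform G H = inner k v.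
Proof.
move=> LG Lk dG [Lv hH] v0.
have c1 : aform G (fun i => moll m (H i)) @[m --> \oo] --> aform G H.
  by apply: aform_cvg => // i; apply: L2cvg_moll; have [] := hH i.
have c2 : aform G (fun i => moll m (H i)) @[m --> \oo] --> inner k v.
  have := L2cvg_innerr (L2cvg_moll Lv) Lk; apply: cvg_trans; apply: near_eq_cvg; near=> m.
  have [tm _] := moll_tf m Lv v0; rewrite -(dG _ tm); congr aform.
  apply/funext => i; apply/funext => x; have [LH wH] := hH i.
  by have [-> _] := moll_partial m x Lv LH wH.
exact: (cvg_unique (@Rhausdorff R) c1 c2).
Unshelve. all: by end_near. Qed.

Lemma chi_out m (x : V) : ~ box m.+1%:R x -> chi m x = 0.
Proof.
move=> nx; apply: beta0 => H; apply: nx => i; have := H i.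
by rewrite mxE normrM ger0_norm// mulrC ler_pdivrMr// mul1r.
Qed.

(** Test functions are dense in H^1: mollification settles compactly supported v, in [wdiv_box], and
    the cutoffs [chi] the rest. The weak equation may thus be tested with the solution itself. *)
Lemma wdiv_grad G k v H : (forall i, L2 (G i)) -> L2 k -> wdiv G k -> grad v H -> aform G H = inner k v.
Proof.
move=> LG Lk dG gH; have [Lv hH] := gH.
pose H_ m i x := chi m x * H i x + partial i (chi m) x * v x.
have c1 : aform G (H_ m) @[m --> \oo] --> aform G H.
  by apply: aform_cvg => // i; apply: chi_grad_L2cvg => //; have [] := hH i.
have c2 : aform G (H_ m) @[m --> \oo] --> inner k v.
  have := L2cvg_innerr (chi_L2cvg Lv) Lk; apply: cvg_trans; apply: near_eq_cvg; near=> m.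
  have gm := gradM (tf_cbd (tf_chi m)) gH.
  by rewrite (wdiv_box LG Lk dG gm (M := m.+1%:R))// => x /chi_out ->; rewrite mul0r.
exact: (cvg_unique (@Rhausdorff R) c1 c2).
Unshelve. all: by end_near. Qed.

Lemma flux_sub G H i x : flux (fun i x => G i x - H i x) i x = flux G i x - flux H i x.
Proof. by rewrite /flux -sumrB; apply: eq_bigr => j _; rewrite mulrBr. Qed.

Lemma div_op_L2 f k : div_op A f k -> L2 f /\ L2 k. Proof. by case. Qed.

Lemma div_op_sub f k f' k' : div_op A f k -> div_op A f' k' ->
  div_op A (fun x => f x - f' x) (fun x => k x - k' x).
Proof.
move=> /div_opE[Lk [G [gG dG]]] /div_opE[Lk' [G' [gG' dG']]]; apply/div_opE.
split; first exact: L2B.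
exists (fun i x => G i x - G' i x); split; first exact: gradB.
move=> phi tp; have Lp := tf_L2 tp; rewrite innerBl// -dG// -dG'// /aform -sumrB.
have LG i : L2 (G i) by case: gG => _ /(_ i)[].
have LG' i : L2 (G' i) by case: gG' => _ /(_ i)[].
apply: eq_bigr => i _; rewrite -innerBl; [|exact: L2_flux..|exact: tf_L2 (tf_partial i tp)].
by apply: eq_Rintegral => x _; rewrite flux_sub.
Qed.

Variable Lambda : R.
Hypothesis L0 : 0 < Lambda.
Hypothesis Asym : forall x, (A x)^T = A x.
Hypothesis Aell : elliptic A Lambda.

Lemma A_sym x i j : A x i j = A x j i.
Proof. by rewrite -[in RHS](Asym x) mxE. Qed.

Lemma A_ell x (xi : 'I_n -> R) :
  Lambda^-1 * (\sum_(i < n) xi i ^+ 2) <= \sum_(i < n) \sum_(j < n) A x i j * xi j * xi i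
    <= Lambda * (\sum_(i < n) xi i ^+ 2).
Proof.
have := Aell x (\row_i xi i).
have -> : sqnorm (\row_i xi i : V) = \sum_(i < n) xi i ^+ 2 by apply: eq_bigr => i _; rewrite mxE.
have -> // : \sum_(i < n) \sum_(j < n) A x i j * (\row_i xi i : V) 0 i * (\row_i xi i : V) 0 j =
  \sum_(i < n) \sum_(j < n) A x i j * xi j * xi i.
by apply: eq_bigr => i _; apply: eq_bigr => j _; rewrite !mxE mulrAC.
Qed.

Lemma A_ge0 x (xi : 'I_n -> R) : 0 <= \sum_(i < n) \sum_(j < n) A x i j * xi j * xi i.
Proof.
have /andP[h _] := A_ell x xi; apply: le_trans h.
apply: mulr_ge0; first by rewrite invr_ge0 ltW.
by apply: sumr_ge0 => i _; exact: sqr_ge0.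
Qed.

Lemma div_op_ge0 f k : div_op A f k -> 0 <= inner k f.
Proof.
move=> /div_opE[Lk [G [gG dG]]]; have [Lf hG] := gG.
have LG i : L2 (G i) by have [] := hG i.
rewrite -(wdiv_grad LG Lk dG gG) -aformE//; apply: Rint_ge0 => x; exact: A_ge0.
Qed.

Lemma aformC G H : (forall i, L2 (G i)) -> (forall i, L2 (H i)) -> aform G H = aform H G.
Proof.
move=> LG LH; rewrite -!aformE//; apply: eq_Rintegral => x _; rewrite exchange_big/=.
by apply: eq_bigr => i _; apply: eq_bigr => j _; rewrite A_sym mulrAC.
Qed.

Definition Lop phi x : R := - \sum_(i < n) partial i (flux (fun j => partial j phi) i) x.

Lemma smooth_flux phi i : smooth phi -> smooth (flux (fun j => partial j phi) i).
Proof. by move=> sp; apply: smooth_sum => j; apply: smoothM; [exact: Asm|exact: smooth_partial]. Qed.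

Lemma tf_flux O phi i : test_function O phi -> test_function O (flux (fun j => partial j phi) i).
Proof. by move=> tp; apply: tf_sum => j; apply: tf_Ml => //; exact: tf_partial. Qed.

Lemma tf_Lop O phi : test_function O phi -> test_function O (Lop phi).
Proof. by move=> tp; apply: tfN; apply: tf_sum => i; apply: tf_partial; exact: tf_flux. Qed.

Lemma wdiv_tf phi : test_function setT phi -> wdiv (fun j => partial j phi) (Lop phi).
Proof.
move=> tp psi ts; have Ls := tf_L2 ts; have tfl i := tf_flux i tp.
rewrite /Lop innerNl//; last by apply: L2_sum => i; exact: tf_L2 (tf_partial i (tfl i)).
rewrite inner_suml//; last by move=> i; exact: tf_L2 (tf_partial i (tfl i)).
rewrite -sumrN; apply: eq_bigr => i _.
exact: (weak_partial_smooth i (tf_smooth (tfl i)) ts).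
Qed.

Lemma div_op_inner f k phi : div_op A f k -> test_function setT phi -> inner k phi = inner f (Lop phi).
Proof.
move=> /div_opE[Lk [G [gG dG]]] tp; have [Lf hG] := gG.
have LG i : L2 (G i) by have [] := hG i.
have Lp i : L2 (partial i phi) by exact: tf_L2 (tf_partial i tp).
rewrite -(dG _ tp) aformC// (wdiv_grad Lp _ (wdiv_tf tp) gG); first exact: innerC.
exact: tf_L2 (tf_Lop tp).
Qed.

End div_form.

(** * Locality on balls *)

Section locality.
Context {R : realType} {n : nat}.
Local Notation V := 'rV[R]_n.
Implicit Types (f g : V -> R).

(** The parameter r is the square of the radius; the defining function stays smooth and no root
    occurs. *)
Definition eball (x0 : V) (r : R) : set V := [set x | sqnorm (x - x0) < r].

Lemma sqnorm_ge (x : V) i : x 0 i ^+ 2 <= sqnorm x.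
Proof. by rewrite /sqnorm (bigD1 i)//= lerDl sumr_ge0// => j _; exact: sqr_ge0. Qed.

Lemma sqnorm_ge0 (x : V) : 0 <= sqnorm x.
Proof. by apply: sumr_ge0 => i _; exact: sqr_ge0. Qed.

Lemma eball_compact (x0 : V) (c : R) : compact [set x | sqnorm (x - x0) <= c].
Proof.
have cs : continuous (fun x : V => sqnorm (x - x0)) := smooth_cont (@smooth_sqnorm R n x0).
have sb : [set x : V | sqnorm (x - x0) <= c] `<=` box (1 + c + `|x0|).
  move=> x /= xc i; have h1 := le_trans (sqnorm_ge (x - x0) i) xc; rewrite !mxE in h1.
  have h2 := coord_le_norm x0 i; have := ler_normD (x 0 i - x0 0 i) (x0 0 i); rewrite subrK.
  have : `|x 0 i - x0 0 i| <= 1 + c.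
    by move: h1; rewrite -real_normK ?num_real//; move: `|_| (normr_ge0 (x 0 i - x0 0 i)) => a; nra.
  by lra.
have cl : closed [set x : V | sqnorm (x - x0) <= c].
  by apply: (@closed_comp _ _ (fun x : V => sqnorm (x - x0)) [set y | y <= c]) => [x _|]; [exact: cs|exact: closed_le].
by apply: (subclosed_compact cl _ sb); exact: box_compact.
Qed.

Lemma inner_ae0 f g : L2 f -> L2 g -> {ae mu, forall x, f x * g x = 0} -> inner f g = 0.
Proof.
move=> Lf Lg H; rewrite -[RHS](inner0l g); apply: Rint_ae.
- by apply: measurable_funM; exact: L2_meas.
- by apply: measurable_funM; [exact: measurable_cst|exact: L2_meas].
- by apply: filterS H => x ->; rewrite mul0r.
Qed.

Lemma ae_seq (P : nat -> V -> Prop) : (forall m, {ae mu, forall x, P m x}) -> {ae mu, forall x, forall m, P m x}.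
Proof.
move=> H; have : mu.-negligible (\bigcup_m ~` [set x | P m x]) by apply: negligible_bigcup => m; exact: H.
by apply: negligibleS => x /= /existsNP[m nm]; exists m.
Qed.

(** Multiplied by a bump that is positive exactly on a slightly smaller ball, f is orthogonal to all
    test functions, hence null. The smaller balls exhaust the given one. *)
Lemma local_zero x0 r f : L2 f -> (forall phi, test_function (eball x0 r) phi -> inner f phi = 0) ->
  {ae mu, forall x, eball x0 r x -> f x = 0}.
Proof.
move=> Lf H.
pose c (m : nat) := r - m.+1%:R^-1.
pose e m (x : V) := eta1 (c m - sqnorm (x - x0)).
have te m : test_function (eball x0 r) (e m).
  split.
    apply: (@smooth_comp _ _ eta1 (fun x => c m - sqnorm (x - x0))); first exact: eta1_smooth1.
    by apply: smoothB; [exact: smooth_cst|exact: smooth_sqnorm].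
  exists [set x | sqnorm (x - x0) <= c m]; split; first exact: eball_compact.
    by move=> x /=; rewrite /eball /= /c => h; apply: le_lt_trans h _; rewrite gtrBl invr_gt0.
  by move=> x /= /negP; rewrite -ltNge => h; rewrite /e eta1_le0// subr_le0 ltW.
have ae0 m : {ae mu, forall x, e m x * f x = 0}.
  apply: (@test_ext _ _ (fun x => e m x * f x) (fun=> 0)) => //.
  - exact: tf_bM (te m) Lf.
  - exact: L20.
  - move=> phi tp; rewrite inner0l -[RHS](H (fun x => phi x * e m x)).
      by apply: eq_Rintegral => x _; ring.
    by apply: tf_Ml => //; exact: tf_smooth tp.
apply: filterS (ae_seq ae0) => x h xr.
have [m Hm] : exists m : nat, sqnorm (x - x0) < c m.
  have d0 : 0 < r - sqnorm (x - x0) by rewrite subr_gt0.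
  have [m Hm] := cvg_lt_ex (@cvg_harmonic R) d0; exists m; rewrite /c.
  by move: Hm; rewrite /harmonic/=; move: (m.+1%:R^-1) => y; lra.
have := h m; move/eqP; rewrite mulf_eq0 => /orP[|/eqP//].
by rewrite /e gt_eqF// eta1_gt0 subr_gt0.
Qed.

Lemma tf_vanish_ae O phi f : test_function O phi -> {ae mu, forall x, O x -> f x = 0} ->
  {ae mu, forall x, f x * phi x = 0}.
Proof.
move=> [_ [K [_ KO p0]]]; apply: filterS => x h.
have [Kx|/p0 ->] := pselect (K x); last by rewrite mulr0.
by rewrite h ?mul0r//; exact: KO.
Qed.

Lemma grad_local x0 r w G i : grad w G -> {ae mu, forall x, eball x0 r x -> w x = 0} ->
  {ae mu, forall x, eball x0 r x -> G i x = 0}.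
Proof.
move=> [Lw hG] w0; have [LG wG] := hG i; apply: local_zero => // phi tp.
apply: oppr_inj; rewrite -wG ?oppr0; last exact: tf_setT tp.
apply: inner_ae0 => //; first exact: tf_L2 (tf_partial i tp).
exact: tf_vanish_ae (tf_partial i tp) w0.
Qed.

End locality.

Lemma derive1_expR {R : realType} (x : R) : derive1 (@expR R) x = expR x.
Proof. by rewrite derive1E; exact: (@derive_val _ _ _ _ _ _ _ (is_derive_expR x)). Qed.

Lemma smooth1_expR {R : realType} : smooth1 (@expR R).
Proof.
have E k : derive1n k (@expR R) = @expR R.
  elim: k => [//|k IH]; rewrite derive1nS IH; apply/funext => x.
  exact: derive1_expR.
by move=> k x; rewrite E; exact: derivable_expR.
Qed.

(** * Off-diagonal decay and positivity of the heat semigroup *)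

Section combes_thomas.
Context {R : realType} {n : nat}.
Local Notation V := 'rV[R]_n.
Implicit Types (f g k u v w psi : V -> R) (G H : 'I_n -> V -> R).

Lemma smooth_expR f : smooth f -> smooth (fun x => expR (f x)).
Proof. by apply: smooth_comp; exact: smooth1_expR. Qed.

Lemma partial_expR i f x : smooth f -> partial i (fun x => expR (f x)) x = partial i f x * expR (f x).
Proof.
move=> sf; rewrite (partial_comp (h := expR) (@smooth_der _ _ _ i x sf) (@derivable_expR R _)).
by rewrite derive1_expR mulrC.
Qed.

Lemma cbd_exp psi (a : R) : test_function setT psi -> cbd (fun x => expR (a * psi x)).
Proof.
move=> tp; have sap := tf_smooth (tfZ a tp).
have [C C0 HC] := tf_bounded (tfZ a tp).
have eC x : expR (a * psi x) <= expR C by rewrite ler_expR; apply: le_trans (ler_norm _) (HC x).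
split; first exact: smooth_expR.
split; first by exists (expR C) => x; rewrite ger0_norm ?expR_ge0.
move=> i; have [D D0 HD] := tf_bounded (tf_partial i (tfZ a tp)); exists (D * expR C) => x.
by rewrite partial_expR// normrM [X in _ * X]ger0_norm ?expR_ge0//; apply: ler_pM => //; exact: expR_ge0.
Qed.

Variable A : V -> 'M[R]_n.
Hypothesis Abd : bounded_entries A.
Hypothesis Asm : smooth_entries A.
Variable Lambda : R.
Hypothesis L0 : 0 < Lambda.
Hypothesis Asym : forall x, (A x)^T = A x.
Hypothesis Aell : elliptic A Lambda.

Definition qf x (a b : 'I_n -> R) : R := \sum_(i < n) \sum_(j < n) A x i j * a j * b i.

Lemma qfC x a b : qf x a b = qf x b a.
Proof.
rewrite /qf exchange_big/=; apply: eq_bigr => i _; apply: eq_bigr => j _.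
by rewrite (A_sym Asym) mulrAC.
Qed.

Lemma qfDr x a b c : qf x a (fun i => b i + c i) = qf x a b + qf x a c.
Proof. by rewrite /qf -big_split; apply: eq_bigr => i _; rewrite -big_split; apply: eq_bigr => j _; rewrite mulrDr. Qed.

Lemma qfZr x a (t : R) b : qf x a (fun i => t * b i) = t * qf x a b.
Proof. by rewrite /qf mulr_sumr; apply: eq_bigr => i _; rewrite mulr_sumr; apply: eq_bigr => j _; ring. Qed.

Lemma qfDl x a b c : qf x (fun i => b i + c i) a = qf x b a + qf x c a.
Proof. by rewrite qfC qfDr !(qfC x a). Qed.

Lemma qfZl x a (t : R) b : qf x (fun i => t * b i) a = t * qf x b a.
Proof. by rewrite qfC qfZr !(qfC x a). Qed.

Lemma qf_ge0 x a : 0 <= qf x a a.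
Proof. exact: (A_ge0 L0 Aell). Qed.

Lemma qf_ell x a : Lambda^-1 * (\sum_(i < n) a i ^+ 2) <= qf x a a <= Lambda * (\sum_(i < n) a i ^+ 2).
Proof. exact: (A_ell Aell). Qed.

Lemma aform_qf G H : (forall i, L2 (G i)) -> (forall i, L2 (H i)) ->
  aform A G H = \int[mu]_x qf x (fun i => G i x) (fun i => H i x).
Proof. by move=> LG LH; rewrite -(aformE Abd Asm LG LH). Qed.

(** Test L w with exp(2 a psi) w and complete the square: the integrand is exp(2 a psi) times the
    form of G + a w grad psi minus (a w)^2 times the form of grad psi. The first is nonnegative and
    C bounds the form of grad psi. *)
Lemma ct_energy w k psi (a C : R) : div_op A w k -> test_function setT psi ->
  (forall x, Lambda * (\sum_(i < n) partial i psi x ^+ 2) <= C) ->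
  - (a ^+ 2 * C * inner (fun x => expR (a * psi x) * w x) (fun x => expR (a * psi x) * w x))
   <= inner k (fun x => expR (2 * a * psi x) * w x).
Proof.
move=> /(div_opE Abd Asm)[Lk [G [gG dG]]] tp HC; have [Lw hG] := gG.
have cg := cbd_exp (2 * a) tp; have gH := gradM cg gG; have [LgW hH] := gH.
have LG i : L2 (G i) by have [] := hG i.
have LH i := (hH i).1.
rewrite -(wdiv_grad Abd Asm LG Lk dG gH) aform_qf//.
have [ce [[M eM] _]] := cbd_exp a tp.
have Lew : L2 (fun x => expR (a * psi x) * w x) := smooth_bM ce eM Lw.
rewrite -mulNr inner_sqr -RintZ; last exact: L2_intg_sqr.
have iq := aform_intg Abd Asm LG LH.
apply: Rint_le => [||x]; [by apply: intgZ; exact: L2_intg_sqr|exact: iq|].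
have e2 : expR (2 * a * psi x) = expR (a * psi x) ^+ 2.
  by rewrite -expRM_natl; congr expR; ring.
have spsi := tf_smooth tp.
have pe i : partial i (fun x => expR (2 * a * psi x)) x = 2 * a * partial i psi x * expR (a * psi x) ^+ 2.
  by rewrite (partial_expR _ _ (smoothZ (2 * a) spsi)) (partialZ _ _ _ spsi) e2.
set e := expR (a * psi x) in e2 pe *.
have -> : qf x (fun i => G i x) (fun i => expR (2 * a * psi x) * G i x + partial i (fun x => expR (2 * a * psi x)) x * w x) =
   e ^+ 2 * (qf x (fun i => G i x + a * w x * partial i psi x) (fun i => G i x + a * w x * partial i psi x)
     - (a * w x) ^+ 2 * qf x (fun i => partial i psi x) (fun i => partial i psi x)).
  have -> : (fun i => expR (2 * a * psi x) * G i x + partial i (fun x => expR (2 * a * psi x)) x * w x) =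
     fun i => e ^+ 2 * G i x + e ^+ 2 * (2 * a * w x) * partial i psi x.
    by apply/funext => i; rewrite e2 pe; ring.
  rewrite !(qfDr, qfDl, qfZr, qfZl) [qf x (fun i => partial i psi x) _]qfC; ring.
have q0 := qf_ge0 x (fun i => G i x + a * w x * partial i psi x).
have /andP[_ q1] := qf_ell x (fun i => partial i psi x).
have q2 := le_trans q1 (HC x).
have E : (e * w x) ^+ 2 * a ^+ 2 * C = e ^+ 2 * ((a * w x) ^+ 2 * C) by ring.
rewrite (_ : - (a ^+ 2 * C) * (e * w x) ^+ 2 = e ^+ 2 * (0 - (a * w x) ^+ 2 * C)); last by ring.
apply: ler_wpM2l; first exact: sqr_ge0.
by apply: lerB => //; apply: ler_wpM2l => //; exact: sqr_ge0.
Qed.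

(** The resolvent equation tested with exp(2 a psi) w bounds (1 - h a^2 C) times the squared
    weighted norm of w by the weighted product of f and w; Cauchy-Schwarz then removes one norm of
    w. *)
Lemma ct_resolv (h : R) f w psi (a C : R) : 0 < h -> L2 f -> resolv (div_op A) h f w -> test_function setT psi ->
  (forall x, Lambda * (\sum_(i < n) partial i psi x ^+ 2) <= C) -> h * (a ^+ 2 * C) < 1 ->
  (1 - h * (a ^+ 2 * C)) ^+ 2 * inner (fun x => expR (a * psi x) * w x) (fun x => expR (a * psi x) * w x)
   <= inner (fun x => expR (a * psi x) * f x) (fun x => expR (a * psi x) * f x).
Proof.
move=> h0 Lf [k [dk fk]] tp HC th; have [Lw Lk] := div_op_L2 dk.
have En := ct_energy a dk tp HC.
have [ce [[M eM] _]] := cbd_exp a tp; have [cg [[M2 gM] _]] := cbd_exp (2 * a) tp.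
have Lew : L2 (fun x => expR (a * psi x) * w x) := smooth_bM ce eM Lw.
have Lef : L2 (fun x => expR (a * psi x) * f x) := smooth_bM ce eM Lf.
have Lgw : L2 (fun x => expR (2 * a * psi x) * w x) := smooth_bM cg gM Lw.
set W := inner (fun x => expR (a * psi x) * w x) _ in En *.
have e2 x : expR (2 * a * psi x) = expR (a * psi x) ^+ 2.
  by rewrite -expRM_natl; congr expR; ring.
have E1 : inner (fun x => expR (a * psi x) * f x) (fun x => expR (a * psi x) * w x) =
    W + h * inner k (fun x => expR (2 * a * psi x) * w x).
  have -> : inner (fun x => expR (a * psi x) * f x) (fun x => expR (a * psi x) * w x) =
      inner f (fun x => expR (2 * a * psi x) * w x).
    by apply: eq_Rintegral => x _; rewrite e2; ring.
  rewrite (inner_ae Lf (L2D Lw (L2Z h Lk)) Lgw fk) innerDl//; last exact: L2Z.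
  rewrite (innerZl h Lk Lgw); congr (_ + _).
  by apply: eq_Rintegral => x _; rewrite e2; move: (expR _) (w x) => p q; clear; ring.
have W0 : 0 <= W := inner_ge0 _.
set t := h * (a ^+ 2 * C) in th *.
have E2 : (1 - t) * W <= inner (fun x => expR (a * psi x) * f x) (fun x => expR (a * psi x) * w x).
  rewrite E1 mulrBl mul1r lerD2l; have := ler_wpM2l (ltW h0) En; apply: le_trans.
  by rewrite le_eqVlt /t; apply/orP; left; apply/eqP; ring.
have CS := inner_CS Lef Lew; rewrite -/W in CS.
have [->|Wn] := eqVneq W 0; first by rewrite mulr0 inner_ge0.
have Wp : 0 < W by rewrite lt_neqAle eq_sym Wn.
rewrite -(ler_pM2r Wp); apply: le_trans CS.
rewrite -mulrA -expr2 -exprMn ler_sqr ?nnegrE//; first by rewrite mulr_ge0// subr_ge0 ltW.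
by apply: le_trans E2; rewrite mulr_ge0// subr_ge0 ltW.
Qed.

Lemma ct_riter (h : R) m f w psi (a C : R) : 0 < h -> L2 f -> riter (div_op A) h m f w -> test_function setT psi ->
  (forall x, Lambda * (\sum_(i < n) partial i psi x ^+ 2) <= C) -> h * (a ^+ 2 * C) < 1 ->
  ((1 - h * (a ^+ 2 * C)) ^+ 2) ^+ m * inner (fun x => expR (a * psi x) * w x) (fun x => expR (a * psi x) * w x)
   <= inner (fun x => expR (a * psi x) * f x) (fun x => expR (a * psi x) * f x).
Proof.
move=> h0 Lf rw tp HC th; have [ce [[M eM] _]] := cbd_exp a tp.
elim: m w rw => [|m IH] w /=.
  move=> [Lw fw]; rewrite expr0 mul1r le_eqVlt; apply/orP; left; apply/eqP.
  have aeE : {ae mu, forall x, expR (a * psi x) * w x = expR (a * psi x) * f x} by apply: filterS fw => x ->.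
  have Lew := smooth_bM ce eM Lw; have Lef := smooth_bM ce eM Lf.
  by rewrite (inner_ae Lew Lef Lew aeE) innerC (inner_ae Lew Lef Lef aeE).
move=> [v [rv rw]]; have := IH v rv; apply: le_trans.
have Lv : L2 v := riter_L2 (@div_op_L2 _ _ A) rv.
rewrite exprSr -mulrA; apply: ler_wpM2l; first by rewrite exprn_ge0// sqr_ge0.
exact: ct_resolv rw tp HC th.
Qed.

Lemma expR_inv_lower (y : R) : 0 <= y <= 2^-1 -> expR (- (2 * y)) <= 1 - y.
Proof.
move=> /andP[y0 y1]; rewrite expRN; have p : 0 < 1 + 2 * y by lra.
apply: (@le_trans _ _ ((1 + 2 * y)^-1)); first by rewrite lef_pV2 ?posrE ?expR_gt0//; exact: expR_ge1Dx.
by rewrite -[(_)^-1]mul1r ler_pdivrMr//; nra.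
Qed.

Variable E : set (measurableTypeR R) -> (V -> R) -> V -> R.
Hypothesis hres : spectral_resolution (div_op A) E.

(** With h = t/(m+1) and y = X/(m+1) <= 1/2, the factor (1 - y)^(2(m+1)) is at least exp(-4X). The
    weight exp(a psi) is 1 where f lives and exp(a) where phi lives, and this discrepancy yields
    exp(-2a). *)
Lemma combes_thomas_bound f phi psi (a C t : R) : 0 < t -> L2 f -> L2 phi -> test_function setT psi ->
  (forall x, Lambda * (\sum_(i < n) partial i psi x ^+ 2) <= C) ->
  {ae mu, forall x, psi x != 0 -> f x = 0} -> (forall x, phi x != 0 -> psi x = 1) ->
  polar hres.1 (ep t) f phi ^+ 2 <= expR (4 * (t * (a ^+ 2 * C)) - 2 * a) * (inner f f * inner phi phi).
Proof.
move=> t0 Lf Lp tp HC f0 phi1; set X := t * (a ^+ 2 * C).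
have C0 : 0 <= C.
  apply: le_trans (HC 0); apply: mulr_ge0; [exact: ltW|by apply: sumr_ge0 => i _; exact: sqr_ge0].
have X0 : 0 <= X by apply: mulr_ge0; [exact: ltW|apply: mulr_ge0 => //; exact: sqr_ge0].
have h0 (m : nat) : 0 < t / m.+1%:R by rewrite divr_gt0.
have /choice[w_ rw] : forall m : nat, exists w, riter (div_op A) (t / m.+1%:R) m.+1 f w.
  by move=> m; apply: (riter_ex (div_op_ge0 Abd Asm L0 Aell) hres).
have cv : inner (w_ m) phi @[m --> \oo] --> polar hres.1 (ep t) f phi.
  apply: heat_limit => //; [exact: div_op_L2|exact: (div_op_sub Abd Asm)|exact: (div_op_ge0 Abd Asm L0 Aell)].
have [ce [[M eM] _]] := cbd_exp a tp.
have Lef := smooth_bM ce eM Lf.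
have eff : inner (fun x => expR (a * psi x) * f x) (fun x => expR (a * psi x) * f x) = inner f f.
  have ae1 : {ae mu, forall x, expR (a * psi x) * f x = f x}.
    apply: filterS f0 => x h; have [->|/h ->] := eqVneq (psi x) 0; last by rewrite mulr0.
    by rewrite mulr0 expR0 mul1r.
  by rewrite (inner_ae Lef Lf Lef ae1) innerC (inner_ae Lef Lf Lf ae1).
have bound : \forall m \near \oo, inner (w_ m) phi ^+ 2 <= expR (4 * X - 2 * a) * (inner f f * inner phi phi).
  near=> m; set y := X / m.+1%:R.
  have m0 : 0 < m.+1%:R :> R by [].
  have y01 : 0 <= y <= 2^-1.
    rewrite divr_ge0//= ler_pdivrMr// mulrC ler_pdivlMr//.
    apply: (@le_trans _ _ m%:R); last by rewrite ler_nat.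
    near: m; exact: nbhs_infty_ger.
  have yE : t / m.+1%:R * (a ^+ 2 * C) = y by rewrite /y /X; ring.
  have y1 : t / m.+1%:R * (a ^+ 2 * C) < 1 by rewrite yE; lra.
  have := ct_riter (h0 m) Lf (rw m) tp HC y1; rewrite yE eff => H.
  have Lw : L2 (w_ m) := riter_L2 (@div_op_L2 _ _ A) (rw m).
  have Lew := smooth_bM ce eM Lw.
  set W := inner (fun x => expR (a * psi x) * w_ m x) _ in H.
  have W0 : 0 <= W := inner_ge0 _.
  have HW : W <= expR (4 * X) * inner f f.
    have lo : expR (- (4 * X)) <= ((1 - y) ^+ 2) ^+ m.+1.
      rewrite -exprM (_ : - (4 * X) = (2 * m.+1)%:R * (- (2 * y))); last first.
        by rewrite /y natrM; field; rewrite gt_eqF.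
      rewrite expRM_natl; apply: lerXn2r; rewrite ?nnegrE ?expR_ge0//; first lra.
      exact: expR_inv_lower.
    have := le_trans (ler_wpM2r W0 lo) H.
    by rewrite expRN mulrC ler_pdivrMr ?expR_gt0// mulrC.
  have CS := inner_CS Lew (L2Z (expR (- a)) Lp).
  have -> : inner (w_ m) phi = inner (fun x => expR (a * psi x) * w_ m x) (fun x => expR (- a) * phi x).
    apply: eq_Rintegral => x _; have [->|/phi1 ->] := eqVneq (phi x) 0; first by rewrite !mulr0.
    by rewrite mulr1 mulrACA -expRD subrr expR0 mul1r.
  apply: le_trans CS _; rewrite -/W innerZl ?innerZr//; last exact: L2Z.
  rewrite [X in W * X]mulrA -expRD.
  have -> : expR (4 * X - 2 * a) * (inner f f * inner phi phi) = (expR (4 * X) * inner f f) * (expR (- a - a) * inner phi phi).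
    by rewrite (_ : 4 * X - 2 * a = 4 * X + (- a - a)) ?expRD; [ring|ring].
  by apply: ler_wpM2r => //; rewrite mulr_ge0 ?expR_ge0 ?inner_ge0.
have cv2 : inner (w_ m) phi ^+ 2 @[m --> \oo] --> polar hres.1 (ep t) f phi ^+ 2.
  by under eq_fun do rewrite expr2; rewrite expr2; apply: cvgM.
exact: (cvgr_to_le cv2 bound).
Unshelve. all: by end_near. Qed.

(* Optimizing the weight [a] against [t] turns the previous bound into a Gaussian one. *)
Lemma heat_offdiag f phi psi : L2 f -> L2 phi -> test_function setT psi ->
  {ae mu, forall x, psi x != 0 -> f x = 0} -> (forall x, phi x != 0 -> psi x = 1) ->
  exists2 c : R, 0 < c & forall t, 0 < t ->
   `|polar hres.1 (ep t) f phi| <= Num.sqrt (inner f f * inner phi phi) * expR (- (c / t)).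
Proof.
move=> Lf Lp tp f0 phi1.
have [C HC] : exists C : R, forall x, Lambda * (\sum_(i < n) partial i psi x ^+ 2) <= C.
  have ts : test_function setT (fun x => Lambda * (\sum_(i < n) partial i psi x * partial i psi x)).
    by apply: tfZ; apply: tf_sum => i; apply: tf_Ml; [exact: smooth_partial (tf_smooth tp)|exact: tf_partial].
  have [C C0 h] := tf_bounded ts; exists C => x; apply: le_trans (h x); apply: le_trans (ler_norm _).
  by rewrite le_eqVlt; apply/orP; left; apply/eqP; congr (_ * _); apply: eq_bigr => i _; rewrite expr2.
pose D := 1 + `|C|; have D0 : 0 < D by rewrite /D ltr_pwDl.
have HD x : Lambda * (\sum_(i < n) partial i psi x ^+ 2) <= D.
  by apply: le_trans (HC x) _; apply: le_trans (ler_norm _) _; rewrite lerDr.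
exists (8 * D)^-1; first by rewrite invr_gt0 mulr_gt0.
move=> t t0; have := combes_thomas_bound ((4 * D * t)^-1) t0 Lf Lp tp HD f0 phi1.
have -> : 4 * (t * ((4 * D * t)^-1 ^+ 2 * D)) - 2 * (4 * D * t)^-1 = - ((8 * D)^-1 / t) + - ((8 * D)^-1 / t).
  by field; rewrite !gt_eqF.
rewrite expRD -expr2 => H.
have I0 : 0 <= inner f f * inner phi phi by rewrite mulr_ge0 ?inner_ge0.
rewrite -(@ler_pXn2r _ 2) ?nnegrE ?mulr_ge0 ?sqrtr_ge0 ?expR_ge0//.
rewrite real_normK ?num_real//; apply: le_trans H _.
by rewrite -{1}[inner f f * inner phi phi]sqr_sqrtr// -exprMn mulrC.
Qed.

End combes_thomas.

Section truncation.
Context {R : realType}.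

(* Testing the resolvent equation for [w] against [ntr w] forces [w >= 0]. *)
Definition ntr (s : R) : R := if 0 <= s then 0 else if -1 <= s then - (s ^+ 2 / 2) else s + 2^-1.
Definition ntr' (s : R) : R := if 0 <= s then 0 else if -1 <= s then - s else 1.

(** The negative part is rounded near 0 so that [ntr] is of class C^1 with a Lipschitz derivative:
    the chain rule for weak gradients then needs no discussion of the zero set of w. *)
Lemma ntr_taylor s h : `|ntr (s + h) - ntr s - ntr' s * h| <= h ^+ 2 / 2.
Proof.
rewrite /ntr /ntr' ler_norml; have := sqr_ge0 h.
by case: (leP 0 s) => s0; case: (leP 0 (s + h)) => t0; case: (leP (-1) s) => s1; case: (leP (-1) (s + h)) => t1; nra.
Qed.

Lemma ntr'_01 s : 0 <= ntr' s <= 1.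
Proof. by rewrite /ntr'; case: (leP 0 s) => s0; case: (leP (-1) s) => s1; lra. Qed.

Lemma ntr'_lip s t : `|ntr' s - ntr' t| <= `|s - t|.
Proof.
rewrite /ntr'; case: (leP 0 s) => s0; case: (leP 0 t) => t0; case: (leP (-1) s) => s1; case: (leP (-1) t) => t1;
  rewrite ?subrr ?normr0//; have := ler_norm (s - t); have := ler_norm (t - s); rewrite (distrC t s) ler_norml; lra.
Qed.

Lemma ntr_lip s t : `|ntr s - ntr t| <= `|s - t|.
Proof.
rewrite /ntr; case: (leP 0 s) => s0; case: (leP 0 t) => t0; case: (leP (-1) s) => s1; case: (leP (-1) t) => t1;
  rewrite ?subrr ?normr0//; have := ler_norm (s - t); have := ler_norm (t - s); rewrite (distrC t s) ler_norml; nra.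
Qed.

Lemma ntr_le0 s : ntr s <= 0.
Proof. by rewrite /ntr; case: (leP 0 s) => s0; case: (leP (-1) s) => s1; nra. Qed.

Lemma ntr_mul_ge0 s : 0 <= s * ntr s.
Proof. by rewrite /ntr; case: (leP 0 s) => s0; case: (leP (-1) s) => s1; nra. Qed.

Lemma ntr_mul_eq0 s : s * ntr s = 0 -> 0 <= s.
Proof.
rewrite /ntr; case: (leP 0 s) => // s0; case: (leP (-1) s) => s1 /eqP; rewrite mulf_eq0 => /orP[/eqP e|/eqP e]; nra.
Qed.

Lemma ntr_derive (s : R) : derivable ntr s 1 /\ derive1 ntr s = ntr' s.
Proof.
suff H : (fun h : R => h^-1 *: ((ntr \o shift s) (h *: 1) - ntr s)) @ (0 : R)^' --> ntr' s.
  by split; [apply: cvgP; exact: H|rewrite derive1E; exact: (cvg_lim (@Rhausdorff R) H)].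
apply: seq_cvg_dnbhs => u un u0; apply/cvgrPdist_lt => e e0.
have := u0 => /cvgrPdist_lt/(_ e e0); apply: filterS => k; rewrite sub0r normrN => ue.
have T := ntr_taylor s (u k); have uk : 0 < `|u k| by rewrite normr_gt0.
rewrite /= [u k *: 1]mulr1 [u k + s]addrC -[ntr' s]mul1r -(mulVf (un k)) /GRing.scale/= -mulrA -mulrBr normrM normfV.
rewrite mulrC ltr_pdivrMr// distrC [u k * _]mulrC; apply: le_lt_trans T _.
rewrite -[u k ^+ 2]real_normK ?num_real//; nra.
Qed.

Lemma ntr_cont : continuous ntr.
Proof.
by move=> s; apply/differentiable_continuous/derivable1_diffP; have [] := ntr_derive s.
Qed.

Lemma ntr'_cont : continuous ntr'.
Proof.
move=> s; apply/cvgrPdist_lt => e e0; near=> t.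
apply: le_lt_trans (ntr'_lip s t) _; near: t; exact: cvgr_dist_lt (@cvg_id _ _) _ e0.
Unshelve. all: by end_near. Qed.

End truncation.

Section positivity.
Context {R : realType} {n : nat}.
Local Notation V := 'rV[R]_n.
Implicit Types (f g k u v w psi : V -> R) (G H : 'I_n -> V -> R).

Lemma contM f g : continuous f -> continuous g -> continuous (fun x => f x * g x).
Proof. by move=> cf cg x; apply: (@continuousM R V f g x); [exact: cf|exact: cg]. Qed.

Lemma contD f g : continuous f -> continuous g -> continuous (fun x => f x + g x).
Proof. by move=> cf cg x; apply: (@continuousD R R V f g x); [exact: cf|exact: cg]. Qed.

Lemma L2_ntr w : L2 w -> L2 (fun x => ntr (w x)).
Proof.
move=> Lw; apply: (L2_le _ _ (L2_norm Lw)) => [|x].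
  by apply: (measurableT_comp (continuous_measurable_fun ntr_cont)); exact: L2_meas.
by have := ntr_lip (w x) 0; rewrite /ntr lexx !subr0.
Qed.

Lemma L2_ntr' w f : L2 w -> L2 f -> L2 (fun x => ntr' (w x) * f x).
Proof.
move=> Lw Lf; apply: (@L2_bM _ _ 1) => //.
  by apply: (measurableT_comp (continuous_measurable_fun ntr'_cont)); exact: L2_meas.
by move=> x; have /andP[h0 h1] := ntr'_01 (w x); rewrite ger0_norm.
Qed.

(** The classical chain rule holds for the mollified w_m. The error in the product is ntr'(w_m)
    times the error of the gradient, plus (ntr'(w) - ntr'(w_m)) G_i, which paired with phi is
    controlled by the L^2 distance of w_m to w since phi is bounded. *)
Lemma grad_ntr w G : grad w G -> grad (fun x => ntr (w x)) (fun i x => ntr' (w x) * G i x).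
Proof.
move=> [Lw hG]; split; first exact: L2_ntr.
move=> i; have [LG wG] := hG i; split; first exact: L2_ntr'.
move=> phi tp; have Lp := tf_L2 tp; have tpp := tf_partial i tp; have Lpp := tf_L2 tpp.
pose wm m := moll m w; pose gm m := moll m (G i).
have Lwm m : L2 (wm m) by exact: moll_L2.
have Lgm m : L2 (gm m) by exact: moll_L2.
have Em m : inner (fun x => ntr (wm m x)) (partial i phi) = - inner (fun x => ntr' (wm m x) * gm m x) phi.
  have sw : smooth (wm m) := moll_smooth m Lw.
  have dw x : derivable (wm m) x (delta_mx 0 i) by exact: smooth_der.
  have dn x : derivable (fun x => ntr (wm m x)) x (delta_mx 0 i) /\ partial i (fun x => ntr (wm m x)) x = ntr' (wm m x) * gm m x.
    have [d1 d2] := ntr_derive (wm m x); have [c1 c2] := chain_rule (@dw x) d1; split => //.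
    by rewrite /partial c2 d2; congr (_ * _); have [] := moll_partial m x Lw LG wG.
  have dp x : derivable phi x (delta_mx 0 i) by exact: smooth_der (tf_smooth tp).
  have cn : continuous (fun x => ntr (wm m x)).
    by move=> x; apply: (@continuous_comp _ _ _ (wm m) ntr x); [exact: smooth_cont sw x|exact: ntr_cont].
  have cn' : continuous (fun x => ntr' (wm m x)).
    by move=> x; apply: (@continuous_comp _ _ _ (wm m) ntr' x); [exact: smooth_cont sw x|exact: ntr'_cont].
  pose F x := ntr (wm m x) * phi x.
  have pF x : partial i F x = ntr (wm m x) * partial i phi x + ntr' (wm m x) * gm m x * phi x.
    by rewrite /F (partialM (dn x).1 (@dp x)) (dn x).2 [phi x * _]mulrC.
  have cg : continuous (gm m) := smooth_cont (moll_smooth m LG).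
  have cF : continuous F := contM cn (tf_cont tp).
  have cpF : continuous (partial i F).
    rewrite (_ : partial i F = fun x => ntr (wm m x) * partial i phi x + ntr' (wm m x) * gm m x * phi x); last exact/funext.
    by apply: contD; [exact: contM cn (tf_cont tpp)|exact: contM (contM cn' cg) (tf_cont tp)].
  case: (tp) => _ [K [cK _ p0]]; have [M KM] := compact_box cK.
  have clK : closed K by exact: compact_closed_rV.
  have F0 x : ~ K x -> F x = 0 by move=> /p0; rewrite /F => ->; rewrite mulr0.
  have [C1 C10 HC1] := cpt_bounded cK cF F0.
  have [C2 C20 HC2] := cpt_bounded cK cpF (@partial_vanish _ _ _ _ i clK F0).
  have := @Rint_partial0 R n i F (fun x => derivableM (dn x).1 (@dp x)) M (C1 + C2)
    (continuous_measurable_rV cF) (continuous_measurable_rV cpF).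
  move=> H; have {H} : \int[mu]_x partial i F x = 0.
    apply: H => [x nx|x|x]; [by apply: F0 => /KM|by apply: le_trans (HC1 x) _; rewrite lerDl|by apply: le_trans (HC2 x) _; rewrite lerDr].
  rewrite (eq_Rintegral _ (fun x _ => pF x)) RintD.
  - by rewrite /inner; lra.
  - by apply: L2M => //; exact: L2_ntr.
  - by apply: L2M => //; exact: L2_ntr'.
have [Cp Cp0 HCp] := tf_bounded tp.
have c1 : inner (fun x => ntr (wm m x)) (partial i phi) @[m --> \oo] --> inner (fun x => ntr (w x)) (partial i phi).
  apply: L2cvg_inner => //; split => [m||]; [exact: L2_ntr|exact: L2_ntr|].
  apply: (squeeze_cvgr _ (@cvg_cst _ (0 : R) _ _ _) (moll_cvg Lw)); apply: nearW => m.
  rewrite inner_ge0/= !inner_sqr; apply: Rint_le => [||x].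
  - by apply: L2_intg_sqr; apply: L2B; exact: L2_ntr.
  - exact: L2_intg_sqr (L2B (Lwm m) Lw).
  - by rewrite -[leLHS]real_normK ?num_real// -[leRHS]real_normK ?num_real// ler_sqr ?nnegrE// ntr_lip.
have c2 : inner (fun x => ntr' (wm m x) * gm m x) phi @[m --> \oo] --> inner (fun x => ntr' (w x) * G i x) phi.
  apply/cvgrPdist_le => e e0.
  pose a m := Num.sqrt (inner (fun x => gm m x - G i x) (fun x => gm m x - G i x)) * Num.sqrt (inner phi phi).
  pose b m := Num.sqrt (inner (fun x => wm m x - w x) (fun x => wm m x - w x)) * (Cp * Num.sqrt (inner (G i) (G i))).
  have sq (z : nat -> R) : z @ \oo --> (0 : R) -> Num.sqrt (z m) @[m --> \oo] --> (0 : R).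
    by move=> z0; rewrite -[X in _ --> X](@sqrtr0 R); apply: (cvg_comp _ _ z0); exact: sqrt_continuous.
  have ab0 : a m + b m @[m --> \oo] --> (0 : R).
    rewrite -[X in _ --> X]addr0 -[X in _ --> X + _](mul0r (Num.sqrt (inner phi phi))) -[X in _ --> _ + X](mul0r (Cp * Num.sqrt (inner (G i) (G i)))).
    by apply: cvgD; apply: cvgM; try exact: cvg_cst; apply: sq; exact: moll_cvg.
  have := ab0 => /cvgrPdist_le/(_ e e0); apply: filterS => m; rewrite sub0r normrN => ab.
  apply: le_trans (le_trans _ (ler_norm _)) ab.
  have Ln := L2_ntr' Lw LG; have Lnm := L2_ntr' (Lwm m) (Lgm m); have Lx := L2_ntr' (Lwm m) LG.
  have Ld := L2B (Lgm m) LG.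
  have -> : inner (fun x => ntr' (w x) * G i x) phi - inner (fun x => ntr' (wm m x) * gm m x) phi =
     - inner (fun x => ntr' (wm m x) * (gm m x - G i x)) phi + inner (fun x => (ntr' (w x) - ntr' (wm m x)) * G i x) phi.
    rewrite (_ : (fun x => ntr' (wm m x) * (gm m x - G i x)) = fun x => ntr' (wm m x) * gm m x - ntr' (wm m x) * G i x); last by apply/funext => x; ring.
    rewrite (_ : (fun x => (ntr' (w x) - ntr' (wm m x)) * G i x) = fun x => ntr' (w x) * G i x - ntr' (wm m x) * G i x); last by apply/funext => x; ring.
    by rewrite !innerBl//; ring.
  apply: le_trans (ler_normD _ _) _; rewrite normrN; apply: lerD.
    have L1 := L2_ntr' (Lwm m) Ld.
    apply: le_trans (inner_CS_sqrt L1 Lp) _; apply: ler_wpM2r; first exact: sqrtr_ge0.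
    apply: ler_wsqrtr; rewrite !inner_sqr; apply: Rint_le => [||x]; [exact: L2_intg_sqr|exact: L2_intg_sqr|].
    rewrite exprMn -[leRHS]mul1r; apply: ler_wpM2r; first exact: sqr_ge0.
    by have /andP[h0 h1] := ntr'_01 (wm m x); rewrite expr_le1.
  have Lwd := L2B (Lwm m) Lw; have LGp : L2 (fun x => G i x * phi x) by under eq_fun do rewrite mulrC; exact: tf_bM tp LG.
  have Ldn : L2 (fun x => ntr' (w x) - ntr' (wm m x)).
    apply: (L2_le _ _ (L2_norm Lwd)) => [|x]; last by rewrite distrC ntr'_lip.
    by apply: measurable_funB; apply: (measurableT_comp (continuous_measurable_fun ntr'_cont)); exact: L2_meas.
  have -> : inner (fun x => (ntr' (w x) - ntr' (wm m x)) * G i x) phi = inner (fun x => ntr' (w x) - ntr' (wm m x)) (fun x => G i x * phi x).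
    by apply: eq_Rintegral => x _; ring.
  apply: le_trans (inner_CS_sqrt Ldn LGp) _; apply: ler_pM; rewrite ?sqrtr_ge0//.
    apply: ler_wsqrtr; rewrite !inner_sqr; apply: Rint_le => [||x]; [exact: L2_intg_sqr|exact: L2_intg_sqr|].
    by rewrite -[leLHS]real_normK ?num_real// -[leRHS]real_normK ?num_real// ler_sqr ?nnegrE// distrC ntr'_lip.
  rewrite -[X in X * _](ger0_norm Cp0) -sqrtr_sqr -sqrtrM ?sqr_ge0//.
  apply: ler_wsqrtr; rewrite !inner_sqr -RintZ; last exact: L2_intg_sqr.
  apply: Rint_le => [||x]; [exact: L2_intg_sqr|by apply: intgZ; exact: L2_intg_sqr|].
  rewrite exprMn mulrC; apply: ler_wpM2r; first exact: sqr_ge0.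
  by rewrite -[leLHS]real_normK ?num_real// ler_sqr ?nnegrE.
have c1' : inner (fun x => ntr (wm m x)) (partial i phi) @[m --> \oo] --> - inner (fun x => ntr' (w x) * G i x) phi.
  by under eq_fun do rewrite Em; exact: cvgN.
exact: (cvg_unique (@Rhausdorff R) c1 c1').
Qed.

Variable A : V -> 'M[R]_n.
Hypothesis Abd : bounded_entries A.
Hypothesis Asm : smooth_entries A.
Variable Lambda : R.
Hypothesis L0 : 0 < Lambda.
Hypothesis Asym : forall x, (A x)^T = A x.
Hypothesis Aell : elliptic A Lambda.

(** In <f, ntr w> = <w, ntr w> + h <L w, ntr w> the left side is nonpositive and both terms on the
    right are nonnegative, so w ntr(w) = 0 almost everywhere. *)
Lemma resolv_ge0 (h : R) f w : 0 < h -> L2 f -> {ae mu, forall x, 0 <= f x} ->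
  resolv (div_op A) h f w -> {ae mu, forall x, 0 <= w x}.
Proof.
move=> h0 Lf f0 [k [dk fk]]; have [Lw Lk] := div_op_L2 dk.
move: dk => /(div_opE Abd Asm)[_ [G [gG dG]]].
have LG i : L2 (G i) by case: gG => _ /(_ i)[].
have gN := grad_ntr gG; have LN : L2 (fun x => ntr (w x)) by case: gN.
have e1 : 0 <= inner k (fun x => ntr (w x)).
  rewrite -(wdiv_grad Abd Asm LG Lk dG gN) (aform_qf Abd Asm)//; last by move=> i; exact: L2_ntr'.
  apply: Rint_ge0 => x; rewrite qfZr; apply: mulr_ge0; last exact: (qf_ge0 L0 Aell).
  by have /andP[] := ntr'_01 (w x).
have e2 : inner f (fun x => ntr (w x)) = inner w (fun x => ntr (w x)) + h * inner k (fun x => ntr (w x)).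
  by rewrite (inner_ae Lf (L2D Lw (L2Z h Lk)) LN fk) (innerDl Lw (L2Z h Lk) LN) (innerZl h Lk LN).
have e3 : inner f (fun x => ntr (w x)) <= 0.
  have La : L2 (fun x => `|f x|) := L2_norm Lf.
  have aeE : {ae mu, forall x, f x = `|f x|} by apply: filterS f0 => x h'; rewrite ger0_norm.
  rewrite (inner_ae Lf La LN aeE) -oppr_ge0 -innerNl//; apply: Rint_ge0 => x.
  by rewrite mulNr oppr_ge0 mulr_ge0_le0// ntr_le0.
have e4 : 0 <= inner w (fun x => ntr (w x)) by apply: Rint_ge0 => x; exact: ntr_mul_ge0.
have e5 : inner w (fun x => ntr (w x)) = 0 by have := mulr_ge0 (ltW h0) e1; lra.
have := Rint_eq0_ae (L2M Lw LN) (fun x => ntr_mul_ge0 (w x)) e5.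
by apply: filterS => x; exact: ntr_mul_eq0.
Qed.

Lemma riter_ge0 (h : R) m f w : 0 < h -> L2 f -> {ae mu, forall x, 0 <= f x} ->
  riter (div_op A) h m f w -> {ae mu, forall x, 0 <= w x}.
Proof.
move=> h0 Lf f0; elim: m w => [|m IH] w /=.
  by move=> [_]; apply: filterS2 f0 => x fx <-.
move=> [v [rv rw]]; have Lv : L2 v := riter_L2 (@div_op_L2 _ _ A) rv.
exact: (resolv_ge0 h0 Lv (IH _ rv) rw).
Qed.

Variable E : set (measurableTypeR R) -> (V -> R) -> V -> R.
Hypothesis hres : spectral_resolution (div_op A) E.

Lemma heat_ge0 f g (t : R) : 0 < t -> L2 f -> L2 g -> {ae mu, forall x, 0 <= f x} ->
  (forall x, 0 <= g x) -> 0 <= polar hres.1 (ep t) f g.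
Proof.
move=> t0 Lf Lg f0 g0.
have h0 (m : nat) : 0 < t / m.+1%:R by rewrite divr_gt0.
have /choice[w_ rw] : forall m : nat, exists w, riter (div_op A) (t / m.+1%:R) m.+1 f w.
  by move=> m; apply: (riter_ex (div_op_ge0 Abd Asm L0 Aell) hres).
have cv : inner (w_ m) g @[m --> \oo] --> polar hres.1 (ep t) f g.
  apply: heat_limit => //; [exact: div_op_L2|exact: (div_op_sub Abd Asm)|exact: (div_op_ge0 Abd Asm L0 Aell)].
apply: (cvgr_to_ge cv); apply: nearW => m.
have Lw : L2 (w_ m) := riter_L2 (@div_op_L2 _ _ A) (rw m).
have w0 := riter_ge0 (h0 m) Lf f0 (rw m).
have aeE : {ae mu, forall x, w_ m x = `|w_ m x|} by apply: filterS w0 => x h'; rewrite ger0_norm.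
by rewrite (inner_ae Lw (L2_norm Lw) Lg aeE); apply: Rint_ge0 => x; rewrite mulr_ge0.
Qed.

End positivity.

(** * Nonnegativity of the heat kernel *)

Section algebra_sign.
Context {R : realType} d (X : measurableType d) (mu : {measure set X -> \bar R}).
Variable T : set (set X).
Hypothesis Tgen : @measurable _ X = <<s T >>.
Hypothesis TC : forall S, T S -> T (~` S).
Hypothesis TU : forall S S', T S -> T S' -> T (S `|` S').
Hypothesis TT : T setT.

Lemma algebra_measurable S : T S -> measurable S.
Proof. by move=> TS; rewrite Tgen; exact: sub_sigma_algebra. Qed.

Lemma algebra_I : setI_closed T.
Proof. by move=> S S' TS TS'; rewrite -[S `&` S']setCK setCI; apply: TC; apply: TU; exact: TC. Qed.

Definition symd (g : X -> R) (S U : set X) (x : X) : R := `|\1_S x - \1_U x| * `|g x|.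

Lemma symd_le g S U x : `|symd g S U x| <= `|g x|.
Proof.
rewrite ger0_norm ?mulr_ge0// -[leRHS]mul1r; apply: ler_wpM2r => //.
by rewrite !indicE; case: (x \in S); case: (x \in U); rewrite ?subrr ?subr0 ?sub0r ?normrN ?normr1 ?normr0.
Qed.

Lemma intg_symd g S U : intg mu g -> measurable S -> measurable U -> intg mu (symd g S U).
Proof.
move=> ig mS mU; apply: (intg_le _ (symd_le g S U)); last exact: intg_norm.
apply: measurable_funM; last exact: (measurableT_comp _ (intg_meas ig)).
by apply: measurableT_comp => //; apply: measurable_funB; exact: measurable_indic.
Qed.

(** Sets of a generating algebra approximate measurable sets for the finite measure |g| dmu, by
    Dynkin's induction; a countable union is first cut to a finite one. *)
Lemma algebra_approx g S : intg mu g -> measurable S -> forall e : R, 0 < e ->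
  exists2 U, T U & \int[mu]_x symd g S U x < e.
Proof.
move=> ig mS.
pose P S := forall e : R, 0 < e -> exists2 U, T U & \int[mu]_x symd g S U x < e.
suff : P S by [].
have PT U : T U -> P U.
  move=> TU' e e0; exists U => //; rewrite (_ : \int[mu]_x symd g U U x = 0)//.
  have := RintZ 0 ig; rewrite mul0r => <-; apply: eq_Rintegral => x _.
  by rewrite /symd subrr normr0 !mul0r.
have PU A B : measurable A -> measurable B -> P A -> P B -> P (A `|` B).
  move=> mA mB PA PB e e0; have e2 : 0 < e / 2 by rewrite divr_gt0.
  have [U TU' HU] := PA _ e2; have [W TW HW] := PB _ e2; exists (U `|` W); first exact: TU.
  have mU := algebra_measurable TU'; have mW := algebra_measurable TW.
  apply: (@le_lt_trans _ _ (\int[mu]_x symd g A U x + \int[mu]_x symd g B W x)); last by lra.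
  rewrite -RintD; [|exact: intg_symd..].
  apply: Rint_le => [||x]; [by apply: intg_symd => //; exact: measurableU|by apply: intgD; exact: intg_symd|].
  rewrite /symd -mulrDl; apply: ler_wpM2r => //; rewrite !indicE !in_setU.
  by case: (x \in A); case: (x \in U); case: (x \in B); case: (x \in W) => /=;
    rewrite ?subrr ?subr0 ?sub0r ?normrN ?normr1 ?normr0 ?addr0 ?add0r ?lerDl ?ler01 ?lexx// ?ler_wpDl ?ler01.
apply: (@dynkin_induction _ X T P) => //.
- exact: algebra_I.
- exact: PT.
- move=> A mA PA e e0; have [U TU' HU] := PA e e0; exists (~` U); first exact: TC.
  apply: le_lt_trans HU; apply: Rint_le => [||x].
  + by apply: intg_symd => //; apply: measurableC => //; exact: algebra_measurable.
  + by apply: intg_symd => //; exact: algebra_measurable.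
  + rewrite /symd !indicE !in_setC; apply: ler_wpM2r => //.
    by case: (x \in A); case: (x \in U); rewrite /= ?subrr ?subr0 ?sub0r ?normrN.
- move=> F mF tF PF e e0; have e2 : 0 < e / 2 by rewrite divr_gt0.
  pose S_ m := \bigcup_(k < m) F k.
  have mS_ m : measurable (S_ m) by apply: bigcup_measurable => k _; exact: mF.
  have mU : measurable (\bigcup_k F k) by exact: bigcupT_measurable.
  have PS m : P (S_ m).
    elim: m => [|m IH].
      rewrite (_ : S_ 0%N = ~` setT); first by apply: PT; exact: TC.
      by rewrite setCT; apply/seteqP; split => x // [].
    rewrite (_ : S_ m.+1 = S_ m `|` F m); first exact: PU.
    by rewrite /S_ !bigcup_mkord big_ord_recr.
  have cv : \int[mu]_x symd g (\bigcup_k F k) (S_ m) x @[m --> \oo] --> \int[mu]_x (0 : R).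
    have [] := Rint_dct (f_ := fun m => symd g (\bigcup_k F k) (S_ m)) (f := fun=> 0) (g := fun x => `|g x|) _ _ (intg_norm ig) _; last by move=> _; exact.
    + by move=> m; apply: intg_meas; exact: intg_symd.
    + move=> x; apply: cvg_near_cst; have [[k _ Fk]|nx] := pselect ((\bigcup_k F k) x).
        exists k.+1 => // m /= km; rewrite /symd !indicE !mem_set ?subrr ?normr0 ?mul0r//; first by exists k.
        by exists k.
      apply: nearW => m; rewrite /symd !indicE !memNset ?subrr ?normr0 ?mul0r//.
      by move=> [k _ Fk]; apply: nx; exists k.
    + by move=> m x; exact: symd_le.
  have z0 : \int[mu]_x (0 : R) = 0.
    by rewrite /Rintegral integral0.
  rewrite z0 in cv; have [m Hm] := cvg_lt_ex cv e2.
  have [U TU' HU] := PS m _ e2; exists U => //; have mU' := algebra_measurable TU'.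
  apply: (@le_lt_trans _ _ (\int[mu]_x symd g (\bigcup_k F k) (S_ m) x + \int[mu]_x symd g (S_ m) U x)); last by lra.
  rewrite -RintD; [|exact: intg_symd..].
  apply: Rint_le => [||x]; [exact: intg_symd|by apply: intgD; exact: intg_symd|].
  rewrite /symd -mulrDl; apply: ler_wpM2r => //.
  exact: ler_distD.
- by rewrite -Tgen.
Qed.

(** Only sets of the algebra are tested. When it is countable, as for [hset], conditions that hold
    almost everywhere for each set hold simultaneously off one null set. *)
Lemma algebra_sign g : intg mu g -> (forall S, T S -> 0 <= \int[mu]_x (\1_S x * g x)) ->
  {ae mu, forall x, 0 <= g x}.
Proof.
move=> ig H; pose S := [set x | g x < 0].
have mS : measurable S.
  rewrite (_ : S = g @^-1` `]-oo, 0[%classic); last by apply/seteqP; split => x; rewrite /S /= in_itv.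
  by have := intg_meas ig measurableT (measurable_itv `]-oo, (0 : R)[); rewrite setTI.
have iS U : measurable U -> intg mu (fun x => \1_U x * g x).
  move=> mU; apply: (intg_le _ _ (intg_norm ig)).
    by apply: measurable_funM; [exact: measurable_indic|exact: (intg_meas ig)].
  by move=> x; rewrite normrM indicE; case: (x \in U); rewrite ?normr1 ?normr0 ?mul1r ?mul0r.
have neg x : 0 <= - (\1_S x * g x).
  rewrite indicE; have [/set_mem h|_] := boolP (x \in S); last by rewrite mul0r oppr0.
  by rewrite mul1r oppr_ge0 ltW.
have I0 : \int[mu]_x (- (\1_S x * g x)) = 0.
  apply/eqP; rewrite eq_le; apply/andP; split; last by apply: Rint_ge0.
  rewrite (_ : \int[mu]_x _ = - \int[mu]_x (\1_S x * g x)); last first.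
    by rewrite -mulN1r -RintZ; [apply: eq_Rintegral => x _; rewrite mulN1r|exact: iS].
  rewrite oppr_le0; apply/ler_addgt0Pl => e e0.
  have [U TU' HU] := algebra_approx ig mS e0; have mU := algebra_measurable TU'.
  apply: le_trans (H U TU') _; rewrite -lerBlDr -RintB; [|exact: iS..].
  apply: le_trans (ler_norm _) _; apply: le_trans (Rint_norm _) _; first by apply: intgB; exact: iS.
  apply: ltW; apply: le_lt_trans HU; apply: Rint_le => [||x].
  - by apply: intg_norm; apply: intgB; exact: iS.
  - exact: intg_symd.
  - by rewrite -mulrBl normrM /symd distrC.
have := Rint_eq0_ae (intgN (iS _ mS)) neg I0; apply: filterS => x /eqP; rewrite oppr_eq0 mulf_eq0.
rewrite leNgt => /orP[|/eqP ->]; last by rewrite ltxx.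
by rewrite indicE; apply: contraTN => h; rewrite mem_set// oner_eq0.
Qed.

End algebra_sign.

Section halfspaces.
Context {R : realType} {n : nat}.
Local Notation V := 'rV[R]_n.

(* Codes for the countable algebra of sets generated by the rational half-spaces. *)
Fixpoint hset (t : GenTree.tree ('I_n * rat)) : set V :=
  match t with
  | GenTree.Leaf q => [set x | ratr q.2 < x 0 q.1]
  | GenTree.Node 0 (t :: _) => ~` hset t
  | GenTree.Node _ (t :: t' :: _) => hset t `|` hset t'
  | _ => setT
  end.

Lemma hset_gen : @measurable _ V = <<s range hset >>.
Proof.
apply/seteqP; split; last first.
  apply: smallest_sub; first exact: sigma_algebra_measurable.
  move=> _ [t _ <-]; move: t; fix IH 1 => -[[i q]|m l] /=.
    rewrite (_ : (fun x : V => is_true _) = (fun x : V => x 0 i) @^-1` `]ratr q, +oo[%classic); last first.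
      by apply/seteqP; split => x; rewrite /= in_itv/= andbT.
    by have := @measurable_coord R n i measurableT _ (measurable_itv `](ratr q : R), +oo[); rewrite setTI.
  case: m => [|m]; case: l => [|t l] //=; first by apply: measurableC; exact: IH.
  by case: l => [|t' l] //; apply: measurableU; exact: IH.
apply: smallest_sub; first exact: smallest_sigma_algebra.
rewrite -bigcup_seq => Y [i _ [Z mZ <-]].
suff H : measurable_fun setT ((fun x => x 0 i) : g_sigma_algebraType (range hset) -> measurableTypeR R).
  by have := H measurableT _ mZ.
apply: (measurability (@RGenOInfty.G R) (RGenOInfty.measurableE R)).
move=> _ [_ [a ->] <-]; rewrite setTI.
have -> : ((fun x : V => x 0 i) @^-1` `]a, +oo[%classic) =
    \bigcup_(q : rat) (if a < ratr q then hset (GenTree.Leaf (i, q)) else set0).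
  apply/seteqP; split => x /=; rewrite in_itv/= ?andbT.
    move=> ax; have [q] := @rat_in_itvoo R a (x 0 i) ax.
    by rewrite in_itv/= => /andP[h1 h2]; exists q => //; rewrite h1.
  by case=> q _ /=; case: (ltP a (ratr q)) => // h1 h2; exact: lt_trans h2.
apply: countable_bigcupT_measurable => [|q]; first exact: countableP.
by case: ifP => _; [apply: sub_sigma_algebra; exists (GenTree.Leaf (i, q))|exact: measurable0].
Qed.

Lemma hsetC S : range hset S -> range hset (~` S).
Proof. by move=> [t _ <-]; exists (GenTree.Node 0 [:: t]). Qed.

Lemma hsetU S S' : range hset S -> range hset S' -> range hset (S `|` S').
Proof. by move=> [t _ <-] [t' _ <-]; exists (GenTree.Node 1 [:: t; t']). Qed.

Lemma hsetT : range hset setT.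
Proof. by exists (GenTree.Node 0 [::]). Qed.

End halfspaces.

Section kernel_sign.
Context {R : realType} {n : nat}.
Local Notation V := 'rV[R]_n.
Implicit Types (f g : V -> R).

Lemma dual_ge0 f : L2 f -> (forall g, L2 g -> (forall x, 0 <= g x) -> 0 <= inner f g) ->
  {ae mu, forall x, 0 <= f x}.
Proof.
move=> Lf H; pose g x := (`|f x| - f x) / 2.
have g0 x : 0 <= g x by rewrite /g divr_ge0// subr_ge0 ler_norm.
have Lg : L2 g.
  have := L2Z (2^-1) (L2B (L2_norm Lf) Lf); congr (is_true (L2 _)).
  by apply/funext => x; rewrite mulrC.
have gg x : f x * g x = - (g x * g x).
  rewrite /g; case: (leP 0 (f x)) => h; first by rewrite ger0_norm// subrr; ring.
  by rewrite ltr0_norm//; field.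
have I0 : inner g g = 0.
  apply/eqP; rewrite eq_le inner_ge0 andbT; have := H g Lg g0.
  rewrite (_ : inner f g = - inner g g) ?oppr_ge0//.
  by rewrite /inner -mulN1r -RintZ; [apply: eq_Rintegral => x _; rewrite gg mulN1r|exact: L2M].
have := inner_eq0 Lg I0; apply: filterS => x gx.
by move: (g0 x) gx; rewrite /g => _ h; have := normr_ge0 (f x); lra.
Qed.

Variable A : V -> 'M[R]_n.
Hypothesis Abd : bounded_entries A.
Hypothesis Asm : smooth_entries A.
Variable Lambda : R.
Hypothesis L0 : 0 < Lambda.
Hypothesis Aell : elliptic A Lambda.
Variable E : set (measurableTypeR R) -> (V -> R) -> V -> R.
Hypothesis hres : spectral_resolution (div_op A) E.
Variable p : R -> V -> V -> R.
Hypothesis hp : is_heat_kernel A p.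

Definition heat (t : R) f x : R := \int[mu]_z (p t x z * f z).

Lemma heat_kernel_bfc t f : 0 < t -> L2 f -> bfc hres.1 (ep t) f (heat t f).
Proof.
move=> t0 Lf; have [_ _ /(_ t f t0 Lf)[_ H]] := hp.
by apply: heat_bfc => //; [exact: div_op_L2|exact: (div_op_sub Abd Asm)|exact: (div_op_ge0 Abd Asm L0 Aell)].
Qed.

Lemma heat_fun_ge0 t f : 0 < t -> L2 f -> (forall x, 0 <= f x) -> {ae mu, forall x, 0 <= heat t f x}.
Proof.
move=> t0 Lf f0; have b := heat_kernel_bfc t0 Lf; apply: dual_ge0; first exact: b.1.
by move=> g Lg g0; rewrite b.2//; apply: (heat_ge0 Abd Asm L0 Aell) => //; apply: aeW.
Qed.

(** Positivity of the semigroup says only that, for each set, the integral of p(t, x, .) over it is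
    nonnegative for almost every x. Over the countable algebra of half-spaces and the integer boxes,
    one null set of x serves for all, and [algebra_sign] concludes in z. The boxes keep the
    indicators in L^2. *)
Lemma heat_kernel_ge0 t : 0 < t -> {ae mu, forall x, {ae mu, forall z, 0 <= p t x z}}.
Proof.
move=> t0.
have mb m : measurable (box m%:R : set V) by exact: measurable_sqbox.
have ai m : {ae mu, forall x, intg mu (fun z => p t x z * \1_(box m%:R) z)}.
  by have [_ _ /(_ t _ t0 (L2_box m%:R))[]] := hp.
(* Pairs of a box and a set are enumerated by their codes; integers that code nothing impose no
   condition. *)
pose Q (N : nat) x := if unpickle N is Some (m, tr) then
   0 <= heat t (\1_((box m%:R : set V) `&` hset tr)) x else true.
have mh tr : measurable (@hset R n tr) by rewrite hset_gen; apply: sub_sigma_algebra; exists tr.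
have aQ N : {ae mu, forall x, Q N x}.
  rewrite /Q; case: unpickle => [[m tr]|]; last by apply: aeW.
  apply: heat_fun_ge0 => //; apply: (@L2_indic _ _ _ m%:R) => [|x []//].
  by apply: measurableI.
apply: filterS2 (ae_seq ai) (ae_seq aQ) => x ix Qx.
suff : forall m : nat, {ae mu, forall z, 0 <= p t x z * \1_(box m%:R) z}.
  move=> /ae_seq; apply: filterS => z H.
  have [m Hm] : exists m : nat, box m%:R z.
    exists (Num.bound `|z|) => i; apply: le_trans (coord_le_norm z i) _; exact/ltW/archi_boundP.
  by have := H m; rewrite indicE mem_set// mulr1.
move=> m; apply: (algebra_sign (@hset_gen R n) (@hsetC R n) (@hsetU R n) (@hsetT R n)) => //.
move=> _ [tr _ <-]; have := Qx (pickle (m, tr)); rewrite /Q pickleK /heat; congr (_ <= _).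
apply: eq_Rintegral => z _; rewrite !indicE in_setI.
by case: (z \in box m%:R); case: (z \in hset tr); rewrite /= ?mulr1 ?mulr0 ?mul1r ?mul0r.
Qed.

End kernel_sign.

(** * The fractional pairing *)

Section half_line.
Context {R : realType}.
Local Notation la := (@lebesgue_measure R).
Implicit Types (t y c a : R).

(** The Heaviside factor turns integrals over the half-line into integrals over R, the form in which
    the Fubini and convergence lemmas apply. *)
Definition hl t : R := (0 < t)%R%:R.

Lemma hl_indic t : hl t = \1_(`]0, +oo[%classic : set R) t.
Proof.
rewrite /hl indicE; case: (ltP 0 t) => t0; first by rewrite mem_set// /= in_itv/= t0.
by rewrite memNset// /= in_itv/= andbT => /(le_lt_trans t0); rewrite ltxx.
Qed.

Lemma measurable_hl : measurable_fun setT (hl : measurableTypeR R -> R).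
Proof.
rewrite (_ : hl = \1_(`]0, +oo[%classic : set R)); last by apply/funext => t; exact: hl_indic.
exact: measurable_indic.
Qed.

Lemma Rint_hl (f : R -> R) : \int[la]_(t in `]0, +oo[) f t = \int[la]_t (hl t * f t).
Proof.
rewrite Rintegral_mkcond; apply: eq_Rintegral => t _; rewrite patchE hl_indic indicE.
by case: (t \in _); rewrite ?mul1r ?mul0r.
Qed.

Lemma ftc2 (F f : R -> R) (a b : R) : 0 < a -> a < b ->
  (forall t, 0 < t -> is_derive t (1 : R) F (f t)) -> (forall t, 0 < t -> {for t, continuous f}) ->
  (\int[la]_(x in `[a, b]) (f x)%:E = (F b - F a)%:E)%E.
Proof.
move=> a0 ab dF cf.
have cF t : 0 < t -> {for t, continuous F}.
  by move=> t0; apply/differentiable_continuous/derivable1_diffP; have [] := dF t t0.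
have b0 := lt_trans a0 ab.
rewrite (@continuous_FTC2 R f F)//.
- apply: continuous_in_subspaceT => t /set_mem /=; rewrite in_itv/= => /andP[h _].
  by apply: cf; exact: lt_le_trans h.
- split.
  + by move=> t; rewrite in_itv/= => /andP[h _]; have [] := dF t (lt_trans a0 h).
  + by apply: cvg_at_right_filter; exact: cF.
  + by apply: cvg_at_left_filter; exact: cF.
- move=> t; rewrite in_itv/= => /andP[h _]; rewrite derive1E.
  exact: (@derive_val _ _ _ _ _ _ _ (dF t (lt_trans a0 h))).
Qed.

Lemma powR_cont a t : 0 < t -> {for t, continuous (fun t : R => t `^ a)}.
Proof.
move=> t0; apply/differentiable_continuous/derivable1_diffP.
by have [] := is_derive1_powR a t0.
Qed.

Lemma ge0_exhaust_le (f : measurableTypeR R -> R) (C : R) : measurable_fun setT f -> (forall t, 0 <= f t) ->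
  (forall t, t <= 0 -> f t = 0) ->
  (forall N : nat, (\int[la]_(t in `[(N.+2%:R^-1)%R, (N.+2%:R)%R]) (f t)%:E <= C%:E)%E) ->
  (\int[la]_t (f t)%:E <= C%:E)%E.
Proof.
move=> mf f0 fneg HC.
pose I (N : nat) : set R := `[N.+2%:R^-1, N.+2%:R]%classic.
pose g (N : nat) (t : measurableTypeR R) := (f t * \1_(I N) t)%:E.
have mg N : measurable_fun setT (g N).
  by apply/measurable_EFinP; apply: measurable_funM => //; apply: measurable_indic; exact: measurable_itv.
have g0 N t : setT t -> (0 <= g N t)%E by move=> _; rewrite lee_fin mulr_ge0.
have ndg t : setT t -> {homo g ^~ t : N M / (N <= M)%N >-> (N <= M)%E}.
  move=> _ N M NM; rewrite lee_fin; apply: ler_wpM2l => //; rewrite !indicE.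
  have [/set_mem|//] := boolP (t \in I N); rewrite /I /= in_itv/= => /andP[h1 h2].
  rewrite mem_set//= in_itv/= (le_trans _ h1) ?(le_trans h2)// ?ler_nat//.
  by rewrite lef_pV2 ?posrE// ler_nat.
have lim t : (f t)%:E = limn (g ^~ t).
  apply/esym/cvg_lim => //; apply: cvg_near_cst.
  have [t0|t0] := leP t 0; first by apply: nearW => N; rewrite /g fneg// mul0r.
  near=> N; rewrite /g indicE mem_set ?mulr1// /I /= in_itv/=; apply/andP; split.
    rewrite invf_ple ?posrE//; apply: (@le_trans _ _ N%:R); last by rewrite ler_nat; lia.
    by near: N; exact: nbhs_infty_ger.
  apply: (@le_trans _ _ N%:R); last by rewrite ler_nat; lia.
  by near: N; exact: nbhs_infty_ger.
under eq_integral do rewrite lim.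
have := @cvg_monotone_convergence _ _ _ la setT measurableT g mg g0 ndg.
move=> /cvge_to_le; apply; apply: nearW => N.
apply: le_trans (HC N); rewrite [leRHS]integral_mkcond le_eqVlt; apply/orP; left; apply/eqP.
apply: eq_integral => t _; rewrite patchE /g indicE /I.
by case: (t \in _); rewrite ?mulr1 ?mulr0.
Unshelve. all: by end_near. Qed.

(** The derivative of -1/(1 + t^a) on t > 0: an explicit integrable majorant that behaves like
    t^(a-1) at 0 and t^(-a-1) at infinity. *)
Definition bpow a t : R := hl t * (a * t `^ (a - 1) / (1 + t `^ a) ^+ 2).

Lemma bpow_ge0 a t : 0 <= a -> 0 <= bpow a t.
Proof.
move=> a0; rewrite /bpow /hl; case: (0 < t) => /=; rewrite ?mul0r// mul1r.
by apply: divr_ge0; [apply: mulr_ge0 => //; exact: powR_ge0|exact: sqr_ge0].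
Qed.

Lemma measurable_bpow a : measurable_fun setT (bpow a : measurableTypeR R -> R).
Proof.
apply: measurable_funM; first exact: measurable_hl.
apply: measurable_funM; first by apply: measurable_funM => //; exact: measurable_powR.
have -> : (fun t => ((1 + t `^ a) ^+ 2)^-1) = (fun y => y `^ -1) \o (fun t : R => (1 + t `^ a) ^+ 2).
  by apply/funext => t /=; rewrite powR_inv1// sqr_ge0.
apply: (measurableT_comp (measurable_powR _)); apply: measurable_funX.
by apply: measurable_funD => //; exact: measurable_powR.
Qed.

Lemma bpow_intg a : 0 < a -> intg la (bpow a : measurableTypeR R -> R).
Proof.
move=> a0; apply: intg_ge0; [exact: measurable_bpow|by move=> t; apply: bpow_ge0; exact: ltW|].
apply: (@le_lt_trans _ _ (1%:E)%E); last by rewrite ltry.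
have den t : 0 < 1 + t `^ a by rewrite ltr_pwDl// powR_ge0.
pose H t : R := - (1 + t `^ a)^-1.
have dH t : 0 < t -> is_derive t (1 : R) H (a * t `^ (a - 1) / (1 + t `^ a) ^+ 2).
  move=> t0.
  have d1 := is_deriveD (is_derive_cst (1 : R) t 1) (is_derive1_powR a t0).
  have n0 : (cst (1 : R) + (@powR R)^~ a) t != 0 by rewrite gt_eqF//; exact: den.
  have D := is_deriveN (@is_deriveV R _ t _ 1 n0 d1).
  rewrite (_ : a * t `^ (a - 1) / (1 + t `^ a) ^+ 2 = - (- (1 + t `^ a) ^- 2 * (0 + a * t `^ (a - 1)))); first exact: D.
  by rewrite add0r mulNr opprK mulrC.
apply: ge0_exhaust_le; [exact: measurable_bpow|by move=> t; apply: bpow_ge0; exact: ltW| |].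
  by move=> t t0; rewrite /bpow /hl ltNge t0 mul0r.
move=> N; have i0 : 0 < N.+2%:R^-1 :> R by rewrite invr_gt0.
have ab : N.+2%:R^-1 < N.+2%:R :> R.
  by apply: (@lt_trans _ _ 1); rewrite ?invf_lt1// ltr1n.
under eq_integral => t.
  rewrite inE /= in_itv/= => /andP[h _]; rewrite /bpow /hl (lt_le_trans i0 h) mul1r; over.
rewrite (ftc2 i0 ab dH).
  rewrite lee_fin /H opprK.
  have : 0 <= (1 + N.+2%:R `^ a : R)^-1 by rewrite invr_ge0 ltW.
  have : (1 + N.+2%:R^-1 `^ a : R)^-1 <= 1 by rewrite invf_le1// lerDl powR_ge0.
  by lra.
move=> t t0; apply: cvgM; first by apply: cvgM; [exact: cvg_cst|exact: powR_cont].
apply: cvgV; first by rewrite gt_eqF// exprn_gt0.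
have c1 : {for t, continuous (fun t : R => 1 + t `^ a)} by apply: cvgD; [exact: cvg_cst|exact: powR_cont].
by under eq_fun do rewrite expr2; rewrite expr2; apply: cvgM.
Qed.

Lemma powR_le1D t a : 0 <= t -> 0 <= a <= 1 -> t `^ a <= 1 + t.
Proof.
move=> t0 /andP[a0 a1]; have [t1|t1] := leP 1 t.
  by apply: le_trans (ler1_powR t1 a1) _; rewrite lerDr.
apply: (@le_trans _ _ 1); last by rewrite lerDl.
have := @ge0_ler_powR R a a0 t 1; rewrite !nnegrE powR1; apply => //; exact: ltW.
Qed.

Lemma expR_sq_bound y c : 0 <= y -> 0 < c -> (2 + y) ^+ 2 * expR (- (c * y)) <= (2 + 2 / c) ^+ 2.
Proof.
move=> y0 c0; rewrite expRN ler_pdivrMr ?expR_gt0//.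
have -> : c * y = 2%:R * (c / 2 * y) by field.
have c20 : 0 <= 2 / c by rewrite divr_ge0// ltW.
rewrite expRM_natl -exprMn; apply: lerXn2r.
- by rewrite nnegrE; lra.
- by rewrite nnegrE; apply: mulr_ge0; [lra|exact: expR_ge0].
apply: (@le_trans _ _ ((2 + 2 / c) * (1 + c / 2 * y))); last by apply: ler_wpM2l; [lra|exact: expR_ge1Dx].
have -> : (2 + 2 / c) * (1 + c / 2 * y) = 2 + y + (2 / c + c * y) by field; rewrite gt_eqF.
by rewrite lerDl addr_ge0// mulr_ge0// ltW.
Qed.

Definition wt (s t : R) : R := hl t * (t `^ (1 + s))^-1.

Lemma wt_ge0 s t : 0 <= wt s t.
Proof. by rewrite /wt /hl; case: (0 < t) => /=; rewrite ?mul0r// mul1r invr_ge0 powR_ge0. Qed.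

Lemma measurable_wt s : measurable_fun setT (wt s : measurableTypeR R -> R).
Proof.
apply: measurable_funM; first exact: measurable_hl.
have -> : (fun t : R => (t `^ (1 + s))^-1) = (fun t : R => t `^ (- (1 + s))) by apply/funext => t; rewrite powRN.
exact: measurable_powR.
Qed.

Lemma measurable_wt_exp s c :
  measurable_fun setT ((fun t => wt s t * expR (- (c / t))) : measurableTypeR R -> R).
Proof.
rewrite (_ : (fun t => _) = fun t => wt s t * expR (- (c * t `^ (-1)))).
  apply: measurable_funM; first exact: measurable_wt.
  apply: measurableT_comp => //; apply: measurableT_comp => //; exact: measurable_funM.
apply/funext => t; rewrite /wt /hl; case: (ltP 0 t) => t0 /=; last by rewrite !mul0r.
by rewrite powR_inv1// ltW.
Qed.

(** Comparison with [bpow s]: for P = t^s the ratio is, up to a constant, (1 + 1/P)^2 exp(-c/t), and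
    it is bounded because 1/P <= 1 + 1/t. *)
Lemma wt_intg s c : 0 < s < 1 -> 0 < c -> intg la ((fun t => wt s t * expR (- (c / t))) : measurableTypeR R -> R).
Proof.
move=> /andP[s0 s1] c0; pose K := (2 + 2 / c) ^+ 2 / s.
apply: (@intg_le _ _ _ _ _ (fun t : measurableTypeR R => K * bpow s t)); last by apply: (intgZ K); exact: bpow_intg.
  exact: measurable_wt_exp.
move=> t; rewrite ger0_norm; last by apply: mulr_ge0; [exact: wt_ge0|exact: expR_ge0].
rewrite /wt /bpow /hl; case: (ltP 0 t) => t0 /=; last by rewrite !mul0r mulr0.
rewrite !mul1r; have p0 : 0 < t `^ s by rewrite powR_gt0.
have tn (b : bool) : b ==> (t != 0) by rewrite gt_eqF// implybT.
have e1 : (t `^ (1 + s))^-1 = (t * t `^ s)^-1 by rewrite (powRD (tn _)) powRr1// ltW.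
have e2 : t `^ (s - 1) = t `^ s / t by rewrite (powRD (tn _)) powR_inv1// ltW.
have ti0 : 0 <= t^-1 by rewrite invr_ge0 ltW.
have B := expR_sq_bound ti0 c0.
have ps : (t `^ s)^-1 <= 1 + t^-1.
  rewrite -powRN; have := @powR_le1D (t^-1) s; rewrite invr_ge0 (ltW t0) (ltW s0) (ltW s1) => /(_ isT isT).
  have <- : t^-1 `^ s = t `^ (- s) by rewrite -[t^-1]powR_inv1 ?(ltW t0)// -powRrM mulN1r.
  by [].
rewrite e1 e2 /K; set P := t `^ s in p0 ps *.
have ps0 : 0 < P^-1 by rewrite invr_gt0.
have E : (1 + P^-1) ^+ 2 * expR (- (c / t)) <= (2 + 2 / c) ^+ 2.
  apply: le_trans B; apply: ler_wpM2r; first exact: expR_ge0.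
  by apply: lerXn2r; rewrite ?nnegrE; [rewrite addr_ge0// ltW|rewrite addr_ge0// invr_ge0 ltW|lra].
have -> : (2 + 2 / c) ^+ 2 / s * (s * (P / t) / (1 + P) ^+ 2) = (2 + 2 / c) ^+ 2 * ((P / t) / (1 + P) ^+ 2).
  by field; rewrite !gt_eqF ?addr_gt0.
have -> : (t * P)^-1 * expR (- (c / t)) = (1 + P^-1) ^+ 2 * expR (- (c / t)) * ((P / t) / (1 + P) ^+ 2).
  by field; rewrite !gt_eqF ?addr_gt0.
by apply: ler_wpM2r => //; rewrite !divr_ge0 ?sqr_ge0// ltW.
Qed.

(** Positivity allows the constant of the fractional kernel to be cancelled. Integrability has to
    come first, because the real-valued integral is 0 by convention when the integral is infinite;
    then a zero integral would make [1, 2] negligible. *)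
Lemma Gamma_gt0 a : 0 < a < 1 -> 0 < Gamma a.
Proof.
move=> /andP[a0 a1]; rewrite /Gamma Rint_hl.
pose f t : R := hl t * (t `^ (a - 1) * expR (- t)).
have f0 t : 0 <= f t by rewrite /f /hl; case: (0 < t) => /=; rewrite ?mul0r// mul1r mulr_ge0 ?powR_ge0 ?expR_ge0.
have fi : intg la (f : measurableTypeR R -> R).
  apply: (@intg_le _ _ _ _ _ (fun t : measurableTypeR R => (2 + 2 / 1) ^+ 2 / a * bpow a t)); last by apply: intgZ; exact: bpow_intg.
    apply: measurable_funM; first exact: measurable_hl.
    apply: measurable_funM; first exact: measurable_powR.
    by apply: measurableT_comp => //.
  move=> t; rewrite ger0_norm// /f /bpow /hl; case: (ltP 0 t) => t0 /=; last by rewrite !mul0r mulr0.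
  rewrite !mul1r; have B := expR_sq_bound (ltW t0) (@ltr01 R); rewrite mul1r in B.
  have p0 : 0 <= t `^ a by rewrite powR_ge0.
  have pt : t `^ a <= 1 + t by apply: powR_le1D; rewrite ?(ltW t0) ?(ltW a0) ?(ltW a1).
  have E : (1 + t `^ a) ^+ 2 * expR (- t) <= (2 + 2 / 1) ^+ 2.
    apply: le_trans B; apply: ler_wpM2r; first exact: expR_ge0.
    by apply: lerXn2r; rewrite ?nnegrE; move: (t `^ a) p0 pt t0 => P p0 pt t0; lra.
  move: p0 E; set P := t `^ a; set Q := t `^ (a - 1) => p0 E.
  have -> : Q * expR (- t) = (1 + P) ^+ 2 * expR (- t) * (Q / (1 + P) ^+ 2) by field; rewrite gt_eqF// ltr_pwDl.
  rewrite [leRHS](_ : _ = (2 + 2 / 1) ^+ 2 * (Q / (1 + P) ^+ 2)); last by field; rewrite !gt_eqF// ltr_pwDl.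
  by apply: ler_wpM2r => //; rewrite divr_ge0 ?sqr_ge0// powR_ge0.
rewrite lt_neqAle Rint_ge0// andbT; apply/eqP => I0.
have [N [mN N0 HN]] := Rint_eq0_ae fi f0 (esym I0).
have sub : `[1, 2]%classic `<=` N.
  move=> t; rewrite /= in_itv/= => /andP[h1 h2]; apply: HN => /=; rewrite /f /hl (lt_le_trans ltr01 h1) mul1r.
  by apply/eqP; rewrite mulf_neq0// gt_eqF ?expR_gt0// powR_gt0// (lt_le_trans ltr01 h1).
have le := le_measure la (mem_set (measurable_itv `[(1 : R), 2])) (mem_set mN) sub.
have I1 : la `[(1 : R), 2]%classic = 1%E.
  by have := @lebesgue_measure_itv R `[1, 2]; rewrite /= lte_fin ltr1n -EFinD => ->; congr EFin; lra.
have N0' : la N = 0%E := N0.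
have : (1%:E <= 0%:E :> \bar R)%E by rewrite -[X in (X <= _)%E]I1 -[X in (_ <= X)%E]N0'.
by rewrite lee_fin ler10.
Qed.

End half_line.

(* The library's sigma-finite instance on [m1 \x m2] is shadowed by the one for
   subprobability measures, whence the alias. *)
Section product_sigma_finite.
Context d1 d2 (T1 : measurableType d1) (T2 : measurableType d2) (R : realType).
Variable m1 : {sigma_finite_measure set T1 -> \bar R}.
Variable m2 : {sigma_finite_measure set T2 -> \bar R}.

Definition prodm : set (T1 * T2) -> \bar R := (m1 \x m2)%E.

HB.instance Definition _ := Measure.copy prodm (m1 \x m2)%E.

Let prodm_sigma_finite : sigma_finite setT prodm.
Proof.
have /sigma_finiteP[F [TF ndF Foo]] := sigma_finiteT m1.
have /sigma_finiteP[G [TG ndG Goo]] := sigma_finiteT m2.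
exists (fun k => F k `*` G k).
  apply/seteqP; split => // -[x y] _.
  have [i _ Fx] : (\bigcup_k F k) x by rewrite -TF.
  have [j _ Gy] : (\bigcup_k G k) y by rewrite -TG.
  exists (maxn i j) => //; split.
    by move: x Fx; exact/subsetPset/ndF/leq_maxl.
  by move: y Gy; exact/subsetPset/ndG/leq_maxr.
move=> k; have [? ?] := Foo k; have [? ?] := Goo k; split; first exact: measurableX.
by rewrite /prodm product_measure1E// lte_mul_pinfty// ge0_fin_numE.
Qed.

HB.instance Definition _ := Measure_isSigmaFinite.Build _ _ _ prodm prodm_sigma_finite.

End product_sigma_finite.

Section product_integrals.
Context d1 d2 (T1 : measurableType d1) (T2 : measurableType d2) (R : realType).
Variable m1 : {sigma_finite_measure set T1 -> \bar R}.
Variable m2 : {sigma_finite_measure set T2 -> \bar R}.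

Lemma prod_intg (f : T1 * T2 -> R) (h : T1 -> R) : measurable_fun setT f -> intg m1 h ->
  {ae m1, forall x, intg m2 (fun y => f (x, y)) /\ \int[m2]_y `|f (x, y)| <= h x} ->
  intg (m1 \x m2)%E f.
Proof.
move=> mf ih H; have mF : measurable_fun setT (EFin \o f) by exact/measurable_EFinP.
apply/(integrable12ltyP _ _ mF).
apply: (@le_lt_trans _ _ (\int[m1]_x (`|h x|)%:E)%E); last exact: (intg_lty (intg_norm ih)).
apply: ae_ge0_le_integral => //.
- by move=> x _; apply: integral_ge0.
- apply: (measurable_fun_fubini_tonelli_F (abse \o (EFin \o f))) => //=; exact: measurableT_comp.
- exact: (measurable_int m1 (intg_norm ih)).
apply: filterS H => x [ix Hx] _.
have := Rint_EFin (intg_norm ix) => /= <-; rewrite lee_fin; exact: le_trans Hx (ler_norm _).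
Qed.

Lemma prod_Rint (f : T1 * T2 -> R) : intg (m1 \x m2)%E f ->
  (\int[(m1 \x m2)%E]_q f q = \int[m1]_x \int[m2]_y f (x, y)).
Proof.
move=> fi; rewrite /Rintegral -(integral12_prod_meas1 fi); congr fine.
have mF := measurable_fubini_F fi.
apply: ae_eq_integral => //.
  apply/measurable_EFinP; apply: (measurableT_comp _ mF).
  exact: (@fine_measurable R setT).
apply: filterS (ae_integrable1 fi) => x ix _; rewrite /fubini_F /=.
exact/esym/(@Rint_EFin _ _ _ _ (fun y => f (x, y))).
Qed.

Lemma ae_prod (P : set T1) (Q : set T2) : {ae m1, forall x, P x} -> {ae m2, forall y, Q y} ->
  {ae (m1 \x m2)%E, forall q, P q.1 /\ Q q.2}.
Proof.
move=> [N [mN N0 HN]] [M [mM M0 HM]].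
have mX1 : measurable (N `*` [set: T2]) by exact: measurableX.
have mX2 : measurable ([set: T1] `*` M) by exact: measurableX.
exists (N `*` setT `|` setT `*` M); split.
- exact: measurableU.
- apply/eqP; rewrite eq_le measure_ge0 andbT.
  apply: le_trans (measureU2 _ mX1 mX2) _.
  have e1 := product_measure1E m1 m2 mN (@measurableT _ T2).
  have e2 := product_measure1E m1 m2 (@measurableT _ T1) mM.
  rewrite -[leRHS]adde0; apply: leeD; rewrite le_eqVlt; apply/orP; left; apply/eqP.
    by apply: (etrans e1); apply: (etrans (congr1 (fun z => z * m2 setT)%E N0)); exact: mul0e.
  by apply: (etrans e2); apply: (etrans (congr1 (fun z => m1 setT * z)%E M0)); exact: mule0.
- move=> -[x y] /= nPQ; apply: contrapT => nNM; apply: nPQ; split.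
    by apply: contrapT => nP; apply: nNM; left; split => //; exact: HN.
  by apply: contrapT => nQ; apply: nNM; right; split => //; exact: HM.
Qed.

Lemma ae_prod_sections (P : set (T1 * T2)) : measurable P ->
  {ae m1, forall x, {ae m2, forall y, P (x, y)}} -> {ae (m1 \x m2)%E, forall q, P q}.
Proof.
move=> mP H; have mN : measurable (~` P) by exact: measurableC.
exists (~` P); split => //; rewrite /= /product_measure1 -[RHS](integral0 m1 setT).
apply: ae_eq_integral => //; first exact: measurable_fun_xsection.
apply: filterS H => x [M [mM M0 HM]] _ /=.
apply: (subset_measure0 _ mM _ M0); first exact: measurable_xsection.
by move=> y /xsectionP nP; exact: HM.
Qed.

(** The hypothesis lives in the extended reals, where the integral of k(., y) may be infinite, as on
    the diagonal for the fractional kernel. If f0(y) = 0 both integrands vanish, by the convention 0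
    times infinity = 0; otherwise k(., y) is integrable for almost every y and Fubini applies. *)
Lemma fubini_weight (k : T1 * T2 -> R) (f0 : T2 -> R) (h : T1 -> R) :
  measurable_fun setT k -> measurable_fun setT f0 -> intg m1 h ->
  (forall t, intg m2 (fun y => f0 y * k (t, y)) /\ \int[m2]_y `|f0 y * k (t, y)| <= h t) ->
  (\int[m2]_y ((f0 y)%:E * \int[m1]_t (k (t, y))%:E) = 0)%E ->
  intg m1 (fun t => \int[m2]_y (f0 y * k (t, y))) /\
  \int[m1]_t \int[m2]_y (f0 y * k (t, y)) = 0.
Proof.
move=> mk mf0 ih H H0; pose F (q : T1 * T2) := f0 q.2 * k q.
have mF : measurable_fun setT F.
  by apply: measurable_funM => //; apply: (measurableT_comp mf0); exact: measurable_snd.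
have iF : intg (m1 \x m2)%E F by apply: (prod_intg mF ih); apply: aeW => t; exact: H.
split.
  apply: (intg_le _ _ ih).
    exact: (measurableT_comp (@fine_measurable R setT measurableT) (measurable_fubini_F iF)).
  by move=> t; have [it Ht] := H t; apply: le_trans (Rint_norm it) Ht.
have <- := prod_Rint iF; rewrite /Rintegral -(integral21_prod_meas1 iF) -[RHS]/(fine 0%:E).
congr fine; rewrite -[RHS]H0; apply: ae_eq_integral => //.
- exact: (measurable_fubini_G iF).
- apply: emeasurable_funM; first exact/measurable_EFinP.
  have mk' : measurable_fun setT (EFin \o k) by exact/measurable_EFinP.
  rewrite (_ : (fun y => _) = fun y => (\int[m1]_t ((EFin \o k)^\+ (t, y)) - \int[m1]_t ((EFin \o k)^\- (t, y)))%E).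
    apply: emeasurable_funB.
      by apply: measurable_fun_fubini_tonelli_G => //; exact: measurable_funepos.
    by apply: measurable_fun_fubini_tonelli_G => //; exact: measurable_funeneg.
  by apply/funext => y; rewrite integralE; congr (_ - _)%E; apply: eq_integral => t _; rewrite ?funeposE ?funenegE.
apply: filterS (ae_integrable2 iF) => y iy _; rewrite /fubini_G /=.
have [f00|f00] := eqVneq (f0 y) 0.
  by under eq_integral do rewrite /F /= f00 mul0r; rewrite integral0 f00 mul0e.
have iky : intg m1 (fun t => k (t, y)).
  have := intgZ (f0 y)^-1 iy; apply: eq_intg => t.
  by rewrite /F /= mulrA mulVf// mul1r.
rewrite -(@integralZl _ _ _ m1 _ measurableT (fun t => (k (t, y))%:E) iky (f0 y)).
by apply: eq_integral => t _; rewrite /F EFinM.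
Qed.

End product_integrals.

Section pairing.
Context {R : realType} {n : nat}.
Local Notation V := 'rV[R]_n.
Local Notation la := (@lebesgue_measure R).
Implicit Types (f g a b : V -> R).
Variable A : V -> 'M[R]_n.
Hypothesis Abd : bounded_entries A.
Hypothesis Asm : smooth_entries A.
Variable Lambda : R.
Hypothesis L0 : 0 < Lambda.
Hypothesis Aell : elliptic A Lambda.
Variable E : set (measurableTypeR R) -> (V -> R) -> V -> R.
Hypothesis hres : spectral_resolution (div_op A) E.
Variable p : R -> V -> V -> R.
Hypothesis hp : is_heat_kernel A p.
Local Notation pol := (polar hres.1).
Let heat_bfc' := (heat_kernel_bfc Abd Asm L0 Aell hres hp).

Definition pk (tq : measurableTypeR R * (V * V)) : R := hl tq.1 * p tq.1 tq.2.1 tq.2.2.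

Lemma measurable_pk : measurable_fun setT pk.
Proof.
have [mp _ _] := hp.
have mD : measurable ((`]0, +oo[ : set (measurableTypeR R)) `*` [set: V * V]).
  by apply: measurableX => //; exact: measurable_itv.
have := (measurable_restrictT _ mD).1 mp; congr measurable_fun.
apply/funext => -[t q]; rewrite patchE /pk /= hl_indic indicE.
have -> : ((t, q) \in `]0, +oo[ `*` [set: V * V]) = (t \in (`]0, +oo[%classic : set R)).
  by apply/idP/idP => [/set_mem[/= h _]|/set_mem h]; apply/mem_set.
by case: (t \in _); rewrite ?mul1r ?mul0r.
Qed.

Lemma measurable_pt t : 0 < t -> measurable_fun setT (fun q : V * V => p t q.1 q.2).
Proof.
move=> t0; have := measurableT_comp measurable_pk (@measurable_pair1 _ _ (measurableTypeR R) (V * V)%type t).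
by congr measurable_fun; apply/funext => q; rewrite /pk /= /hl t0 mul1r.
Qed.

(** Nonnegativity of the kernel identifies the integral of the absolute values with the heat form of
    |a| and |b|; this makes the double integral absolutely convergent and supplies the domination
    needed for Fubini in t. *)
Lemma heat_form t a b : 0 < t -> L2 a -> L2 b ->
  [/\ intg (mu \x mu)%E (fun q => a q.1 * b q.2 * p t q.1 q.2),
      \int[(mu \x mu)%E]_q (a q.1 * b q.2 * p t q.1 q.2) = pol (ep t) b a &
      \int[(mu \x mu)%E]_q `|a q.1 * b q.2 * p t q.1 q.2| = pol (ep t) (fun x => `|b x|) (fun x => `|a x|)].
Proof.
move=> t0; have mpt := measurable_pt t0.
have main a' b' : L2 a' -> L2 b' ->
    intg (mu \x mu)%E (fun q => a' q.1 * b' q.2 * p t q.1 q.2) /\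
    \int[(mu \x mu)%E]_q (a' q.1 * b' q.2 * p t q.1 q.2) = pol (ep t) b' a'.
  move=> La Lb.
  have [hL2 hin] := heat_bfc' t0 Lb; have [kL2 _] := heat_bfc' t0 (L2_norm Lb).
  have [_ _ /(_ t b' t0 Lb)[ib _]] := hp.
  have mf : measurable_fun setT (fun q : V * V => a' q.1 * b' q.2 * p t q.1 q.2).
    apply: measurable_funM => //; apply: measurable_funM.
      by apply: (measurableT_comp (L2_meas La)); exact: measurable_fst.
    by apply: (measurableT_comp (L2_meas Lb)); exact: measurable_snd.
  have ifq : intg (mu \x mu)%E (fun q => a' q.1 * b' q.2 * p t q.1 q.2).
    apply: (prod_intg mf (L2M (L2_norm La) kL2)).
    apply: filterS2 (heat_kernel_ge0 Abd Asm L0 Aell hres hp t0) ib => x px ix.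
    have e y : a' x * (p t x y * b' y) = a' x * b' y * p t x y by ring.
    have ix' := eq_intg e (@intgZ _ _ _ _ (a' x) (fun y => p t x y * b' y) ix); split => //.
    rewrite /heat -RintZ; last first.
      apply: (@intg_ae _ _ _ mu (fun y => `|p t x y * b' y|)); last exact: intg_norm.
        apply: measurable_funM; last by apply: L2_meas; exact: L2_norm.
        exact: (measurableT_comp mpt (measurable_pair1 x)).
      by apply: filterS px => y py; rewrite normrM (ger0_norm py).
    rewrite le_eqVlt; apply/orP; left; apply/eqP; apply: Rint_ae.
    - exact: (intg_meas (intg_norm ix')).
    - apply: measurable_funM => //; apply: measurable_funM; last by apply: L2_meas; exact: L2_norm.
      exact: (measurableT_comp mpt (measurable_pair1 x)).
    - by apply: filterS px => y py; rewrite !normrM (ger0_norm py) -mulrA (mulrC `|b' y|).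
  split=> //; rewrite (prod_Rint ifq)/= -hin// innerC; apply: Rint_ae.
  - have := measurable_fubini_F ifq => mF.
    exact: (measurableT_comp (@fine_measurable R setT _) mF).
  - by apply: measurable_funM; exact: L2_meas.
  apply: filterS ib => x ix; rewrite /heat -RintZ//.
  by apply: eq_Rintegral => y _; ring.
move=> La Lb; have [i1 e1] := main a b La Lb; split=> //.
have [i2 <-] := main _ _ (L2_norm La) (L2_norm Lb).
apply: Rint_ae; [exact: (intg_meas (intg_norm i1))|exact: (intg_meas i2)|].
have mP : measurable [set q : V * V | 0 <= p t q.1 q.2].
  have := mpt measurableT _ (@measurable_itv R `[0, +oo[); rewrite setTI.
  by congr measurable; apply/seteqP; split => q /=; rewrite in_itv/= andbT.
have := ae_prod_sections mP (heat_kernel_ge0 Abd Asm L0 Aell hres hp t0).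
apply: filterS => q pq; by rewrite !normrM (ger0_norm pq).
Qed.

(** Since u phi = 0, the product (u(x) - u(z)) (phi(x) - phi(z)) is -(u(x) phi(z) + phi(x) u(z)),
    whose integral against p_t is -2 <exp(-tL) u, phi>. The decay assumed for |u| and |phi| makes
    the slices integrable against t^(-1-s), so the order of integration may be exchanged. *)
Lemma fractional_moment0 (s c C : R) (u phi : V -> R) : 0 < s < 1 -> 0 < c -> L2 u -> L2 phi ->
  {ae mu, forall x, u x * phi x = 0} -> frac_pairing p s u phi = 0%E ->
  (forall t, 0 < t -> pol (ep t) (fun x => `|u x|) (fun x => `|phi x|) <= C * expR (- (c / t))) ->
  \int[la]_t (wt s t * pol (ep t) u phi) = 0.
Proof.
move=> s01 c0 Lu Lphi up0 fp0 HC.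
pose k (tq : measurableTypeR R * (V * V)) := wt s tq.1 * pk tq.
pose G : R := `|GammaN s|^-1.
have G0 : 0 < G.
  have /andP[s0 s1] := s01; rewrite invr_gt0 normr_gt0 /GammaN oppr_eq0 mulf_neq0//.
    by rewrite gt_eqF// Gamma_gt0//; lra.
  by rewrite invr_eq0 gt_eqF.
pose f0 (q : V * V) := G * ((u q.1 - u q.2) * (phi q.1 - phi q.2)).
have mu1 (g : V -> R) : L2 g -> measurable_fun setT (fun q : V * V => g q.1).
  by move=> Lg; apply: (measurableT_comp (L2_meas Lg)); exact: measurable_fst.
have mu2 (g : V -> R) : L2 g -> measurable_fun setT (fun q : V * V => g q.2).
  by move=> Lg; apply: (measurableT_comp (L2_meas Lg)); exact: measurable_snd.
have mk : measurable_fun setT k.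
  apply: measurable_funM; last exact: measurable_pk.
  by apply: (measurableT_comp (measurable_wt s)); exact: measurable_fst.
have mf0 : measurable_fun setT f0.
  by apply: measurable_funM => //; apply: measurable_funM; apply: measurable_funB; [exact: mu1|exact: mu2|exact: mu1|exact: mu2].
have ae0 : {ae (mu \x mu)%E, forall q : V * V, f0 q = - G * (u q.1 * phi q.2 + phi q.1 * u q.2)}.
  by apply: filterS (ae_prod up0 up0) => q [/= h1 h2]; rewrite /f0 mulNr -mulrN; congr (_ * _); lra.
have slice t : intg (mu \x mu)%E (fun q => f0 q * k (t, q)) /\
    \int[(mu \x mu)%E]_q (f0 q * k (t, q)) = - (2 * G) * (wt s t * pol (ep t) u phi) /\
    \int[(mu \x mu)%E]_q `|f0 q * k (t, q)| <= 2 * G * C * (wt s t * expR (- (c / t))).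
  have [t0|t0] := leP t 0.
    have w0 : wt s t = 0 by rewrite /wt /hl ltNge t0 mul0r.
    have e q : 0 = f0 q * k (t, q) by rewrite /k /= w0 mul0r mulr0.
    rewrite w0 !mul0r !mulr0; split; first exact: (eq_intg e (intg0 _)).
    split; [under eq_Rintegral do rewrite -e|under eq_Rintegral do rewrite -e normr0].
      by rewrite /Rintegral integral0.
    by rewrite /Rintegral integral0.
  have [i1 e1 n1] := heat_form t0 Lu Lphi; have [i2 e2 n2] := heat_form t0 Lphi Lu.
  have La := L2_norm Lu; have Lb := L2_norm Lphi; have be := bdd_ep (ltW t0).
  have ik := intgZ (- (G * wt s t)) (intgD i1 i2).
  have kae : {ae (mu \x mu)%E, forall q : V * V, - (G * wt s t) * (u q.1 * phi q.2 * p t q.1 q.2 + phi q.1 * u q.2 * p t q.1 q.2) = f0 q * k (t, q)}.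
    by apply: filterS ae0 => q ->; rewrite /k /pk /= /hl t0 mul1r; ring.
  have mfk : measurable_fun setT (fun q => f0 q * k (t, q)).
    by apply: measurable_funM => //; apply: (measurableT_comp mk); exact: measurable_pair1.
  have ifk := intg_ae mfk kae ik; split=> //; split.
    rewrite -(Rint_ae (intg_meas ik) mfk kae) RintZ; last exact: intgD.
    rewrite RintD// e1 e2 (polC hres.1 Lphi Lu be); ring.
  have nae : {ae (mu \x mu)%E, forall q : V * V, `|f0 q * k (t, q)| = `|- (G * wt s t) * (u q.1 * phi q.2 * p t q.1 q.2 + phi q.1 * u q.2 * p t q.1 q.2)|}.
    by apply: filterS kae => q ->.
  rewrite (Rint_ae (intg_meas (intg_norm ifk)) (intg_meas (intg_norm ik)) nae).
  have gw0 : 0 <= G * wt s t by apply: mulr_ge0; [exact: ltW|exact: wt_ge0].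
  have isum := intgD (intg_norm i1) (intg_norm i2).
  apply: (@le_trans _ _ (\int[(mu \x mu)%E]_q (G * wt s t * (`|u q.1 * phi q.2 * p t q.1 q.2| + `|phi q.1 * u q.2 * p t q.1 q.2|)))).
    apply: Rint_le; [exact: intg_norm|exact: intgZ|].
    move=> q; rewrite normrM normrN (ger0_norm gw0); apply: ler_wpM2l => //.
    exact: ler_normD.
  rewrite RintZ// RintD; [|exact: intg_norm..].
  rewrite n1 n2 (polC hres.1 Lb La be).
  have := ler_wpM2l gw0 (HC t t0); set X := pol _ _ _; set Y := expR _ => h.
  by rewrite -mulr2n -mulr_natl; lra.
have Ik q : (\int[la]_(t in `]0%R, +oo[) (p t q.1 q.2 / t `^ (1 + s))%:E = \int[la]_t (k (t, q))%:E)%E.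
  rewrite integral_mkcond; apply: eq_integral => t _; rewrite patchE /k /pk /wt /=.
  have -> : (t \in (`]0, +oo[%classic : set R)) = (0 < t) by apply/idP/idP => [/set_mem|h]; [|apply/mem_set]; rewrite /= in_itv/= andbT.
  by rewrite /hl; case: (0 < t) => /=; rewrite ?mul0r// !mul1r mulrC.
have I0 : (\int[(mu \x mu)%E]_q ((f0 q)%:E * \int[la]_t (k (t, q))%:E) = 0)%E.
  move: fp0; rewrite /frac_pairing /frac_kernel => /eqP; rewrite mule_eq0 eqe invr_eq0 pnatr_eq0/= => /eqP <-.
  apply: eq_integral => q _; rewrite Ik muleA -EFinM /f0 mulrC//.
have [||] := @fubini_weight _ _ (measurableTypeR R) (V * V)%type R la (prodm mu mu) k f0 (fun t => 2 * G * C * (wt s t * expR (- (c / t)))) mk mf0 (intgZ (2 * G * C) (wt_intg s01 c0)).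
- by move=> t; have [? [_ ?]] := slice t.
- exact: I0.
move=> ii; under eq_Rintegral => t _ do rewrite (slice t).2.1.
have n0 : - (2 * G) != 0 by rewrite oppr_eq0 mulf_neq0// gt_eqF.
have iw : intg la (fun t : measurableTypeR R => wt s t * pol (ep t) u phi).
  have := intgZ (- (2 * G))^-1 ii; apply: eq_intg => t /=.
  by rewrite (slice t).2.1 mulrA mulVf// mul1r.
by rewrite RintZ// => /eqP; rewrite mulf_eq0 (negPf n0) => /eqP.
Qed.

End pairing.

(** * Moments in time *)

Section moments.
Context {R : realType}.
Local Notation la := (@lebesgue_measure R).
Implicit Types (t : R).

Lemma measurable_hlM (f : R -> R) : (forall t, 0 < t -> {for t, continuous f}) ->
  measurable_fun setT ((fun t => hl t * f t) : measurableTypeR R -> R).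
Proof.
move=> cf; have oI : open (`]0, +oo[%classic : set R) by exact: interval_open.
have mf : measurable_fun (`]0, +oo[%classic : set (measurableTypeR R)) (f : measurableTypeR R -> R).
  apply: (@open_continuous_measurable_fun R _ f oI) => t /set_mem; rewrite /= in_itv/= andbT; exact: cf.
have := (measurable_restrictT _ (@measurable_itv R `]0, +oo[)).1 mf; congr measurable_fun.
apply/funext => t; rewrite patchE hl_indic indicE.
by case: (t \in _); rewrite ?mul1r ?mul0r.
Qed.

Lemma ibp_upto (G D : R -> R) (T : R) : 0 < T -> (forall t, 0 < t -> is_derive t (1 : R) G (D t)) ->
  (forall t, 0 < t -> {for t, continuous D}) -> intg la (fun t : measurableTypeR R => hl t * D t) ->
  G N.+2%:R^-1 @[N --> \oo] --> (0 : R) ->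
  \int[la]_t ((t <= T)%R%:R * (hl t * D t)) = G T.
Proof.
move=> T0 dG cD iD G0.
pose I (N : nat) : set R := `[N.+2%:R^-1, T]%classic.
pose f_ (N : nat) (t : measurableTypeR R) := \1_(I N) t * (hl t * D t).
have i0 (N : nat) : 0 < N.+2%:R^-1 :> R by rewrite invr_gt0.
have mf N : measurable_fun setT (f_ N).
  by apply: measurable_funM; [apply: measurable_indic; exact: measurable_itv|exact: (intg_meas iD)].
have fcvg t : f_ N t @[N --> \oo] --> (t <= T)%R%:R * (hl t * D t).
  apply: cvg_near_cst; have [t0|t0] := leP t 0.
    by apply: nearW => N; rewrite /f_ /hl ltNge t0 mul0r !mulr0.
  near=> N; rewrite /f_ indicE; congr (_%:R * _).
  have tN : N.+2%:R^-1 <= t.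
    rewrite invf_ple ?posrE//; apply: (@le_trans _ _ N%:R); last by rewrite ler_nat; lia.
    by near: N; exact: nbhs_infty_ger.
  by congr nat_of_bool; apply/idP/idP => [/set_mem|h]; [|apply/mem_set]; rewrite /I /= in_itv/= tN.
have fb N t : `|f_ N t| <= `|hl t * D t|.
  rewrite normrM indicE; case: (t \in _); by rewrite ?normr1 ?normr0 ?mul1r ?mul0r.
have [_ lim] := Rint_dct mf fcvg (intg_norm iD) fb.
have eN : \forall N \near \oo, \int[la]_t f_ N t = G T - G N.+2%:R^-1.
  near=> N.
  have NT : N.+2%:R^-1 < T.
    rewrite invf_plt ?posrE//; apply: (@lt_le_trans _ _ N.+1%:R); last by rewrite ler_nat.
    by near: N; exists (Num.truncn T^-1).+1 => // N /= h; apply: (lt_le_trans (truncnS_gt _)); rewrite ler_nat; exact: (leq_trans h (leqnSn N)).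
  rewrite /Rintegral -[RHS]/(fine (G T - G N.+2%:R^-1)%:E) -(ftc2 (i0 N) NT dG cD); congr fine.
  rewrite [RHS]integral_mkcond; apply: eq_integral => t _; rewrite patchE /f_ indicE /I.
  have [/set_mem|] := boolP (t \in _); last by rewrite mul0r.
  by rewrite /= in_itv/= => /andP[h _]; rewrite /hl (lt_le_trans (i0 N) h) !mul1r.
apply: (cvg_unique _ lim); first exact: Rhausdorff.
have : (fun N : nat => G T - G N.+2%:R^-1) @ \oo --> G T - 0 by apply: cvgB => //; exact: cvg_cst.
rewrite subr0; apply: cvg_trans; apply: near_eq_cvg; near=> N; apply/esym; near: N; exact: eN.
Unshelve. all: by end_near. Qed.

Lemma ibp_half_line (G D : R -> R) : (forall t, 0 < t -> is_derive t (1 : R) G (D t)) ->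
  (forall t, 0 < t -> {for t, continuous D}) -> intg la (fun t : measurableTypeR R => hl t * D t) ->
  G N.+2%:R^-1 @[N --> \oo] --> (0 : R) -> G N.+2%:R @[N --> \oo] --> (0 : R) ->
  \int[la]_t (hl t * D t) = 0.
Proof.
move=> dG cD iD G0 Goo.
have mt (N : nat) : measurable_fun setT (fun t : measurableTypeR R => (t <= N.+2%:R)%R%:R : R).
  exact: (measurable_fun_ler_cst (N.+2%:R : R) (@measurable_id _ (measurableTypeR R) setT)).
have [|t|N t|_ lim] := @Rint_dct _ _ _ la (fun (N : nat) (t : measurableTypeR R) => (t <= N.+2%:R)%R%:R * (hl t * D t)) (fun t => hl t * D t) _ _ _ (intg_norm iD) _.
- by move=> N; apply: measurable_funM => //; exact: intg_meas iD.
- apply: cvg_near_cst; near=> N; rewrite (_ : t <= N.+2%:R) ?mul1r//.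
  apply: (@le_trans _ _ N%:R); last by rewrite ler_nat; lia.
  by near: N; exact: nbhs_infty_ger.
- by rewrite normrM; case: (t <= _); rewrite ?normr1 ?normr0 ?mul1r ?mul0r.
apply: (cvg_unique _ lim); first exact: Rhausdorff.
rewrite [X in X @ _](_ : _ = fun N : nat => G N.+2%:R)//; apply/funext => N; exact: (ibp_upto _ dG cD iD G0).
Unshelve. all: by end_near. Qed.

Variable s : R.
Hypothesis s01 : 0 < s < 1.
Variables (T : Type) (F : T -> R -> R) (L : T -> T).
Hypothesis dF : forall f t, 0 < t -> is_derive t (1 : R) (F f) (- F (L f) t).
Hypothesis bF : forall f, exists C c : R, [/\ 0 < c, 0 <= C & forall t, 0 < t -> `|F f t| <= C * expR (- (c / t))].
Hypothesis F0 : forall f, \int[la]_t (wt s t * F f t) = 0.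

Let cF f t : 0 < t -> {for t, continuous (F f)}.
Proof. by move=> t0; apply/differentiable_continuous/derivable1_diffP; have [] := dF f t0. Qed.

(** The integrand of the j-th moment in the variable 1/t. Here f ranges over an abstract family
    stable under L, later the test functions of a ball with [F f t] = <exp(-tL) u, f>. *)
Definition mom j f t := wt s t * t^-1 ^+ j * F f t.

Lemma wt_powR j t : 0 < t -> wt s t * t^-1 ^+ j = t `^ (- (1 + s + j%:R)).
Proof.
move=> t0; have tn (b : bool) : b ==> (t != 0) by rewrite gt_eqF// implybT.
have -> : - (1 + s + j%:R) = - (1 + s) + - j%:R by rewrite opprD.
rewrite (@powRD R t (- (1 + s)) (- j%:R) (tn _)) /wt /hl t0 mul1r -powRN.
by rewrite [t `^ - j%:R]powRN powR_mulrn ?exprVn// ltW.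
Qed.

Lemma mom_bound j f : exists K c : R, [/\ 0 < c, 0 <= K & forall t, `|mom j f t| <= K * (wt s t * expR (- (c / t)))].
Proof.
have [C [c [c0 C0 HC]]] := bF f; have c20 : 0 < c / 2 by rewrite divr_gt0.
exists (C * (j`!%:R / (c / 2) ^+ j)), (c / 2); split=> //.
  by apply: mulr_ge0 => //; apply: divr_ge0 => //; apply: exprn_ge0; exact: ltW.
move=> t; have [t0|t0] := leP t 0; first by rewrite /mom /wt /hl ltNge t0 !mul0r normr0 mulr0.
have ti : 0 <= t^-1 by rewrite invr_ge0 ltW.
rewrite /mom normrM ger0_norm; last by apply: mulr_ge0; [exact: wt_ge0|exact: exprn_ge0].
have rE (a b d e : R) : a * b * (d * e) = d * (a * b * e)  by ring.
rewrite rE -[leLHS]mulrA; apply: ler_wpM2l; first exact: wt_ge0.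
apply: (@le_trans _ _ (j`!%:R / (c / 2) ^+ j * expR (c / 2 * t^-1) * (C * expR (- (c / t))))).
  by apply: ler_pM => //; [exact: exprn_ge0|exact: pow_le_expR|exact: HC].
have -> : - (c / t) = - (c / 2 / t) - c / 2 * t^-1 by field; rewrite gt_eqF.
rewrite expRD [expR (- (c / 2 * t^-1))]expRN.
have := expR_gt0 (c / 2 * t^-1); set X := expR (c / 2 * t^-1); set Y := expR (- (c / 2 / t)); set Z := (_ / _).
by move=> X0; rewrite le_eqVlt; apply/orP; left; apply/eqP; field; rewrite gt_eqF.
Qed.

Lemma mom_meas j f : measurable_fun setT ((mom j f) : measurableTypeR R -> R).
Proof.
rewrite (_ : mom j f = fun t => hl t * (t `^ (- (1 + s + j%:R)) * F f t)).
  by apply: measurable_hlM => t t0; apply: cvgM; [exact: powR_cont|exact: cF].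
apply/funext => t; rewrite /mom; have [t0|t0] := leP t 0; first by rewrite /wt /hl ltNge t0 !mul0r.
by rewrite wt_powR// /hl t0 mul1r.
Qed.

Lemma mom_intg j f : intg la ((mom j f) : measurableTypeR R -> R).
Proof.
have [K [c [c0 K0 HK]]] := mom_bound j f.
by apply: (intg_le (mom_meas j f) HK); apply: intgZ; exact: wt_intg.
Qed.

Let G j f t := F f t * t `^ (- (1 + s + j%:R)).
Let D j f t := F f t * (- (1 + s + j%:R) * t `^ (- (1 + s + j%:R) - 1)) + t `^ (- (1 + s + j%:R)) * - F (L f) t.

Let dG j f t : 0 < t -> is_derive t (1 : R) (G j f) (D j f t).
Proof. by move=> t0; exact: is_deriveM (dF f t0) (is_derive1_powR (- (1 + s + j%:R)) t0). Qed.

Let cD j f t : 0 < t -> {for t, continuous (D j f)}.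
Proof.
move=> t0; apply: cvgD; apply: cvgM.
- exact: cF.
- by apply: cvgM; [exact: cvg_cst|exact: powR_cont].
- exact: powR_cont.
- by apply: cvgN; exact: cF.
Qed.

Let hlD j f t : hl t * D j f t = - (1 + s + j%:R) * mom j.+1 f t - mom j (L f) t.
Proof.
rewrite /mom /D; have [t0|t0] := leP t 0; first by rewrite /wt /hl ltNge t0 !mul0r; ring.
rewrite !wt_powR// /hl t0 mul1r -natr1.
have -> : - (1 + s + (j%:R + 1)) = - (1 + s + j%:R) - 1 by ring.
ring.
Qed.

Let iD j f : intg la (fun t : measurableTypeR R => hl t * D j f t).
Proof.
have e (t : measurableTypeR R) : - (1 + s + j%:R) * mom j.+1 f t - mom j (L f) t = hl t * D j f t by rewrite hlD.
by apply: (eq_intg e); apply: intgB; [apply: intgZ|]; exact: mom_intg.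
Qed.

Let Gbound j f : exists K c : R, [/\ 0 < c, 0 <= K & forall t, 0 < t -> `|G j f t| <= K * (wt s t * expR (- (c / t)))].
Proof.
have [K [c [c0 K0 HK]]] := mom_bound j f; exists K, c; split=> // t t0.
by have := HK t; rewrite /mom wt_powR// mulrC.
Qed.

Let small_cvg (g : nat -> R) (K : R) : (forall N, `|g N| <= K * N.+1%:R^-1) -> g @ \oo --> (0 : R).
Proof.
move=> gK; apply: norm_cvg0; apply: (@squeeze_cvgr _ _ _ _ (cst 0) (fun m : nat => K * m.+1%:R^-1)).
- by apply: nearW => m; rewrite normr_ge0 gK.
- exact: cvg_cst.
- by rewrite -[X in _ --> X](mulr0 K); apply: cvgM; [exact: cvg_cst|exact: cvg_harmonic].
Qed.

Let G0cvg j f : G j f N.+2%:R^-1 @[N --> \oo] --> (0 : R).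
Proof.
have [K [c [c0 K0 HK]]] := Gbound j f; have /andP[s0 s1] := s01.
apply: (@small_cvg _ (K * (3`!%:R / c ^+ 3))) => N.
have i0 : 0 < N.+2%:R^-1 :> R by rewrite invr_gt0.
apply: le_trans (HK _ i0) _; rewrite -mulrA; apply: ler_wpM2l => //.
have m1 : 1 <= N.+2%:R :> R by rewrite ler1n.
have mN : N.+2%:R^-1 <= N.+1%:R^-1 :> R by rewrite lef_pV2 ?posrE// ler_nat.
have -> : wt s N.+2%:R^-1 = N.+2%:R `^ (1 + s).
  by rewrite /wt /hl i0 mul1r -[N.+2%:R^-1]powR_inv1// -powRN -powRrM mulN1r opprK.
have P2 : N.+2%:R `^ (1 + s) <= N.+2%:R ^+ 2 :> R.
  by rewrite -powR_mulrn//; apply: ler_powR => //; lra.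
have E3 := pow_le_expR 3 (le_trans ler01 m1) c0.
rewrite invrK; move: mN m1 P2 E3; set m : R := N.+2%:R; set q : R := N.+1%:R^-1.
set P := m `^ _; set Q : R := _ / _ => mN m1 P2 E3.
have m0 : 0 < m by lra.
have Q0 : 0 <= Q by rewrite /Q divr_ge0// exprn_ge0// ltW.
rewrite expRN ler_pdivrMr ?expR_gt0//.
apply: (le_trans P2); apply: (@le_trans _ _ (Q * m^-1 * expR (c * m))).
  by rewrite mulrAC ler_pdivlMr// -exprSr.
by apply: ler_wpM2r; [exact: expR_ge0|apply: ler_wpM2l].
Qed.

Let Goocvg j f : G j f N.+2%:R @[N --> \oo] --> (0 : R).
Proof.
have [K [c [c0 K0 HK]]] := Gbound j f; have /andP[s0 s1] := s01.
apply: (@small_cvg _ K) => N; have m1 : 1 <= N.+2%:R :> R by rewrite ler1n.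
have m0 : 0 < N.+2%:R :> R by [].
apply: le_trans (HK _ m0) _; apply: ler_wpM2l => //.
apply: (@le_trans _ _ (N.+2%:R^-1 * 1)); last by rewrite mulr1 lef_pV2 ?posrE// ler_nat.
apply: ler_pM; [exact: wt_ge0|exact: expR_ge0| |].
  rewrite /wt /hl m0 mul1r lef_pV2 ?posrE ?powR_gt0//.
  by rewrite -[leLHS]powRr1//; apply: ler_powR => //; lra.
by rewrite -expR0 ler_expR oppr_le0 divr_ge0// ltW.
Qed.

(** The derivative of F(t) t^-(1+s+j) integrates to 0, as F decays like exp(-c/t) at 0 and the power
    decays at infinity. This expresses (1 + s + j) times the moment of order j+1 of f by the moment
    of order j of L f, so the induction must range over all f. *)
Lemma mom_eq0 j f : \int[la]_t mom j f t = 0.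
Proof.
elim: j f => [|j IH] f.
  by rewrite -[RHS](F0 f); apply: eq_Rintegral => t _; rewrite /mom expr0 mulr1.
have := ibp_half_line (@dG j f) (@cD j f) (iD j f) (G0cvg j f) (Goocvg j f).
under eq_Rintegral do rewrite hlD.
rewrite RintB; [|apply: intgZ|]; try exact: mom_intg.
rewrite RintZ; last exact: mom_intg.
rewrite IH subr0 => /eqP; rewrite mulf_eq0 oppr_eq0 => /orP[|/eqP//].
have /andP[s0 _] := s01; rewrite gt_eqF// -addrA addr_gt0// ltr_wpDr//.
Qed.

(** The moment theorem is applied in the variable 1/r to the derivative g of F(r) r^-(1+s) rather
    than to F. The integral of g over r <= t is F(t) t^-(1+s), so the result is pointwise in t. *)
Lemma moments_vanish f t : 0 < t -> F f t = 0.
Proof.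
move=> t0; have /andP[s0 s1] := s01.
pose X (r : measurableTypeR R) : R := hl r * r `^ (-1).
have mX : measurable_fun setT X by apply: measurable_hlM => r r0; exact: powR_cont.
have XE r : 0 < r -> X r = r^-1 by move=> r0; rewrite /X /hl r0 mul1r powR_inv1// ltW.
have X0 r : 0 <= X r by rewrite /X /hl; case: (0 < r); rewrite ?mul0r// mul1r powR_ge0.
pose g (r : measurableTypeR R) : R := hl r * D 0 f r.
have g0 r : r <= 0 -> g r = 0 by move=> r0; rewrite /g /hl ltNge r0 mul0r.
have mg : measurable_fun setT g by exact: intg_meas (iD 0 f).
have [K1 [c1 [c10 K10 H1]]] := mom_bound 1 f; have [K2 [c2 [c20 K20 H2]]] := mom_bound 0 (L f).
(* Half of the decay rate pays for the weight exp(cX); the other half keeps the product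
   integrable. *)
pose c : R := Num.min c1 c2 / 2.
have c0 : 0 < c by rewrite divr_gt0// lt_min c10.
have cmin : [/\ 2 * c <= c1 & 2 * c <= c2].
  by rewrite /c mulrCA divff// mulr1 !ge_min !lexx orbT.
pose K := (1 + s) * K1 + K2.
have gb r : `|g r| <= K * (wt s r * expR (- (2 * c / r))).
  have [r0|r0] := leP r 0; first by rewrite g0// /wt /hl ltNge r0 !mul0r normr0 mulr0.
  rewrite /g hlD addr0; apply: le_trans (ler_normB _ _) _.
  rewrite normrM normrN (ger0_norm (_ : 0 <= 1 + s)); last by lra.
  have mono d : 2 * c <= d -> wt s r * expR (- (d / r)) <= wt s r * expR (- (2 * c / r)).
    move=> cd; apply: ler_wpM2l; first exact: wt_ge0.
    by rewrite ler_expR lerN2; apply: ler_wpM2r => //; rewrite invr_ge0 ltW.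
  have [m1 m2] := cmin; have h1 := mono _ m1; have h2 := mono _ m2.
  rewrite (_ : K * _ = (1 + s) * (K1 * (wt s r * expR (- (2 * c / r)))) + K2 * (wt s r * expR (- (2 * c / r)))); last by rewrite /K; move: (wt s r * _) => Y; ring.
  apply: lerD.
    apply: ler_wpM2l; first by lra.
    by apply: le_trans (H1 r) _; apply: ler_wpM2l.
  by apply: le_trans (H2 r) _; apply: ler_wpM2l.
have ig : intg la (fun r => `|g r| * expR (c * X r)).
  apply: (@intg_le _ _ _ la _ (fun r : measurableTypeR R => K * (wt s r * expR (- (c / r))))); last by apply: intgZ; exact: wt_intg.
    apply: measurable_funM; first exact: measurableT_comp.
    by apply: measurableT_comp => //; exact: measurable_funM.
  move=> r; rewrite ger0_norm ?mulr_ge0 ?expR_ge0//.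
  have [r0|r0] := leP r 0; first by rewrite g0// /wt /hl ltNge r0 !mul0r normr0 mul0r mulr0.
  rewrite XE//; apply: (@le_trans _ _ (K * (wt s r * expR (- (2 * c / r))) * expR (c * r^-1))).
    by apply: ler_wpM2r; [exact: expR_ge0|exact: gb].
  have -> : - (2 * c / r) = - (c / r) - c / r by ring.
  have -> : expR (- (c / r) - c / r) = expR (- (c / r)) * expR (- (c / r)) by rewrite -expRD.
  rewrite [X in _ * (_ * (_ * X)) * _ <= _]expRN.
  have := expR_gt0 (c / r); set Y := expR (c / r); set Z := expR (- _); move: (wt s r) => W Y0.
  by rewrite le_eqVlt; apply/orP; left; apply/eqP; field; rewrite gt_eqF.
have mom k : \int[la]_r (g r * X r ^+ k) = 0.
  have e r : g r * X r ^+ k = - (1 + s) * mom k.+1 f r - mom k (L f) r.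
    have [r0|r0] := leP r 0; first by rewrite g0// /mom /wt /hl ltNge r0 !mul0r; ring.
    rewrite /g hlD XE// /mom addr0 expr1 expr0 exprS; ring.
  under eq_Rintegral do rewrite e.
  rewrite RintB; [|apply: intgZ|]; try exact: mom_intg.
  by rewrite RintZ; [rewrite !mom_eq0 mulr0 subr0|exact: mom_intg].
have ti0 : 0 <= t^-1 by rewrite invr_ge0 ltW.
have := exp_moments_indic c0 mg mX X0 ig mom ti0.
have e r : g r * (t^-1 <= X r)%R%:R = (r <= t)%R%:R * (hl r * D 0 f r).
  have [r0|r0] := leP r 0; first by rewrite g0// /hl ltNge r0 !mul0r mulr0.
  by rewrite XE// lef_pV2 ?posrE// mulrC.
under eq_Rintegral do rewrite e.
rewrite (ibp_upto t0 (@dG 0 f) (@cD 0 f) (iD 0 f) (G0cvg 0 f)) /G => /eqP.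
by rewrite mulf_eq0 [X in _ || X]gt_eqF ?powR_gt0// orbF => /eqP.
Qed.

End moments.

(** * Time derivative of the heat symbol *)

Section exp_quotient.
Context {R : realType}.
Implicit Types (a b m t h l : R).

Lemma expRN_lip m a b : m <= a -> m <= b -> `|expR (- a) - expR (- b)| <= `|a - b| * expR (- m).
Proof.
suff H x y : m <= x -> x <= y -> `|expR (- x) - expR (- y)| <= `|x - y| * expR (- m).
  move=> ma mb; have [ab|/ltW ba] := leP a b; first exact: H.
  by rewrite distrC (distrC a); exact: H.
move=> mx xy; rewrite ger0_norm; last by rewrite subr_ge0 ler_expR lerN2.
rewrite ler0_norm ?subr_le0// opprB.
have -> : expR (- y) = expR (- x) * expR (- (y - x)) by rewrite -expRD; congr expR; ring.
have h1 := expR_ge1Dx (- (y - x)); have h2 : expR (- x) <= expR (- m) by rewrite ler_expR lerN2.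
have h3 := expR_gt0 (- x); move: h1 h2 h3; set P := expR (- (y - x)); set Q := expR (- x); set S := expR (- m).
by move=> h1 h2 h3; nra.
Qed.

(* Cutting off at [|h| <= t / 2] bounds the difference quotient uniformly in [h]. *)
Definition epq t h l : R := if `|h| <= t / 2 then h^-1 * (ep (h + t) l - ep t l) else 0.

(** For |h| <= t/2 both times are at least t/2, so the quotient is at most l exp(-t l/2), and 1 + y
    <= exp y bounds this by 2/t. *)
Lemma epq_bound t h l : 0 < t -> h != 0 -> `|epq t h l| <= 2 / t.
Proof.
move=> t0 h0; have tp : 0 <= 2 / t by rewrite divr_ge0// ltW.
rewrite /epq; case: ifPn => [ht|_]; last by rewrite normr0.
rewrite /ep; case: (ge0_01 l) => [->|[-> l0]]; first by rewrite !mul0r subrr mulr0 normr0.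
rewrite !mul1r (ger0_norm l0).
have [h1 h2] := ler_normlP _ _ ht.
have m1 : t / 2 * l <= (h + t) * l by apply: ler_wpM2r => //; lra.
have m2 : t / 2 * l <= t * l by apply: ler_wpM2r => //; lra.
have H := expRN_lip m1 m2.
have e : (h + t) * l - t * l = h * l by ring.
rewrite e in H; rewrite normrM normfV ler_pdivrMl ?normr_gt0//.
apply: le_trans H _; rewrite normrM -[leLHS]mulrA; apply: ler_wpM2l => //; rewrite ger0_norm//.
rewrite expRN ler_pdivrMr ?expR_gt0//.
apply: (@le_trans _ _ (2 / t * (1 + t / 2 * l))); last by apply: ler_wpM2l => //; exact: expR_ge1Dx.
by rewrite mulrDr mulr1 mulrA (_ : 2 / t * (t / 2) = 1) ?mul1r ?lerDr//; field; rewrite gt_eqF.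
Qed.

Lemma measurable_epq t h : 0 < t -> measurable_fun setT (epq t h : measurableTypeR R -> R).
Proof.
move=> t0; rewrite /epq; case: (_ <= _); last exact: measurable_cst.
by apply: measurable_funM => //; apply: measurable_funB; exact: measurable_ep.
Qed.

Lemma lep_bound t l : 0 < t -> `|l * ep t l| <= 1 / t.
Proof.
move=> t0; rewrite /ep; case: (ge0_01 l) => [->|[-> l0]].
  by rewrite mul0r mulr0 normr0 divr_ge0// ltW.
rewrite mul1r (ger0_norm l0) ger0_norm ?mulr_ge0 ?expR_ge0//.
rewrite expRN ler_pdivrMr ?expR_gt0//.
apply: (@le_trans _ _ (1 / t * (1 + t * l))); last by apply: ler_wpM2l; [rewrite divr_ge0// ltW|exact: expR_ge1Dx].
by rewrite mulrDr mulr1 mulrA div1r mulVf ?gt_eqF// mul1r lerDr invr_ge0 ltW.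
Qed.

Lemma bdd_lep t : 0 < t -> bdd (fun l : R => l * ep t l).
Proof.
move=> t0; split; first by apply: measurable_funM => //; exact: measurable_ep.
by exists (1 / t) => l; exact: lep_bound.
Qed.

Lemma epq_cvg t l (u : nat -> R) : 0 < t -> (forall k, u k != 0) -> u @ \oo --> (0 : R) ->
  epq t (u k) l @[k --> \oo] --> - (l * ep t l).
Proof.
move=> t0 un u0.
suff H : (u k)^-1 * (ep (u k + t) l - ep t l) @[k --> \oo] --> - (l * ep t l).
  move: H; apply: cvg_trans; apply: near_eq_cvg.
  have t20 : 0 < t / 2 by rewrite divr_gt0.
  have := u0; move=> /cvgrPdist_lt/(_ _ t20); apply: filterS => k; rewrite sub0r normrN => h.
  by rewrite /epq ltW.
rewrite /ep; case: (ge0_01 l) => [->|[-> l0]].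
  under eq_fun do rewrite !mul0r subrr mulr0; rewrite mul0r mulr0 oppr0; exact: cvg_cst.
rewrite !mul1r (ger0_norm l0).
pose g (r : R) : R := expR (- (r * l)).
have dg : is_derive t (1 : R) g (- (l * expR (- (t * l)))).
  have d1 : is_derive t (1 : R) (fun r : R => - (r * l)) (- l).
    have := is_deriveN (is_deriveM (is_derive_id t (1 : R)) (is_derive_cst l t (1 : R))).
    by rewrite scaler0 add0r [_ *: 1]mulr1.
  have := @is_derive1_comp R expR (fun r : R => - (r * l)) t _ _ (is_derive_expR (- (t * l))) d1.
  by rewrite mulrN mulrC.
have [/cvg_ex[z Hz] Dz] := dg.
have zE : z = - (l * expR (- (t * l))) by rewrite -Dz; apply/esym/(cvg_lim (@Rhausdorff R) Hz).
have u0' : u @ \oo --> (0 : R)^'.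
  move=> P; rewrite /dnbhs /within => HP; have := u0 _ HP.
  change ((\forall k \near \oo, u k != 0 -> P (u k)) -> \forall k \near \oo, P (u k)).
  by apply: filterS => k; apply.
have c := cvg_comp _ _ u0' Hz; rewrite -zE.
rewrite (_ : (fun k => _) = (fun h : R => h^-1 *: ((g \o shift t) (h *: 1) - g t)) \o u); first exact: c.
by apply/funext => k /=; rewrite /g mul1r [u k *: 1]mulr1.
Qed.

End exp_quotient.

(** * Local vanishing of the spectral truncations *)

Section local_spectral_zero.
Context {R : realType} {n : nat}.
Local Notation V := 'rV[R]_n.
Local Notation la := (@lebesgue_measure R).
Implicit Types (f g phi : V -> R) (t : R).
Variable A : V -> 'M[R]_n.
Hypothesis Abd : bounded_entries A.
Hypothesis Asm : smooth_entries A.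
Variable Lambda : R.
Hypothesis L0 : 0 < Lambda.
Hypothesis Asym : forall x, (A x)^T = A x.
Hypothesis Aell : elliptic A Lambda.
Variable E : set (measurableTypeR R) -> (V -> R) -> V -> R.
Hypothesis hres : spectral_resolution (div_op A) E.
Local Notation pol := (polar hres.1).

(** Differentiation of the symbol produces l exp(-t l), and this factor l, that is L applied to
    exp(-tL) f, is moved to the test function by symmetry. *)
Lemma pol_ep_derive f phi t : 0 < t -> L2 f -> test_function setT phi ->
  is_derive t (1 : R) (fun t => pol (ep t) f phi) (- pol (ep t) f (Lop A phi)).
Proof.
move=> t0 Lf tp; have Lp := tf_L2 tp; have LLp := tf_L2 (tf_Lop Asm tp).
have bl := bdd_lep t0; have be := bdd_ep (ltW t0).
have -> : pol (ep t) f (Lop A phi) = pol (fun l => l * ep t l) f phi.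
  have [h bh] := bfc_ex hres.1 Lf be; have [k bk] := bfc_ex hres.1 Lf bl.
  have hk := bfc_op Lf be bl bh bk.
  by rewrite -bh.2// -bk.2// (div_op_inner Abd Asm Asym hk tp).
suff H : (fun k : R => k^-1 *: (((fun t => pol (ep t) f phi) \o shift t) (k *: (1 : R)) - pol (ep t) f phi)) @ (0 : R)^' -->
    - pol (fun l => l * ep t l) f phi.
  by apply: DeriveDef; [apply: cvgP; exact: H|exact: (cvg_lim (@Rhausdorff R) H)].
apply: seq_cvg_dnbhs => u un u0.
have c : pol (epq t (u k)) f phi @[k --> \oo] --> - pol (fun l => l * ep t l) f phi.
  rewrite -mulN1r -polZ//; apply: (pol_dct (b := fun=> 2 / t)) => //.
  - by move=> N; exact: measurable_epq.
  - by move=> l; rewrite mulN1r; exact: epq_cvg.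
  - by apply: bdd_intg; [exact: L2D|exact: bdd_cst].
  - by apply: bdd_intg; [exact: L2B|exact: bdd_cst].
  - by move=> N l; exact: epq_bound.
move: c; apply: cvg_trans; apply: near_eq_cvg.
have t20 : 0 < t / 2 by rewrite divr_gt0.
have := u0; move=> /cvgrPdist_lt/(_ _ t20); apply: filterS => k; rewrite sub0r normrN => h /=.
have [h1 h2] := ler_normlP _ _ (ltW h).
have -> : epq t (u k) = fun l => (u k)^-1 * ep (u k + t) l + - (u k)^-1 * ep t l.
  by apply/funext => l; rewrite /epq ltW//; ring.
have b1 : bdd (ep (u k + t)) by apply: bdd_ep; lra.
rewrite pol_lin//; last exact: bddZ.
rewrite polZ// -[RHS]/((u k)^-1 * (pol (ep ((u k)%:A + t)) f phi - pol (ep t) f phi)) [(u k)%:A]mulr1.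
by ring.
Qed.

Variable p : R -> V -> V -> R.
Hypothesis hp : is_heat_kernel A p.
Variables (s : R) (O : set V) (u : V -> R) (x1 : V) (r : R).
Hypothesis s01 : 0 < s < 1.
Hypothesis r0 : 0 < r.
Hypothesis BO : eball x1 r `<=` O.
Hypothesis Lu : L2 u.
Hypothesis u0 : {ae mu, forall x, O x -> u x = 0}.
Hypothesis pair0 : forall phi, test_function O phi -> frac_pairing p s u phi = 0%E.

Let B : set V := eball x1 (r / 4).

Let BO' : B `<=` O.
Proof. by move=> x; rewrite /B /eball /= => h; apply: BO; rewrite /eball /=; move: (sqnorm _) h r0 => y; lra. Qed.

(** Equal to 1 up to squared distance r/4, which contains the supports of the test functions used,
    and to 0 beyond r/2, well inside the ball where u vanishes. *)
Let psi : V -> R := cutoff (fun x => 2 - 4 / r * sqnorm (x - x1)).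

Let tf_psi : test_function setT psi.
Proof.
split.
  apply: smooth_cutoff; apply: smoothB; first exact: smooth_cst.
  by apply: smoothM; [exact: smooth_cst|exact: smooth_sqnorm].
exists [set x | sqnorm (x - x1) <= r / 2]; split=> //; first exact: eball_compact.
move=> x /= /negP; rewrite -ltNge => h; apply: cutoff_eq0.
rewrite subr_le0 mulrAC ler_pdivlMr//; move: (sqnorm _) h r0 => y; lra.
Qed.

Let psi_supp : {ae mu, forall x, psi x != 0 -> u x = 0}.
Proof.
apply: filterS u0 => x ux px; apply: ux; apply: BO; rewrite /eball /= ltNge; apply/negP => rx.
move/eqP: px; apply; apply: cutoff_eq0; rewrite subr_le0 mulrAC ler_pdivlMr//; move: (sqnorm _) rx r0 => y; lra.
Qed.

Let psi1 phi : test_function B phi -> forall x, phi x != 0 -> psi x = 1.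
Proof.
move=> [_ [K [_ KB p0]]] x px; have Kx : K x by apply: contrapT => /p0/eqP; rewrite (negPf px).
have := KB _ Kx; rewrite /B /eball /= => h; apply: cutoff_eq1.
suff : 4 / r * sqnorm (x - x1) <= 1 by lra.
by rewrite mulrAC ler_pdivrMr//; move: (sqnorm _) h r0 => y; lra.
Qed.

Let offdiag f g : L2 f -> L2 g -> {ae mu, forall x, psi x != 0 -> f x = 0} ->
  (forall x, g x != 0 -> psi x = 1) -> exists C c : R, [/\ 0 < c, 0 <= C & forall t, 0 < t ->
   `|pol (ep t) f g| <= C * expR (- (c / t))].
Proof.
move=> Lf Lg f0 g1; have [c c0 H] := heat_offdiag Abd Asm L0 Asym Aell hres Lf Lg tf_psi f0 g1.
by exists (Num.sqrt (inner f f * inner g g)), c; split => //; exact: sqrtr_ge0.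
Qed.

(** The moment argument is run on the test functions of the small ball, a family stable under L.
    Passing to |u| and |phi| does not enlarge supports, so the same off-diagonal estimate provides
    the domination for [fractional_moment0]. *)
Lemma heat_form_vanish phi t : test_function B phi -> 0 < t -> pol (ep t) u phi = 0.
Proof.
move=> tphi t0.
pose T := {phi : V -> R | test_function B phi}.
pose F (f : T) t := pol (ep t) u (sval f).
pose L (f : T) : T := exist _ (Lop A (sval f)) (tf_Lop Asm (proj2_sig f)).
apply: (@moments_vanish R s s01 T F L _ _ _ (exist _ phi tphi) t t0) => [f q q0|f|f].
- exact: (pol_ep_derive q0 Lu (tf_setT (proj2_sig f))).
- exact: (offdiag Lu (tf_L2 (proj2_sig f)) psi_supp (psi1 (proj2_sig f))).
have tf := proj2_sig f; have Lf := tf_L2 tf.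
have [|x fx|C [c [c0 C0 H]]] := offdiag (L2_norm Lu) (L2_norm Lf).
- by apply: filterS psi_supp => x ux px; rewrite ux// normr0.
- by apply: (psi1 tf); rewrite normr_eq0 in fx.
have := @fractional_moment0 R n A Abd Asm Lambda L0 Aell E hres p hp s c C u (sval f) s01 c0 Lu Lf (tf_vanish_ae (tf_mono BO' tf) u0) (pair0 (tf_mono BO' tf)).
  apply; by move=> q q0; apply: le_trans (ler_norm _) (H q q0).
Qed.

(** The positive integer times give the vanishing for the powers of exp(-l), and the power 0 is <u,
    phi> = 0 because the supports are disjoint. The factor exp(-k l) makes the statement stable
    under Horner's recursion. *)
Lemma pol_horner_vanish phi (P : {poly R}) : test_function B phi ->
  bdd (fun l => P.[ep 1 l]) /\ forall k, pol (fun l => P.[ep 1 l] * ep 1 l ^+ k) u phi = 0.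
Proof.
move=> tphi; have Lp := tf_L2 tphi; have b1 := @bdd_ep R 1 ler01.
have bX k : bdd (fun l : R => ep 1 l ^+ k).
  elim: k => [|k IH]; first by have := @bdd_cst R 1; congr bdd; apply/funext => l; rewrite expr0.
  by have := bddM b1 IH; congr bdd; apply/funext => l; rewrite exprS.
have pX k : pol (fun l => ep 1 l ^+ k) u phi = 0.
  have mX := (bX k).1; case: k mX => [|k] mX.
    have -> : (fun l : R => ep 1 l ^+ 0) = fun=> 1 by apply/funext => l; rewrite expr0.
    rewrite pol_cst// mul1r; apply: inner_ae0 => //; exact: tf_vanish_ae (tf_mono BO' tphi) u0.
  rewrite -[RHS](@heat_form_vanish phi k.+1%:R tphi)//; apply: (pol_eq_ge0 (div_op_ge0 Abd Asm L0 Aell) hres) => //; first exact: measurable_ep.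
  by move=> l l0; rewrite /ep l0 !mul1r -expRM_natl mulrN.
elim/poly_ind: P => [|P c [bP IH]].
  split; first by have := @bdd_cst R 0; congr bdd; apply/funext => l; rewrite horner0.
  by move=> k; rewrite -[RHS](pol0 hres.1 u phi); congr polar; apply/funext => l; rewrite horner0 mul0r.
have hE l : (P * 'X + c%:P).[ep 1 l] = P.[ep 1 l] * ep 1 l + c by rewrite !hornerE.
split; first by under eq_fun do rewrite hE; apply: bddD; [exact: bddM|exact: bdd_cst].
move=> k.
have -> : (fun l => (P * 'X + c%:P).[ep 1 l] * ep 1 l ^+ k) = fun l => c * ep 1 l ^+ k + P.[ep 1 l] * ep 1 l ^+ k.+1.
  by apply/funext => l; rewrite hE exprS; ring.
by rewrite pol_lin//; [rewrite pX IH mulr0 addr0|exact: bddM].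
Qed.

(** Step polynomials in exp(-l) tend to the indicator of exp(-l) <= exp(-N), that is of l >= N on
    the spectrum. Subtracting it from 1, whose pairing <u, phi> is zero too, leaves the projection
    on l < N. *)
Lemma spectral_local_zero (N : R) : 0 <= N -> {ae mu, forall x, eball x1 (r / 4) x -> E `]-oo, N[%classic u x = 0}.
Proof.
move=> N0; have mI : measurable (`]-oo, N[%classic : set (measurableTypeR R)) by exact: measurable_itv.
apply: local_zero; first exact: (E_L2 hres.1).
move=> phi tphi; have Lp := tf_L2 tphi; rewrite -(pol_indic hres.1)//.
pose a : R := expR (- N); have a01 : 0 <= a <= 1 by rewrite expR_ge0 -expR0 ler_expR oppr_le0.
have e01 (l : R) : 0 <= ep 1 l <= 1 by apply: ep_le1.
have zero : pol (fun l => (ep 1 l <= a)%R%:R) u phi = 0.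
  have c : pol (fun l => (stepp a m).[ep 1 l]) u phi @[m --> \oo] --> pol (fun l => (ep 1 l <= a)%R%:R) u phi.
    apply: (pol_dct (b := fun=> 1)) => //.
    - by move=> m; have [[]] := pol_horner_vanish (stepp a m) tphi.
    - by move=> l; under eq_fun do rewrite steppE; exact: stepq_cvg.
    - by apply: bdd_intg; [exact: L2D|exact: bdd_cst].
    - by apply: bdd_intg; [exact: L2B|exact: bdd_cst].
    - by move=> m l; rewrite steppE; have /andP[h1 h2] := stepq_bd m a01 (e01 l); rewrite ger0_norm.
  apply: (cvg_unique (@Rhausdorff R) c); rewrite [X in X @ _](_ : _ = fun=> 0); first exact: cvg_cst.
  apply/funext => m; have [_ /(_ 0%N)] := pol_horner_vanish (stepp a m) tphi.
  by move=> <-; congr polar; apply/funext => l; rewrite expr0 mulr1.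
have ble : bdd (fun l => (ep 1 l <= a)%R%:R).
  split; first by apply: measurable_fun_ler_cst; exact: measurable_ep.
  by exists 1 => l; case: (ep 1 l <= a); rewrite ?normr1 ?normr0.
have : pol (fun l => 1 + -1 * (ep 1 l <= a)%R%:R) u phi = 0.
  rewrite polD ?polZ ?pol_cst//; [|exact: bdd_cst|exact: bddZ].
  rewrite zero mulr0 addr0 mul1r; apply: inner_ae0 => //; exact: tf_vanish_ae (tf_mono BO' tphi) u0.
have m1 : measurable_fun setT (\1_(`]-oo, N[%classic : set R) : R -> R) by exact: (bdd_indic mI).1.
have m2 : measurable_fun setT ((fun l : R => 1 + -1 * (ep 1 l <= a)%R%:R) : R -> R).
  by apply: measurable_funD => //; apply: measurable_funM => //; exact: ble.1.
move=> <-; apply: (pol_eq_ge0 (div_op_ge0 Abd Asm L0 Aell) hres Lu Lp m1 m2).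
move=> l l0; rewrite /ep l0 mul1r ger0_norm// mul1r ler_expR lerN2 indicE.
have -> : (l \in (`]-oo, N[%classic : set R)) = (l < N) by apply/idP/idP => [/set_mem|h]; [|apply/mem_set]; rewrite /= in_itv.
by rewrite ltNge; case: (N <= l) => /=; ring.
Qed.

End local_spectral_zero.

(** * Carleman estimate *)

Section mixed_partials.
Context {R : realType} {n : nat}.
Local Notation V := 'rV[R]_n.
Implicit Types (v h w G : V -> R).

Lemma conv_weak_partial h w G i x : test_function setT h -> weak_partial i w G ->
  conv (partial i h) w x = - conv h G x.
Proof.
move=> th wG; rewrite /conv; have := wG _ (tf_shift x th); rewrite /inner => H.
have e1 : \int[mu]_z (partial i h (z - x) * w z) = \int[mu]_z (w z * partial i (fun z => h (z - x)) z).
  by apply: eq_Rintegral => z _; rewrite (partial_shift _ _ _ (tf_smooth th)) mulrC.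
by rewrite e1 H; congr (- _); apply: eq_Rintegral => z _; exact: mulrC.
Qed.

(** Mollification transfers both derivatives to the kernel, and only one order, D_i D_k of the
    kernel, ever occurs: both mixed derivatives have the same mollifications. Equality almost
    everywhere is enough under an integral. *)
Lemma partial_swap_ae v i k : test_function setT v ->
  {ae mu, forall x, partial i (partial k v) x = partial k (partial i v) x}.
Proof.
move=> tv; have tik := tf_partial i (tf_partial k tv); have tki := tf_partial k (tf_partial i tv).
have Lf := tf_L2 tik; have Lg := tf_L2 tki; have Lv := tf_L2 tv.
have E m x : moll m (partial i (partial k v)) x = moll m (partial k (partial i v)) x.
  have [e0 _] := moll_partial m x (tf_L2 (tf_partial k tv)) Lf (weak_partial_tf i (tf_partial k tv)).
  have [_ e1] := moll_partial m x (tf_L2 (tf_partial i tv)) Lg (weak_partial_tf k (tf_partial i tv)).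
  have neg (a b : R) : b = - a -> a = -1 * b by move=> ->; rewrite mulrNN mul1r.
  have neg3 (a b c d : R) : a = - b -> b = - c -> c = - d -> -1 * a = d by move=> -> -> ->; ring.
  have e2 : moll m (partial k v) = fun x => -1 * conv (partial k (rho m)) v x.
    by apply/funext => y; apply: neg; exact: (moll_partial m y Lv (tf_L2 (tf_partial k tv)) (weak_partial_tf k tv)).2.
  have tr := tf_partial k (@tf_rho R n m); have [_ d2] := conv_partial i x tr Lv.
  have d3 := conv_weak_partial x tr (weak_partial_tf i tv).
  apply: (etrans (esym e0)); apply: (etrans (congr1 (fun f => partial i f x) e2)).
  apply: (etrans (partialZ i (-1) x (conv_smooth tr Lv))).
  exact: neg3 d2 d3 e1.
have := L2cvg_moll (L2B Lf Lg) => -[_ LB c].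
have I0 : inner (fun x => partial i (partial k v) x - partial k (partial i v) x)
    (fun x => partial i (partial k v) x - partial k (partial i v) x) = 0.
  apply: (cvg_unique (@Rhausdorff R) _ c).
  rewrite [X in X @ _](_ : _ = fun=> inner (fun x => partial i (partial k v) x - partial k (partial i v) x)
    (fun x => partial i (partial k v) x - partial k (partial i v) x)); first exact: cvg_cst.
  have sq (a b : R) : a = 0 -> (a - b) * (a - b) = b * b by move=> ->; rewrite sub0r mulrNN.
  apply/funext => m; apply: eq_Rintegral => x _; apply: sq.
  apply: (etrans (mollB m x Lf Lg)); apply/eqP; rewrite subr_eq0; apply/eqP; exact: E.
by apply: filterS (inner_eq0 LB I0) => x /eqP; rewrite subr_eq0 => /eqP.
Qed.

End mixed_partials.

Section pointwise.
Context {R : realType} {n : nat}.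
Implicit Types (a D dX : 'I_n -> 'I_n -> R) (g X dm : 'I_n -> R) (da : 'I_n -> 'I_n -> 'I_n -> R) (m v : R).

Lemma sym_sum a g (d : 'I_n -> R) : (forall i j, a i j = a j i) ->
  \sum_(i < n) \sum_(j < n) a i j * (d i * g j + g i * d j) = 2 * \sum_(i < n) (\sum_(j < n) a i j * g j) * d i.
Proof.
move=> sa; transitivity (\sum_(i < n) \sum_(j < n) a i j * d i * g j + \sum_(i < n) \sum_(j < n) a i j * g i * d j).
  by rewrite -big_split; apply: eq_bigr => i _; rewrite -big_split; apply: eq_bigr => j _ /=; ring.
rewrite [X in _ + X]exchange_big -big_split mulr_sumr; apply: eq_bigr => i _ /=.
rewrite mulr_suml mulr_sumr -big_split; apply: eq_bigr => j _ /=; rewrite (sa j i); ring.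
Qed.

(** The pointwise Rellich identity for the flux against the gradient of 2 X.grad v + m v. Here g is
    the gradient of v, D its Hessian, [dX i k] = D_i X_k and [da k i j] = D_k a_ij. The last sum is
    the divergence of e X, with e = a g.g; the second derivatives of v occur on the right in this
    sum only. *)
Lemma carleman_alg a g D X dX da m dm v : (forall i j, a i j = a j i) -> (forall i k, D i k = D k i) ->
  let F i := \sum_(j < n) a i j * g j in
  let e := \sum_(i < n) \sum_(j < n) a i j * (g i * g j) in
  \sum_(i < n) F i * (2 * (\sum_(k < n) (X k * D i k + g k * dX i k)) + (m * g i + v * dm i)) =
  2 * (\sum_(i < n) F i * \sum_(k < n) dX i k * g k)
  - \sum_(k < n) X k * (\sum_(i < n) \sum_(j < n) da k i j * (g i * g j))
  + (m - \sum_(k < n) dX k k) * e + v * (\sum_(i < n) F i * dm i)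
  + \sum_(k < n) (X k * (\sum_(i < n) \sum_(j < n) (da k i j * (g i * g j) + a i j * (D k i * g j + g i * D k j))) + e * dX k k).
Proof.
move=> sa sD F e.
have -> : \sum_(k < n) (X k * (\sum_(i < n) \sum_(j < n) (da k i j * (g i * g j) + a i j * (D k i * g j + g i * D k j))) + e * dX k k) =
   \sum_(k < n) X k * (\sum_(i < n) \sum_(j < n) da k i j * (g i * g j)) + 2 * \sum_(i < n) F i * (\sum_(k < n) X k * D i k)
   + e * \sum_(k < n) dX k k.
  have -> : \sum_(i < n) F i * (\sum_(k < n) X k * D i k) = \sum_(k < n) X k * \sum_(i < n) F i * D k i.
    under eq_bigr do rewrite mulr_sumr; rewrite exchange_big/=; apply: eq_bigr => k _; rewrite mulr_sumr.
    by apply: eq_bigr => i _; rewrite (sD i k); ring.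
  rewrite !mulr_sumr -!big_split/=; apply: eq_bigr => k _; congr (_ + _).
  rewrite mulrCA -mulrDr; congr (_ * _); rewrite -(sym_sum g (D k) sa) -big_split; apply: eq_bigr => i _.
  by rewrite -big_split; apply: eq_bigr => j _ /=.
have -> : e = \sum_(i < n) F i * g i.
  by apply: eq_bigr => i _; rewrite /F mulr_suml; apply: eq_bigr => j _; ring.
transitivity (2 * (\sum_(i < n) F i * \sum_(k < n) X k * D i k) + 2 * (\sum_(i < n) F i * \sum_(k < n) dX i k * g k)
   + m * (\sum_(i < n) F i * g i) + v * \sum_(i < n) F i * dm i); last by ring.
rewrite !mulr_sumr -!big_split/=; apply: eq_bigr => i _.
have -> : \sum_(k < n) (X k * D i k + g k * dX i k) = \sum_(k < n) X k * D i k + \sum_(k < n) dX i k * g k.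
  by rewrite -big_split; apply: eq_bigr => k _ /=; ring.
ring.
Qed.

End pointwise.

Section carleman.
Context {R : realType} {n : nat}.
Local Notation V := 'rV[R]_n.
Implicit Types (f g v m q phi : V -> R).

Lemma partial_smoothD i f g x : smooth f -> smooth g ->
  partial i (fun x => f x + g x) x = partial i f x + partial i g x.
Proof. by move=> sf sg; exact: (partialD (@smooth_der _ _ _ i x sf) (@smooth_der _ _ _ i x sg)). Qed.

Lemma partial_smooth_sum i I (s : seq I) (F : I -> V -> R) x : (forall j, smooth (F j)) ->
  partial i (fun x => \sum_(j <- s) F j x) x = \sum_(j <- s) partial i (F j) x.
Proof.
move=> sF; elim: s => [|j s IH].
  rewrite big_nil (_ : (fun x => _) = fun=> 0); first exact: derive_cst.
  by apply/funext => y; rewrite big_nil.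
rewrite big_cons -IH -partial_smoothD//; last exact: smooth_sum.
by congr partial; apply/funext => y; rewrite big_cons.
Qed.

Variable A : V -> 'M[R]_n.
Hypothesis Abd : bounded_entries A.
Hypothesis Asm : smooth_entries A.
Variable Lambda : R.
Hypothesis L0 : 0 < Lambda.
Hypothesis Asym : forall x, (A x)^T = A x.
Hypothesis Aell : elliptic A Lambda.
Local Notation Lop := (Lop A).

Definition dflux v i : V -> R := flux A (fun j => partial j v) i.
Definition denergy v x : R := \sum_(i < n) \sum_(j < n) A x i j * (partial i v x * partial j v x).
Definition multiplier (X : 'I_n -> V -> R) m v x : R := 2 * (\sum_(k < n) X k x * partial k v x) + m x * v x.

(** What remains of the flux against the gradient of the multiplier once the divergence is dropped:
    first-order terms in v only. *)
Definition carleman_form (X : 'I_n -> V -> R) m v x : R :=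
  2 * (\sum_(i < n) dflux v i x * \sum_(k < n) partial i (X k) x * partial k v x)
  - \sum_(k < n) X k x * (\sum_(i < n) \sum_(j < n) partial k (fun x => A x i j) x * (partial i v x * partial j v x))
  + (m x - \sum_(k < n) partial k (X k) x) * denergy v x + v x * (\sum_(i < n) dflux v i x * partial i m x).

Variables (X : 'I_n -> V -> R) (m : V -> R).
Hypothesis sXm : (forall k, smooth (X k)) /\ smooth m.
Let sX := sXm.1.
Let sm := sXm.2.

Let sXp v k : smooth v -> smooth (fun x => X k x * partial k v x).
Proof. by move=> sv; exact: smoothM (sX k) (smooth_partial k sv). Qed.

Lemma tf_multiplier v : test_function setT v -> test_function setT (multiplier X m v).
Proof.
move=> tv; apply: (tfD (tfZ 2 (tf_sum _ _)) (tf_Ml sm tv)) => k.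
exact: tf_Ml (sX k) (tf_partial k tv).
Qed.

Lemma tf_denergy v : test_function setT v -> test_function setT (denergy v).
Proof.
move=> tv; apply: tf_sum => i; apply: tf_sum => j.
exact: tf_Ml (Asm i j) (tf_Ml (smooth_partial i (tf_smooth tv)) (tf_partial j tv)).
Qed.

Let tF v i : test_function setT v -> test_function setT (dflux v i).
Proof. by move=> tv; exact: tf_flux. Qed.

Lemma tf_carleman_form v : test_function setT v -> test_function setT (carleman_form X m v).
Proof.
move=> tv; apply: (tfD (tfD (tfB (tfZ 2 (tf_sum _ _)) (tf_sum _ _)) (tf_Ml _ (tf_denergy tv))) (tf_Ml (tf_smooth tv) (tf_sum _ _))) => [i|k||i].
- apply: (tf_Mr _ (tF i tv)); apply: smooth_sum => k.
  exact: smoothM (smooth_partial i (sX k)) (smooth_partial k (tf_smooth tv)).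
- apply: (tf_Ml (sX k)); apply: tf_sum => i; apply: tf_sum => j.
  apply: (tf_Ml (smooth_partial k (Asm i j))).
  exact: tf_Ml (smooth_partial i (tf_smooth tv)) (tf_partial j tv).
- apply: (smoothB sm); apply: smooth_sum => k; exact: smooth_partial k (sX k).
- exact: tf_Mr (smooth_partial i sm) (tF i tv).
Qed.

Let partial_multiplier v i x : smooth v -> partial i (multiplier X m v) x =
    2 * (\sum_(k < n) (X k x * partial i (partial k v) x + partial k v x * partial i (X k) x)) + (m x * partial i v x + v x * partial i m x).
Proof.
move=> sv; have s1 : smooth (fun x => \sum_(k < n) X k x * partial k v x) by apply: smooth_sum => k; exact: sXp.
rewrite /multiplier (partial_smoothD i x (smoothZ 2 s1) (smoothM sm sv)) (partialZ i 2 x s1) (partialM_tf i x sm sv).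
rewrite (partial_smooth_sum i _ x (fun k => sXp k sv)); congr (2 * _ + _).
by apply: eq_bigr => k _; rewrite (partialM_tf i x (sX k) (smooth_partial k sv)).
Qed.

Let partial_denergy v k x : smooth v -> partial k (denergy v) x =
  \sum_(i < n) \sum_(j < n) (partial k (fun x => A x i j) x * (partial i v x * partial j v x)
     + A x i j * (partial k (partial i v) x * partial j v x + partial i v x * partial k (partial j v) x)).
Proof.
move=> sv; have spp i j := smoothM (smooth_partial i sv) (smooth_partial j sv).
have sa i j := smoothM (Asm i j) (spp i j).
have alg (a g h ga gh da : R) : a * (g * gh + h * ga) + g * h * da = da * (g * h) + a * (ga * h + g * gh) by ring.
rewrite /denergy (partial_smooth_sum k _ x (fun i => smooth_sum _ (sa i))); apply: eq_bigr => i _.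
rewrite (partial_smooth_sum k _ x (sa i)); apply: eq_bigr => j _.
rewrite (partialM_tf k x (Asm i j) (spp i j)) (partialM_tf k x (smooth_partial i sv) (smooth_partial j sv)).
exact: alg.
Qed.

(** Integrate by parts once, apply [carleman_alg] pointwise and drop the divergence, which has zero
    integral. *)
Lemma multiplier_Lop v : test_function setT v ->
  inner (Lop v) (multiplier X m v) = \int[mu]_x carleman_form X m v x.
Proof.
move=> tv; have th := tf_multiplier tv; have te := tf_denergy tv.
have tdiv k : test_function setT (fun x => X k x * denergy v x) by exact: tf_Ml (sX k) te.
have tdivs : test_function setT (fun x => \sum_(k < n) partial k (fun x => X k x * denergy v x) x).
  by apply: tf_sum => k; exact: tf_partial k (tdiv k).
have tc := tf_carleman_form tv.
rewrite -(wdiv_tf Asm tv th) /aform /inner -Rint_sum; last first.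
  by move=> i; apply: (L2M (tf_L2 (tF i tv)) (tf_L2 (tf_partial i th))).
transitivity (\int[mu]_x (carleman_form X m v x + \sum_(k < n) partial k (fun x => X k x * denergy v x) x)).
  apply: Rint_ae.
  - have ts : test_function setT (fun x => \sum_(i < n) flux A (fun j => partial j v) i x * partial i (multiplier X m v) x).
      by apply: tf_sum => i; exact: tf_Mr (smooth_partial i (tf_smooth th)) (tF i tv).
    exact: intg_meas (tf_intg ts).
  - exact: intg_meas (intgD (tf_intg tc) (tf_intg tdivs)).
  have sw : {ae mu, forall x, forall ik : 'I_n * 'I_n, partial ik.1 (partial ik.2 v) x = partial ik.2 (partial ik.1 v) x}.
    by apply: filter_forall => -[i k]; exact: (partial_swap_ae i k tv).
  apply: filterS sw => x sw.
  have := @carleman_alg R n (fun i j => A x i j) (fun i => partial i v x) (fun i k => partial i (partial k v) x)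
    (fun k => X k x) (fun i k => partial i (X k) x) (fun k i j => partial k (fun x => A x i j) x) (m x) (fun i => partial i m x) (v x)
    (A_sym Asym x) (fun i k => sw (i, k)).
  rewrite /= => H; rewrite (eq_bigr _ (fun i _ => congr1 (fun z => _ * z) (partial_multiplier i x (tf_smooth tv)))) H; congr (_ + _).
  by apply: eq_bigr => k _; rewrite (partialM_tf k x (sX k) (tf_smooth te)) (partial_denergy k x (tf_smooth tv)).
rewrite (RintD (tf_intg tc) (tf_intg tdivs)).
rewrite Rint_sum; last by move=> k; exact: tf_intg (tf_partial k (tdiv k)).
by rewrite big1 ?addr0// => k _; exact: tf_partial0 (tdiv k).
Qed.

(** Since 2 v X.grad v = X.grad(v^2), an integration by parts leaves a multiple of v^2. *)
Lemma multiplier_potential q v : smooth q -> test_function setT v ->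
  inner (fun x => q x * v x) (multiplier X m v) =
  \int[mu]_x ((q x * m x - \sum_(k < n) partial k (fun x => q x * X k x) x) * v x ^+ 2).
Proof.
move=> sq tv; have sqX k := smoothM sq (sX k).
have svv := smoothM (tf_smooth tv) (tf_smooth tv).
have tvv := tf_Ml (tf_smooth tv) tv.
have alg (a b c d e : R) : a * b * (c * d + c * d) + c * c * e = e * c ^+ 2 + 2 * (a * c) * (b * d) by ring.
have alg2 (a c d e f : R) : a * c * (2 * d + e * c) = (a * e - f) * c ^+ 2 + (f * c ^+ 2 + 2 * (a * c) * d) by ring.
have tdiv k := tf_Ml (sqX k) tvv.
have tdivs : test_function setT (fun x => \sum_(k < n) partial k (fun x => (q x * X k x) * (v x * v x)) x).
  by apply: tf_sum => k; exact: tf_partial k (tdiv k).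
have tr : test_function setT (fun x => (q x * m x - \sum_(k < n) partial k (fun x => q x * X k x) x) * v x ^+ 2).
  under eq_fun do rewrite expr2; apply: (tf_Ml (smoothB (smoothM sq sm) _) tvv).
  by apply: smooth_sum => k; exact: smooth_partial k (sqX k).
transitivity (\int[mu]_x ((q x * m x - \sum_(k < n) partial k (fun x => q x * X k x) x) * v x ^+ 2
   + \sum_(k < n) partial k (fun x => (q x * X k x) * (v x * v x)) x)).
  apply: eq_Rintegral => x _; rewrite /multiplier.
  have -> : \sum_(k < n) partial k (fun x => (q x * X k x) * (v x * v x)) x =
     (\sum_(k < n) partial k (fun x => q x * X k x) x) * v x ^+ 2 + 2 * (q x * v x) * \sum_(k < n) X k x * partial k v x.
    rewrite mulr_suml mulr_sumr -big_split; apply: eq_bigr => k _ /=.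
    by rewrite (partialM_tf k x (sqX k) svv) (partialM_tf k x (tf_smooth tv) (tf_smooth tv)); exact: alg.
  exact: alg2.
rewrite (RintD (tf_intg tr) (tf_intg tdivs)).
rewrite Rint_sum; last by move=> k; exact: tf_intg (tf_partial k (tdiv k)).
by rewrite big1 ?addr0// => k _; exact: tf_partial0 (tdiv k).
Qed.

End carleman.

(** * Conjugation with the weight *)

Section conjugation.
Context {R : realType} {n : nat}.
Local Notation V := 'rV[R]_n.
Variable A : V -> 'M[R]_n.
Hypothesis Asm : smooth_entries A.
Hypothesis Asym : forall x, (A x)^T = A x.
Implicit Types (u phi : V -> R).

Lemma dflux_sym u phi x :
  \sum_(i < n) dflux A u i x * partial i phi x = \sum_(i < n) dflux A phi i x * partial i u x.
Proof.
rewrite /dflux /flux; under eq_bigr do rewrite mulr_suml.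
under [RHS]eq_bigr do rewrite mulr_suml.
rewrite exchange_big/=; apply: eq_bigr => i _; apply: eq_bigr => j _.
have alg (a b c : R) : a * b * c = a * c * b by ring.
by rewrite (A_sym Asym); exact: alg.
Qed.

(** The conjugated operator splits into the symmetric part L - t^2 A grad phi.grad phi and an
    antisymmetric part of order t; the Carleman inequality exploits the cross term of the two. *)
Lemma conj_Lop u phi (t : R) x : smooth u -> smooth phi ->
  let E x := expR (t * phi x) in let v x := E x * u x in
  E x * Lop A u x = Lop A v x + t * (\sum_(k < n) partial k (dflux A phi k) x) * v x
    + 2 * t * (\sum_(k < n) dflux A phi k x * partial k v x)
    - t ^+ 2 * (\sum_(k < n) dflux A phi k x * partial k phi x) * v x.
Proof.
move=> su sphi E v; have stphi : smooth (fun x => t * phi x) by exact: smoothZ.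
have sE : smooth E := smooth_expR stphi.
have sX i : smooth (dflux A phi i) := smooth_flux Asm i sphi.
have sF i : smooth (dflux A u i) := smooth_flux Asm i su.
have dE i y : partial i E y = t * partial i phi y * E y.
  by rewrite /E partial_expR// (partialZ i t y sphi).
have dv i y : partial i v y = E y * partial i u y + u y * (t * partial i phi y * E y).
  by rewrite /v (partialM_tf i y sE su) dE.
have Fv i : flux A (fun j => partial j v) i = fun y => E y * dflux A u i y + t * (E y * (u y * dflux A phi i y)).
  apply/funext => y; rewrite /dflux /flux !mulr_sumr -big_split; apply: eq_bigr => j _ /=.
  rewrite dv; have alg (a e d w c f : R) : a * (e * d + w * (c * f * e)) = e * (a * d) + c * (e * (w * (a * f))) by ring.
  exact: alg.
have suX i := smoothM su (sX i); have sEuX i := smoothM sE (suX i).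
have dFv i : partial i (flux A (fun j => partial j v) i) x =
    E x * partial i (dflux A u i) x + dflux A u i x * (t * partial i phi x * E x)
    + t * (E x * (u x * partial i (dflux A phi i) x + dflux A phi i x * partial i u x)
           + u x * dflux A phi i x * (t * partial i phi x * E x)).
  rewrite Fv (partial_smoothD i x (smoothM sE (sF i)) (smoothZ t (sEuX i))).
  rewrite (partialM_tf i x sE (sF i)) (partialZ i t x (sEuX i)) (partialM_tf i x sE (suX i)).
  by rewrite (partialM_tf i x su (sX i)) dE.
pose S1 := \sum_(i < n) partial i (dflux A u i) x.
have e1 : \sum_(i < n) (E x * partial i (dflux A u i) x + dflux A u i x * (t * partial i phi x * E x)
    + t * (E x * (u x * partial i (dflux A phi i) x + dflux A phi i x * partial i u x)
           + u x * dflux A phi i x * (t * partial i phi x * E x))) =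
    E x * S1 + t * E x * (\sum_(i < n) dflux A u i x * partial i phi x) + t * E x * u x * (\sum_(i < n) partial i (dflux A phi i) x)
    + t * E x * (\sum_(i < n) dflux A phi i x * partial i u x) + t ^+ 2 * E x * u x * (\sum_(i < n) dflux A phi i x * partial i phi x).
  rewrite /S1 !mulr_sumr -!big_split; apply: eq_bigr => i _ /=.
  have alg (e s f p w d g y : R) : e * s + f * (t * p * e) + t * (e * (w * d + y * g) + w * y * (t * p * e)) =
     e * s + t * e * (f * p) + t * e * w * d + t * e * (y * g) + t ^+ 2 * e * w * (y * p) by ring.
  exact: alg.
have e2 : \sum_(k < n) dflux A phi k x * partial k v x =
    E x * (\sum_(i < n) dflux A phi i x * partial i u x) + t * E x * u x * (\sum_(i < n) dflux A phi i x * partial i phi x).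
  rewrite !mulr_sumr -!big_split; apply: eq_bigr => i _ /=; rewrite dv.
  have alg (e y g w p : R) : y * (e * g + w * (t * p * e)) = e * (y * g) + t * e * w * (y * p) by ring.
  exact: alg.
have eL : Lop A v x = - _ := congr1 -%R (etrans (eq_bigr _ (fun i _ => dFv i)) e1).
have fin (e lu lv w dX g y q s3 : R) : lu = - s3 -> lv = - (e * s3 + t * e * g + t * e * w * dX + t * e * g + t ^+ 2 * e * w * q) ->
    y = e * g + t * e * w * q -> e * lu = lv + t * dX * (e * w) + 2 * t * y - t ^+ 2 * q * (e * w).
  by move=> -> -> ->; ring.
rewrite (dflux_sym u phi) in eL.
exact: (fin (E x) (Lop A u x) (Lop A v x) (u x) _ _ _ _ S1 erefl eL e2).
Qed.

End conjugation.

Section homogeneous_bounds.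
Context {R : realType} {n : nat}.
Local Notation V := 'rV[R]_n.
Variable K : set V.
Implicit Types (w : V -> ('I_n -> R) -> R).

Definition gnorm (g : 'I_n -> R) : R := Num.sqrt (\sum_(i < n) g i ^+ 2).

(** Bounds on the compact set K by a power d of the length of the gradient: a calculus for
    lower-order terms whose constants need not be written out. *)
Definition hbound d w := exists2 C : R, 0 <= C & forall x g, K x -> `|w x g| <= C * gnorm g ^+ d.

Lemma gnorm_ge0 g : 0 <= gnorm g. Proof. exact: sqrtr_ge0. Qed.

Lemma gnorm_sqr g : gnorm g ^+ 2 = \sum_(i < n) g i ^+ 2.
Proof. by rewrite sqr_sqrtr// sumr_ge0// => i _; exact: sqr_ge0. Qed.

Lemma hbound_coord i : hbound 1 (fun _ g => g i).
Proof.
exists 1 => // x g _; rewrite mul1r expr1 -(ler_pXn2r (ltn0Sn 1)) ?nnegrE ?gnorm_ge0//.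
rewrite gnorm_sqr real_normK ?num_real// (bigD1 i)//= lerDl sumr_ge0// => j _; exact: sqr_ge0.
Qed.

Lemma hboundD d w1 w2 : hbound d w1 -> hbound d w2 -> hbound d (fun x g => w1 x g + w2 x g).
Proof.
move=> [C1 c1 h1] [C2 c2 h2]; exists (C1 + C2); first exact: addr_ge0.
by move=> x g Kx; rewrite mulrDl (le_trans (ler_normD _ _))// lerD// ?h1// h2.
Qed.

Lemma hboundM d1 d2 w1 w2 : hbound d1 w1 -> hbound d2 w2 -> hbound (d1 + d2) (fun x g => w1 x g * w2 x g).
Proof.
move=> [C1 c1 h1] [C2 c2 h2]; exists (C1 * C2); first exact: mulr_ge0.
move=> x g Kx; rewrite normrM exprD mulrACA; apply: ler_pM => //; [exact: h1|exact: h2].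
Qed.

Lemma hbound_sum d (w : 'I_n -> V -> ('I_n -> R) -> R) : (forall i, hbound d (w i)) ->
  hbound d (fun x g => \sum_(i < n) w i x g).
Proof.
move=> H; have /choice[C HC] : forall i, exists C, 0 <= C /\ forall x g, K x -> `|w i x g| <= C * gnorm g ^+ d.
  by move=> i; have [C c0 h] := H i; exists C.
exists (\sum_i C i); first by apply: sumr_ge0 => i _; have [] := HC i.
move=> x g Kx; rewrite mulr_suml; apply: le_trans (ler_norm_sum _ _ _) _; apply: ler_sum => i _.
by have [_ h] := HC i; exact: h.
Qed.

Lemma hbound_cont (f : V -> R) : compact K -> continuous f -> hbound 0 (fun x _ => f x).
Proof.
move=> cK cf.
have cfK : {within K, continuous f} by exact: continuous_subspaceT.
have [M [_ HM]] : bounded_set (f @` K) by apply: compact_bounded; exact: continuous_compact.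
exists (1 + `|M|); first by rewrite addr_ge0.
move=> x g Kx; rewrite expr0 mulr1; apply: (HM (1 + `|M|)); last by exists x.
by rewrite (le_lt_trans (ler_norm M))// ltrDr.
Qed.

End homogeneous_bounds.

(** The weight decreases away from x1. The inner exponential convexifies: for large l its second
    derivatives in the direction of the gradient dominate the errors caused by variable
    coefficients. *)
Definition cweight {R : realType} {n : nat} (x1 : 'rV[R]_n) (l t : R) (x : 'rV[R]_n) : R :=
  expR (t * expR (- (l * sqnorm (x - x1)))).

(** Here N is the length of grad v, y stands for v, and w and z are errors of degree 2 and 1 in the
    gradient. The choice of l lets the leading term absorb w and still leave f0 N^2, which absorbs y
    z by completing a square; this costs C3^2/(4 f0) y^2. *)
Lemma carleman_arith {R : realType} (p0 Lam C1 C3 l f0 N e w z f pp s y : R) : 0 <= p0 -> 0 < Lam -> 0 <= C1 -> 1 <= l ->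
  C1 + 1 <= l * p0 / Lam -> 0 < f0 -> 0 <= N -> Lam^-1 * N ^+ 2 <= e -> `|w| <= C1 * N ^+ 2 ->
  `|z| <= C3 * N -> f0 <= f -> p0 <= pp ->
  - (C3 ^+ 2 / (4 * f0)) * y ^+ 2 <= l ^+ 2 * f * (2 * s ^+ 2 + pp * e) + l * f * w + y * z.
Proof.
move=> p00 L0 C10 l1 lp f00 N0 eN hw hz hf hp.
have l0 : 0 < l by lra.
have N20 : 0 <= N ^+ 2 by exact: sqr_ge0.
have Li0 : 0 < Lam^-1 by rewrite invr_gt0.
have pe : p0 * (Lam^-1 * N ^+ 2) <= pp * e.
  by apply: ler_pM => //; [apply: mulr_ge0 => //; exact: ltW].
have b1 : f0 * N ^+ 2 <= l ^+ 2 * f * (2 * s ^+ 2 + pp * e) + l * f * w.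
  have -> : l ^+ 2 * f * (2 * s ^+ 2 + pp * e) + l * f * w = l * f * (l * (2 * s ^+ 2 + pp * e) + w) by ring.
  have h1 : N ^+ 2 <= l * (2 * s ^+ 2 + pp * e) + w.
    have hw' : - (C1 * N ^+ 2) <= w by have /ler_normlP[+ _] := hw; lra.
    have s0 := sqr_ge0 s; have h2 : l * (p0 * (Lam^-1 * N ^+ 2)) <= l * (2 * s ^+ 2 + pp * e).
      by apply: ler_wpM2l; [exact: ltW|lra].
    have h3 : (C1 + 1) * N ^+ 2 <= l * (p0 * (Lam^-1 * N ^+ 2)) by rewrite (_ : l * _ = l * p0 / Lam * N ^+ 2); [exact: ler_wpM2r|ring].
    by lra.
  have lf : f0 <= l * f by rewrite -[f0]mul1r; apply: ler_pM => //; exact: ltW.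
  by apply: ler_pM => //; exact: ltW.
have yz : - (`|y| * (C3 * N)) <= y * z.
  have : `|y * z| <= `|y| * (C3 * N) by rewrite normrM; apply: ler_wpM2l.
  by move=> /ler_normlP[+ _]; lra.
have sq : 0 <= f0 * N ^+ 2 - `|y| * (C3 * N) + C3 ^+ 2 / (4 * f0) * y ^+ 2.
  have -> : f0 * N ^+ 2 - `|y| * (C3 * N) + C3 ^+ 2 / (4 * f0) * y ^+ 2 = (2 * f0 * N - C3 * `|y|) ^+ 2 / (4 * f0).
    by rewrite -[y ^+ 2](real_normK (num_real y)); field; rewrite gt_eqF.
  by apply: divr_ge0; [exact: sqr_ge0|rewrite mulr_ge0// ltW].
by rewrite mulNr; move: b1 yz sq; move: (_ * y ^+ 2) (`|y| * _) (y * z) (f0 * _) (_ + l * f * w) => a b c d e'; lra.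
Qed.

Section carleman_estimate.
Context {R : realType} {n : nat}.
Local Notation V := 'rV[R]_n.
Variable A : V -> 'M[R]_n.
Hypothesis Abd : bounded_entries A.
Hypothesis Asm : smooth_entries A.
Variable Lambda : R.
Hypothesis L0 : 0 < Lambda.
Hypothesis Asym : forall x, (A x)^T = A x.
Hypothesis Aell : elliptic A Lambda.
Variables (x1 : V) (r1 r2 : R).
Hypothesis r10 : 0 < r1.
Implicit Types (u v : V -> R) (l t : R).

(** An annulus, because the gradient of the squared distance vanishes at the centre. *)
Let K : set V := [set x | r1 <= sqnorm (x - x1) <= r2].

Let cK : compact K.
Proof.
have cs : continuous (fun x : V => sqnorm (x - x1)) := smooth_cont (@smooth_sqnorm R n x1).
have cl : closed [set x : V | r1 <= sqnorm (x - x1)].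
  by apply: (@closed_comp _ _ (fun x : V => sqnorm (x - x1)) [set y | r1 <= y]) => [x _|]; [exact: cs|exact: closed_ge].
have -> : K = [set x : V | r1 <= sqnorm (x - x1)] `&` [set x : V | sqnorm (x - x1) <= r2].
  by apply/seteqP; split => x /=; [move=> /andP|move=> [h1 h2]; apply/andP].
by rewrite setIC; apply: compact_closedI => //; exact: eball_compact.
Qed.

Let psi (x : V) : R := - sqnorm (x - x1).
Let spsi : smooth psi. Proof. exact: smoothN (@smooth_sqnorm R n x1). Qed.
Let Y k : V -> R := dflux A psi k.
Let sY k : smooth (Y k). Proof. exact: (smooth_flux Asm k spsi). Qed.
Let p (x : V) : R := \sum_(k < n) Y k x * partial k psi x.
Let sp : smooth p. Proof. by apply: smooth_sum => k; exact: smoothM (sY k) (smooth_partial k spsi). Qed.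
Let phi l (x : V) : R := expR (l * psi x).
Let sphi l : smooth (phi l). Proof. exact: smooth_expR (smoothZ l spsi). Qed.
Let X l k : V -> R := dflux A (phi l) k.
Let sX l k : smooth (X l k). Proof. exact: (smooth_flux Asm k (sphi l)). Qed.
(** To leading order in l, div X is l^2 phi p and div(q X) is 3 l^2 phi p q. The middle value 2 l^2
    phi p gives the right sign to both the gradient term m - div X and the potential term q m -
    div(q X). *)
Let m l (x : V) : R := 2 * l ^+ 2 * (phi l x * p x).
Let sm l : smooth (m l). Proof. exact: smoothZ _ (smoothM (sphi l) sp). Qed.
Let q l (x : V) : R := \sum_(k < n) X l k x * partial k (phi l) x.

Lemma partial_sqdist k x : partial k psi x = - 2 * (x 0 k - x1 0 k).
Proof.
have sc j : smooth (fun x : V => x 0 j - x1 0 j) := smoothB (@smooth_coord R n j) (smooth_cst (x1 0 j)).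
have dc j : partial k (fun x : V => x 0 j - x1 0 j) x = (k == j)%:R.
  rewrite (partial_smoothD k x (@smooth_coord R n j) (smooth_cst (- x1 0 j))) partial_coord.
  by rewrite [X in _ + X]derive_cst addr0.
have -> : psi = fun x => -1 * \sum_(j < n) (x 0 j - x1 0 j) * (x 0 j - x1 0 j).
  apply/funext => y; rewrite /psi /sqnorm mulN1r; congr (- _); apply: eq_bigr => j _.
  by rewrite !mxE expr2.
have scc j := smoothM (sc j) (sc j).
rewrite (partialZ k (-1) x (smooth_sum _ scc)) (partial_smooth_sum k _ x scc) (bigD1 k)//= big1 ?addr0.
  by rewrite (partialM_tf k x (sc k) (sc k)) dc eqxx !mulr1; ring.
by move=> j jk; rewrite (partialM_tf k x (sc j) (sc j)) dc eq_sym (negPf jk) !mulr0 addr0.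
Qed.

(** The squared length of grad psi is 4 |x - x1|^2, at least 4 r1 on K; ellipticity divides by
    Lambda. *)
Let p0 : R := 4 * r1 / Lambda.
Let p00 : 0 < p0. Proof. by rewrite divr_gt0// mulr_gt0. Qed.

Let p_ge x : K x -> p0 <= p x.
Proof.
move=> /andP[hx _]; have /andP[h _] := A_ell Aell x (fun k => partial k psi x).
have -> : p x = \sum_(i < n) \sum_(j < n) A x i j * partial j psi x * partial i psi x.
  by rewrite /p /Y /dflux /flux; apply: eq_bigr => k _; rewrite mulr_suml.
apply: le_trans h; rewrite /p0 mulrC; apply: ler_wpM2l; first by rewrite invr_ge0 ltW.
have -> : \sum_(i < n) partial i psi x ^+ 2 = 4 * sqnorm (x - x1).
  rewrite /sqnorm mulr_sumr; apply: eq_bigr => i _; rewrite partial_sqdist !mxE; ring.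
by rewrite ler_pM2l.
Qed.

Let dphi l k x : partial k (phi l) x = l * partial k psi x * phi l x.
Proof. by rewrite /phi (partial_expR k x (smoothZ l spsi)) (partialZ k l x spsi). Qed.

Let XE l k : X l k = fun x => l * (phi l x * Y k x).
Proof.
apply/funext => x; rewrite /X /Y /dflux /flux !mulr_sumr; apply: eq_bigr => j _; rewrite dphi.
have alg (a b c d : R) : a * (b * c * d) = b * (d * (a * c)) by ring.
exact: alg.
Qed.

Let dX l i k x : partial i (X l k) x = l * (phi l x * partial i (Y k) x + Y k x * (l * partial i psi x * phi l x)).
Proof. by rewrite XE (partialZ i l x (smoothM (sphi l) (sY k))) (partialM_tf i x (sphi l) (sY k)) dphi. Qed.

Let qE l x : q l x = l ^+ 2 * phi l x ^+ 2 * p x.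
Proof.
rewrite /q /p mulr_sumr; apply: eq_bigr => k _; rewrite XE dphi.
have alg (a b c d : R) : a * (b * c) * (a * d * b) = a ^+ 2 * b ^+ 2 * (c * d) by ring.
exact: alg.
Qed.

Let divX l x : R := \sum_(k < n) partial k (X l k) x.
Let divY x : R := \sum_(k < n) partial k (Y k) x.

Let divXE l x : divX l x = l * phi l x * divY x + l ^+ 2 * phi l x * p x.
Proof.
rewrite /divX /divY /p !mulr_sumr -big_split; apply: eq_bigr => k _ /=; rewrite dX.
have alg (a b c d e : R) : a * (b * c + d * (a * e * b)) = a * b * c + a ^+ 2 * b * (d * e) by ring.
exact: alg.
Qed.

Let Fl i x (g : 'I_n -> R) : R := \sum_(j < n) A x i j * g j.
Let el x (g : 'I_n -> R) : R := \sum_(i < n) \sum_(j < n) A x i j * (g i * g j).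
Let W x (g : 'I_n -> R) : R :=
  2 * (\sum_(i < n) Fl i x g * \sum_(k < n) partial i (Y k) x * g k)
  + -1 * (\sum_(k < n) Y k x * (\sum_(i < n) \sum_(j < n) partial k (fun x => A x i j) x * (g i * g j)))
  + -1 * (divY x * el x g).

Let hb0 (f : V -> R) : smooth f -> hbound K 0 (fun x _ => f x).
Proof. by move=> sf; apply: (hbound_cont cK); exact: smooth_cont. Qed.

Let hbgg i j : hbound K 2 (fun _ g => g i * g j).
Proof. exact: hboundM (hbound_coord K i) (hbound_coord K j). Qed.

Let hbF i : hbound K 1 (Fl i).
Proof. apply: hbound_sum => j; exact: (hboundM (hb0 (Asm i j)) (hbound_coord K j)). Qed.

Let sdivY : smooth divY.
Proof. by apply: smooth_sum => k; exact: smooth_partial k (sY k). Qed.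

Let hbW : hbound K 2 W.
Proof.
have c0 (c : R) : hbound K 0 (fun _ _ => c) := hb0 (smooth_cst c).
apply: hboundD; [apply: hboundD|].
- apply: (hboundM (c0 2)); apply: hbound_sum => i; apply: (hboundM (hbF i)).
  apply: hbound_sum => k; exact: (hboundM (hb0 (smooth_partial i (sY k))) (hbound_coord K k)).
- apply: (hboundM (c0 (-1))); apply: hbound_sum => k; apply: (hboundM (hb0 (sY k))).
  apply: hbound_sum => i; apply: hbound_sum => j; exact: (hboundM (hb0 (smooth_partial k (Asm i j))) (hbgg i j)).
- apply: (hboundM (c0 (-1))); apply: (hboundM (hb0 sdivY)); apply: hbound_sum => i; apply: hbound_sum => j.
  exact: (hboundM (hb0 (Asm i j)) (hbgg i j)).
Qed.

(** An expansion in powers of l: the l^2 part is nonnegative and controls the energy, W gathers the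
    terms of order l, and the last term, the only one that contains v undifferentiated, is linear in
    the gradient. *)
Let form_expand l v x (g := fun i => partial i v x) :
  carleman_form A (X l) (m l) v x =
  l ^+ 2 * phi l x * (2 * (\sum_(k < n) Y k x * g k) ^+ 2 + p x * el x g)
  + l * phi l x * W x g + v x * (\sum_(i < n) Fl i x g * partial i (m l) x).
Proof.
have YF : \sum_(i < n) Fl i x g * partial i psi x = \sum_(k < n) Y k x * g k := dflux_sym Asym v psi x.
rewrite /carleman_form -/(divX l x) divXE; congr (_ + _).
have e1 : \sum_(i < n) dflux A v i x * (\sum_(k < n) partial i (X l k) x * partial k v x) =
   l * phi l x * (\sum_(i < n) Fl i x g * \sum_(k < n) partial i (Y k) x * g k)
   + l ^+ 2 * phi l x * (\sum_(k < n) Y k x * g k) ^+ 2.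
  have -> : (\sum_(k < n) Y k x * g k) ^+ 2 = (\sum_(i < n) Fl i x g * partial i psi x) * (\sum_(k < n) Y k x * g k).
    by rewrite YF expr2.
  rewrite mulr_suml !mulr_sumr -big_split; apply: eq_bigr => i _ /=.
  have eX : \sum_(k < n) partial i (X l k) x * partial k v x =
     l * phi l x * (\sum_(k < n) partial i (Y k) x * g k) + l ^+ 2 * phi l x * partial i psi x * (\sum_(k < n) Y k x * g k).
    rewrite !mulr_sumr -big_split; apply: eq_bigr => k _ /=; rewrite dX.
    have alg (a b c d e f : R) : a * (b * c + d * (a * e * b)) * f = a * b * (c * f) + a ^+ 2 * b * e * (d * f) by ring.
    exact: alg.
  apply: (etrans (congr1 (fun z => dflux A v i x * z) eX)).
  have alg (f a b s y e : R) : f * (a * b * s + a ^+ 2 * b * e * y) = a * b * (f * s) + a ^+ 2 * b * (f * e * y) by ring.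
  exact: alg.
have e2 : \sum_(k < n) X l k x * (\sum_(i < n) \sum_(j < n) partial k (fun x => A x i j) x * (partial i v x * partial j v x)) =
   l * phi l x * (\sum_(k < n) Y k x * (\sum_(i < n) \sum_(j < n) partial k (fun x => A x i j) x * (g i * g j))).
  rewrite mulr_sumr; apply: eq_bigr => k _; rewrite XE.
  have alg (a b c d : R) : a * (b * c) * d = a * b * (c * d) by ring.
  exact: alg.
rewrite e1 e2 /W /m.
have alg (a b s y t e d pp : R) : 2 * (a * b * s + a ^+ 2 * b * y ^+ 2) - a * b * t + (2 * a ^+ 2 * (b * pp) - (a * b * d + a ^+ 2 * b * pp)) * e
   = a ^+ 2 * b * (2 * y ^+ 2 + pp * e) + a * b * (2 * s + -1 * t + -1 * (d * e)) by ring.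
exact: alg.
Qed.

Let divpY x : R := \sum_(k < n) partial k (fun x => p x * Y k x) x.
Let spY k : smooth (fun x => p x * Y k x). Proof. exact: smoothM sp (sY k). Qed.
Let sdivpY : smooth divpY.
Proof. by apply: smooth_sum => k; exact: smooth_partial k (spY k). Qed.

Let sq l : smooth (q l).
Proof. by apply: smooth_sum => k; exact: smoothM (sX l k) (smooth_partial k (sphi l)). Qed.

Let potential_expand l x :
  q l x * m l x - \sum_(k < n) partial k (fun x => q l x * X l k x) x =
  - (l ^+ 3 * phi l x ^+ 3 * (l * p x ^+ 2 + divpY x)).
Proof.
have s3 : smooth (fun x => 3 * l * psi x) := smoothZ (3 * l) spsi.
have e3 y : expR (3 * l * psi y) = phi l y ^+ 3 by rewrite /phi -expRM_natl mulrA.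
have sE3 := smooth_expR s3.
have e k : (fun x => q l x * X l k x) = fun x => l ^+ 3 * (expR (3 * l * psi x) * (p x * Y k x)).
  apply/funext => y; rewrite qE XE e3.
  have alg (a b c d : R) : a ^+ 2 * b ^+ 2 * c * (a * (b * d)) = a ^+ 3 * (b ^+ 3 * (c * d)) by ring.
  exact: alg.
have de k : partial k (fun x => q l x * X l k x) x =
    l ^+ 3 * (phi l x ^+ 3 * partial k (fun x => p x * Y k x) x + p x * Y k x * (3 * l * partial k psi x * phi l x ^+ 3)).
  rewrite e (partialZ k _ x (smoothM sE3 (spY k))) (partialM_tf k x sE3 (spY k)).
  by rewrite (partial_expR k x s3) (partialZ k _ x spsi) e3.
have -> : \sum_(k < n) partial k (fun x => q l x * X l k x) x =
    l ^+ 3 * phi l x ^+ 3 * divpY x + 3 * l ^+ 4 * phi l x ^+ 3 * p x * (\sum_(k < n) Y k x * partial k psi x).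
  rewrite /divpY [X in X + _]mulr_sumr [X in _ + X]mulr_sumr -big_split; apply: eq_bigr => k _ /=; rewrite de.
  have alg (a b c d y z : R) : a ^+ 3 * (b ^+ 3 * c + d * y * (3 * a * z * b ^+ 3)) = a ^+ 3 * b ^+ 3 * c + 3 * a ^+ 4 * b ^+ 3 * d * (y * z) by ring.
  exact: alg.
rewrite -/(p x) qE /m.
have alg (a b c d : R) : a ^+ 2 * b ^+ 2 * c * (2 * a ^+ 2 * (b * c)) - (a ^+ 3 * b ^+ 3 * d + 3 * a ^+ 4 * b ^+ 3 * c * c) =
  - (a ^+ 3 * b ^+ 3 * (a * c ^+ 2 + d)) by ring.
exact: alg.
Qed.

(** Fixes l once and for all, before t: the constants k1 and k2 must not depend on t. The gradient
    may be bounded below only up to a multiple of v^2, since the potential term will enter with the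
    factor t^2. *)
Let weight_bounds : exists l k1 k2 : R, [/\ 0 < l, 0 < k2, 0 <= k1,
  forall v x, K x -> - k1 * v x ^+ 2 <= carleman_form A (X l) (m l) v x &
  forall x, K x -> q l x * m l x - \sum_(k < n) partial k (fun x => q l x * X l k x) x <= - k2].
Proof.
have [C1 C10 H1] := hbW; have [C2 C20 H2] := hb0 sdivpY.
(* The second summand beats the gradient errors of size C1, the third the potential error of size
   C2, and the 1 ensures l >= 1. *)
pose l := 1 + (C1 + 1) * Lambda / p0 + (C2 + 1) / p0 ^+ 2.
have t1 : 0 <= (C1 + 1) * Lambda / p0 by apply: divr_ge0; [apply: mulr_ge0; [exact: addr_ge0|exact: ltW]|exact: ltW].
have t2 : 0 <= (C2 + 1) / p0 ^+ 2 by apply: divr_ge0; [exact: addr_ge0|apply: exprn_ge0; exact: ltW].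
have l1 : 1 <= l by rewrite /l; lra.
have l0 : 0 < l by lra.
have lp : C1 + 1 <= l * p0 / Lambda.
  rewrite ler_pdivlMr// -ler_pdivrMr//; apply: (@le_trans _ _ (1 + (C1 + 1) * Lambda / p0)); first by rewrite lerDr.
  by rewrite /l lerDl.
have lp2 : C2 + 1 <= l * p0 ^+ 2 by rewrite -ler_pdivrMr ?exprn_gt0// /l; lra.
pose f0 := expR (- (l * r2)); have f00 : 0 < f0 by exact: expR_gt0.
have fK x : K x -> f0 <= phi l x.
  by move=> /andP[_ h]; rewrite /phi /psi ler_expR mulrN lerN2; apply: ler_wpM2l => //; exact: ltW.
have [C3 C30 H3] : hbound K 1 (fun x g => \sum_(i < n) Fl i x g * partial i (m l) x).
  apply: hbound_sum => i; exact: (hboundM (hbF i) (hb0 (smooth_partial i (sm l)))).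
exists l, (C3 ^+ 2 / (4 * f0)), (f0 ^+ 3); split=> //.
- by rewrite exprn_gt0.
- by apply: divr_ge0; [exact: sqr_ge0|rewrite mulr_ge0// ltW].
- move=> v x Kx; rewrite form_expand; set g := fun i => partial i v x.
  have w := H1 x g Kx; have w3 := H3 x g Kx; have fx := fK x Kx; have px := p_ge Kx.
  have eN : Lambda^-1 * gnorm g ^+ 2 <= el x g.
    have /andP[h _] := A_ell Aell x g; rewrite gnorm_sqr; apply: le_trans h _.
    rewrite le_eqVlt; apply/orP; left; apply/eqP; apply: eq_bigr => i _; apply: eq_bigr => j _.
    by rewrite -mulrA [g j * _]mulrC.
  rewrite expr1 in w3.
  exact: (carleman_arith (\sum_(k < n) Y k x * g k) (v x) (ltW p00) L0 C10 l1 lp f00 (gnorm_ge0 g) eN w w3 fx px).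
- move=> x Kx; rewrite potential_expand lerN2.
  have fx := fK x Kx; have px := p_ge Kx; have d2 := H2 x (fun=> 0) Kx; rewrite expr0 mulr1 in d2.
  have h1 : 1 <= l * p x ^+ 2 + divpY x.
    have : l * p0 ^+ 2 <= l * p x ^+ 2.
      by apply: ler_wpM2l; [exact: ltW|apply: lerXn2r; rewrite ?nnegrE; [exact: ltW|exact: le_trans (ltW p00) px|]].
    by have /ler_normlP[+ _] := d2; move: (divpY x) (p x ^+ 2) (p0 ^+ 2) lp2 => a b c; lra.
  rewrite -[f0 ^+ 3]mulr1; apply: ler_pM => //; first by rewrite exprn_ge0// ltW.
  rewrite -exprMn; apply: lerXn2r; rewrite ?nnegrE; first exact: ltW.
    by rewrite mulr_ge0// ?expR_ge0// ltW.
  by rewrite -[f0]mul1r; apply: ler_pM => //; exact: ltW.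
Qed.

(** For v = exp(t phi) u, the cross term <S, h> of the symmetric part with the multiplier is at
    least (t^2 k2 - k1) ||v||^2. As 4 t <S, h> is bounded by the norm of the conjugated operator up
    to O(t^2) ||v||^2, a gain t^3 results. *)
Lemma carleman_estimate : exists l C t0 : R, [/\ 0 < l, 0 < C, 1 <= t0 &
  forall t u, t0 <= t -> test_function setT u -> (forall x, ~ K x -> u x = 0) ->
  t ^+ 3 * inner (fun x => cweight x1 l t x * u x) (fun x => cweight x1 l t x * u x) <=
    C * inner (fun x => cweight x1 l t x * Lop A u x) (fun x => cweight x1 l t x * Lop A u x)].
Proof.
have [l [k1 [k2 [l0 k20 k10 Hform Hpot]]]] := weight_bounds.
have sdX : smooth (fun x => (divX l x - m l x) * (divX l x - m l x)).
  have s1 : smooth (fun x => divX l x - m l x).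
    by apply: (smoothB _ (sm l)); apply: smooth_sum => k; exact: smooth_partial k (sX l k).
  exact: (smoothM s1 s1).
have [C4 C40 H4] := hb0 sdX.
have k0 : 0 <= (2 * k1 + C4) / k2 by rewrite divr_ge0 ?addr_ge0 ?mulr_ge0// ltW.
(* This threshold means k2 t >= k2 + 2 k1 + C4, so that half of the leading term absorbs the
   errors. *)
exists l, k2^-1, (1 + (2 * k1 + C4) / k2); split=> //; [by rewrite invr_gt0|by rewrite lerDl|].
move=> t u ht tu u0; pose E := cweight x1 l t; rewrite -/E.
have t1 : 1 <= t by lra.
have tp : 0 < t by lra.
have EE : E = fun x => expR (t * phi l x).
  by apply/funext => x; rewrite /E /cweight /phi /psi mulrN.
have sE : smooth E by rewrite EE; exact: smooth_expR (smoothZ t (sphi l)).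
pose v x := E x * u x; have tv : test_function setT v := tf_Ml sE tu.
have v0 x : ~ K x -> v x = 0 by move=> nK; rewrite /v u0// mulr0.
have clK : closed K by exact: compact_closed_rV.
have g0 i x : ~ K x -> partial i v x = 0 by exact: partial_vanish clK v0 x.
pose h := multiplier (X l) (m l) v; have sXm := conj (sX l) (sm l).
have th : test_function setT h := tf_multiplier sXm tv.
have tL : test_function setT (Lop A v) := tf_Lop Asm tv.
have tqv : test_function setT (fun x => q l x * v x) := tf_Ml (sq l) tv.
pose P x := E x * Lop A u x; have tP : test_function setT P := tf_Ml sE (tf_Lop Asm tu).
pose S x := Lop A v x - t ^+ 2 * (q l x * v x).
have tS : test_function setT S := tfB tL (tfZ (t ^+ 2) tqv).
(* The multiplier has m where the antisymmetric part has div X; the difference is of order zero in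
   v. *)
have PE x : P x = S x + t * h x + t * (divX l x - m l x) * v x.
  have := conj_Lop Asm Asym t x (tf_smooth tu) (sphi l); rewrite /P /S /h /multiplier EE /v EE => ->.
  rewrite -/(divX l x) -/(q l x).
  have alg (a b c d e f y : R) : a + y * b * c + 2 * y * d - y ^+ 2 * e * c = a - y ^+ 2 * (e * c) + y * (2 * d + f * c) + y * (b - f) * c by ring.
  exact: alg.
pose I := inner v v.
have I0 : 0 <= I by exact: inner_ge0.
have Lv := tf_L2 tv; have Lh := tf_L2 th; have LS := tf_L2 tS; have LP := tf_L2 tP.
have ivv := L2M Lv Lv.
have form0 x : ~ K x -> carleman_form A (X l) (m l) v x = 0.
  move=> nK; have F0 i : dflux A v i x = 0.
    by apply: big1 => j _; rewrite g0// mulr0.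
  have d0 : denergy A v x = 0 by apply: big1 => i _; apply: big1 => j _; rewrite g0// mul0r mulr0.
  rewrite /carleman_form d0 v0// mul0r mulr0 !addr0 big1 ?mulr0; last by move=> i _; rewrite F0 mul0r.
  rewrite big1 ?subr0// => k _; rewrite big1 ?mulr0// => i _; apply: big1 => j _; rewrite g0// mul0r mulr0//.
have B1 : - k1 * I <= inner (Lop A v) h.
  rewrite (multiplier_Lop Asm Asym sXm tv) /I /inner -RintZ//; apply: Rint_le.
  - exact: intgZ.
  - exact: tf_intg (tf_carleman_form Asm sXm tv).
  move=> x; have [Kx|nK] := pselect (K x); last by rewrite form0// v0// mulr0 mulr0.
  by rewrite -expr2; exact: Hform.
have B2 : inner (fun x => q l x * v x) h <= - k2 * I.
  rewrite (multiplier_potential sXm (sq l) tv) /I /inner -RintZ//; apply: Rint_le.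
  - have ts : smooth (fun x => q l x * m l x - \sum_(k < n) partial k (fun x => q l x * X l k x) x).
      apply: (smoothB (smoothM (sq l) (sm l))); apply: smooth_sum => k.
      exact: smooth_partial k (smoothM (sq l) (sX l k)).
    have := tf_intg (tf_Ml ts (tf_Ml (tf_smooth tv) tv)).
    by apply: eq_intg => x; rewrite expr2.
  - exact: intgZ.
  move=> x; have [Kx|nK] := pselect (K x); last by rewrite v0// expr0n !mulr0.
  by rewrite -expr2; apply: ler_wpM2r; [exact: sqr_ge0|exact: Hpot].
have LLv := tf_L2 tL; have Lqv := tf_L2 tqv.
have B3 : inner S h = inner (Lop A v) h - t ^+ 2 * inner (fun x => q l x * v x) h.
  rewrite /S innerBl//; last exact: L2Z.
  by rewrite innerZl.
(* Pointwise 4 t S h <= (S + t h)^2, and S + t h differs from P by t (div X - m) v, where C4 bounds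
   (div X - m)^2 on K. *)
have B4 : 4 * t * inner S h <= 2 * inner P P + 2 * t ^+ 2 * C4 * I.
  rewrite /I /inner -!RintZ//; [|exact: L2M..].
  rewrite -RintD; [|apply: intgZ; exact: L2M..].
  apply: Rint_le; [apply: intgZ; exact: L2M|by apply: intgD; apply: intgZ; exact: L2M|].
  move=> x; rewrite PE.
  have hv : (divX l x - m l x) * (divX l x - m l x) * (v x * v x) <= C4 * (v x * v x).
    have [Kx|nK] := pselect (K x); last by rewrite v0// !mulr0.
    have vv : 0 <= v x * v x by rewrite -expr2 sqr_ge0.
    apply: ler_wpM2r => //; have := H4 x (fun=> 0) Kx; rewrite expr0 mulr1; exact: le_trans (ler_norm _).
  move: (S x) (h x) (divX l x - m l x) (v x) hv => a b c d hv.
  have h1 := sqr_ge0 (a - t * b); have h2 := sqr_ge0 (a + t * b + 2 * (t * c * d)).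
  have h3 : t ^+ 2 * (c * c * (d * d)) <= t ^+ 2 * (C4 * (d * d)) by apply: ler_wpM2l => //; exact: sqr_ge0.
  nra.
rewrite -/(inner P P) -/P -/I ler_pdivlMl//.
have kt : k2 + 2 * k1 + C4 <= k2 * t.
  have : (2 * k1 + C4) / k2 <= t - 1 by lra.
  by rewrite ler_pdivrMr//; lra.
have t2 : t <= t ^+ 2 by rewrite expr2 -{1}[t]mulr1 ler_pM2l.
have G1 : 4 * t * (- k1 * I + t ^+ 2 * (k2 * I)) <= 2 * inner P P + 2 * t ^+ 2 * C4 * I.
  apply: le_trans B4; rewrite B3; apply: ler_wpM2l; first by rewrite mulr_ge0// ltW.
  apply: lerD => //; rewrite -mulrN; apply: ler_wpM2l; [exact: sqr_ge0|lra].
have G2 : (k2 + 2 * k1 + C4) * (t ^+ 2 * I) <= k2 * t * (t ^+ 2 * I).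
  by apply: ler_wpM2r => //; rewrite mulr_ge0// sqr_ge0.
have G3 : k1 * (t * I) <= k1 * (t ^+ 2 * I) by apply: ler_wpM2l => //; apply: ler_wpM2r.
have G4 : 0 <= k2 * (t ^+ 2 * I) by rewrite !mulr_ge0 ?sqr_ge0// ltW.
have e3 : t ^+ 3 = t * t ^+ 2 by rewrite exprS.
rewrite e3; move: G1 G2 G3 G4; move: (t ^+ 2) => T; nra.
Qed.

End carleman_estimate.

Section null_sequences.
Context {R : realType} {n : nat}.
Local Notation V := 'rV[R]_n.
Implicit Types (fs gs : nat -> V -> R) (f g : V -> R).

Definition null2 fs := (forall k, L2 (fs k)) /\ inner (fs k) (fs k) @[k --> \oo] --> (0 : R).

Lemma null2_le fs (b : nat -> R) : (forall k, L2 (fs k)) -> (forall k, inner (fs k) (fs k) <= b k) ->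
  b @ \oo --> (0 : R) -> null2 fs.
Proof.
move=> Lf fb b0; split=> //; apply: (@squeeze_cvgr _ _ _ _ (cst 0) b) => //; last exact: cvg_cst.
by apply: nearW => k; rewrite inner_ge0 fb.
Qed.

Lemma null2D fs gs : null2 fs -> null2 gs -> null2 (fun k x => fs k x + gs k x).
Proof.
move=> [Lf cf] [Lg cg]; apply: (@null2_le _ (fun k => 2 * inner (fs k) (fs k) + 2 * inner (gs k) (gs k))).
- by move=> k; exact: (L2D (Lf k) (Lg k)).
- by move=> k; exact: (inner_add_le (Lf k) (Lg k)).
rewrite -[X in _ --> X](addr0 0) -[X in _ --> X + _](mulr0 2) -[X in _ --> _ + X](mulr0 2).
by apply: cvgD; apply: cvgM => //; exact: cvg_cst.
Qed.

Lemma inner_bM_le (E f : V -> R) (M : R) : measurable_fun setT E -> (forall x, `|E x| <= M) -> L2 f ->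
  inner (fun x => E x * f x) (fun x => E x * f x) <= M ^+ 2 * inner f f.
Proof.
move=> mE EM Lf; have LE := L2_bM mE EM Lf.
rewrite /inner -RintZ; last exact: L2M.
apply: Rint_le; [exact: L2M|by apply: intgZ; exact: L2M|] => x.
rewrite mulrACA -!expr2; apply: ler_wpM2r; first exact: sqr_ge0.
by rewrite -[E x ^+ 2](real_normK (num_real _)); apply: lerXn2r; rewrite ?nnegrE ?EM//; exact: le_trans (EM x).
Qed.

Lemma null2_bM (E : V -> R) (M : R) fs : measurable_fun setT E -> (forall x, `|E x| <= M) -> null2 fs ->
  null2 (fun k x => E x * fs k x).
Proof.
move=> mE EM [Lf cf]; apply: (@null2_le _ (fun k => M ^+ 2 * inner (fs k) (fs k))).
- by move=> k; exact: (L2_bM mE EM (Lf k)).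
- by move=> k; exact: (inner_bM_le mE EM (Lf k)).
by rewrite -[X in _ --> X](mulr0 (M ^+ 2)); apply: cvgM => //; exact: cvg_cst.
Qed.

Lemma null2_sum I (s : seq I) (F : I -> nat -> V -> R) : (forall i, null2 (F i)) ->
  null2 (fun k x => \sum_(i <- s) F i k x).
Proof.
move=> nF; elim: s => [|i s IH].
  apply: (@null2_le _ (fun=> 0)) => [k|k|]; last exact: cvg_cst.
    by under eq_fun do rewrite big_nil; exact: L20.
  under eq_fun do rewrite big_nil; by rewrite inner0l.
have := null2D (nF i) IH; congr null2; apply/funext => k; apply/funext => x; by rewrite big_cons.
Qed.

Lemma null2_norm fs f : (forall k, L2 (fs k)) -> L2 f -> null2 (fun k x => fs k x - f x) ->
  inner (fs k) (fs k) @[k --> \oo] --> inner f f.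
Proof.
move=> Lf_ Lf [LB c0].
have c : L2cvg fs f by split.
have ci := L2cvg_inner c Lf.
have -> : inner f f = 0 + 2 * inner f f - inner f f by ring.
rewrite (_ : (fun k => _) = fun k => inner (fun x => fs k x - f x) (fun x => fs k x - f x) + 2 * inner (fs k) f - inner f f).
  by apply: cvgB; [apply: cvgD => //; apply: cvgM => //; exact: cvg_cst|exact: cvg_cst].
by apply/funext => k; rewrite inner_subE//; ring.
Qed.

Lemma comm_null2 i a g : test_function setT a -> L2 g -> null2 (fun k => comm i a k g).
Proof.
move=> ta Lg; split; last exact: friedrichs_cvg ta Lg.
move=> k; have kr := tf_kern (tf_partial i (@tf_rho R n k)).
apply: L2D; [apply: L2B|].
- exact: (tf_bM (tf_partial i ta) (moll_L2 k Lg)).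
- by apply: (tf_bM ta); have [] := conv_L2 kr Lg.
- by have [] := conv_L2 kr (tf_bM ta Lg).
Qed.

End null_sequences.

Section near_annulus.
Context {R : realType} {n : nat}.
Local Notation V := 'rV[R]_n.

Lemma sqnorm_close (y d : V) (e r : R) : 0 <= e <= 1 -> (forall i, `|d 0 i| <= e) -> sqnorm y <= r ->
  `|sqnorm (y + d) - sqnorm y| <= e * (n%:R * (3 + 2 * r)).
Proof.
move=> /andP[e0 e1] de yr.
have -> : sqnorm (y + d) - sqnorm y = \sum_(i < n) (2 * y 0 i * d 0 i + d 0 i ^+ 2).
  by rewrite /sqnorm -sumrB; apply: eq_bigr => i _; rewrite !mxE; ring.
apply: le_trans (ler_norm_sum _ _ _) _.
have -> : e * (n%:R * (3 + 2 * r)) = \sum_(i < n) e * (3 + 2 * r).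
  by rewrite sumr_const card_ord -[RHS]mulr_natl mulrCA.
apply: ler_sum => i _; have h1 := le_trans (sqnorm_ge y i) yr; have h2 := de i.
have h3 : `|y 0 i| <= 1 + r.
  have := h1; rewrite -(real_normK (num_real (y 0 i))); move: `|y 0 i| (normr_ge0 (y 0 i)) => a a0; nra.
apply: le_trans (ler_normD _ _) _; rewrite normrX -mulrA 2!normrM (ger0_norm (ler0n R 2)).
move: `|y 0 i| `|d 0 i| (normr_ge0 (y 0 i)) (normr_ge0 (d 0 i)) h2 h3 => a b a0 b0 h2 h3.
have r0 : 0 <= 1 + r by exact: le_trans a0 h3.
have h4 : a * b <= (1 + r) * e by apply: ler_pM.
have h5 : b ^+ 2 <= e * 1 by rewrite expr2; apply: ler_pM => //; exact: le_trans h2 e1.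
by lra.
Qed.

Lemma annulus_margin (x1 : V) (r1 r1' r2' r2 : R) : r1 < r1' -> r2' < r2 -> 0 <= r2' -> exists m0 : nat,
  forall m, (m0 <= m)%N -> forall x z, box (m.+1%:R^-1) (z - x) -> r1' <= sqnorm (z - x1) <= r2' ->
    r1 <= sqnorm (x - x1) <= r2.
Proof.
move=> h1 h2 r20; pose D : R := n%:R * (3 + 2 * r2') + 1.
have D0 : 0 < D by rewrite ltr_wpDl// mulr_ge0// addr_ge0// mulr_ge0.
pose dl := Num.min (r1' - r1) (r2 - r2').
have dl0 : 0 < dl by rewrite lt_min !subr_gt0 h1.
have e0 : 0 < dl / D by rewrite divr_gt0.
have [m0 _ Hm] := @cvgr0_norm_lt _ _ _ _ _ _ (@cvg_harmonic R) _ e0.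
exists m0 => m mm x z bz /andP[z1 z2].
have He := Hm m mm; rewrite /= /harmonic in He.
have i0 : 0 <= m.+1%:R^-1 :> R by rewrite invr_ge0.
have i1 : m.+1%:R^-1 <= 1 :> R by rewrite invf_le1// ler1n.
have bd i : `|(x - z) 0 i| <= m.+1%:R^-1 by have := bz i; rewrite !mxE distrC.
have := @sqnorm_close (z - x1) (x - z) (m.+1%:R^-1) r2' _ bd z2; rewrite i0 i1 => /(_ isT).
have -> : z - x1 + (x - z) = x - x1 by rewrite [LHS]addrC addrA subrK.
rewrite ger0_norm// ltr_pdivlMr// in He.
have : m.+1%:R^-1 * (n%:R * (3 + 2 * r2')) <= m.+1%:R^-1 * D by apply: ler_wpM2l => //; rewrite lerDl.
have d1 : dl <= r1' - r1 by rewrite ge_min lexx.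
have d2 : dl <= r2 - r2' by rewrite ge_min lexx orbT.
move: (_ * D) (_ * (n%:R * _)) He => a b He ba /ler_normlP[k1 k2].
move: (sqnorm (x - x1)) (sqnorm (z - x1)) z1 z2 k1 k2 => s t *; apply/andP; split; lra.
Qed.

End near_annulus.

(** * Unique continuation *)

Section unique_continuation.
Context {R : realType} {n : nat}.
Local Notation V := 'rV[R]_n.
Variable A : V -> 'M[R]_n.
Hypothesis Abd : bounded_entries A.
Hypothesis Asm : smooth_entries A.
Variable Lambda : R.
Hypothesis L0 : 0 < Lambda.
Hypothesis Asym : forall x, (A x)^T = A x.
Hypothesis Aell : elliptic A Lambda.
Implicit Types (f g w F h : V -> R) (G : 'I_n -> V -> R).

Lemma smooth_cweight (x1 : V) (l t : R) : smooth (cweight x1 l t).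
Proof.
apply: smooth_expR; apply: smoothZ; apply: smooth_expR; apply: smoothN; apply: smoothZ.
exact: smooth_sqnorm.
Qed.

Lemma measurable_cweight (x1 : V) (l t : R) : measurable_fun setT (cweight x1 l t).
Proof. by apply: continuous_measurable_rV; apply: smooth_cont; exact: smooth_cweight. Qed.

Lemma cweight_le (x1 : V) (l t b : R) x : 0 <= l -> 0 <= t -> b <= sqnorm (x - x1) ->
  `|cweight x1 l t x| <= expR (t * expR (- (l * b))).
Proof.
move=> l0 t0 bx; rewrite /cweight ger0_norm ?expR_ge0// ler_expR; apply: ler_wpM2l => //.
by rewrite ler_expR lerN2; exact: ler_wpM2l.
Qed.

(** * The Carleman inequality for weak gradients *)

Section weak_carleman.
Variables (x1 : V) (r1 r1' r2' r2 : R).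
Hypotheses (r10 : 0 < r1) (r11 : r1 < r1') (r20 : 0 <= r2') (r22 : r2' < r2).

Let K0 : set V := [set x | r1' <= sqnorm (x - x1) <= r2'].
Let K : set V := [set x | r1 <= sqnorm (x - x1) <= r2].

Let conv_far : exists m0 : nat, forall k, (m0 <= k)%N -> forall h g x, L2 h -> L2 g ->
  (forall y, ~ box (k.+1%:R^-1) y -> h y = 0) -> {ae mu, forall z, ~ K0 z -> g z = 0} -> ~ K x -> conv h g x = 0.
Proof.
have [m0 H] := annulus_margin x1 r11 r22 r20; exists m0 => k mk h g x Lh Lg h0 g0 nK.
have i1 := conv_intg x Lh Lg.
rewrite /conv (@Rint_ae _ _ _ mu _ (fun=> 0)); first by rewrite /Rintegral integral0.
- exact: intg_meas i1.
- exact: measurable_cst.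
apply: filterS g0 => z gz; have [bz|nb] := pselect (box (k.+1%:R^-1) (z - x)); last by rewrite h0 ?mul0r.
by rewrite gz ?mulr0// => Kz; apply: nK; exact: (H k mk x z bz Kz).
Qed.

Let eta : V -> R := cutoff (fun x => r2 + 2 - sqnorm (x - x1)).

Let tf_eta : test_function setT eta.
Proof.
split.
  apply: smooth_cutoff; apply: smoothB; [exact: smooth_cst|exact: smooth_sqnorm].
exists [set x | sqnorm (x - x1) <= r2 + 2]; split=> //; first exact: eball_compact.
by move=> x /= /negP; rewrite -ltNge => h; apply: cutoff_eq0; rewrite subr_le0 ltW.
Qed.

Let eta1K x : K x -> eta x = 1.
Proof. by move=> /andP[_ h]; apply: cutoff_eq1; lra. Qed.

Let deta i x : K x -> partial i eta x = 0.
Proof.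
move=> /andP[_ h]; have cs : continuous (fun x : V => sqnorm (x - x1)) := smooth_cont (@smooth_sqnorm R n x1).
have cl : closed [set x : V | r2 + 1 <= sqnorm (x - x1)].
  by apply: (@closed_comp _ _ (fun x : V => sqnorm (x - x1)) [set y | r2 + 1 <= y]) => [y _|]; [exact: cs|exact: closed_ge].
have e0 y : ~ [set x : V | r2 + 1 <= sqnorm (x - x1)] y -> eta y + - 1 = 0.
  by move=> /= /negP; rewrite -ltNge => hy; rewrite /eta cutoff_eq1 ?subrr//; lra.
have eq := partial_smoothD i x (tf_smooth tf_eta) (smooth_cst (-1)).
have z : partial i (fun _ : V => -1 : R) x = 0 by exact: derive_cst.
rewrite z addr0 in eq; rewrite -eq; apply: (partial_vanish i cl e0 (x := x)).
by move=> /= h'; lra.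
Qed.

(** Coefficients cut off away from K: Friedrichs' lemma needs compactly supported coefficients, and
    nothing changes where the mollified functions live. *)
Let a i j x : R := eta x * A x i j.
Let ta i j : test_function setT (a i j). Proof. exact: (tf_Mr (Asm i j) tf_eta). Qed.

(** On K the cutoff is 1 with zero gradient, so moving the mollifier through the derivative and the
    coefficients leaves exactly the commutators [comm]. Off K every term with a kernel vanishes. *)
Let Lop_moll k w G F x : grad w G -> L2 F -> wdiv A G F ->
  {ae mu, forall x, ~ K0 x -> forall i, G i x = 0} ->
  (forall h g x, L2 h -> L2 g -> (forall y, ~ box (k.+1%:R^-1) y -> h y = 0) ->
     {ae mu, forall z, ~ K0 z -> g z = 0} -> ~ K x -> conv h g x = 0) ->
  Lop A (moll k w) x = moll k F x + \sum_(i < n) \sum_(j < n) -1 * comm i (a i j) k (G j) x.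
Proof.
move=> [Lw hG] LF dG G0 far.
have LG i : L2 (G i) by have [] := hG i.
have tr := @tf_rho R n k; have Lr := tf_L2 tr.
have smo j : smooth (moll k (G j)) := moll_smooth k (LG j).
have cb : closed (box (k.+1%:R^-1) : set V) by apply: compact_closed_rV; exact: box_compact.
have dr0 i y : ~ box (k.+1%:R^-1) y -> partial i (rho k) y = 0 := partial_vanish i cb (@rho_0 R n k) (x := y).
have Gj0 j : {ae mu, forall z, ~ K0 z -> G j z = 0} by apply: filterS G0 => z h nK; exact: h.
have dmoll i : partial i (moll k w) = moll k (G i).
  by apply/funext => y; have [_ wG] := hG i; have [] := moll_partial k y Lw (LG i) wG.
have dflx i : partial i (flux A (fun j => partial j (moll k w)) i) x =
    \sum_(j < n) (A x i j * - conv (partial i (rho k)) (G j) x + moll k (G j) x * partial i (fun x => A x i j) x).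
  have -> : flux A (fun j => partial j (moll k w)) i = fun y => \sum_(j < n) A y i j * moll k (G j) y.
    by apply/funext => y; apply: eq_bigr => j _; rewrite dmoll.
  rewrite (partial_smooth_sum i _ x (fun j => smoothM (Asm i j) (smo j))); apply: eq_bigr => j _.
  rewrite (partialM_tf i x (Asm i j) (smo j)); congr (_ * _ + _).
  by have [_ e] := conv_partial i x tr (LG j); exact: e.
have key i j : A x i j * - conv (partial i (rho k)) (G j) x + moll k (G j) x * partial i (fun x => A x i j) x =
    comm i (a i j) k (G j) x - conv (partial i (rho k)) (fun z => a i j z * G j z) x.
  rewrite /comm; have [Kx|nK] := pselect (K x).
    have -> : a i j x = A x i j by rewrite /a eta1K// mul1r.
    have -> : partial i (a i j) x = partial i (fun x => A x i j) x.
      by rewrite /a (partialM_tf i x (tf_smooth tf_eta) (Asm i j)) deta// eta1K// mulr0 addr0 mul1r.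
    have alg (b c d e f : R) : b * - c + d * e = e * d - b * c + f - f by ring.
    exact: alg.
  have c0 : conv (partial i (rho k)) (G j) x = 0 := far _ _ _ (tf_L2 (tf_partial i tr)) (LG j) (dr0 i) (Gj0 j) nK.
  have m0 : moll k (G j) x = 0 := far _ _ _ Lr (LG j) (@rho_0 R n k) (Gj0 j) nK.
  rewrite c0 m0.
  have alg (b c d e f : R) : b * - 0 + 0 * c = d * 0 - e * 0 + f - f by ring.
  exact: alg.
have LaG i j : L2 (fun z => a i j z * G j z) := tf_bM (ta i j) (LG j).
have eF : \sum_(i < n) \sum_(j < n) conv (partial i (rho k)) (fun z => a i j z * G j z) x = moll k F x.
  have -> : moll k F x = inner F (fun z => rho k (z - x)) by apply: eq_Rintegral => z _; exact: mulrC.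
  rewrite -(dG _ (tf_shift x tr)) /aform; apply: eq_bigr => i _.
  have Lpr := tf_L2 (tf_partial i tr).
  rewrite /conv -Rint_sum; last by move=> j; exact: (conv_intg x Lpr (LaG i j)).
  apply: Rint_ae.
  - exact: (intg_meas (intg_sum _ (fun j => conv_intg x Lpr (LaG i j)))).
  - exact: (intg_meas (L2M (L2_flux Abd Asm i LG) (tf_L2 (tf_partial i (tf_shift x tr))))).
  apply: filterS G0 => z hz; rewrite (partial_shift x i z (tf_smooth tr)) /flux mulr_suml.
  apply: eq_bigr => j _; have [Kz|nKz] := pselect (K0 z); last by rewrite hz// !mulr0 mul0r.
  have -> : a i j z = A z i j.
    rewrite /a eta1K ?mul1r//; move: Kz => /andP[h1 h2]; apply/andP; split.
      by apply: le_trans h1; exact: ltW.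
    by apply: le_trans h2 _; exact: ltW.
  have alg (b c d : R) : b * (c * d) = c * d * b by ring.
  exact: alg.
have e : \sum_(i < n) partial i (flux A (fun j => partial j (moll k w)) i) x =
    \sum_(i < n) \sum_(j < n) (comm i (a i j) k (G j) x - conv (partial i (rho k)) (fun z => a i j z * G j z) x).
  by apply: eq_bigr => i _; rewrite dflx; apply: eq_bigr => j _; exact: key.
apply: (etrans (congr1 -%R e)); rewrite -eF -sumrN -big_split; apply: eq_bigr => i _.
rewrite /= -sumrN -big_split; apply: eq_bigr => j _ /=.
have alg (b c : R) : - (b - c) = c + -1 * b by ring.
exact: alg.
Qed.

Let null2_shift (fs : nat -> V -> R) (m0 : nat) : null2 fs -> null2 (fun m => fs (m + m0)%N).
Proof.
move=> [Lf cf]; split; first by move=> k; exact: Lf.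
by have := cvg_comp _ _ (cvg_addnr m0) cf.
Qed.

(** The mollifications of w are smooth and supported in the larger annulus, and by Friedrichs' lemma
    L of them tends to F in L^2. As the weight is bounded for fixed t, the classical inequality
    passes to the limit. *)
Lemma weak_carleman : exists l C t0 : R, [/\ 0 < l, 0 < C, 1 <= t0 &
  forall t w G F, t0 <= t -> grad w G -> L2 F -> wdiv A G F ->
  {ae mu, forall x, ~ K0 x -> w x = 0} -> {ae mu, forall x, ~ K0 x -> forall i, G i x = 0} ->
  t ^+ 3 * inner (fun x => cweight x1 l t x * w x) (fun x => cweight x1 l t x * w x) <=
    C * inner (fun x => cweight x1 l t x * F x) (fun x => cweight x1 l t x * F x)].
Proof.
have [l [C [t0 [l0 C0 t01 H]]]] := carleman_estimate Asm L0 Asym Aell x1 r2 r10.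
have [m0 far] := conv_far.
exists l, C, t0; split=> // t w G F tt gw LF dG w0 G0.
have [Lw hG] := gw; have LG i : L2 (G i) by have [] := hG i.
pose u m := moll (m + m0) w; pose E := cweight x1 l t.
have mE : measurable_fun setT E := measurable_cweight x1 l t.
have t00 : 0 <= t by lra.
have EM x : `|E x| <= expR (t * expR (- (l * 0))).
  by apply: cweight_le => //; [exact: ltW|exact: sqnorm_ge0].
have tu m : test_function setT (u m) /\ forall x, ~ K x -> u m x = 0.
  have v x : ~ K x -> u m x = 0.
    exact: (far _ (leq_addl m m0) _ _ x (tf_L2 (@tf_rho R n _)) Lw (@rho_0 R n _) w0).
  split=> //; split; first exact: moll_smooth.
  exists [set x | sqnorm (x - x1) <= r2]; split=> //; first exact: eball_compact.
  by move=> x /= nx; apply: v => /andP[_]; exact: nx.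
have nw : null2 (fun m x => u m x - w x).
  have : null2 (fun k x => moll k w x - w x).
    by split; [move=> k; exact: (L2B (moll_L2 k Lw) Lw)|exact: moll_cvg].
  exact: null2_shift.
have nL : null2 (fun m x => Lop A (u m) x - F x).
  have n1 : null2 (fun k x => moll k F x - F x).
    by split; [move=> k; exact: (L2B (moll_L2 k LF) LF)|exact: moll_cvg].
  have n2 : null2 (fun k x => \sum_(i < n) \sum_(j < n) -1 * comm i (a i j) k (G j) x).
    apply: null2_sum => i; apply: null2_sum => j.
    apply: (@null2_bM _ _ (fun=> -1) 1); [exact: measurable_cst|by move=> x; rewrite normrN1|].
    exact: (comm_null2 i (ta i j) (LG j)).
  have := null2_shift m0 (null2D n1 n2); congr null2; apply/funext => m; apply/funext => x.
  have eq := Lop_moll x gw LF dG G0 (far _ (leq_addl m m0)).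
  have alg (b c d e : R) : e = b + d -> b - c + d = e - c by move=> ->; ring.
  exact: alg eq.
have bdE f : L2 f -> L2 (fun x => E x * f x) by move=> Lf; exact: (L2_bM mE EM Lf).
have LLu m : L2 (Lop A (u m)) := tf_L2 (tf_Lop Asm (tu m).1).
have lim fs f : (forall m, L2 (fs m)) -> L2 f -> null2 (fun m x => fs m x - f x) ->
    inner (fun x => E x * fs m x) (fun x => E x * fs m x) @[m --> \oo] --> inner (fun x => E x * f x) (fun x => E x * f x).
  move=> Lfs Lf nf; apply: null2_norm; [by move=> m; exact: bdE|exact: bdE|].
  have := null2_bM mE EM nf; congr null2; apply/funext => m; apply/funext => x.
  exact: mulrBr.
have c1 := lim _ _ (fun m => tf_L2 (tu m).1) Lw nw.
have c2 := lim _ _ LLu LF nL.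
have scale (c : R) (fs : nat -> R) (f : R) : fs @ \oo --> f -> (fun m => c * fs m) @ \oo --> c * f.
  by move=> h; apply: cvgM => //; exact: cvg_cst.
have d1 := scale (t ^+ 3) _ _ c1; have d2 := scale C _ _ c2.
apply: (ler_cvg_to d1 d2); apply: nearW => m.
exact: (H t (u m) tt (tu m).1 (tu m).2).
Qed.

End weak_carleman.

Implicit Types (k chi : V -> R).

(** The commutator of L with multiplication by chi, of first order: G is the weak gradient of f. *)
Definition commutator chi f G x : R :=
  -2 * (\sum_(i < n) dflux A chi i x * G i x) + Lop A chi x * f x.

Lemma L2_commutator chi f G : test_function setT chi -> grad f G -> L2 (commutator chi f G).
Proof.
move=> tc [Lf hG]; apply: L2D; last exact: (tf_bM (tf_Lop Asm tc) Lf).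
apply: L2Z; apply: L2_sum => i; have [LG _] := hG i; exact: (tf_bM (tf_flux Asm i tc) LG).
Qed.

(** The Leibniz rule for L in weak form. Testing the equation of f with chi phi moves the cutoff,
    and the symmetry of A merges the two mixed terms into the factor -2. *)
Lemma wdiv_cutoff chi f k G : test_function setT chi -> grad f G -> L2 k -> wdiv A G k ->
  wdiv A (fun i x => chi x * G i x + partial i chi x * f x) (fun x => chi x * k x + commutator chi f G x).
Proof.
move=> tc gG Lk dG phi tp; have [Lf hG] := gG; have LG i : L2 (G i) by have [] := hG i.
have sc := tf_smooth tc; have sp := tf_smooth tp; have Lp := tf_L2 tp.
pose X := dflux A chi; have tX i : test_function setT (X i) := tf_flux Asm i tc.
have LF i : L2 (flux A G i) := L2_flux Abd Asm i LG.
have Lcp i : L2 (fun x => chi x * partial i phi x) := tf_L2 (tf_Ml sc (tf_partial i tp)).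
have Lpc i : L2 (fun x => phi x * partial i chi x) := tf_L2 (tf_Ml sp (tf_partial i tc)).
have LXp i : L2 (fun x => X i x * partial i phi x) := tf_L2 (tf_Ml (tf_smooth (tX i)) (tf_partial i tp)).
have LpX i : L2 (fun x => phi x * partial i (X i) x) := tf_L2 (tf_Ml sp (tf_partial i (tX i))).
have tcp := tf_Ml sc tp; have tXp i := tf_Ml (tf_smooth (tX i)) tp.
have e0 : aform A (fun i x => chi x * G i x + partial i chi x * f x) (fun i => partial i phi) =
    \sum_(i < n) (inner (flux A G i) (fun x => chi x * partial i phi x) + inner f (fun x => X i x * partial i phi x)).
  apply: eq_bigr => i _; rewrite /inner -RintD; [|exact: (L2M (LF i) (Lcp i))|exact: (L2M Lf (LXp i))].
  apply: eq_Rintegral => x _.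
  have -> : flux A (fun i x => chi x * G i x + partial i chi x * f x) i x = chi x * flux A G i x + f x * X i x.
    rewrite /X /dflux /flux !mulr_sumr -big_split; apply: eq_bigr => j _ /=.
    have alg (a b c d e : R) : a * (b * c + d * e) = b * (a * c) + e * (a * d) by ring.
    exact: alg.
  have alg (a b c d e : R) : (a * b + c * d) * e = b * (a * e) + c * (d * e) by ring.
  exact: alg.
have e1 : inner k (fun x => chi x * phi x) =
    \sum_(i < n) (inner (flux A G i) (fun x => chi x * partial i phi x) + inner (flux A G i) (fun x => phi x * partial i chi x)).
  rewrite -(dG _ tcp); apply: eq_bigr => i _; rewrite -(innerDr (Lcp i) (Lpc i) (LF i)).
  by congr inner; apply/funext => x; rewrite (partialM_tf i x sc sp).
have e2 i : inner f (fun x => X i x * partial i phi x) =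
    - inner (G i) (fun x => X i x * phi x) - inner f (fun x => phi x * partial i (X i) x).
  have [_ wG] := hG i; rewrite -(wG _ (tXp i)).
  have -> : partial i (fun x => X i x * phi x) = fun x => X i x * partial i phi x + phi x * partial i (X i) x.
    by apply/funext => x; rewrite (partialM_tf i x (tf_smooth (tX i)) sp).
  by rewrite (innerDr (LXp i) (LpX i) Lf) addrK.
have e3 : \sum_(i < n) inner (flux A G i) (fun x => phi x * partial i chi x) = \sum_(i < n) inner (G i) (fun x => X i x * phi x).
  rewrite /inner -!Rint_sum; [|by move=> i; exact: (L2M (LG i) (tf_L2 (tXp i)))|by move=> i; exact: (L2M (LF i) (Lpc i))].
  apply: eq_Rintegral => x _; rewrite /X /dflux /flux.
  under eq_bigr do rewrite mulr_suml.
  rewrite exchange_big/=; apply: eq_bigr => j _.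
  rewrite mulr_suml mulr_sumr; apply: eq_bigr => i _.
  have alg (a b c d : R) : a * b * (c * d) = b * (a * d * c) by ring.
  by rewrite (A_sym Asym x i j); exact: alg.
have Lck : L2 (fun x => chi x * k x) := tf_bM tc Lk.
have LZ := L2_commutator tc gG.
have LXG i : L2 (fun x => X i x * G i x) := tf_bM (tX i) (LG i).
rewrite e0 (innerDl Lck LZ Lp) (innerDl (L2Z (-2) (L2_sum _ LXG)) (tf_bM (tf_Lop Asm tc) Lf) Lp).
rewrite (innerZl (-2) (L2_sum _ LXG) Lp) (inner_suml _ LXG Lp).
have -> : inner (fun x => chi x * k x) phi = inner k (fun x => chi x * phi x).
  by apply: eq_Rintegral => x _; rewrite -mulrA mulrCA.
have -> : \sum_(i < n) inner (fun x => X i x * G i x) phi = \sum_(i < n) inner (G i) (fun x => X i x * phi x).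
  by apply: eq_bigr => i _; apply: eq_Rintegral => x _; rewrite [X i x * _]mulrC mulrA.
have -> : inner (fun x => Lop A chi x * f x) phi = - \sum_(i < n) inner f (fun x => phi x * partial i (X i) x).
  rewrite -sumrN -[RHS](_ : inner f (fun x => \sum_(i < n) -1 * (phi x * partial i (X i) x)) = _).
    apply: eq_Rintegral => x _; rewrite /Lop -mulr_sumr -mulr_sumr.
    have alg (a b c : R) : - a * b * c = b * (-1 * (c * a)) by ring.
    exact: alg.
  rewrite (inner_sumr _ (fun i => L2Z (-1) (LpX i)) Lf); apply: eq_bigr => i _.
  by rewrite (innerZr (-1) (LpX i) Lf) mulN1r.
have e2s : \sum_(i < n) inner f (fun x => X i x * partial i phi x) =
    - (\sum_(i < n) inner (G i) (fun x => X i x * phi x)) - \sum_(i < n) inner f (fun x => phi x * partial i (X i) x).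
  by rewrite -sumrN -sumrB; apply: eq_bigr => i _; exact: e2.
have fin (a b c s t : R) : b = - s - t -> c = a + s -> a + b = c + (-2 * s - t) by move=> -> ->; ring.
apply: (etrans (big_split _ _ _ _ _)); apply: (fin _ _ _ _ _ e2s).
by apply: (etrans e1); apply: (etrans (big_split _ _ _ _ _)); congr (_ + _); exact: e3.
Qed.

Lemma grad_energy f k G : grad f G -> L2 k -> wdiv A G k ->
  \sum_(i < n) inner (G i) (G i) <= Lambda * inner k f.
Proof.
move=> gG Lk dG; have [Lf hG] := gG; have LG i : L2 (G i) by have [] := hG i.
rewrite -(wdiv_grad Abd Asm LG Lk dG gG) -(aformE Abd Asm LG LG) /inner -Rint_sum; last by move=> i; exact: (L2M (LG i) (LG i)).
rewrite -RintZ; last exact: (aform_intg Abd Asm LG LG).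
apply: Rint_le; [by apply: intg_sum => i; exact: (L2M (LG i) (LG i))|by apply: intgZ; exact: (aform_intg Abd Asm LG LG)|].
move=> x; have /andP[h _] := A_ell Aell x (fun i => G i x).
rewrite -ler_pdivrMl//; apply: le_trans h; rewrite le_eqVlt; apply/orP; left; apply/eqP; congr (_ * _).
Qed.

(** The gradient on the right is integrated over the whole space and so is controlled by <L f, f>
    through [grad_energy]; no local energy estimate is needed. *)
Lemma commutator_bound chi : test_function setT chi -> exists2 D : R, 0 <= D & forall f G, grad f G ->
  inner (commutator chi f G) (commutator chi f G) <= D * (\sum_(i < n) inner (G i) (G i) + inner f f).
Proof.
move=> tc; have tX i := tf_flux Asm i tc.
have hX i : hbound setT 0 (fun x (_ : 'I_n -> R) => dflux A chi i x).
  by have [C C0 h] := tf_bounded (tX i); exists C => // x g _; rewrite expr0 mulr1; exact: h.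
have [C1 C10 H1] := hbound_sum (fun i => hboundM (hX i) (hbound_coord setT i)).
have [C2 C20 H2] := tf_bounded (tf_Lop Asm tc).
pose D := 8 * C1 ^+ 2 + 2 * C2 ^+ 2.
have q1 : 0 <= C1 ^+ 2 by exact: sqr_ge0.
have q2 : 0 <= C2 ^+ 2 by exact: sqr_ge0.
exists D => [|f G gG]; first by rewrite /D; lra.
have [Lf hG] := gG; have LG i : L2 (G i) by have [] := hG i.
have LZ := L2_commutator tc gG.
have iG := fun i => L2M (LG i) (LG i); have iff := L2M Lf Lf.
rewrite /inner -Rint_sum// -RintD//; last exact: intg_sum.
rewrite -RintZ; last by apply: intgD => //; exact: intg_sum.
apply: Rint_le; [exact: (L2M LZ LZ)|by apply: intgZ; apply: intgD => //; exact: intg_sum|].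
move=> x; rewrite -expr2 /commutator.
have h1 := H1 x (fun i => G i x) I; have h2 := H2 x.
have -> : \sum_(i < n) G i x * G i x = gnorm (fun i => G i x) ^+ 2.
  by rewrite gnorm_sqr; apply: eq_bigr => i _; rewrite expr2.
rewrite add0n expr1 in h1.
have s1 : (\sum_(i < n) dflux A chi i x * G i x) ^+ 2 <= C1 ^+ 2 * gnorm (fun i => G i x) ^+ 2.
  rewrite -(real_normK (num_real (\sum_(i < n) _))) -exprMn; apply: lerXn2r; rewrite ?nnegrE//.
  by apply: mulr_ge0 => //; exact: gnorm_ge0.
have s2 : (Lop A chi x * f x) ^+ 2 <= C2 ^+ 2 * f x ^+ 2.
  rewrite exprMn; apply: ler_wpM2r; first exact: sqr_ge0.
  by rewrite -(real_normK (num_real (Lop A chi x))); apply: lerXn2r; rewrite ?nnegrE.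
have s3 := sq_add_le (-2 * (\sum_(i < n) dflux A chi i x * G i x)) (Lop A chi x * f x).
have g0 := sqr_ge0 (gnorm (fun i => G i x)); have f0 := sqr_ge0 (f x).
rewrite /D -(expr2 (f x)); apply: le_trans s3 _.
have fin (a b p q c1 c2 z : R) : a <= c1 * p -> b <= c2 * q -> 0 <= p -> 0 <= q -> 0 <= c1 -> 0 <= c2 -> z = 4 * a ->
    2 * z + 2 * b <= (8 * c1 + 2 * c2) * (p + q) by move=> *; nra.
by apply: (fin _ _ _ _ _ _ _ s1 s2 g0 f0 q1 q2); rewrite exprMn; congr (_ * _); ring.
Qed.

Lemma commutator_zero (x1 : V) (b : R) chi f G x : smooth chi -> (forall y, sqnorm (y - x1) <= b -> chi y = 1) ->
  sqnorm (x - x1) < b -> commutator chi f G x = 0.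
Proof.
move=> sc c1 xb; have cs : continuous (fun x : V => sqnorm (x - x1)) := smooth_cont (@smooth_sqnorm R n x1).
have cl : closed [set x : V | b <= sqnorm (x - x1)].
  by apply: (@closed_comp _ _ (fun x : V => sqnorm (x - x1)) [set y | b <= y]) => [y _|]; [exact: cs|exact: closed_ge].
have nx : ~ [set x : V | b <= sqnorm (x - x1)] x by move=> /=; rewrite leNgt xb.
have e0 y : ~ [set x : V | b <= sqnorm (x - x1)] y -> chi y + -1 = 0.
  by move=> /= /negP; rewrite -ltNge => hy; rewrite c1 ?subrr// ltW.
have d0 j y : ~ [set x : V | b <= sqnorm (x - x1)] y -> partial j chi y = 0.
  have eq := partial_smoothD j y sc (smooth_cst (-1)).
  have z : partial j (fun _ : V => -1 : R) y = 0 by exact: derive_cst.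
  by rewrite z addr0 in eq; rewrite -eq; exact: (partial_vanish j cl e0 (x := y)).
have X0 i y : ~ [set x : V | b <= sqnorm (x - x1)] y -> dflux A chi i y = 0.
  by move=> ny; apply: big1 => j _; rewrite d0// mulr0.
rewrite /commutator big1 ?mulr0 ?add0r; last by move=> i _; rewrite X0// mul0r.
rewrite /Lop big1 ?oppr0 ?mul0r// => i _; exact: (partial_vanish i cl (X0 i) nx).
Qed.

(** * Spreading the zero set *)

Section iteration.
Variables (x1 : V) (r N2 : R) (P : (V -> R) -> Prop).
Hypothesis r0 : 0 < r.
Hypothesis N20 : 0 <= N2.
Hypothesis hP : forall f, P f -> [/\ L2 f, {ae mu, forall x, eball x1 r x -> f x = 0} &
  exists k, [/\ div_op A f k, inner k k <= N2 * inner f f & P k]].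

(** Equal to 1 up to squared distance b from x1, and to 0 beyond b + 1. *)
Let chi (b : R) : V -> R := cutoff (fun x => b + 1 - sqnorm (x - x1)).

Let schi b : smooth (chi b).
Proof. by apply: smooth_cutoff; apply: smoothB; [exact: smooth_cst|exact: smooth_sqnorm]. Qed.

Let chi0 b x : ~ [set x : V | sqnorm (x - x1) <= b + 1] x -> chi b x = 0.
Proof. by move=> /= /negP; rewrite -ltNge => h; apply: cutoff_eq0; rewrite subr_le0 ltW. Qed.

Let tchi b : test_function setT (chi b).
Proof.
split; first exact: schi.
by exists [set x | sqnorm (x - x1) <= b + 1]; split=> //; [exact: eball_compact|exact: chi0].
Qed.

Let chi1 b x : sqnorm (x - x1) <= b -> chi b x = 1.
Proof. by move=> h; apply: cutoff_eq1; lra. Qed.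

Let weighted (l t b : R) f : R :=
  inner (fun x => cweight x1 l t x * (chi b x * f x)) (fun x => cweight x1 l t x * (chi b x * f x)).

(** The weak Carleman inequality for chi f, supported between squared distances r and b + 1; the
    outer annulus runs from r/2 to b + 2. In L(chi f) = chi k + Z the first term is of the same kind
    as chi f, with k = L f in the class P again, and the second carries a weight of at most exp(t
    exp(-l b)). *)
Let carleman_step (b : R) : 0 < b -> exists l D t0 : R, [/\ 0 < l, 0 < D, 1 <= t0 & forall t f, t0 <= t -> P f ->
  exists2 k, P k & inner k k <= N2 * inner f f /\
    t ^+ 3 * weighted l t b f <= D * (weighted l t b k + expR (t * expR (- (l * b))) ^+ 2 * inner f f)].
Proof.
move=> b0; have r20 : 0 < r / 2 by rewrite divr_gt0.
have rr : r / 2 < r by lra.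
have bb : 0 <= b + 1 by lra.
have bb2 : b + 1 < b + 2 by lra.
have [l [C [t0 [l0 C0 t01 H]]]] := weak_carleman x1 r20 rr bb bb2.
have [D1 D10 HD] := commutator_bound (tchi b).
pose D := 2 * C * (1 + D1 * (Lambda * (N2 + 1) + 1)).
have D2 : 0 <= D1 * (Lambda * (N2 + 1) + 1).
  by apply: mulr_ge0 => //; apply: addr_ge0 => //; apply: mulr_ge0; [exact: ltW|exact: addr_ge0].
have D0 : 0 < D by rewrite mulr_gt0 ?mulr_gt0// ltr_wpDr.
exists l, D, t0; split=> // t f tt Pf.
have [Lf f0 [k [Lfk kN Pk]]] := hP Pf; exists k => //; split=> //.
have [Lk [G [gG dG]]] := (div_opE Abd Asm _ _).1 Lfk; have [_ hG] := gG; have LG i : L2 (G i) by have [] := hG i.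
pose Z := commutator (chi b) f G; pose E := cweight x1 l t.
have LZ : L2 Z := L2_commutator (tchi b) gG.
have Lck : L2 (fun x => chi b x * k x) := tf_bM (tchi b) Lk.
have G0 i := grad_local i gG f0.
have K0out x : ~ [set x : V | r <= sqnorm (x - x1) <= b + 1] x -> eball x1 r x \/ ~ [set x : V | sqnorm (x - x1) <= b + 1] x.
  move=> nK; have [h|h] := ltP (sqnorm (x - x1)) r; [by left|right => /= h2].
  by apply: nK; rewrite /= h h2.
have w0 : {ae mu, forall x, ~ [set x : V | r <= sqnorm (x - x1) <= b + 1] x -> chi b x * f x = 0}.
  apply: filterS f0 => x hx /K0out[/hx ->|/chi0 ->]; [exact: mulr0|exact: mul0r].
have cl : closed [set x : V | sqnorm (x - x1) <= b + 1] by apply: compact_closed_rV; exact: eball_compact.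
have GG0 : {ae mu, forall x, ~ [set x : V | r <= sqnorm (x - x1) <= b + 1] x ->
    forall i, chi b x * G i x + partial i (chi b) x * f x = 0}.
  have G0' : {ae mu, forall x, forall i, eball x1 r x -> G i x = 0} by apply: filter_forall => i; exact: G0.
  apply: filterS2 G0' f0 => x gx hx /K0out[bx|nx] i; first by rewrite gx// hx// !mulr0 addr0.
  by rewrite chi0// (partial_vanish i cl (@chi0 b) nx) !mul0r addr0.
have W := H t _ _ _ tt (gradM (tf_cbd (tchi b)) gG) (L2D Lck LZ) (wdiv_cutoff (tchi b) gG Lk dG) w0 GG0.
have t00 : 0 <= t by lra.
have mE : measurable_fun setT E := measurable_cweight x1 l t.
have EM x : `|E x| <= expR (t * expR (- (l * 0))).
  by apply: cweight_le => //; [exact: ltW|exact: sqnorm_ge0].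
have LEk : L2 (fun x => E x * (chi b x * k x)) := L2_bM mE EM Lck.
have LEZ : L2 (fun x => E x * Z x) := L2_bM mE EM LZ.
pose M := expR (t * expR (- (l * b))).
(* [Z] lives where the weight is at most [M], since the cutoff is 1 closer to [x1]. *)
have EZ : inner (fun x => E x * Z x) (fun x => E x * Z x) <= M ^+ 2 * inner Z Z.
  rewrite /inner -RintZ; last exact: (L2M LZ LZ).
  apply: Rint_le; [exact: (L2M LEZ LEZ)|by apply: intgZ; exact: (L2M LZ LZ)|] => x.
  rewrite mulrACA -!expr2; have [xb|xb] := ltP (sqnorm (x - x1)) b.
    by rewrite /Z (commutator_zero f G (schi b) (@chi1 b) xb) expr0n !mulr0.
  apply: ler_wpM2r; first exact: sqr_ge0.
  rewrite -(real_normK (num_real (E x))); apply: lerXn2r; rewrite ?nnegrE//; first exact: expR_ge0.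
  exact: (cweight_le (ltW l0) t00 xb).
have en := grad_energy gG Lk dG; have HZ := HD f G gG.
have kf : inner k f <= (N2 + 1) * inner f f.
  have cs := inner_ge0 (fun x => k x - f x); rewrite inner_subE// in cs.
  have ff := inner_ge0 f; have kk := inner_ge0 k; have nf := mulr_ge0 N20 ff; lra.
have ZZ : inner Z Z <= D1 * (Lambda * (N2 + 1) + 1) * inner f f.
  apply: le_trans HZ _; rewrite -mulrA; apply: ler_wpM2l => //; rewrite mulrDl mul1r; apply: lerD => //.
  by apply: le_trans en _; rewrite -mulrA; apply: ler_wpM2l => //; exact: ltW.
have split2 : inner (fun x => E x * (chi b x * k x + Z x)) (fun x => E x * (chi b x * k x + Z x)) <=
    2 * weighted l t b k + 2 * inner (fun x => E x * Z x) (fun x => E x * Z x).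
  have := inner_add_le LEk LEZ; congr (_ <= _).
  by apply: eq_Rintegral => x _; rewrite -!mulrDr.
apply: le_trans W _; apply: (le_trans (ler_wpM2l (ltW C0) split2)).
have M20 : 0 <= M ^+ 2 by exact: sqr_ge0.
have h2 : M ^+ 2 * inner Z Z <= M ^+ 2 * (D1 * (Lambda * (N2 + 1) + 1) * inner f f) by exact: ler_wpM2l.
have Wk : 0 <= weighted l t b k by exact: inner_ge0.
have Mf : 0 <= M ^+ 2 * inner f f by apply: mulr_ge0 => //; exact: inner_ge0.
rewrite -/M /D.
move: (inner (fun x => E x * Z x) _) (inner Z Z) EZ ZZ h2 D2 Wk Mf => IZ IZZ EZ ZZ h2 D2 Wk Mf.
set d := D1 * _ in ZZ h2 D2 *; move: (weighted l t b k) Wk => w Wk.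
have h3 : IZ <= d * (M ^+ 2 * inner f f) by rewrite mulrCA; exact: le_trans EZ h2.
have h4 : 0 <= d * w by exact: mulr_ge0.
move: (M ^+ 2 * inner f f) Mf h3 => q Mf h3.
have -> : 2 * C * (1 + d) * (w + q) = C * (2 * ((1 + d) * (w + q))) by ring.
by apply: ler_wpM2l; [exact: ltW|lra].
Qed.

Let weighted_le (l t b : R) f : 0 <= l -> 0 <= t -> L2 f -> weighted l t b f <= expR t ^+ 2 * inner f f.
Proof.
move=> l0 t0 Lf; have -> : weighted l t b f = inner (fun x => (cweight x1 l t x * chi b x) * f x) (fun x => (cweight x1 l t x * chi b x) * f x).
  by rewrite /weighted /inner; apply: eq_Rintegral => x _; rewrite !mulrA.
apply: inner_bM_le => //.
  apply: measurable_funM; first exact: measurable_cweight.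
  by apply: continuous_measurable_rV; exact: smooth_cont (schi b).
move=> x; have /andP[c0 c1] := cutoff_01 (fun x => b + 1 - sqnorm (x - x1)) x.
rewrite normrM [`|chi b x|]ger0_norm// -[expR t]mulr1; apply: ler_pM => //.
have := @cweight_le x1 l t 0 x l0 t0 (sqnorm_ge0 _).
by rewrite mulr0 oppr0 expR0 mulr1.
Qed.

(** Iterating the step without end removes the crude bound exp(2t) and leaves the weighted norm of
    order exp(2 t exp(-l b)). On the smaller ball b' the weight is larger by a factor exp(2 t dl),
    and large t forces the mass I there to vanish. *)
Let ball_zero (b' : R) f : 0 < b' -> P f -> {ae mu, forall x, eball x1 b' x -> f x = 0}.
Proof.
move=> b'0 Pf; have b0 : 0 < b' + 1 by lra.
have [l [D [t0 [l0 D0 t01 step]]]] := carleman_step b0.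
set b := b' + 1 in b0 step.
pose I := \int[mu]_x (\1_(eball x1 b') x * (f x * f x)).
have [Lf _ _] := hP Pf; have iff := L2M Lf Lf.
have mB : measurable (eball x1 b').
  apply: open_measurable_rV; rewrite /eball.
  have cs : continuous (fun x : V => sqnorm (x - x1)) := smooth_cont (@smooth_sqnorm R n x1).
  by apply: (@open_comp _ _ (fun x : V => sqnorm (x - x1)) [set y | y < b']) => [x _|]; [exact: cs|exact: open_lt].
have mI : measurable_fun setT (fun x => \1_(eball x1 b') x * (f x * f x)).
  by apply: measurable_funM; [exact: measurable_indic|exact: intg_meas iff].
have ind01 x : 0 <= (\1_(eball x1 b') x : R) <= 1 by rewrite indicE; case: (x \in _); rewrite /= ler01 lexx.
have iI : intg mu (fun x => \1_(eball x1 b') x * (f x * f x)).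
  apply: (intg_le mI _ iff) => x; have /andP[i0 i1] := ind01 x.
  have ff : 0 <= f x * f x by rewrite -expr2; exact: sqr_ge0.
  rewrite ger0_norm; last exact: mulr_ge0.
  by rewrite -[leRHS]mul1r; exact: ler_wpM2r.
have I0 : 0 <= I by apply: Rint_ge0 => x; have /andP[i0 i1] := ind01 x; rewrite mulr_ge0// -expr2 sqr_ge0.
pose dl := expR (- (l * b')) - expR (- (l * b)).
have dl0 : 0 < dl by rewrite subr_gt0 ltr_expR ltrN2 ltr_pM2l// /b; lra.
have main t : t0 <= t -> 2 * D * (N2 + 1) <= t -> I * (1 + 2 * t * dl) <= 2 * D * inner f f.
  move=> tt tD; have t1 : 1 <= t by lra.
  have t00 : 0 <= t by lra.
  pose Q := expR (t * expR (- (l * b))) ^+ 2; have Q0 : 0 < Q by rewrite exprn_gt0// expR_gt0.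
  have t3 : t <= t ^+ 3 by rewrite exprS ler_peMr// exprn_ege1.
  have t3g : 0 < t ^+ 3 by lra.
  (* Each use of [step] halves the first term; the second one is reproduced. *)
  have iter j g : P g -> weighted l t b g <= (expR t ^+ 2 * (2^-1) ^+ j + 2 * D * Q) * inner g g.
    elim: j g => [|j IH] g Pg.
      have [Lg _ _] := hP Pg; rewrite expr0 mulr1; apply: le_trans (weighted_le b (ltW l0) t00 Lg) _.
      by apply: ler_wpM2r; [exact: inner_ge0|rewrite lerDl; apply: mulr_ge0; [apply: mulr_ge0 => //; exact: ltW|exact: ltW]].
    have [k Pk [kN Hs]] := step t g tt Pg; have := IH k Pk.
    set M0 := expR t ^+ 2; set h := 2^-1 ^+ j; have M00 : 0 <= M0 by exact: sqr_ge0.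
    have h0 : 0 <= h by rewrite exprn_ge0// invr_ge0.
    rewrite exprS -/h; have gg := inner_ge0 g.
    have DQ : 0 <= D * Q by rewrite mulr_ge0// ltW.
    have c0 : 0 <= M0 * h + 2 * D * Q by rewrite addr_ge0// ?mulr_ge0// ?mulr_ge0// ltW.
    rewrite -/Q in Hs; move=> IHk.
    have s1 : weighted l t b k <= (M0 * h + 2 * D * Q) * (N2 * inner g g).
      by apply: le_trans IHk _; apply: ler_wpM2l.
    have s2 : t ^+ 3 * weighted l t b g <= D * ((M0 * h + 2 * D * Q) * (N2 * inner g g) + Q * inner g g).
      by apply: le_trans Hs _; apply: ler_wpM2l; [exact: ltW|rewrite lerD2r].
    rewrite -(ler_pM2l t3g); apply: le_trans s2 _.
    have s3 : D * (N2 * inner g g) * 2 <= t ^+ 3 * inner g g.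
      have : 2 * D * (N2 + 1) * inner g g <= t ^+ 3 * inner g g by apply: ler_wpM2r => //; lra.
      have : 0 <= D * inner g g by rewrite mulr_ge0// ltW.
      set T := t ^+ 3; set v := inner g g; move=> hv hT; lra.
    have s4 : (M0 * h + 2 * D * Q) * (D * (N2 * inner g g) * 2) <= (M0 * h + 2 * D * Q) * (t ^+ 3 * inner g g) by apply: ler_wpM2l.
    have s5 : D * Q * inner g g <= t ^+ 3 * (D * Q * inner g g).
      by rewrite ler_peMl ?mulr_ge0//; lra.
    move: s4 s5; set u := inner g g; set T := t ^+ 3 => s4 s5.
    have -> : D * ((M0 * h + 2 * D * Q) * (N2 * u) + Q * u) = 2^-1 * ((M0 * h + 2 * D * Q) * (D * (N2 * u) * 2)) + D * Q * u by field.
    have -> : T * ((M0 * (2^-1 * h) + 2 * D * Q) * u) = 2^-1 * ((M0 * h + 2 * D * Q) * (T * u)) + T * (D * Q * u) by field.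
    by lra.
  have lim : weighted l t b f <= 2 * D * Q * inner f f.
    have c : (fun j => (expR t ^+ 2 * (2^-1) ^+ j + 2 * D * Q) * inner f f) @ \oo --> (expR t ^+ 2 * 0 + 2 * D * Q) * inner f f.
      apply: cvgM; last exact: cvg_cst.
      apply: cvgD; last exact: cvg_cst.
      apply: cvgM; first exact: cvg_cst.
      by apply: cvg_expr; rewrite ger0_norm ?invr_ge0// invf_lt1// ltr1n.
    rewrite mulr0 add0r in c; apply: (ler_cvg_to (@cvg_cst _ (weighted l t b f) _ \oo _) c).
    by apply: nearW => j; exact: iter.
  have low : expR (t * expR (- (l * b'))) ^+ 2 * I <= weighted l t b f.
    rewrite /I -RintZ// /weighted /inner; apply: Rint_le; first exact: intgZ.
      have Lc : L2 (fun x => cweight x1 l t x * (chi b x * f x)).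
        apply: (L2_bM (measurable_cweight x1 l t) (fun x => cweight_le (ltW l0) t00 (sqnorm_ge0 (x - x1)))).
        exact: (tf_bM (tchi b) Lf).
      exact: (L2M Lc Lc).
    move=> x; rewrite indicE; have [/set_mem xb|_] := boolP (x \in eball x1 b'); last by rewrite mul0r mulr0 -expr2 sqr_ge0.
    rewrite mul1r /eball /= in xb *; rewrite (@chi1 b); last by rewrite /b; lra.
    have alg (a c : R) : a * (1 * c) * (a * (1 * c)) = a ^+ 2 * (c * c) by ring.
    rewrite alg; apply: ler_wpM2r; first by rewrite -expr2; exact: sqr_ge0.
    apply: lerXn2r; rewrite ?nnegrE ?expR_ge0// /cweight ler_expR; apply: ler_wpM2l => //.
    by rewrite ler_expR lerN2 ler_pM2l// ltW.
  have := le_trans low lim.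
  have -> : expR (t * expR (- (l * b'))) ^+ 2 = expR (2 * t * dl) * Q.
    by rewrite /Q -!expRM_natl -expRD; congr expR; rewrite /dl; ring.
  have -> : expR (2 * t * dl) * Q * I = Q * (expR (2 * t * dl) * I) by ring.
  have -> : 2 * D * Q * inner f f = Q * (2 * D * inner f f) by ring.
  rewrite ler_pM2l//; apply: le_trans; rewrite mulrC; apply: ler_wpM2r => //; exact: expR_ge1Dx.
have Iz : I = 0.
  apply/eqP; rewrite eq_le I0 andbT leNgt; apply/negP => Ip.
  (* The first two summands meet the requirements of [main]; the third alone makes 2 t I dl as large
     as 2 D ||f||^2, so the additional I > 0 contradicts [main]. *)
  pose t := t0 + 2 * D * (N2 + 1) + D * inner f f / (I * dl).
  have ff := inner_ge0 f.
  have q1 : 0 <= 2 * D * (N2 + 1) by rewrite !mulr_ge0 ?addr_ge0// ltW.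
  have q2 : 0 <= D * inner f f / (I * dl) by rewrite divr_ge0 ?mulr_ge0// ltW.
  have ta : t0 <= t by rewrite /t; lra.
  have tb : 2 * D * (N2 + 1) <= t by rewrite /t; lra.
  have := main t ta tb; rewrite /t.
  have e : I * dl * (D * inner f f / (I * dl)) = D * inner f f.
    by rewrite mulrC divfK// mulf_neq0// gt_eqF.
  have q3 : 0 <= I * dl * (t0 + 2 * D * (N2 + 1)) by apply: mulr_ge0; [rewrite ltW// mulr_gt0|apply: addr_ge0 => //; lra].
  have -> : I * (1 + 2 * (t0 + 2 * D * (N2 + 1) + D * inner f f / (I * dl)) * dl) =
    I + 2 * (I * dl * (t0 + 2 * D * (N2 + 1))) + 2 * (I * dl * (D * inner f f / (I * dl))) by ring.
  by rewrite e; lra.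
have nn x : 0 <= \1_(eball x1 b') x * (f x * f x).
  by have /andP[i0 i1] := ind01 x; rewrite mulr_ge0// -expr2 sqr_ge0.
have := Rint_eq0_ae iI nn Iz; apply: filterS => x; rewrite indicE => hx bx; move: hx; rewrite mem_set// mul1r => /eqP.
by rewrite mulf_eq0 orbb => /eqP.
Qed.

Lemma unique_continuation f : P f -> {ae mu, forall x, f x = 0}.
Proof.
move=> Pf; have H (m : nat) : {ae mu, forall x, eball x1 m.+1%:R x -> f x = 0} by exact: ball_zero.
apply: filterS (ae_seq H) => x hx; apply: (hx (Num.truncn (sqnorm (x - x1)))).
by rewrite /eball /=; exact: truncnS_gt.
Qed.

End iteration.

Implicit Types (phi : V -> R).
Variable E : set (measurableTypeR R) -> (V -> R) -> V -> R.
Hypothesis hres : spectral_resolution (div_op A) E.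
Local Notation pol := (polar hres.1).
Local Notation bfc := (bfc hres.1).

Lemma bfc_absorb p q f h : L2 f -> bdd p -> bdd q -> (forall l, q l * p l = p l) ->
  bfc p f h -> bfc q h h.
Proof.
move=> Lf bp bq qp bh; have Lh := bh.1; split=> // g Lg.
have [k bk] := bfc_ex hres.1 Lh bq.
rewrite -bk.2// (bfc_comp Lf bp bq bh bk).2// bh.2//.
by congr polar; apply/funext => l; rewrite qp.
Qed.

(** The indicator of [0, N). The lower bound, which spectral measures do not notice, is what makes l
    times the window bounded. *)
Definition window (N : nat) (l : R) : R := (0 <= l)%R%:R * \1_(`]-oo, N%:R[%classic : set R) l.

Lemma windowE N l : window N l = ((0 <= l) && (l < N%:R))%R%:R.
Proof.
rewrite /window indicE.
have -> : (l \in (`]-oo, N%:R[%classic : set R)) = (l < N%:R) by apply/idP/idP => [/set_mem|h]; [|apply/mem_set]; rewrite /= in_itv.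
by rewrite -natrM mulnb.
Qed.

Lemma bdd_window N : bdd (window N).
Proof.
apply: bddM; last by apply: bdd_indic; exact: measurable_itv.
by split; [exact: measurable_ge0|exists 1 => l; case: (0 <= l); rewrite ?normr1 ?normr0].
Qed.

Lemma bdd_lwindow N : bdd (fun l => l * window N l).
Proof.
split; first by apply: measurable_funM => //; exact: (bdd_window N).1.
exists N%:R => l; rewrite windowE; case: (boolP (_ && _)) => [/andP[l0 lN]|_].
  by rewrite mulr1 ger0_norm// ltW.
by rewrite mulr0 normr0.
Qed.

Lemma window_cvg l : window N l @[N --> \oo] --> ((0 <= l)%R%:R : R).
Proof.
apply: cvg_near_cst; near=> N; rewrite windowE.
have -> : l < N%:R by near: N; exact: nbhs_infty_gtr.
by rewrite andbT.
Unshelve. all: by end_near. Qed.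

Variables (u : V -> R) (x1 : V) (r : R).
Hypothesis r0 : 0 < r.
Hypothesis Lu : L2 u.
Hypothesis u0 : forall N : R, 0 <= N -> {ae mu, forall x, eball x1 r x -> E `]-oo, N[%classic u x = 0}.

(** The class of functions fixed by the window and null on the ball is stable under L: spectrally
    because l times the window is again absorbed by the window, locally because L maps test
    functions of the ball to test functions of the ball. On it L has norm at most N. *)
Lemma window_zero N f : bfc (window N) u f -> {ae mu, forall x, f x = 0}.
Proof.
move=> bf; have Lf := bf.1.
pose P g := [/\ L2 g, {ae mu, forall x, eball x1 r x -> g x = 0} & bfc (window N) g g].
have N20 : 0 <= (N%:R ^+ 2 : R) by exact: sqr_ge0.
apply: (@unique_continuation x1 r (N%:R ^+ 2) P r0 N20).
  move=> g [Lg g0 bg]; split=> //.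
  have [k bk] := bfc_ex hres.1 Lg (bdd_lwindow N); have Lk := bk.1.
  have dk : div_op A g k := bfc_op (hres := hres) Lg (bdd_window N) (bdd_lwindow N) bg bk.
  exists k; split=> //.
    rewrite (bfc_inner Lg (bdd_lwindow N) (bdd_lwindow N) bk bk).
    have bdN l : `|l * window N l * (l * window N l)| <= N%:R ^+ 2.
      rewrite -expr2 windowE; case: (boolP (_ && _)) => [/andP[l0 lN]|_].
        by rewrite mulr1 ger0_norm ?sqr_ge0// lerXn2r ?nnegrE// ltW.
      by rewrite mulr0 expr0n/= normr0.
    have := pol_bound hres.1 Lg Lg (bddM (bdd_lwindow N) (bdd_lwindow N)) bdN.
    by move/(le_trans (ler_norm _))/le_trans; apply; lra.
  split=> //.
    apply: local_zero => // phi tphi; have tT := tf_setT tphi.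
    rewrite (div_op_inner Abd Asm Asym dk tT); apply: inner_ae0 => //; first exact: (tf_L2 (tf_Lop Asm tT)).
    exact: (tf_vanish_ae (tf_Lop Asm tphi) g0).
  apply: (bfc_absorb Lg (bdd_lwindow N) (bdd_window N) _ bk) => l.
  by rewrite windowE; case: (_ && _) => /=; rewrite ?mul1r ?mulr1 ?mul0r ?mulr0.
split=> //.
  have mI : measurable (`]-oo, N%:R[%classic : set (measurableTypeR R)) by exact: measurable_itv.
  have LE := E_L2 hres.1 mI Lu.
  have e : {ae mu, forall x, f x = E `]-oo, N%:R[%classic u x}.
    apply: test_ext => // phi tphi; have Lp := tf_L2 tphi.
    rewrite bf.2// -(pol_indic hres.1)//.
    apply: (pol_eq_ge0 (div_op_ge0 Abd Asm L0 Aell) hres Lu Lp (bdd_window N).1 (bdd_indic mI).1).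
    by move=> l l0; rewrite /window l0 mul1r.
  by apply: filterS2 e (u0 (ler0n R N)) => x -> h /h.
apply: (bfc_absorb Lu (bdd_window N) (bdd_window N) _ bf) => l.
by rewrite windowE; case: (_ && _); rewrite ?mul1r// mulr0.
Qed.
(** The windows increase to the indicator of l >= 0, which acts as the identity, so ||u||^2 is the
    limit of the null quantities <window(L) u, u>. *)
Lemma spectral_zero : {ae mu, forall x, u x = 0}.
Proof.
apply: inner_eq0 => //.
have z N : pol (window N) u u = 0.
  have [f bf] := bfc_ex hres.1 Lu (bdd_window N).
  rewrite -bf.2//; apply: inner_ae0 => //; first exact: bf.1.
  by apply: filterS (window_zero bf) => x ->; rewrite mul0r.
have c : pol (window N) u u @[N --> \oo] --> pol (fun l => (0 <= l)%R%:R) u u.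
  apply: (pol_dct (b := fun=> 1)) => //.
  - by move=> N; exact: (bdd_window N).1.
  - by move=> l; exact: window_cvg.
  - by apply: bdd_intg; [exact: L2D|exact: bdd_cst].
  - by apply: bdd_intg; [exact: L2B|exact: bdd_cst].
  - by move=> N l; rewrite windowE; case: (_ && _); rewrite ?normr1 ?normr0.
have e : pol (fun l => (0 <= l)%R%:R) u u = pol (fun=> 1) u u.
  by apply: (pol_eq_ge0 (div_op_ge0 Abd Asm L0 Aell) hres Lu Lu measurable_ge0) => // l ->.
rewrite -[LHS]mul1r -(pol_cst hres.1)// -e.
apply: (cvg_unique (@Rhausdorff R) c); rewrite [X in X @ _](_ : _ = fun=> 0); first exact: cvg_cst.
by apply/funext => N; exact: z.
Qed.

End unique_continuation.

Lemma open_eball {R : realType} {n : nat} (O : set 'rV[R]_n) x : open O -> O x ->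
  exists2 r : R, 0 < r & eball x r `<=` O.
Proof.
move=> oO Ox; have /nbhs_ballP[e /= e0 eO] := open_nbhs_nbhs (conj oO Ox).
exists (e ^+ 2); first exact: exprn_gt0.
move=> y; rewrite /eball /= => yx; apply: eO; split=> // i j; rewrite /ball /=.
rewrite -(ltr_pXn2r (n := 2))// ?nnegrE ?(ltW e0)// real_normK ?num_real//.
apply: le_lt_trans yx; rewrite ord1 -sqrrN opprB.
by have := sqnorm_ge (y - x) j; rewrite !mxE.
Qed.

Theorem theorem1p2 (R : realType) (n : nat) (s Lambda : R)
    (A : 'rV[R]_n -> 'M[R]_n) (p : R -> 'rV[R]_n -> 'rV[R]_n -> R)
    (O : set 'rV[R]_n) (u : 'rV[R]_n -> R) :
  (2 <= n)%N ->
  0 < s < 1 ->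
  (exists M : R, forall x i j, `|A x i j| <= M) ->
  (forall x, (A x)^T = A x) ->
  (forall i j, smooth (fun x => A x i j)) ->
  0 < Lambda ->
  (forall x xi : 'rV[R]_n,
     Lambda^-1 * sqnorm xi
       <= \sum_(i < n) \sum_(j < n) A x i j * xi 0 i * xi 0 j
       <= Lambda * sqnorm xi) ->
  is_heat_kernel A p ->
  open O -> O !=set0 ->
  Hs s u ->
  {ae @lebesgue_rV R n, forall x, O x -> u x = 0} ->
  (forall phi, test_function O phi -> frac_pairing p s u phi = 0%E) ->
  {ae @lebesgue_rV R n, forall x, u x = 0}.
Proof.
move=> _ s01 Abd Asym Asm L0 Aell hp oO [x1 Ox1] [Lu _] u0 pair0.
have [r r0 rO] := open_eball oO Ox1.
(* The hypothesis on the heat kernel contains the existence of a spectral resolution; the instance t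
   = 1, f = 0 extracts one, which is fixed from here on. *)
have [_ _ H] := hp; have [_ [E hres _]] := H 1 _ ltr01 (@L20 R n).
have r40 : 0 < r / 4 by rewrite divr_gt0.
apply: (spectral_zero Abd Asm L0 Asym Aell hres r40 Lu) => N N0.
exact: (spectral_local_zero Abd Asm L0 Asym Aell hres hp s01 r0 rO Lu u0 pair0 N0).
Qed.
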